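(* Fix $m\in\mathbb Z$. There are complex numbers $c_{m,j}$ ($j\ge 0$), depending only on $m$ and $j$, with $$c_{m,0}=-\frac{1}{\pi i\, z_0^{m}\, e^{z_0/2}},$$ such that for every integer $r\ge 1$ and all integers $N\ge 1$, $$A_m(1,N)=\mathrm{Re}\Big[\frac{w_0^{-N}}{N^{1-m}}\Big(c_{m,0}+\frac{c_{m,1}}{N}+\dots+\frac{c_{m,r-1}}{N^{r-1}}\Big)\Big]+O\Big(\frac{|w_0|^{-N}}{N^{r+1-m}}\Big),$$ where the implied constant depends only on $m$ and $r$.
   Context: $(q)_N:=(1-q)(1-q^2)\cdots(1-q^N)$. For a primitive $k$th root of unity $\xi$, the numbers $A_m(\xi,N)$ are the coefficients of the Laurent expansion $1/(q)_N=\sum_{m\ge -\lfloor N/k\rfloor}A_m(\xi,N)(q-\xi)^m$ about $q=\xi$. $\mathrm{Li}_2$ denotes the dilogarithm ($\mathrm{Li}_2(w)=\sum_{n\ge1}w^n/n^2$ for $|w|\le1$, continued analytically to $\mathbb C\setminus[1,\infty)$). $w_0$ is the solution of $\mathrm{Li}_2(w)-2\pi i\log w=0$ (principal branches), numerically $w_0\approx 0.91619782-0.18245890i$, and $z_0:=2\pi i+\log(1-w_0)\approx -1.6055276+7.4234262i$ (principal logarithm). Note $|w_0|<1$. *)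

(* Defs.v *)
From Stdlib Require Import Reals ZArith.
Open Scope R_scope.

Definition CC : Type := (R * R)%type.
Definition Re (z : CC) : R := fst z.
Definition Im (z : CC) : R := snd z.
Definition RtoC (x : R) : CC := (x, 0).
Definition C0 : CC := (0, 0).
Definition C1 : CC := (1, 0).
Definition Ci : CC := (0, 1).
Definition Cadd (z w : CC) : CC := (Re z + Re w, Im z + Im w).
Definition Copp (z : CC) : CC := (- Re z, - Im z).
Definition Csub (z w : CC) : CC := Cadd z (Copp w).
Definition Cmul (z w : CC) : CC :=
  (Re z * Re w - Im z * Im w, Re z * Im w + Im z * Re w).
Definition Cnorm (z : CC) : R := sqrt (Re z * Re z + Im z * Im z).
Definition Cinv (z : CC) : CC :=
  let d := Re z * Re z + Im z * Im z in (Re z / d, - Im z / d).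
Definition Cdiv (z w : CC) : CC := Cmul z (Cinv w).

Fixpoint Cpow (z : CC) (n : nat) : CC :=
  match n with O => C1 | S k => Cmul z (Cpow z k) end.
Definition Cpowz (z : CC) (m : Z) : CC :=
  match m with
  | Z0 => C1
  | Zpos p => Cpow z (Pos.to_nat p)
  | Zneg p => Cinv (Cpow z (Pos.to_nat p))
  end.

Definition Cexp (z : CC) : CC := (exp (Re z) * cos (Im z), exp (Re z) * sin (Im z)).

(* principal argument in (-pi, pi] (atan2), and principal logarithm *)
Definition Carg (z : CC) : R :=
  let x := Re z in let y := Im z in
  if Rlt_dec 0 x then atan (y / x)
  else if Rlt_dec x 0 then
         (if Rle_dec 0 y then atan (y / x) + PI else atan (y / x) - PI)
  else if Rlt_dec 0 y then PI / 2
  else if Rlt_dec y 0 then - (PI / 2)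
  else 0.
Definition CLog (z : CC) : CC := (ln (Cnorm z), Carg z).

Fixpoint Csum (f : nat -> CC) (M : nat) : CC :=
  match M with O => C0 | S k => Cadd (Csum f k) (f k) end.

Definition Ccv (u : nat -> CC) (l : CC) : Prop :=
  Un_cv (fun n => Cnorm (Csub (u n) l)) 0.

Definition Li2_partial (w : CC) (M : nat) : CC :=
  Csum (fun k => Cdiv (Cpow w (S k)) (RtoC (INR (S k) * INR (S k)))) M.
Definition Li2_is (w s : CC) : Prop := Ccv (Li2_partial w) s.

Fixpoint qpoch (q : CC) (N : nat) : CC :=
  match N with O => C1 | S k => Cmul (qpoch q k) (Csub C1 (Cpow q (S k))) end.

(* a : Z -> CC is the sequence of Laurent coefficients of 1/(q)_N about q = 1:
   a m = 0 for m < -N, and on a punctured disc around 1,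
   1/(q)_N = sum_{m >= -N} a m (q-1)^m  (series converging). *)
Definition IsLaurentAt1 (N : nat) (a : Z -> CC) : Prop :=
  (forall m : Z, (m < - Z.of_nat N)%Z -> a m = C0) /\
  exists delta : R, 0 < delta /\
    forall q : CC, 0 < Cnorm (Csub q C1) < delta ->
      Ccv (fun M => Csum (fun n =>
              let e := (Z.of_nat n - Z.of_nat N)%Z in
              Cmul (a e) (Cpowz (Csub q C1) e)) M)
          (Cinv (qpoch q N)).

Definition two_pi_i : CC := (0, 2 * PI).

Definition z0_of (w0 : CC) : CC := Cadd two_pi_i (CLog (Csub C1 w0)).

Definition c0_of (w0 : CC) (m : Z) : CC :=
  Copp (Cinv (Cmul (Cmul (0, PI) (Cpowz (z0_of w0) m))
                   (Cexp (Cmul (RtoC (1/2)) (z0_of w0))))).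

(* Main.v *)
(** With [q = e^t], [A_m(1,N)] is the residue at [0] of [e^t (e^t - 1)^(-m-1) / (q)_N], and complex
    conjugation turns the loop around [0] into [1/PI] times the imaginary part of the integral along any
    path in the upper half plane from the positive to the negative real axis. Put [t = z/N]. A Riemann sum
    gives [log |1/(q)_N| ~ N Re ((Li2 (e^z) - zeta(2)) / z)]; the critical point of the exponent is
    [z0 = 2 pi i + log (1 - w0)], and by the reflection formula for [Li2] together with
    [Li2 w0 = 2 pi i log w0] its value there is [- log w0]. On the polygonal path
    [3, 3 + i y', s1 z0, 16 z0, - 16 |Re z0|], which passes through [z0] along its own ray, everything away
    from [z0] is exponentially smaller. Near [z0], writing [z = z0 (1 + s)] and
    [1 - e^(x z) = x (1 + s) exp (lam (x (1 + s)))] with [lam] smooth, Stirling's and the Euler-Maclaurin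
    formula expand the integrand in powers of [1/N], [s] and [N s^2], and Laplace's method integrates the
    expansion term by term. The leading constant is determined up to sign by its square, and the sign follows
    from the signs of real parts. *)

(* Contours are deformed by means of a primitive. The poles 2 pi i a / j, 1 <= j <= N, all lie on
   the imaginary axis, so the plane without that axis, but with the gap from 0 to 2 pi i / N
   restored, is star-shaped about pi i / N; an integral over a polygonal path is then a sum of
   differences of one function at the corners. In the variable z = N t the path must cross the
   imaginary axis below 2 pi, whereas Im z0 is about 7.42: hence the crossing at height y' = 2 pi -
   1/20 and the detour to the ray of z0. The rate at the saddle, - log |w0|, is only about 0.068, so
   the bounds off the saddle are numerical with small margins (0.0677 against 0.0676 and 0.0666).

   The summand - log |1 - e^(x z)| is singular at x = 0, so Euler-Maclaurin cannot be applied to it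
   directly. Upper bounds use a one-sided bound on its derivative, which the singularity respects;
   for the expansion at the saddle the factor x (1 + s) is split off, whose product over x = j / N
   is (1 + s)^N N! / N^N. *)
Require Import Defs.
From Stdlib Require Import Reals ZArith Lra Lia ClassicalEpsilon.
From Coquelicot Require Import Coquelicot.
Open Scope R_scope.

(** * Derivatives and continuity of complex-valued functions *)

Lemma C_ext (z w : C) : Re z = Re w -> Im z = Im w -> z = w.
Proof. destruct z, w; unfold Re, Im; simpl; intros; subst; reflexivity. Qed.

Lemma Cmod_le_ReIm (z : C) : Cmod z <= Rabs (Re z) + Rabs (Im z).
Proof.
assert (E : z = (RtoC (Re z) + Ci * RtoC (Im z))%C)
  by (apply C_ext; unfold Re, Im; simpl; ring).
rewrite E at 1. eapply Rle_trans; [apply Cmod_triangle|].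
rewrite Cmod_mult, Cmod_Ci, !Cmod_R. lra.
Qed.

Lemma Re_le_Cmod (z : C) : Rabs (Re z) <= Cmod z.
Proof. apply re_le_Cmod. Qed.

Lemma Im_le_Cmod (z : C) : Rabs (Im z) <= Cmod z.
Proof.
eapply Rle_trans; [|apply Rmax_Cmod]. apply Rmax_r.
Qed.

Lemma Cmod_minus_sym (z w : C) : Cmod (z - w) = Cmod (w - z).
Proof. rewrite <- Cmod_opp. f_equal. ring. Qed.

Lemma Cmod_triangle_inv (z w : C) : Cmod z - Cmod w <= Cmod (z - w).
Proof.
assert (H := Cmod_triangle (z - w) w).
replace (z - w + w)%C with z in H by ring. lra.
Qed.

Lemma Cmod_pair_le (a b : R) : Cmod (a, b) <= Rabs a + Rabs b.
Proof. exact (Cmod_le_ReIm (a, b)). Qed.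

(* [K] is the space of increments: [R] for curves, [C] for complex functions;
   [em] embeds increments into [C]. *)
Section GenericDerivative.
Context {K : Type} (pl : K -> K -> K) (em : K -> C).

Definition gder (f : K -> C) (x : K) (l : C) : Prop :=
  forall eps : R, 0 < eps -> exists d : R, 0 < d /\
    forall h : K, Cmod (em h) < d ->
      Cmod (f (pl x h) - f x - l * em h) <= eps * Cmod (em h).

Definition gcont (f : K -> C) (x : K) : Prop :=
  forall eps : R, 0 < eps -> exists d : R, 0 < d /\
    forall h : K, Cmod (em h) < d -> Cmod (f (pl x h) - f x) < eps.

Lemma gder_cont f x l : gder f x l -> gcont f x.
Proof.
intros H eps He. destruct (H 1 Rlt_0_1) as [d [Hd Hf]].
assert (Hl := Cmod_ge_0 l).
exists (Rmin d (eps / (2 + Cmod l))). split.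
- apply Rmin_pos; [assumption|]. apply Rdiv_lt_0_compat; lra.
- intros h Hh.
  assert (H1 := Rmin_l d (eps / (2 + Cmod l))).
  assert (H2 := Rmin_r d (eps / (2 + Cmod l))).
  assert (Hf' := Hf h ltac:(lra)).
  replace (f (pl x h) - f x)%C with ((f (pl x h) - f x - l * em h) + l * em h)%C by ring.
  eapply Rle_lt_trans; [apply Cmod_triangle|].
  rewrite Cmod_mult.
  assert (Hh2 : Cmod (em h) < eps / (2 + Cmod l)) by lra.
  apply (Rmult_lt_compat_r (2 + Cmod l)) in Hh2; [|lra].
  unfold Rdiv in Hh2. rewrite Rmult_assoc, Rinv_l in Hh2 by lra.
  assert (Hm := Cmod_ge_0 (em h)). nra.
Qed.

Lemma gder_const (c : C) x : gder (fun _ => c) x 0.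
Proof.
intros eps He. exists 1. split; [lra|]. intros h _.
replace (c - c - 0 * em h)%C with (RtoC 0) by ring. rewrite Cmod_0.
apply Rmult_le_pos; [lra|apply Cmod_ge_0].
Qed.

Lemma gder_ext f g x l : (forall y, f y = g y) -> gder f x l -> gder g x l.
Proof.
intros E H eps He. destruct (H eps He) as [d [Hd Hf]]. exists d; split; auto.
intros h Hh. rewrite <- !E. auto.
Qed.

Lemma gder_plus f g x a b : gder f x a -> gder g x b ->
  gder (fun y => f y + g y)%C x (a + b).
Proof.
intros Hf Hg eps He.
destruct (Hf (eps / 2)) as [d1 [Hd1 H1]]; [lra|].
destruct (Hg (eps / 2)) as [d2 [Hd2 H2]]; [lra|].
exists (Rmin d1 d2). split; [apply Rmin_pos; auto|]. intros h Hh.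
assert (L1 := Rmin_l d1 d2). assert (L2 := Rmin_r d1 d2).
specialize (H1 h ltac:(lra)). specialize (H2 h ltac:(lra)).
replace (f (pl x h) + g (pl x h) - (f x + g x) - (a + b) * em h)%C
  with ((f (pl x h) - f x - a * em h) + (g (pl x h) - g x - b * em h))%C by ring.
eapply Rle_trans; [apply Cmod_triangle|]. lra.
Qed.

Lemma gder_mult f g x a b : gder f x a -> gder g x b ->
  gder (fun y => f y * g y)%C x (a * g x + f x * b).
Proof.
intros Hf Hg eps He.
set (G := 1 + Cmod (g x)). set (F := 1 + Cmod (f x)). set (A := 1 + Cmod a).
assert (HG : 1 <= G) by (unfold G; assert (t := Cmod_ge_0 (g x)); lra).
assert (HF : 1 <= F) by (unfold F; assert (t := Cmod_ge_0 (f x)); lra).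
assert (HA : 1 <= A) by (unfold A; assert (t := Cmod_ge_0 a); lra).
assert (Hgc := gder_cont _ _ _ Hg).
destruct (Hf (eps / (3 * G))) as [d1 [Hd1 H1]]; [apply Rdiv_lt_0_compat; lra|].
destruct (Hg (eps / (3 * F))) as [d2 [Hd2 H2]]; [apply Rdiv_lt_0_compat; lra|].
destruct (Hgc (Rmin 1 (eps / (3 * A)))) as [d3 [Hd3 H3]].
{ apply Rmin_pos; [lra|apply Rdiv_lt_0_compat; lra]. }
exists (Rmin d1 (Rmin d2 d3)). split; [repeat apply Rmin_pos; auto|]. intros h Hh.
assert (L1 := Rmin_l d1 (Rmin d2 d3)). assert (L2 := Rmin_r d1 (Rmin d2 d3)).
assert (L3 := Rmin_l d2 d3). assert (L4 := Rmin_r d2 d3).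
specialize (H1 h ltac:(lra)). specialize (H2 h ltac:(lra)). specialize (H3 h ltac:(lra)).
assert (M1 := Rmin_l 1 (eps / (3 * A))). assert (M2 := Rmin_r 1 (eps / (3 * A))).
assert (K3 : A * Cmod (g (pl x h) - g x) <= eps / 3).
{ replace (eps / 3) with (A * (eps / (3 * A))) by (field; lra).
  apply Rmult_le_compat_l; lra. }
assert (K0 := Cmod_ge_0 (em h)).
replace (f (pl x h) * g (pl x h) - f x * g x - (a * g x + f x * b) * em h)%C
  with ((f (pl x h) - f x - a * em h) * g (pl x h)
        + f x * (g (pl x h) - g x - b * em h)
        + a * em h * (g (pl x h) - g x))%C by ring.
eapply Rle_trans; [apply Cmod_triangle|].
eapply Rle_trans; [apply Rplus_le_compat_r, Cmod_triangle|].
rewrite !Cmod_mult.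
assert (Hgb : Cmod (g (pl x h)) <= G).
{ replace (g (pl x h)) with ((g (pl x h) - g x) + g x)%C by ring.
  eapply Rle_trans; [apply Cmod_triangle|]. unfold G. lra. }
assert (T1 : Cmod (f (pl x h) - f x - a * em h) * Cmod (g (pl x h))
   <= eps / 3 * Cmod (em h)).
{ apply Rle_trans with (eps / (3 * G) * Cmod (em h) * G).
  - apply Rmult_le_compat; auto; apply Cmod_ge_0.
  - right. field. lra. }
assert (T2 : Cmod (f x) * Cmod (g (pl x h) - g x - b * em h)
   <= eps / 3 * Cmod (em h)).
{ apply Rle_trans with (F * (eps / (3 * F) * Cmod (em h))).
  - apply Rmult_le_compat; auto; try apply Cmod_ge_0. unfold F; lra.
  - right. field. lra. }
assert (T3 : Cmod a * Cmod (em h) * Cmod (g (pl x h) - g x) <= eps / 3 * Cmod (em h)).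
{ replace (Cmod a * Cmod (em h) * Cmod (g (pl x h) - g x))
    with ((Cmod a * Cmod (g (pl x h) - g x)) * Cmod (em h)) by ring.
  apply Rmult_le_compat_r; auto. eapply Rle_trans; [|exact K3].
  apply Rmult_le_compat_r; [apply Cmod_ge_0|unfold A; lra]. }
lra.
Qed.

Lemma gcont_ext f g x : (forall y, f y = g y) -> gcont f x -> gcont g x.
Proof.
intros E H eps He. destruct (H eps He) as [d [Hd Hf]]. exists d; split; auto.
intros h Hh. rewrite <- !E. auto.
Qed.

Lemma gcont_const (c : C) x : gcont (fun _ => c) x.
Proof. exact (gder_cont _ _ _ (gder_const c x)). Qed.

Lemma gcont_plus f g x : gcont f x -> gcont g x -> gcont (fun y => f y + g y)%C x.
Proof.
intros Hf Hg eps He.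
destruct (Hf (eps / 2)) as [d1 [Hd1 H1]]; [lra|].
destruct (Hg (eps / 2)) as [d2 [Hd2 H2]]; [lra|].
exists (Rmin d1 d2). split; [apply Rmin_pos; auto|]. intros h Hh.
assert (L1 := Rmin_l d1 d2). assert (L2 := Rmin_r d1 d2).
specialize (H1 h ltac:(lra)). specialize (H2 h ltac:(lra)).
replace (f (pl x h) + g (pl x h) - (f x + g x))%C
  with ((f (pl x h) - f x) + (g (pl x h) - g x))%C by ring.
eapply Rle_lt_trans; [apply Cmod_triangle|]. lra.
Qed.

Lemma gcont_mult f g x : gcont f x -> gcont g x -> gcont (fun y => f y * g y)%C x.
Proof.
intros Hf Hg eps He.
set (G := 1 + Cmod (g x)). set (F := 1 + Cmod (f x)).
assert (HG : 1 <= G) by (unfold G; assert (t := Cmod_ge_0 (g x)); lra).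
assert (HF : 1 <= F) by (unfold F; assert (t := Cmod_ge_0 (f x)); lra).
destruct (Hf (eps / (2 * G))) as [d1 [Hd1 H1]]; [apply Rdiv_lt_0_compat; lra|].
destruct (Hg (Rmin 1 (eps / (2 * F)))) as [d2 [Hd2 H2]].
{ apply Rmin_pos; [lra|apply Rdiv_lt_0_compat; lra]. }
exists (Rmin d1 d2). split; [apply Rmin_pos; auto|]. intros h Hh.
assert (L1 := Rmin_l d1 d2). assert (L2 := Rmin_r d1 d2).
specialize (H1 h ltac:(lra)). specialize (H2 h ltac:(lra)).
assert (M1 := Rmin_l 1 (eps / (2 * F))). assert (M2 := Rmin_r 1 (eps / (2 * F))).
replace (f (pl x h) * g (pl x h) - f x * g x)%C
  with ((f (pl x h) - f x) * g (pl x h) + f x * (g (pl x h) - g x))%C by ring.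
eapply Rle_lt_trans; [apply Cmod_triangle|]. rewrite !Cmod_mult.
assert (Hgb : Cmod (g (pl x h)) <= G).
{ replace (g (pl x h)) with ((g (pl x h) - g x) + g x)%C by ring.
  eapply Rle_trans; [apply Cmod_triangle|]. unfold G. lra. }
assert (T1 : Cmod (f (pl x h) - f x) * Cmod (g (pl x h)) < eps / 2).
{ apply Rle_lt_trans with (Cmod (f (pl x h) - f x) * G).
  - apply Rmult_le_compat_l; [apply Cmod_ge_0|auto].
  - replace (eps / 2) with (eps / (2 * G) * G) by (field; lra).
    apply Rmult_lt_compat_r; lra. }
assert (T2 : Cmod (f x) * Cmod (g (pl x h) - g x) <= eps / 2).
{ replace (eps / 2) with (F * (eps / (2 * F))) by (field; lra).
  apply Rmult_le_compat; try apply Cmod_ge_0; [unfold F|]; lra. }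
lra.
Qed.
End GenericDerivative.

Definition Cder := @gder C Cplus (fun h => h).
Definition Ccont := @gcont C Cplus (fun h => h).
Definition cder := @gder R Rplus RtoC.
Definition ccont := @gcont R Rplus RtoC.

Lemma cder_cont (f : R -> C) x l : cder f x l -> ccont f x.
Proof. apply gder_cont. Qed.

Section Composition.
Context {K : Type} (pl : K -> K -> K) (em : K -> C).

Lemma gder_comp (f : C -> C) (c : K -> C) x l m :
  Cder f (c x) m -> gder pl em c x l -> gder pl em (fun y => f (c y)) x (m * l).
Proof.
intros Hf Hc eps He.
set (A := 1 + Cmod l). set (M := 1 + Cmod m).
assert (HA : 1 <= A) by (unfold A; assert (t := Cmod_ge_0 l); lra).
assert (HM : 1 <= M) by (unfold M; assert (t := Cmod_ge_0 m); lra).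
destruct (Hf (eps / (2 * A))) as [d1 [Hd1 H1]]; [apply Rdiv_lt_0_compat; lra|].
destruct (Hc (Rmin 1 (eps / (2 * M)))) as [d2 [Hd2 H2]].
{ apply Rmin_pos; [lra|apply Rdiv_lt_0_compat; lra]. }
exists (Rmin d2 (d1 / A)). split.
{ apply Rmin_pos; auto. apply Rdiv_lt_0_compat; lra. }
intros h Hh.
assert (L1 := Rmin_l d2 (d1 / A)). assert (L2 := Rmin_r d2 (d1 / A)).
specialize (H2 h ltac:(lra)).
assert (M1 := Rmin_l 1 (eps / (2 * M))). assert (M2 := Rmin_r 1 (eps / (2 * M))).
assert (K0 := Cmod_ge_0 (em h)).
set (k := (c (pl x h) - c x)%C).
assert (Hk : Cmod k <= A * Cmod (em h)).
{ unfold k. replace (c (pl x h) - c x)%C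
    with ((c (pl x h) - c x - l * em h) + l * em h)%C by ring.
  eapply Rle_trans; [apply Cmod_triangle|]. rewrite Cmod_mult. unfold A.
  assert (Rmin 1 (eps / (2 * M)) * Cmod (em h) <= 1 * Cmod (em h))
    by (apply Rmult_le_compat_r; auto). lra. }
assert (Hk1 : Cmod k < d1).
{ eapply Rle_lt_trans; [exact Hk|].
  assert (Hx : Cmod (em h) < d1 / A) by lra.
  apply (Rmult_lt_compat_l A) in Hx; [|lra].
  replace (A * (d1 / A)) with d1 in Hx by (field; lra). exact Hx. }
specialize (H1 k Hk1).
replace (c x + k)%C with (c (pl x h)) in H1 by (unfold k; ring).
replace (f (c (pl x h)) - f (c x) - m * l * em h)%C
  with ((f (c (pl x h)) - f (c x) - m * k) + m * (c (pl x h) - c x - l * em h))%C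
  by (unfold k; ring).
eapply Rle_trans; [apply Cmod_triangle|]. rewrite Cmod_mult.
assert (T1 : eps / (2 * A) * Cmod k <= eps / 2 * Cmod (em h)).
{ replace (eps / 2 * Cmod (em h)) with (eps / (2 * A) * (A * Cmod (em h))) by (field; lra).
  apply Rmult_le_compat_l; auto. left. apply Rdiv_lt_0_compat; lra. }
assert (T2 : Cmod m * Cmod (c (pl x h) - c x - l * em h) <= eps / 2 * Cmod (em h)).
{ replace (eps / 2 * Cmod (em h)) with (M * (eps / (2 * M) * Cmod (em h))) by (field; lra).
  apply Rmult_le_compat; try apply Cmod_ge_0; [unfold M; lra|].
  eapply Rle_trans; [exact H2|]. apply Rmult_le_compat_r; auto. }
lra.
Qed.

Lemma gcont_comp (f : C -> C) (c : K -> C) x :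
  Ccont f (c x) -> gcont pl em c x -> gcont pl em (fun y => f (c y)) x.
Proof.
intros Hf Hc eps He.
destruct (Hf eps He) as [d1 [Hd1 H1]].
destruct (Hc d1 Hd1) as [d2 [Hd2 H2]].
exists d2. split; auto. intros h Hh.
specialize (H1 _ (H2 h Hh)).
replace (c x + (c (pl x h) - c x))%C with (c (pl x h)) in H1 by ring.
exact H1.
Qed.
End Composition.

Lemma Cder_id (z : C) : Cder (fun w => w) z 1.
Proof.
intros eps He. exists 1. split; [lra|]. intros h _.
replace (z + h - z - 1 * h)%C with (RtoC 0) by ring. rewrite Cmod_0.
apply Rmult_le_pos; [lra|apply Cmod_ge_0].
Qed.

Lemma cder_RtoC (t : R) : cder RtoC t 1.
Proof.
intros eps He. exists 1. split; [lra|]. intros h _.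
rewrite RtoC_plus.
replace (t + h - t - 1 * h)%C with (RtoC 0) by ring. rewrite Cmod_0.
apply Rmult_le_pos; [lra|apply Cmod_ge_0].
Qed.

Lemma Cmod_small_inv (z h : C) : z <> 0%C -> Cmod h <= Cmod z / 2 ->
  (z + h)%C <> 0%C /\ Cmod (/ (z + h)) <= 2 / Cmod z.
Proof.
intros Hz Hh. assert (Hm : 0 < Cmod z) by (apply Cmod_gt_0; auto).
assert (Hl : Cmod z / 2 <= Cmod (z + h)).
{ assert (T := Cmod_triangle_inv z (- h)). rewrite Cmod_opp in T.
  replace (z - - h)%C with (z + h)%C in T by ring. lra. }
assert (Hn : (z + h)%C <> 0%C).
{ apply Cmod_gt_0. lra. }
split; auto. rewrite Cmod_inv by auto.
replace (2 / Cmod z) with (/ (Cmod z / 2)) by (field; lra).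
apply Rinv_le_contravar; lra.
Qed.

Lemma Cder_inv (z : C) : z <> 0%C -> Cder Cinv z (- (/ z * / z)).
Proof.
intros Hz eps He. assert (Hm : 0 < Cmod z) by (apply Cmod_gt_0; auto).
exists (Rmin (Cmod z / 2) (eps * Cmod z ^ 3 / 2)). split.
{ apply Rmin_pos; [lra|]. apply Rmult_lt_0_compat; [|lra].
  apply Rmult_lt_0_compat; auto. apply pow_lt; auto. }
intros h Hh.
assert (L1 := Rmin_l (Cmod z / 2) (eps * Cmod z ^ 3 / 2)).
assert (L2 := Rmin_r (Cmod z / 2) (eps * Cmod z ^ 3 / 2)).
destruct (Cmod_small_inv z h Hz) as [Hn Hb]; [lra|].
replace (/ (z + h) - / z - - (/ z * / z) * h)%C
  with (h * (h * (/ z * / z) * / (z + h)))%C by (field; auto).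
rewrite Cmod_mult, Rmult_comm. apply Rmult_le_compat_r; [apply Cmod_ge_0|].
rewrite !Cmod_mult, !(Cmod_inv z) by auto.
apply Rle_trans with (eps * Cmod z ^ 3 / 2 * (/ Cmod z * / Cmod z) * (2 / Cmod z)).
- apply Rmult_le_compat; auto; try apply Cmod_ge_0.
  + apply Rmult_le_pos; [apply Cmod_ge_0|].
    apply Rmult_le_pos; left; apply Rinv_0_lt_compat; auto.
  + apply Rmult_le_compat_r; [|lra].
    apply Rmult_le_pos; left; apply Rinv_0_lt_compat; auto.
- right. field. lra.
Qed.

Definition cexp (z : C) : C := (exp (Re z) * cos (Im z), exp (Re z) * sin (Im z)).

Lemma cexp_add (z w : C) : cexp (z + w)%C = (cexp z * cexp w)%C.
Proof.
apply C_ext; unfold cexp, Re, Im; simpl.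
- rewrite exp_plus, cos_plus. ring.
- rewrite exp_plus, sin_plus. ring.
Qed.

Lemma cexp_0 : cexp 0 = 1%C.
Proof. apply C_ext; unfold cexp, Re, Im; simpl; rewrite exp_0, ?cos_0, ?sin_0; ring. Qed.

Lemma Cmod_cexp (z : C) : Cmod (cexp z) = exp (Re z).
Proof.
unfold Cmod, cexp, Re, Im; simpl.
replace (_ + _) with (Rsqr (exp (fst z))).
- rewrite sqrt_Rsqr; auto. left; apply exp_pos.
- assert (H := sin2_cos2 (snd z)). unfold Rsqr in *.
  transitivity (exp (fst z) * exp (fst z) * (sin (snd z) * sin (snd z) + cos (snd z) * cos (snd z))).
  + rewrite H; ring.
  + ring.
Qed.

Lemma cexp_neq_0 (z : C) : cexp z <> 0%C.
Proof. apply Cmod_gt_0. rewrite Cmod_cexp. apply exp_pos. Qed.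

Lemma cexp_opp (z : C) : cexp (- z)%C = (/ cexp z)%C.
Proof.
assert (H : (cexp (- z)%C * cexp z = 1)%C).
{ rewrite <- cexp_add. replace (- z + z)%C with (RtoC 0) by ring. apply cexp_0. }
assert (Hn := cexp_neq_0 z).
replace (cexp (- z)%C) with (cexp (- z)%C * cexp z * / cexp z)%C by (field; auto).
rewrite H. ring.
Qed.

Lemma cexp_pow (z : C) (n : nat) : (cexp z ^ n)%C = cexp (INR n * z)%C.
Proof.
induction n.
- simpl. replace (0 * z)%C with (RtoC 0) by ring. now rewrite cexp_0.
- rewrite Cpow_S, IHn, <- cexp_add, S_INR, RtoC_plus. f_equal. ring.
Qed.

Lemma cexp_RtoC (x : R) : cexp x = exp x.
Proof. apply C_ext; unfold cexp, Re, Im; simpl; rewrite ?cos_0, ?sin_0; ring. Qed.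

Lemma cexp_conj (z : C) : cexp (Cconj z) = Cconj (cexp z).
Proof. apply C_ext; unfold cexp, Re, Im; simpl; rewrite ?cos_neg, ?sin_neg; ring. Qed.

Lemma exp_taylor1 (a : R) : Rabs a <= 1 / 2 -> 0 <= exp a - 1 - a <= 2 * a ^ 2.
Proof.
intros Ha. apply Rabs_le_between in Ha. split.
- assert (H := exp_ineq1_le a). lra.
- assert (H := exp_ineq1_le (- a)). rewrite exp_Ropp in H.
  assert (E : exp a <= / (1 - a)).
  { rewrite <- (Rinv_inv (exp a)). apply Rinv_le_contravar; lra. }
  assert (E2 : / (1 - a) = 1 + a + a ^ 2 / (1 - a)) by (field; lra).
  assert (E3 : a ^ 2 / (1 - a) <= 2 * a ^ 2).
  { unfold Rdiv. rewrite Rmult_comm. apply Rmult_le_compat_r; [apply pow2_ge_0|].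
    replace 2 with (/ (1 / 2)) by field. apply Rinv_le_contravar; lra. }
  lra.
Qed.

Lemma Rabs_sin_le (x : R) : Rabs (sin x) <= Rabs x.
Proof.
assert (P : forall y, 0 < y -> Rabs (sin y) <= y).
{ intros y Hy. apply Rabs_le. split.
  - destruct (Rle_dec y 1).
    + assert (0 <= sin y) by (apply sin_ge_0; assert (t := PI_RGT_0); assert (t2 := PI2_1); lra). lra.
    + assert (t := SIN_bound y). lra.
  - left. apply sin_lt_x; auto. }
destruct (Rtotal_order x 0) as [H|[H|H]].
- rewrite <- (Rabs_Ropp x), <- (Rabs_Ropp (sin x)), <- sin_neg.
  rewrite (Rabs_pos_eq (- x)) by lra. apply P; lra.
- subst. rewrite sin_0. lra.
- rewrite (Rabs_pos_eq x) by lra. apply P; lra.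
Qed.

Lemma one_minus_cos_le (x : R) : 0 <= 1 - cos x <= x ^ 2 / 2.
Proof.
assert (B := COS_bound x). split; [lra|].
replace (cos x) with (cos (2 * (x / 2))) by (f_equal; field).
rewrite cos_2a_sin.
assert (H := Rabs_sin_le (x / 2)).
apply Rsqr_le_abs_1 in H. unfold Rsqr in H. lra.
Qed.

Lemma sin_minus_le (x : R) : Rabs (sin x - x) <= Rabs x * (x ^ 2 / 2).
Proof.
destruct (MVT_gen (fun t => sin t - t) 0 x (fun t => cos t - 1)) as [c [Hc E]].
- intros. auto_derive; auto. ring.
- intros. apply continuity_pt_filterlim, (ex_derive_continuous (fun t => sin t - t)).
  auto_derive; auto.
- rewrite sin_0 in E. replace (sin x - x) with ((cos c - 1) * x) by lra.
  rewrite Rabs_mult, Rmult_comm. apply Rmult_le_compat_l; [apply Rabs_pos|].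
  rewrite Rabs_minus_sym. assert (B := one_minus_cos_le c).
  rewrite Rabs_pos_eq by lra.
  assert (c ^ 2 <= x ^ 2); [|lra].
  unfold Rmin, Rmax in Hc. destruct (Rle_dec 0 x); nra.
Qed.

Lemma cexp_taylor1 (h : C) : Cmod h <= 1 / 2 -> Cmod (cexp h - 1 - h) <= 8 * Cmod h ^ 2.
Proof.
intros Hh. set (m := Cmod h) in *.
assert (Ha := Re_le_Cmod h). assert (Hb := Im_le_Cmod h). fold m in Ha, Hb.
set (a := Re h) in *. set (b := Im h) in *.
eapply Rle_trans; [apply Cmod_le_ReIm|].
assert (M0 : 0 <= m) by apply Cmod_ge_0.
assert (Ea := exp_taylor1 a ltac:(lra)).
assert (A2 : a ^ 2 <= m ^ 2) by (apply pow_maj_Rabs; auto).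
assert (B2 : b ^ 2 <= m ^ 2) by (apply pow_maj_Rabs; auto).
assert (Ex : exp a <= 2).
{ apply Rabs_le_between in Ha. nra. }
assert (Ep := exp_pos a).
assert (R1 : Rabs (Re (cexp h - 1 - h)) <= 3 * m ^ 2).
{ replace (Re (cexp h - 1 - h)%C) with ((exp a - 1 - a) - exp a * (1 - cos b))
    by (unfold cexp, a, b, Re, Im; simpl; ring).
  assert (H := one_minus_cos_le b). apply Rabs_le. split; nra. }
assert (R2 : Rabs (Im (cexp h - 1 - h)) <= 5 * m ^ 2).
{ replace (Im (cexp h - 1 - h)%C) with (exp a * (sin b - b) + (exp a - 1) * b)
    by (unfold cexp, a, b, Re, Im; simpl; ring).
  assert (H := sin_minus_le b).
  eapply Rle_trans; [apply Rabs_triang|]. rewrite !Rabs_mult.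
  rewrite (Rabs_pos_eq (exp a)) by lra.
  assert (Rabs b * (b ^ 2 / 2) <= m ^ 2 / 2 * 1).
  { assert (Rabs b <= 1) by lra. assert (0 <= Rabs b) by apply Rabs_pos.
    assert (0 <= b ^ 2) by apply pow2_ge_0. nra. }
  assert (Rabs (exp a - 1) <= 2 * m).
  { apply Rabs_le_between in Ha. apply Rabs_le. split; nra. }
  assert (Rabs (exp a - 1) * Rabs b <= 2 * m * m).
  { apply Rmult_le_compat; auto; apply Rabs_pos. }
  assert (exp a * Rabs (sin b - b) <= 2 * (m ^ 2 / 2 * 1)).
  { apply Rmult_le_compat; try lra. apply Rabs_pos. }
  nra. }
lra.
Qed.

Lemma Cder_exp (z : C) : Cder cexp z (cexp z).
Proof.
intros eps He. assert (Hm : 0 < Cmod (cexp z)) by (rewrite Cmod_cexp; apply exp_pos).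
exists (Rmin (1 / 2) (eps / (8 * Cmod (cexp z)))). split.
{ apply Rmin_pos; [lra|]. apply Rdiv_lt_0_compat; lra. }
intros h Hh.
assert (L1 := Rmin_l (1/2) (eps / (8 * Cmod (cexp z)))).
assert (L2 := Rmin_r (1/2) (eps / (8 * Cmod (cexp z)))).
rewrite cexp_add.
replace (cexp z * cexp h - cexp z - cexp z * h)%C
  with (cexp z * (cexp h - 1 - h))%C by ring.
rewrite Cmod_mult. assert (T := cexp_taylor1 h ltac:(lra)).
apply Rle_trans with (Cmod (cexp z) * (8 * Cmod h ^ 2)).
- apply Rmult_le_compat_l; lra.
- assert (H0 := Cmod_ge_0 h).
  replace (Cmod (cexp z) * (8 * Cmod h ^ 2)) with ((8 * Cmod (cexp z) * Cmod h) * Cmod h) by ring.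
  apply Rmult_le_compat_r; auto.
  replace eps with (8 * Cmod (cexp z) * (eps / (8 * Cmod (cexp z)))) by (field; lra).
  apply Rmult_le_compat_l; lra.
Qed.

Lemma Ccont_exp (z : C) : Ccont cexp z.
Proof. exact (gder_cont _ _ _ _ _ (Cder_exp z)). Qed.

Lemma gder_eq {K} (pl : K -> K -> K) em f x l l' :
  gder pl em f x l -> l = l' -> gder pl em f x l'.
Proof. now intros H <-. Qed.

(** * Curves through their real and imaginary parts *)

(** Bridge to real analysis: a curve is differentiated as a whole with [cder], while mean values,
    continuity and integrals are taken on its real and imaginary parts. In the proof [p] stands for
    either part. *)
Lemma cder_is_derive (f : R -> C) t l : cder f t l ->
  is_derive (fun u => Re (f u)) t (Re l) /\ is_derive (fun u => Im (f u)) t (Im l).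
Proof.
intros H.
assert (G : forall p : C -> R, (forall z w, p (z - w)%C = p z - p w) ->
   (forall (z : C) (r : R), p (z * r)%C = p z * r) -> (forall z, Rabs (p z) <= Cmod z) ->
   is_derive (fun u => p (f u)) t (p l)).
{ intros p P1 P2 P3. apply is_derive_Reals. intros eps He.
  destruct (H (eps / 2)) as [d [Hd Hf]]; [lra|].
  exists (mkposreal d Hd). simpl. intros h Hh0 Hh.
  specialize (Hf h). rewrite Cmod_R in Hf. specialize (Hf Hh).
  assert (Hp : 0 < Rabs h) by (apply Rabs_pos_lt; auto).
  replace ((p (f (t + h)) - p (f t)) / h - p l)
    with (p (f (t + h)%R - f t - l * h)%C / h) by (rewrite !P1, P2; field; auto).
  unfold Rdiv. rewrite Rabs_mult, Rabs_inv.
  apply Rmult_lt_reg_r with (Rabs h); auto.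
  rewrite Rmult_assoc, Rinv_l, Rmult_1_r by lra.
  eapply Rle_lt_trans; [apply P3|]. eapply Rle_lt_trans; [exact Hf|]. nra. }
split; apply G.
- intros; simpl; unfold Re; simpl; ring.
- intros; unfold Re; simpl; ring.
- apply Re_le_Cmod.
- intros; simpl; unfold Im; simpl; ring.
- intros; unfold Im; simpl; ring.
- apply Im_le_Cmod.
Qed.

Lemma is_derive_cder (f : R -> C) t l :
  is_derive (fun u => Re (f u)) t (Re l) -> is_derive (fun u => Im (f u)) t (Im l) ->
  cder f t l.
Proof.
intros H1 H2 eps He.
apply is_derive_Reals in H1. apply is_derive_Reals in H2.
destruct (H1 (eps / 2)) as [d1 D1]; [lra|]. destruct (H2 (eps / 2)) as [d2 D2]; [lra|].
assert (P1 := cond_pos d1). assert (P2 := cond_pos d2).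
exists (Rmin d1 d2). split; [apply Rmin_pos; auto|].
intros h Hh. rewrite Cmod_R in *.
destruct (Req_dec h 0) as [->|Hn].
{ rewrite (Rplus_0_r t).
  replace (f t - f t - l * 0%R)%C with (RtoC 0) by (apply C_ext; unfold Re, Im; simpl; ring).
  rewrite Cmod_0, Rabs_R0. lra. }
assert (L1 := Rmin_l d1 d2). assert (L2 := Rmin_r d1 d2).
specialize (D1 h Hn ltac:(lra)). specialize (D2 h Hn ltac:(lra)).
assert (Hp : 0 < Rabs h) by (apply Rabs_pos_lt; auto).
assert (S : forall a b c : R, Rabs ((a - b) / h - c) < eps / 2 ->
   Rabs (a - b - c * h) <= eps / 2 * Rabs h).
{ intros a b c Hc. replace (a - b - c * h) with (((a - b) / h - c) * h) by (field; auto).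
  rewrite Rabs_mult. apply Rmult_le_compat_r; lra. }
eapply Rle_trans; [apply Cmod_le_ReIm|].
replace (Re (f (t + h)%R - f t - l * h)%C) with (Re (f (t + h)%R) - Re (f t) - Re l * h)
  by (unfold Re; simpl; ring).
replace (Im (f (t + h)%R - f t - l * h)%C) with (Im (f (t + h)%R) - Im (f t) - Im l * h)
  by (unfold Im; simpl; ring).
apply S in D1. apply S in D2. lra.
Qed.

Lemma ccont_continuous (f : R -> C) t : ccont f t ->
  continuous (fun u => Re (f u)) t /\ continuous (fun u => Im (f u)) t.
Proof.
intros H.
assert (G : forall p : C -> R, (forall z w, p (z - w)%C = p z - p w) ->
   (forall z, Rabs (p z) <= Cmod z) -> continuous (fun u => p (f u)) t).
{ intros p P1 P3. apply continuity_pt_filterlim. intros eps He.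
  destruct (H eps He) as [d [Hd Hf]]. exists d. split; auto.
  intros u [_ Hu]. unfold dist in *; simpl in *; unfold R_dist in *.
  specialize (Hf (u - t)). rewrite Cmod_R in Hf. specialize (Hf Hu).
  replace (t + (u - t)) with u in Hf by ring. rewrite <- P1.
  eapply Rle_lt_trans; [apply P3|]. auto. }
split; apply G.
- intros; unfold Re; simpl; ring.
- apply Re_le_Cmod.
- intros; unfold Im; simpl; ring.
- apply Im_le_Cmod.
Qed.

Lemma continuous_ccont (f : R -> C) t :
  continuous (fun u => Re (f u)) t -> continuous (fun u => Im (f u)) t -> ccont f t.
Proof.
intros H1 H2 eps He.
apply continuity_pt_filterlim in H1. apply continuity_pt_filterlim in H2.
destruct (H1 (eps / 2)) as [d1 [P1 D1]]; [lra|]. destruct (H2 (eps / 2)) as [d2 [P2 D2]]; [lra|].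
exists (Rmin d1 d2). split; [apply Rmin_pos; auto|].
intros h Hh. rewrite Cmod_R in *.
assert (L1 := Rmin_l d1 d2). assert (L2 := Rmin_r d1 d2).
destruct (Req_dec h 0) as [->|Hn].
{ rewrite (Rplus_0_r t).
  replace (f t - f t)%C with (RtoC 0) by ring. rewrite Cmod_0. lra. }
assert (T : Rabs (t + h - t) = Rabs h) by (f_equal; ring).
specialize (D1 (t + h)). specialize (D2 (t + h)).
unfold dist in *; simpl in *; unfold R_dist in *. rewrite T in D1, D2.
assert (Hd1 : Rabs (Re (f (t + h)%R) - Re (f t)) < eps / 2).
{ apply D1. split; [|lra]. split; [exact I|]. intros E; apply Hn; lra. }
assert (Hd2 : Rabs (Im (f (t + h)%R) - Im (f t)) < eps / 2).
{ apply D2. split; [|lra]. split; [exact I|]. intros E; apply Hn; lra. }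
eapply Rle_lt_trans; [apply Cmod_le_ReIm|].
replace (Re (f (t + h)%R - f t)%C) with (Re (f (t + h)%R) - Re (f t)) by (unfold Re; simpl; ring).
replace (Im (f (t + h)%R - f t)%C) with (Im (f (t + h)%R) - Im (f t)) by (unfold Im; simpl; ring).
lra.
Qed.

(** * Integrals of curves *)

Definition CInt (f : R -> C) (a b : R) : C :=
  (RInt (fun t => Re (f t)) a b, RInt (fun t => Im (f t)) a b).

Definition ccont_on (f : R -> C) (a b : R) : Prop :=
  forall t, a <= t <= b -> ccont f t.

Lemma ccont_on_ex (f : R -> C) a b : a <= b -> ccont_on f a b ->
  ex_RInt (fun t => Re (f t)) a b /\ ex_RInt (fun t => Im (f t)) a b.
Proof.
intros Hab H; split; apply (ex_RInt_continuous (V := R_CompleteNormedModule)); intros t;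
  rewrite Rmin_left, Rmax_right by auto; intros Ht; apply (ccont_continuous f t (H t Ht)).
Qed.

Lemma CInt_ext f g a b : a <= b -> (forall t, a < t < b -> f t = g t) -> CInt f a b = CInt g a b.
Proof.
intros Hab H. unfold CInt. f_equal; apply RInt_ext; intros t;
  rewrite Rmin_left, Rmax_right by auto; intros Ht; now rewrite H.
Qed.

Lemma CInt_plus f g a b : a <= b -> ccont_on f a b -> ccont_on g a b ->
  CInt (fun t => f t + g t)%C a b = (CInt f a b + CInt g a b)%C.
Proof.
intros Hab Hf Hg. destruct (ccont_on_ex f a b Hab Hf), (ccont_on_ex g a b Hab Hg).
apply C_ext; unfold CInt; simpl; unfold Re, Im; simpl.
- apply (RInt_plus (V := R_CompleteNormedModule)); auto.
- apply (RInt_plus (V := R_CompleteNormedModule)); auto.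
Qed.

Lemma CInt_scal (c : C) f a b : a <= b -> ccont_on f a b ->
  CInt (fun t => c * f t)%C a b = (c * CInt f a b)%C.
Proof.
intros Hab Hf. destruct (ccont_on_ex f a b Hab Hf) as [H1 H2].
assert (S : forall (k : R) (g : R -> R), ex_RInt g a b -> ex_RInt (fun t => k * g t) a b)
  by (intros k g Hg; apply (ex_RInt_scal (V := R_NormedModule)); auto).
assert (E : forall (k : R) (g : R -> R), ex_RInt g a b ->
   RInt (fun t => k * g t) a b = k * RInt g a b)
  by (intros k g Hg; apply (RInt_scal (V := R_CompleteNormedModule)); auto).
apply C_ext; unfold CInt; simpl.
- rewrite <- !E by auto.
  apply (RInt_minus (V := R_CompleteNormedModule)); auto.
- rewrite <- !E by auto.
  apply (RInt_plus (V := R_CompleteNormedModule)); auto.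
Qed.

Lemma CInt_Chasles f a b c : a <= b -> b <= c -> ccont_on f a c ->
  (CInt f a b + CInt f b c)%C = CInt f a c.
Proof.
intros Hab Hbc Hf.
destruct (ccont_on_ex f a b Hab) as [H1 H2]; [intros t Ht; apply Hf; lra|].
destruct (ccont_on_ex f b c Hbc) as [H3 H4]; [intros t Ht; apply Hf; lra|].
apply C_ext; unfold CInt; simpl; apply (RInt_Chasles (V := R_CompleteNormedModule)); auto.
Qed.

Lemma CInt_point f a : CInt f a a = 0%C.
Proof. apply C_ext; unfold CInt; simpl; apply (RInt_point (V := R_CompleteNormedModule)). Qed.

Lemma CInt_FTC f g a b : a <= b -> (forall t, a <= t <= b -> cder f t (g t)) ->
  ccont_on g a b -> CInt g a b = (f b - f a)%C.
Proof.
intros Hab Hd Hc.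
apply C_ext; unfold CInt; simpl; apply (is_RInt_unique (V := R_CompleteNormedModule)).
- apply (is_RInt_derive (V := R_CompleteNormedModule) (fun t => Re (f t)) (fun t => Re (g t))); intros t;
    rewrite Rmin_left, Rmax_right by auto; intros Ht.
  + apply cder_is_derive; auto.
  + apply ccont_continuous; auto.
- apply (is_RInt_derive (V := R_CompleteNormedModule) (fun t => Im (f t)) (fun t => Im (g t))); intros t;
    rewrite Rmin_left, Rmax_right by auto; intros Ht.
  + apply cder_is_derive; auto.
  + apply ccont_continuous; auto.
Qed.

(** The factor 2 is the price of bounding the real and the imaginary part separately; later only
    orders of magnitude in N matter. *)
Lemma CInt_bound f (g : R -> R) a b : a <= b -> ccont_on f a b -> ex_RInt g a b ->
  (forall t, a < t < b -> Cmod (f t) <= g t) -> Cmod (CInt f a b) <= 2 * RInt g a b.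
Proof.
intros Hab Hf Hg H. destruct (ccont_on_ex f a b Hab Hf) as [H1 H2].
assert (G : forall p : R -> R, ex_RInt p a b -> (forall t, a < t < b -> Rabs (p t) <= g t) ->
   Rabs (RInt p a b) <= RInt g a b).
{ intros p Hp Hb. apply Rabs_le.
  assert (Hgo : ex_RInt (fun t => - g t) a b) by (apply (ex_RInt_opp (V := R_NormedModule)); auto).
  split.
  - replace (- RInt g a b) with (RInt (fun t => - g t) a b)
      by (apply (RInt_opp (V := R_CompleteNormedModule)); auto).
    apply RInt_le; auto. intros t Ht. specialize (Hb t Ht). apply Rabs_le_between in Hb. lra.
  - apply RInt_le; auto. intros t Ht. specialize (Hb t Ht). apply Rabs_le_between in Hb. lra. }
eapply Rle_trans; [apply Cmod_le_ReIm|]. unfold CInt; simpl.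
assert (B1 := G (fun t => Re (f t)) H1 (fun t Ht => Rle_trans _ _ _ (Re_le_Cmod (f t)) (H t Ht))).
assert (B2 := G (fun t => Im (f t)) H2 (fun t Ht => Rle_trans _ _ _ (Im_le_Cmod (f t)) (H t Ht))).
lra.
Qed.

Lemma CInt_bound_const f M a b : a <= b -> ccont_on f a b ->
  (forall t, a < t < b -> Cmod (f t) <= M) -> Cmod (CInt f a b) <= 2 * M * (b - a).
Proof.
intros Hab Hf H.
eapply Rle_trans; [apply (CInt_bound f (fun _ => M)); auto|].
- apply (ex_RInt_const (V := R_NormedModule)).
- rewrite (RInt_const (V := R_CompleteNormedModule)). unfold scal; simpl; unfold mult; simpl. lra.
Qed.

(** * Primitives on star-shaped domains *)

(** A parameter and an integration variable are packed into one complex number, so that joint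
    continuity is [Ccont]. The 1-Lipschitz map [g] will be the clamp of the integration variable to
    its interval. *)
Lemma Ccont_continuity_2d (p : C -> R) (Phi : C -> C) (g : R -> R) (u v : R) :
  (forall z w, p (z - w)%C = p z - p w) -> (forall z, Rabs (p z) <= Cmod z) ->
  (forall x y, Rabs (g x - g y) <= Rabs (x - y)) ->
  Ccont Phi (u, g v) -> continuity_2d_pt (fun x y => p (Phi (x, g y))) u v.
Proof.
intros P1 P3 Hg H eps. destruct (H eps (cond_pos eps)) as [d [Hd Hf]].
exists (mkposreal (d / 2) ltac:(lra)). simpl. intros x y Hx Hy.
specialize (Hf (x - u, g y - g v)%R). rewrite <- P1.
eapply Rle_lt_trans; [apply P3|].
replace ((u, g v) + (x - u, g y - g v)%R)%C with ((x, g y) : C) in Hf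
  by (apply C_ext; unfold Re, Im; simpl; ring).
apply Hf. eapply Rle_lt_trans; [apply Cmod_pair_le|].
specialize (Hg y v). lra.
Qed.

Lemma Ccont_fst (c : R -> C) (u v : R) : ccont c u -> Ccont (fun p : C => c (Re p)) (u, v).
Proof.
intros H eps He. destruct (H eps He) as [d [Hd Hf]]. exists d. split; auto.
intros h Hh. unfold Re at 1. simpl. apply Hf. rewrite Cmod_R.
eapply Rle_lt_trans; [apply Re_le_Cmod|]. auto.
Qed.

Lemma Ccont_snd (u v : R) : Ccont (fun p : C => RtoC (Im p)) (u, v).
Proof.
intros eps He. exists eps. split; auto.
intros h Hh. unfold Im; simpl. rewrite <- RtoC_minus, Cmod_R.
replace (v + snd h - v) with (snd h) by ring.
eapply Rle_lt_trans; [apply Im_le_Cmod|]. auto.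
Qed.


Lemma Re_minus (z w : C) : Re (z - w)%C = Re z - Re w.
Proof. unfold Re; simpl; ring. Qed.

Lemma Im_minus (z w : C) : Im (z - w)%C = Im z - Im w.
Proof. unfold Im; simpl; ring. Qed.

Lemma clamp_in (a b t : R) : a <= b -> a <= Rmax a (Rmin b t) <= b.
Proof. intros H. unfold Rmax, Rmin. repeat destruct Rle_dec; lra. Qed.

Lemma clamp_id (a b t : R) : a <= t <= b -> Rmax a (Rmin b t) = t.
Proof. intros H. unfold Rmax, Rmin. repeat destruct Rle_dec; lra. Qed.

Lemma clamp_lipschitz (a b x y : R) :
  a <= b -> Rabs (Rmax a (Rmin b x) - Rmax a (Rmin b y)) <= Rabs (x - y).
Proof.
intros H. unfold Rmax, Rmin. repeat destruct Rle_dec; unfold Rabs; repeat destruct Rcase_abs; lra.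
Qed.

Lemma cder_CInt_param (F F1 : C -> C) (a b t0 d : R) : a <= b -> 0 < d ->
  (forall u t, Rabs (u - t0) < d -> a <= t <= b -> cder (fun u => F (u, t)) u (F1 (u, t))) ->
  (forall u, Rabs (u - t0) < d -> ccont_on (fun t => F (u, t)) a b) ->
  (forall t, a <= t <= b -> Ccont F1 (t0, t)) ->
  cder (fun u => CInt (fun t => F (u, t)) a b) t0 (CInt (fun t => F1 (t0, t)) a b).
Proof.
intros Hab Hd HF HC HF1.
(* Clamping [t] to [a, b] makes the hypotheses of [is_derive_RInt_param] hold beyond the endpoints. *)
set (g := fun t => Rmax a (Rmin b t)).
assert (G : forall p : C -> R,
   (forall z w, p (z - w)%C = p z - p w) -> (forall z, Rabs (p z) <= Cmod z) ->
   (forall u t, Rabs (u - t0) < d -> a <= t <= b ->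
       is_derive (fun u => p (F (u, t))) u (p (F1 (u, t)))) ->
   (forall u, Rabs (u - t0) < d -> ex_RInt (fun t => p (F (u, t))) a b) ->
   is_derive (fun u => RInt (fun t => p (F (u, t))) a b) t0
      (RInt (fun t => p (F1 (t0, t))) a b)).
{ intros p P1 P3 D1 E1.
  assert (Dg : forall u t, Rabs (u - t0) < d ->
     Derive (fun u => p (F (u, g t))) u = p (F1 (u, g t))).
  { intros u t Hu. apply is_derive_unique. apply D1; auto. apply clamp_in; auto. }
  assert (Z : Rabs (t0 - t0) < d) by (replace (t0 - t0) with 0 by ring; rewrite Rabs_R0; auto).
  apply (is_derive_ext (fun u => RInt (fun t => p (F (u, g t))) a b)).
  { intros u. apply RInt_ext. intros t. rewrite Rmin_left, Rmax_right by auto. intros Ht.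
    unfold g. rewrite clamp_id by lra. auto. }
  replace (RInt (fun t => p (F1 (t0, t))) a b)
    with (RInt (fun t => Derive (fun u => p (F (u, g t))) t0) a b).
  - apply is_derive_RInt_param.
    + exists (mkposreal d Hd). simpl. intros u Hu t _.
      exists (p (F1 (u, g t))). apply D1; [exact Hu|]. apply clamp_in; auto.
    + intros t _. apply (continuity_2d_pt_ext_loc (fun x y => p (F1 (x, g y)))).
      * exists (mkposreal d Hd). simpl. intros u v Hu Hv. symmetry. apply Dg. auto.
      * apply Ccont_continuity_2d; auto.
        -- intros; apply clamp_lipschitz; auto.
        -- apply HF1. apply clamp_in; auto.
    + exists (mkposreal d Hd). simpl. intros u Hu.
      apply (ex_RInt_ext (fun t => p (F (u, t)))); [|apply E1; exact Hu].
      intros t. rewrite Rmin_left, Rmax_right by auto. intros Ht.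
      unfold g. rewrite clamp_id by lra. auto.
  - apply RInt_ext. intros t. rewrite Rmin_left, Rmax_right by auto. intros Ht.
    rewrite Dg by auto. unfold g. rewrite clamp_id by lra. auto. }
apply is_derive_cder; unfold CInt; simpl.
- apply (G Re).
  + apply Re_minus.
  + apply Re_le_Cmod.
  + intros; apply cder_is_derive; auto.
  + intros u Hu; exact (proj1 (ccont_on_ex _ a b Hab (HC u Hu))).
- apply (G Im).
  + apply Im_minus.
  + apply Im_le_Cmod.
  + intros; apply cder_is_derive; auto.
  + intros u Hu; exact (proj2 (ccont_on_ex _ a b Hab (HC u Hu))).
Qed.

(** The integral of [f] over the straight segment from [a] to [z]. *)
Definition star_prim (a : C) (f : C -> C) (z : C) : C :=
  ((z - a) * CInt (fun t => f (a + t * (z - a))%C) 0 1)%C.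

(** Differentiation under the integral sign gives the integral over t of f(p) + t (z - a) f'(p) at p
    = a + t (z - a), and this integrand is the t-derivative of t f(p). So the segment integral is a
    primitive on a domain star-shaped about [a]. The derivative is taken along a curve [c], which is
    the form integration along [c] asks for. *)
Lemma cder_star_prim (D : C -> Prop) (a : C) (f f1 : C -> C) (c c1 : R -> C) (t0 d : R) :
  (forall z t, D z -> 0 <= t <= 1 -> D (a + t * (z - a))%C) ->
  (forall z, D z -> Cder f z (f1 z)) -> (forall z, D z -> Ccont f1 z) ->
  0 < d -> (forall u, Rabs (u - t0) < d -> D (c u) /\ cder c u (c1 u)) -> ccont c1 t0 ->
  cder (fun u => star_prim a f (c u)) t0 (f (c t0) * c1 t0).
Proof.
intros Hs Hf Hf1 Hd Hc Hc1.
assert (Z : Rabs (t0 - t0) < d) by (replace (t0 - t0) with 0 by ring; rewrite Rabs_R0; auto).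
set (P := fun p : C => (a + RtoC (Im p) * (c (Re p) - a))%C).
set (F := fun p : C => f (P p)).
set (F1 := fun p : C => (f1 (P p) * (RtoC (Im p) * c1 (Re p)))%C).
assert (DP : forall u t, Rabs (u - t0) < d -> 0 <= t <= 1 -> D (P (u, t))).
{ intros u t Hu Ht. apply Hs; [apply Hc; exact Hu|exact Ht]. }
assert (Dt : forall u t, cder (fun t => P (u, t)) t (c u - a)).
{ intros u t. unfold P, Re, Im; cbn [fst snd]. eapply gder_eq.
  - apply gder_plus; [apply gder_const|]. apply gder_mult; [apply cder_RtoC|apply gder_const].
  - cbv beta; ring. }
assert (H1 : cder (fun u => CInt (fun t => F (u, t)) 0 1) t0 (CInt (fun t => F1 (t0, t)) 0 1)).
{ apply (cder_CInt_param F F1 0 1 t0 d); auto; [lra| | |].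
  - intros u t Hu Ht. unfold F, F1. apply (gder_comp _ _ f (fun u => P (u, t))); [apply Hf; auto|].
    unfold P, Re, Im; cbn [fst snd]. eapply gder_eq.
    + apply gder_plus; [apply gder_const|]. apply gder_mult; [apply gder_const|].
      apply gder_plus; [apply Hc; exact Hu|apply gder_const].
    + cbv beta; ring.
  - intros u Hu t Ht. eapply gder_cont. apply (gder_comp _ _ f (fun t => P (u, t))); [|apply Dt].
    apply Hf. auto.
  - intros t Ht.
    assert (Cc : Ccont (fun p : C => c (Re p)) (t0, t)).
    { apply Ccont_fst. apply (gder_cont _ _ _ _ _ (proj2 (Hc t0 Z))). }
    apply gcont_mult.
    + apply (gcont_comp _ _ f1 P); [apply Hf1; auto|].
      apply gcont_plus; [apply gcont_const|]. apply gcont_mult; [apply Ccont_snd|].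
      apply gcont_plus; [exact Cc|apply gcont_const].
    + apply gcont_mult; [apply Ccont_snd|]. apply Ccont_fst; auto. }
unfold star_prim. eapply gder_eq.
{ apply gder_mult; [apply gder_plus; [apply (proj2 (Hc t0 Z))|apply gder_const]|exact H1]. }
assert (CF : ccont_on (fun t => F (t0, t)) 0 1).
{ intros t Ht. eapply gder_cont. apply (gder_comp _ _ f (fun t => P (t0, t))); [|apply Dt].
  apply Hf. auto. }
assert (CF1 : ccont_on (fun t => F1 (t0, t)) 0 1).
{ intros t Ht. apply (gcont_ext _ _ (fun t => f1 (P (t0, t)) * (RtoC t * c1 t0))%C); [reflexivity|].
  apply gcont_mult.
  - apply (gcont_comp _ _ f1 (fun t => P (t0, t))); [apply Hf1; auto|].
    eapply gder_cont. apply Dt.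
  - apply gcont_mult; [|apply gcont_const]. exact (gder_cont _ _ _ _ _ (cder_RtoC t)). }
assert (E1 : CInt (fun t => c1 t0 * F (t0, t) + (c t0 - a) * F1 (t0, t))%C 0 1
  = ((c1 t0 + 0) * CInt (fun t : R => F (t0, t)) 0 1 +
     (c t0 + - a) * CInt (fun t : R => F1 (t0, t)) 0 1)%C).
{ rewrite CInt_plus, !CInt_scal; try lra; try ring;
    intros t Ht; first [exact (CF t Ht) | exact (CF1 t Ht) |
      apply gcont_mult; [apply gcont_const|first [exact (CF t Ht) | exact (CF1 t Ht)]]]. }
refine (eq_trans (eq_sym E1) _).
rewrite (CInt_FTC (fun t => c1 t0 * (RtoC t * F (t0, t)))%C).
- unfold F, P, Re, Im; cbn [fst snd]. replace (a + 1 * (c t0 - a))%C with (c t0) by ring. ring.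
- lra.
- intros t Ht. eapply gder_eq.
  + apply gder_mult; [apply gder_const|]. apply gder_mult; [apply cder_RtoC|].
    apply (gder_comp _ _ f (fun t => P (t0, t))); [apply Hf; auto|apply Dt].
  + unfold F, F1, Re, Im; cbn [fst snd]; cbv beta; ring.
- intros t Ht. apply gcont_plus; apply gcont_mult; try apply gcont_const;
    [exact (CF t Ht)|exact (CF1 t Ht)].
Qed.

Definition Copen (D : C -> Prop) : Prop :=
  forall z, D z -> exists d, 0 < d /\ forall h, Cmod h < d -> D (z + h)%C.

(* Twice differentiability makes the derivative continuous for free. *)
Definition hol (D : C -> Prop) (f : C -> C) : Prop :=
  exists f1 f2 : C -> C, forall z, D z -> Cder f z (f1 z) /\ Cder f1 z (f2 z).

Lemma hol_const (D : C -> Prop) (c : C) : hol D (fun _ => c).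
Proof. exists (fun _ => 0%C), (fun _ => 0%C). intros; split; apply gder_const. Qed.

Lemma hol_id D : hol D (fun z => z).
Proof.
exists (fun _ => 1%C), (fun _ => 0%C). intros; split; [apply Cder_id|apply gder_const].
Qed.

Lemma hol_plus (D : C -> Prop) (f g : C -> C) : hol D f -> hol D g -> hol D (fun z => f z + g z)%C.
Proof.
intros [f1 [f2 Hf]] [g1 [g2 Hg]].
exists (fun z => f1 z + g1 z)%C, (fun z => f2 z + g2 z)%C.
intros z Hz. destruct (Hf z Hz), (Hg z Hz). split; apply gder_plus; auto.
Qed.

Lemma hol_mult (D : C -> Prop) (f g : C -> C) : hol D f -> hol D g -> hol D (fun z => f z * g z)%C.
Proof.
intros [f1 [f2 Hf]] [g1 [g2 Hg]].
exists (fun z => f1 z * g z + f z * g1 z)%C,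
  (fun z => (f2 z * g z + f1 z * g1 z) + (f1 z * g1 z + f z * g2 z))%C.
intros z Hz. destruct (Hf z Hz), (Hg z Hz).
split; [apply gder_mult; auto|]. apply gder_plus; apply gder_mult; auto.
Qed.

Lemma hol_exp (D : C -> Prop) (f : C -> C) : hol D f -> hol D (fun z => cexp (f z)).
Proof.
intros [f1 [f2 Hf]].
exists (fun z => cexp (f z) * f1 z)%C,
  (fun z => cexp (f z) * f1 z * f1 z + cexp (f z) * f2 z)%C.
intros z Hz. destruct (Hf z Hz).
assert (H1 : Cder (fun z => cexp (f z)) z (cexp (f z) * f1 z)%C).
{ apply (gder_comp _ _ cexp f); auto. apply Cder_exp. }
split; auto. exact (gder_mult _ _ (fun z => cexp (f z)) f1 _ _ _ H1 H0).
Qed.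

Lemma hol_inv (D : C -> Prop) (f : C -> C) : (forall z, D z -> f z <> 0%C) -> hol D f -> hol D (fun z => / f z)%C.
Proof.
intros Hn [f1 [f2 Hf]].
set (g := fun z => (/ f z)%C). set (g1 := fun z => (- (g z * g z) * f1 z)%C).
exists g1, (fun z => - (g1 z * g z + g z * g1 z) * f1 z + - (g z * g z) * f2 z)%C.
intros z Hz. destruct (Hf z Hz).
assert (H1 : Cder g z (g1 z)).
{ exact (gder_comp _ _ Cinv f z _ _ (Cder_inv (f z) (Hn z Hz)) H). }
split; auto.
refine (gder_mult _ _ (fun z => - (g z * g z))%C f1 _ _ _ _ H0).
eapply gder_eq.
- apply (gder_ext _ _ (fun z => (-1) * (g z * g z))%C); [intros; ring|].
  apply gder_mult; [apply gder_const|]. apply gder_mult; eauto.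
- cbv beta. ring.
Qed.

Lemma hol_pow (D : C -> Prop) (f : C -> C) n : hol D f -> hol D (fun z => f z ^ n)%C.
Proof.
intros Hf. induction n; simpl; [apply hol_const|apply hol_mult; auto].
Qed.

Lemma hol_ccont (D : C -> Prop) (f : C -> C) z : D z -> hol D f -> Ccont f z.
Proof. intros Hz [f1 [f2 Hf]]. eapply gder_cont. apply Hf; auto. Qed.

(** The form in which path independence is used: the integral along any smooth curve inside the
    domain is a difference of values of [star_prim], so replacing a contour amounts to comparing
    values of one function. *)
Lemma star_prim_int (D : C -> Prop) (a : C) (f : C -> C) (c c1 : R -> C) (x y : R) :
  Copen D -> (forall z t, D z -> 0 <= t <= 1 -> D (a + t * (z - a))%C) -> hol D f ->
  (forall t, cder c t (c1 t)) -> (forall t, ccont c1 t) ->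
  x <= y -> (forall t, x <= t <= y -> D (c t)) ->
  CInt (fun t => f (c t) * c1 t)%C x y = (star_prim a f (c y) - star_prim a f (c x))%C.
Proof.
intros Ho Hs Hf Hc Hc1 Hxy HD.
apply (CInt_FTC (fun t => star_prim a f (c t))); auto.
- intros t Ht. destruct (Ho _ (HD t Ht)) as [e [He Hoe]].
  destruct (cder_cont _ _ _ (Hc t) e He) as [d [Hd Hcd]].
  pose proof Hf as [f1 [f2 Hf12]].
  apply (cder_star_prim D a f f1 c c1 t d); auto.
  + intros z Hz; apply Hf12; auto.
  + intros z Hz. eapply gder_cont. apply Hf12; auto.
  + intros u Hu. split; auto.
    replace (c u) with (c t + (c u - c t))%C by ring. apply Hoe.
    replace u with (t + (u - t)) at 1 by ring. apply Hcd. rewrite Cmod_R. auto.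
- intros t Ht. apply gcont_mult; [|exact (Hc1 t)].
  apply (gcont_comp _ _ f c); [apply (hol_ccont D); auto|].
  exact (cder_cont _ _ _ (Hc t)).
Qed.

(** * The integrand *)

Fixpoint cpoch (q : C) (N : nat) : C :=
  match N with O => 1%C | S k => (cpoch q k * (1 - q ^ S k))%C end.

Definition cpowz (z : C) (m : Z) : C :=
  match m with
  | Z0 => 1%C
  | Zpos p => (z ^ Pos.to_nat p)%C
  | Zneg p => (/ z ^ Pos.to_nat p)%C
  end.

Lemma cpowz_of_nat (z : C) n : cpowz z (Z.of_nat n) = (z ^ n)%C.
Proof. destruct n; simpl; auto. now rewrite SuccNat2Pos.id_succ. Qed.

Lemma cpowz_opp_nat (z : C) n : cpowz z (- Z.of_nat n) = (/ z ^ n)%C.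
Proof.
destruct n; simpl; [|now rewrite SuccNat2Pos.id_succ].
field.
Qed.

Lemma cpowz_sub (z : C) (i j : nat) : z <> 0%C ->
  cpowz z (Z.of_nat i - Z.of_nat j) = (z ^ i / z ^ j)%C.
Proof.
intros Hz. destruct (Nat.le_gt_cases j i) as [H|H].
- replace (Z.of_nat i - Z.of_nat j)%Z with (Z.of_nat (i - j)) by lia.
  rewrite cpowz_of_nat. replace i with (i - j + j)%nat at 2 by lia.
  rewrite Cpow_add_r. field. repeat split; apply Cpow_nz; auto.
- replace (Z.of_nat i - Z.of_nat j)%Z with (- Z.of_nat (j - i))%Z by lia.
  rewrite cpowz_opp_nat. replace j with (j - i + i)%nat at 2 by lia.
  rewrite Cpow_add_r. field. split; apply Cpow_nz; auto.
Qed.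

Lemma Z_as_sub (m : Z) : exists i j : nat, m = (Z.of_nat i - Z.of_nat j)%Z.
Proof. exists (Z.to_nat m), (Z.to_nat (- m)). lia. Qed.

Lemma cpowz_add (z : C) m n : z <> 0%C -> cpowz z (m + n) = (cpowz z m * cpowz z n)%C.
Proof.
intros Hz. destruct (Z_as_sub m) as [i [j ->]], (Z_as_sub n) as [k [l ->]].
replace (Z.of_nat i - Z.of_nat j + (Z.of_nat k - Z.of_nat l))%Z
  with (Z.of_nat (i + k) - Z.of_nat (j + l))%Z by lia.
rewrite !cpowz_sub, !Cpow_add_r by auto. field. split; apply Cpow_nz; auto.
Qed.

Lemma Cinv_nz (z : C) : z <> 0%C -> (/ z)%C <> 0%C.
Proof.
intros Hz E. apply C1_nz. rewrite <- (Cinv_r z Hz), E. ring.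
Qed.

Lemma cpowz_neq_0 (z : C) m : z <> 0%C -> cpowz z m <> 0%C.
Proof.
intros Hz. destruct m; simpl.
- apply C1_nz.
- apply Cpow_nz; auto.
- apply Cinv_nz. apply Cpow_nz; auto.
Qed.

Lemma cpowz_mult (z w : C) m : z <> 0%C -> w <> 0%C -> cpowz (z * w)%C m = (cpowz z m * cpowz w m)%C.
Proof.
intros Hz Hw. destruct m; simpl.
- ring.
- apply Cpow_mult_l.
- rewrite Cpow_mult_l. field. split; apply Cpow_nz; auto.
Qed.

Lemma cpowz_conj (z : C) m : z <> 0%C -> cpowz (Cconj z) m = Cconj (cpowz z m).
Proof.
intros Hz. destruct m; simpl.
- apply C_ext; unfold Re, Im; simpl; ring.
- now rewrite Cpow_conj.
- rewrite Cinv_conj by (apply Cpow_nz; auto). now rewrite Cpow_conj.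
Qed.

Lemma hol_cpowz (D : C -> Prop) (f : C -> C) m : (forall z, D z -> f z <> 0%C) -> hol D f ->
  hol D (fun z => cpowz (f z) m).
Proof.
intros Hn Hf. destruct m; simpl.
- apply hol_const.
- apply hol_pow; auto.
- apply hol_inv; [intros; apply Cpow_nz; auto|apply hol_pow; auto].
Qed.

Definition integrand (N : nat) (m : Z) (t : C) : C :=
  (cexp t * cpowz (cexp t - 1) (- m - 1) * / cpoch (cexp t) N)%C.

(** The zeros of (q)_N at q = e^t are the points 2 pi i a / j with 1 <= j <= N. They lie on the
    imaginary axis, and the first one above 0 is 2 pi i / N. The domain consists of the two open
    half planes joined through the gap below that point. *)
Definition dom (N : nat) (t : C) : Prop :=
  Re t <> 0 \/ (0 < Im t < 2 * PI / INR N).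

Lemma cexp_eq_1 (t : C) : cexp t = 1%C -> Re t = 0 /\ cos (Im t) = 1.
Proof.
intros H. assert (E : Re t = 0).
{ assert (H1 := Cmod_cexp t). rewrite H, Cmod_1 in H1.
  rewrite <- exp_0 in H1. symmetry. apply exp_inv. auto. }
split; auto. apply (f_equal Re) in H. unfold cexp in H. rewrite E, exp_0 in H.
unfold Re in H; simpl in H. lra.
Qed.

Lemma cos_eq_1_range (y : R) : 0 < y < 2 * PI -> cos y <> 1.
Proof.
intros H E. replace y with (2 * (y / 2)) in E by field. rewrite cos_2a_sin in E.
assert (0 < sin (y / 2)) by (apply sin_gt_0; lra). nra.
Qed.

Lemma dom_cexp_neq_1 N (t : C) (j : nat) : (1 <= j <= N)%nat -> dom N t -> (cexp t ^ j)%C <> 1%C.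
Proof.
intros Hj Ht E. rewrite cexp_pow in E. apply cexp_eq_1 in E. destruct E as [E1 E2].
assert (J : 1 <= INR j) by (apply (le_INR 1); lia).
assert (JN : INR j <= INR N) by (apply le_INR; lia).
unfold Re, Im in *; simpl in *. destruct Ht as [Ht|Ht].
- apply Ht. unfold Re. nra.
- revert E2. replace (INR j * snd t + 0 * fst t) with (INR j * snd t) by ring.
  apply cos_eq_1_range. unfold Im in Ht. split; [nra|].
  apply Rle_lt_trans with (INR N * snd t); [nra|].
  replace (2 * PI) with (INR N * (2 * PI / INR N)) by (field; lra).
  apply Rmult_lt_compat_l; lra.
Qed.

Lemma cpoch_neq_0 (q : C) N : (forall j, (1 <= j <= N)%nat -> (q ^ j)%C <> 1%C) -> cpoch q N <> 0%C.
Proof.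
induction N; intros H; cbn [cpoch].
- apply C1_nz.
- apply Cmult_neq_0.
  + apply IHN. intros; apply H; lia.
  + intros E. apply (H (S N)); [lia|].
    apply Ceq_minus. rewrite <- Copp_0, <- E. ring.
Qed.

Lemma hol_cpoch (D : C -> Prop) (f : C -> C) N : hol D f -> hol D (fun z => cpoch (f z) N).
Proof.
intros Hf. induction N; cbn [cpoch]; [apply hol_const|].
apply hol_mult; auto. apply hol_plus; [apply hol_const|].
destruct (hol_mult D (fun _ => (-1)%C) (fun z => f z ^ S N)%C) as [g1 [g2 Hg]];
  [apply hol_const|apply hol_pow; auto|].
exists g1, g2. intros z Hz. destruct (Hg z Hz). split; auto.
apply (gder_ext _ _ (fun z => (-1) * f z ^ S N)%C); auto. intros; ring.
Qed.

Lemma hol_integrand (D : C -> Prop) N m : (1 <= N)%nat ->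
  (forall t j, D t -> (1 <= j <= N)%nat -> (cexp t ^ j)%C <> 1%C) -> hol D (integrand N m).
Proof.
intros HN HD. apply hol_mult; [apply hol_mult|].
- apply hol_exp, hol_id.
- apply hol_cpowz.
  + intros z Hz. intros E. apply (HD z 1%nat); auto.
    rewrite Cpow_1_r. apply Ceq_minus. auto.
  + apply hol_plus; [apply hol_exp, hol_id|apply hol_const].
- apply hol_inv; [|apply hol_cpoch, hol_exp, hol_id].
  intros z Hz. apply cpoch_neq_0. intros j Hj. apply (HD z j); auto.
Qed.

Lemma hol_integrand_dom N m : (1 <= N)%nat -> hol (dom N) (integrand N m).
Proof.
intros HN. apply hol_integrand; auto. intros t j Ht Hj. apply (dom_cexp_neq_1 N); auto.
Qed.

Lemma Copen_dom N : Copen (dom N).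
Proof.
intros z [Hz|Hz].
- exists (Rabs (Re z)). split; [apply Rabs_pos_lt; auto|]. intros h Hh. left.
  assert (H := Re_le_Cmod h). unfold Re in *; simpl. intros E.
  replace (fst z) with (- fst h) in Hh by lra. rewrite Rabs_Ropp in Hh. lra.
- exists (Rmin (Im z) (2 * PI / INR N - Im z)). split; [apply Rmin_pos; lra|].
  intros h Hh. right. assert (H := Im_le_Cmod h). apply Rabs_le_between in H.
  assert (L1 := Rmin_l (Im z) (2 * PI / INR N - Im z)).
  assert (L2 := Rmin_r (Im z) (2 * PI / INR N - Im z)).
  unfold Im in *; simpl. lra.
Qed.

Definition dom_center (N : nat) : C := (0, PI / INR N).

(** The centre is the midpoint of the gap: a segment from it to a point off the imaginary axis
    leaves the axis at once, and one to a point of the gap stays in the gap. *)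
Lemma dom_star N z t : (1 <= N)%nat -> dom N z -> 0 <= t <= 1 ->
  dom N (dom_center N + t * (z - dom_center N))%C.
Proof.
intros HN Hz Ht. unfold dom, dom_center, Re, Im in *; simpl.
assert (P := PI_RGT_0).
assert (J : 0 < PI / INR N).
{ apply Rdiv_lt_0_compat; auto. apply (lt_INR 0); lia. }
replace (2 * PI / INR N) with (2 * (PI / INR N)) in * by (unfold Rdiv; ring).
destruct (Req_dec t 0) as [->|Ht0]; [right; lra|].
destruct Hz as [Hz|Hz].
- left. intros E. apply Hz. apply (Rmult_eq_reg_l t); lra.
- right. split; nra.
Qed.

(** * The Laurent coefficient as an integral *)

Fixpoint csum (f : nat -> C) (M : nat) : C :=
  match M with O => 0%C | S k => (csum f k + f k)%C end.

Lemma csum_ext (f g : nat -> C) M : (forall n, (n < M)%nat -> f n = g n) -> csum f M = csum g M.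
Proof.
induction M; intros H; simpl; auto. rewrite IHM by (intros; apply H; lia).
now rewrite H by lia.
Qed.

Lemma csum_scal (c : C) (f : nat -> C) M : csum (fun n => c * f n)%C M = (c * csum f M)%C.
Proof. induction M; simpl; [ring|rewrite IHM; ring]. Qed.

Lemma csum_0 (f : nat -> C) M : (forall n, (n < M)%nat -> f n = 0%C) -> csum f M = 0%C.
Proof.
induction M; intros H; simpl; auto. rewrite IHM by (intros; apply H; lia).
rewrite H by lia. ring.
Qed.


(** From [n0] on, two consecutive partial sums lie within 1 of the limit, so a term is at most 2;
    the finitely many earlier terms have a maximum. *)
Lemma series_tail_bound (b : nat -> C) (u1 : R) (l : C) :
  0 < u1 ->
  (forall eps, 0 < eps -> exists n0, forall n, (n0 <= n)%nat ->
      Cmod (csum (fun n => b n * RtoC u1 ^ n)%C n - l) < eps) ->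
  exists B, 0 <= B /\ forall n, Cmod (b n) * u1 ^ n <= B.
Proof.
intros Hu H. destruct (H 1 Rlt_0_1) as [n0 Hn0].
assert (F : exists B, 0 <= B /\ forall n, (n < n0)%nat -> Cmod (b n) * u1 ^ n <= B).
{ clear Hn0. induction n0.
  - exists 0. split; [lra|]. intros; lia.
  - destruct IHn0 as [B [HB Hn]]. exists (Rmax B (Cmod (b n0) * u1 ^ n0)). split.
    + eapply Rle_trans; [exact HB|apply Rmax_l].
    + intros n Hl. destruct (Nat.eq_dec n n0) as [->|].
      * apply Rmax_r.
      * eapply Rle_trans; [apply Hn; lia|apply Rmax_l]. }
destruct F as [B [HB HF]]. exists (Rmax B 2). split.
{ eapply Rle_trans; [exact HB|apply Rmax_l]. }
intros n. destruct (Nat.lt_ge_cases n n0) as [Hl|Hl].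
- eapply Rle_trans; [apply HF; auto|apply Rmax_l].
- eapply Rle_trans; [|apply Rmax_r].
  assert (H1 := Hn0 n Hl). assert (H2 := Hn0 (S n) ltac:(lia)). simpl in H2.
  set (p := csum (fun n => b n * RtoC u1 ^ n)%C n) in *.
  replace (Cmod (b n) * u1 ^ n) with (Cmod (b n * RtoC u1 ^ n)%C).
  2:{ rewrite Cmod_mult, Cmod_pow, Cmod_R, Rabs_pos_eq by lra. auto. }
  replace (b n * RtoC u1 ^ n)%C with ((p + b n * RtoC u1 ^ n - l) - (p - l))%C by ring.
  eapply Rle_trans; [apply Cmod_triangle|]. rewrite Cmod_opp. lra.
Qed.

(** Comparison with a geometric series of ratio at most 1/2. Carrying 1 - (1/2)^k rather than 1
    makes the induction on [k] close. *)
Lemma power_tail_bound (b : nat -> C) (u : C) (B u1 : R) (M k : nat) :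
  0 < u1 -> 0 <= B -> (forall n, Cmod (b n) * u1 ^ n <= B) -> Cmod u <= u1 / 2 ->
  Cmod (csum (fun n => b n * u ^ n)%C (M + k) - csum (fun n => b n * u ^ n)%C M)
    <= 2 * B * (Cmod u / u1) ^ M * (1 - (1 / 2) ^ k).
Proof.
intros Hu HB Hb Hc. assert (H0 := Cmod_ge_0 u).
assert (Q0 : 0 <= Cmod u / u1) by (apply Rdiv_le_0_compat; auto).
assert (Q1 : Cmod u / u1 <= 1 / 2).
{ apply Rmult_le_reg_r with u1; auto. unfold Rdiv. rewrite Rmult_assoc, Rinv_l; lra. }
induction k.
- rewrite Nat.add_0_r. unfold Cminus. rewrite Cplus_opp_r, Cmod_0. simpl. lra.
- replace (M + S k)%nat with (S (M + k)) by lia. cbn [csum].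
  set (p := csum _ (M + k)) in *. set (p0 := csum _ M) in *.
  replace (p + b (M + k)%nat * u ^ (M + k) - p0)%C
    with ((p - p0) + b (M + k)%nat * u ^ (M + k))%C by ring.
  eapply Rle_trans; [apply Cmod_triangle|].
  assert (Hk : Cmod (b (M + k)%nat * u ^ (M + k)) <= B * (Cmod u / u1) ^ M * (1 / 2) ^ k).
  { rewrite Cmod_mult, Cmod_pow.
    replace (Cmod u ^ (M + k)) with (u1 ^ (M + k) * (Cmod u / u1) ^ (M + k)).
    2:{ rewrite <- Rpow_mult_distr. f_equal. field. lra. }
    rewrite <- Rmult_assoc. rewrite Rmult_assoc with (r1 := B).
    apply Rmult_le_compat; auto.
    - apply Rmult_le_pos; [apply Cmod_ge_0|apply pow_le; lra].
    - apply pow_le; auto.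
    - rewrite pow_add. apply Rmult_le_compat_l; [apply pow_le; auto|].
      apply pow_incr; lra. }
  simpl. lra.
Qed.

Lemma power_tail_limit (b : nat -> C) (u l : C) (B u1 : R) (M : nat) :
  0 < u1 -> 0 <= B -> (forall n, Cmod (b n) * u1 ^ n <= B) -> Cmod u <= u1 / 2 ->
  (forall eps, 0 < eps -> exists n0, forall n, (n0 <= n)%nat ->
      Cmod (csum (fun n => b n * u ^ n)%C n - l) < eps) ->
  Cmod (l - csum (fun n => b n * u ^ n)%C M) <= 2 * B / u1 ^ M * Cmod u ^ M.
Proof.
intros Hu HB Hb Hc Hl.
replace (2 * B / u1 ^ M * Cmod u ^ M) with (2 * B * (Cmod u / u1) ^ M).
2:{ unfold Rdiv. rewrite Rpow_mult_distr, pow_inv. ring. }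
apply le_epsilon. intros eps He. destruct (Hl eps He) as [n0 Hn0].
specialize (Hn0 (M + n0)%nat ltac:(lia)).
assert (T := power_tail_bound b u B u1 M n0 Hu HB Hb Hc).
set (p := csum _ (M + n0)) in *. set (p0 := csum _ M) in *.
replace (l - p0)%C with (- (p - l) + (p - p0))%C by ring.
eapply Rle_trans; [apply Cmod_triangle|]. rewrite Cmod_opp.
assert (Q : 0 <= (1 / 2) ^ n0) by (apply pow_le; lra).
assert (0 <= 2 * B * (Cmod u / u1) ^ M).
{ apply Rmult_le_pos; [lra|]. apply pow_le. apply Rdiv_le_0_compat; auto. apply Cmod_ge_0. }
nra.
Qed.

Lemma cexp_sub_1_bounds (t : C) : Cmod t <= 1 / 16 ->
  Cmod t / 2 <= Cmod (cexp t - 1) <= 2 * Cmod t.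
Proof.
intros Ht. assert (T := cexp_taylor1 t ltac:(lra)). assert (H0 := Cmod_ge_0 t).
replace (cexp t - 1 - t)%C with ((cexp t - 1) - t)%C in T by ring.
assert (T1 := Cmod_triangle_inv (cexp t - 1) t).
assert (T2 := Cmod_triangle_inv t (cexp t - 1)). rewrite (Cmod_minus_sym t) in T2.
assert (Cmod t ^ 2 <= Cmod t / 16) by nra. lra.
Qed.

Definition circ (e th : R) : C := (RtoC e * cexp (Ci * RtoC th))%C.

Lemma cder_circ e th : cder (circ e) th (Ci * circ e th).
Proof.
unfold circ. eapply gder_eq.
- apply gder_mult; [apply gder_const|].
  apply (gder_comp _ _ cexp (fun t => Ci * RtoC t)%C); [apply Cder_exp|].
  apply gder_mult; [apply gder_const|apply cder_RtoC].
- cbv beta. ring.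
Qed.

Lemma Cmod_circ e th : 0 <= e -> Cmod (circ e th) = e.
Proof.
intros He. unfold circ. rewrite Cmod_mult, Cmod_R, Cmod_cexp, Rabs_pos_eq by auto.
replace (Re (Ci * th)%C) with 0 by (unfold Re; simpl; ring). rewrite exp_0. ring.
Qed.

Lemma circ_val e th : circ e th = (e * cos th, e * sin th).
Proof.
unfold circ, cexp. apply C_ext; unfold Re, Im; simpl;
 replace (0 * th - 1 * 0) with 0 by ring; replace (0 * 0 + 1 * th) with th by ring;
 rewrite exp_0; ring.
Qed.

Lemma small_cexp_pow_neq_1 N (t : C) j : (1 <= j <= N)%nat -> t <> 0%C ->
  Cmod t < 2 * PI / INR N -> (cexp t ^ j)%C <> 1%C.
Proof.
intros Hj Ht Hs E. rewrite cexp_pow in E. apply cexp_eq_1 in E. destruct E as [E1 E2].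
assert (J : 1 <= INR j) by (apply (le_INR 1); lia).
assert (JN : INR j <= INR N) by (apply le_INR; lia).
assert (HI := Im_le_Cmod t).
assert (HR : Re t = 0) by (unfold Re, Im in *; simpl in *; nra).
replace (Im (INR j * t)%C) with (INR j * Im t) in E2 by (unfold Im; simpl; ring).
assert (Hy : Im t <> 0) by (intros E; apply Ht, C_ext; auto).
assert (B : INR j * Rabs (Im t) < 2 * PI).
{ apply Rle_lt_trans with (INR N * Rabs (Im t)).
  - apply Rmult_le_compat_r; [apply Rabs_pos|auto].
  - replace (2 * PI) with (INR N * (2 * PI / INR N)) by (field; lra).
    apply Rmult_lt_compat_l; lra. }
apply (cos_eq_1_range (INR j * Rabs (Im t))).
- split; auto. apply Rmult_lt_0_compat; [lra|apply Rabs_pos_lt; auto].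
- rewrite <- E2. destruct (Rcase_abs (Im t)).
  + rewrite Rabs_left by auto. rewrite <- cos_neg. f_equal. ring.
  + rewrite Rabs_right by auto. auto.
Qed.

Lemma gder_pow {K} (pl : K -> K -> K) em (f : K -> C) x l n :
  gder pl em f x l -> gder pl em (fun y => f y ^ S n)%C x (INR (S n) * f x ^ n * l)%C.
Proof.
intros H. induction n.
- apply (gder_ext _ _ f); [intros; now rewrite Cpow_1_r|]. eapply gder_eq; eauto.
  simpl. ring.
- apply (gder_ext _ _ (fun y => f y * f y ^ S n)%C); [reflexivity|].
  eapply gder_eq; [apply gder_mult; eauto|]. cbv beta.
  rewrite (S_INR (S n)), RtoC_plus. rewrite !Cpow_S. ring.
Qed.

Lemma CInt_csum (F : nat -> R -> C) a b M : a <= b ->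
  (forall n, (n < M)%nat -> ccont_on (F n) a b) ->
  CInt (fun t => csum (fun n => F n t) M) a b = csum (fun n => CInt (F n) a b) M /\
  ccont_on (fun t => csum (fun n => F n t) M) a b.
Proof.
intros Hab H. induction M; cbn [csum].
- split.
  + apply C_ext; unfold CInt, Re, Im; simpl;
      rewrite (RInt_const (V := R_CompleteNormedModule));
      unfold scal; simpl; unfold mult; simpl; ring.
  + intros t _. apply gcont_const.
- destruct IHM as [E Hc]; [intros; apply H; lia|]. split.
  + rewrite <- E. apply CInt_plus; auto.
  + intros t Ht. apply gcont_plus; [exact (Hc t Ht)|apply (H M ltac:(lia) t Ht)].
Qed.

Lemma CInt_reflect f a b c : a <= b -> ccont_on f (c - b) (c - a) ->
  CInt f (c - b) (c - a) = CInt (fun t => f (c - t)) a b.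
Proof.
intros Hab Hf. destruct (ccont_on_ex f (c - b) (c - a) ltac:(lra) Hf) as [H1 H2].
assert (G : forall p : R -> R, ex_RInt p (c - b) (c - a) ->
   RInt p (c - b) (c - a) = RInt (fun t => p (c - t)) a b).
{ intros p Hp. assert (T := RInt_comp_lin (V := R_CompleteNormedModule) p (-1) c a b).
  replace (-1 * a + c) with (c - a) in T by ring.
  replace (-1 * b + c) with (c - b) in T by ring.
  apply ex_RInt_swap in Hp. specialize (T Hp).
  rewrite <- (opp_RInt_swap (V := R_CompleteNormedModule) p (c - a) (c - b) Hp).
  rewrite <- T. clear T.
  assert (Hp' : ex_RInt (fun t => p (c - t)) a b).
  { assert (T := ex_RInt_comp_lin (V := R_NormedModule) p (-1) c a b).
    replace (-1 * a + c) with (c - a) in T by ring.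
    replace (-1 * b + c) with (c - b) in T by ring. specialize (T Hp).
    apply (ex_RInt_scal (V := R_NormedModule) _ _ _ (-1)) in T.
    eapply ex_RInt_ext; [|exact T]. intros x _. unfold scal; simpl; unfold mult; simpl.
    replace (-1 * x + c) with (c - x) by ring. ring. }
  rewrite (RInt_ext (V := R_CompleteNormedModule) _ (fun t => opp (p (c - t)))).
  - rewrite (RInt_opp (V := R_CompleteNormedModule)); auto.
    unfold opp; simpl. ring.
  - intros x _. unfold scal, opp; simpl; unfold mult; simpl.
    replace (-1 * x + c) with (c - x) by ring. ring. }
unfold CInt. f_equal; apply G; auto.
Qed.

Lemma CInt_conj f a b : a <= b -> ccont_on f a b ->
  CInt (fun t => Cconj (f t)) a b = Cconj (CInt f a b).
Proof.
intros Hab Hf. destruct (ccont_on_ex f a b Hab Hf) as [H1 H2].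
apply C_ext; unfold CInt, Cconj, Re, Im; simpl; auto.
apply (RInt_opp (V := R_CompleteNormedModule)); auto.
Qed.

Section Circle.
Variable e : R.
Hypothesis He : 0 < e <= 1 / 16.

Let u th := (cexp (circ e th) - 1)%C.

Lemma circ_u_bounds th : e / 2 <= Cmod (u th) <= 2 * e.
Proof.
assert (H := cexp_sub_1_bounds (circ e th)). rewrite Cmod_circ in H by lra.
apply H; lra.
Qed.

Lemma circ_u_nz th : u th <> 0%C.
Proof. apply Cmod_gt_0. assert (H := circ_u_bounds th). lra. Qed.

Lemma cder_circ_u th : cder u th (cexp (circ e th) * (Ci * circ e th)).
Proof.
unfold u. eapply gder_eq.
- apply gder_plus; [|apply gder_const].
  apply (gder_comp _ _ cexp (circ e)); [apply Cder_exp|apply cder_circ].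
- ring.
Qed.

(** This is u^(-k-1) du along t = e exp(i th), where u = e^t - 1. The curve traced by u is not a
    circle, but it is closed and close to the circle of radius e. *)
Definition circ_term k th := ((/ (cexp (circ e th) - 1)) ^ S k * (cexp (circ e th) * (Ci * circ e th)))%C.

Lemma ccont_circ_term k th : ccont (circ_term k) th.
Proof.
assert (Hc : ccont (circ e) th) by exact (cder_cont _ _ _ (cder_circ e th)).
apply gcont_mult; [|apply gcont_mult].
- eapply gder_cont. apply gder_pow.
  apply (gder_comp _ _ Cinv u); [apply Cder_inv, circ_u_nz|apply cder_circ_u].
- apply (gcont_comp _ _ cexp (circ e)); [apply Ccont_exp|auto].
- apply gcont_mult; [apply gcont_const|auto].
Qed.

(** For a pole of order at least 2 the integrand has the primitive - u^(-k-1) / (k+1), which is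
    periodic in the angle. *)
Lemma CInt_circ_term_S k : CInt (circ_term (S k)) 0 (2 * PI) = 0%C.
Proof.
assert (P := PI_RGT_0).
rewrite (CInt_FTC (fun th => - / INR (S k) * (/ u th) ^ S k)%C).
- replace (u (2 * PI)) with (u 0); [ring|]. unfold u. rewrite !circ_val.
  rewrite cos_0, sin_0, cos_2PI, sin_2PI. reflexivity.
- lra.
- intros t _. eapply gder_eq.
  + apply gder_mult; [apply gder_const|]. apply gder_pow.
    apply (gder_comp _ _ Cinv u); [apply Cder_inv, circ_u_nz|apply cder_circ_u].
  + cbv beta. unfold circ_term. fold (u t). rewrite !Cpow_S.
    assert (HS : RtoC (INR (S k)) <> 0%C).
    { intros E. apply RtoC_inj in E. apply (not_0_INR (S k)); auto. }
    assert (Hu := circ_u_nz t). set (v := (/ u t)%C).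
    transitivity (/ INR (S k) * INR (S k) * (v * (v * v ^ k) * (cexp (circ e t) * (Ci * circ e t))))%C.
    * ring.
    * rewrite Cinv_l by auto. ring.
- intros t _. apply ccont_circ_term.
Qed.

(** The simple pole: du / u differs from i d th by O(e). Since e will tend to 0, this approximate
    residue takes the place of a winding number. *)
Lemma circ_term_0_bound th : Cmod (circ_term 0 th - Ci) <= 20 * e.
Proof.
unfold circ_term. fold (u th). set (t := circ e th).
assert (Hm : Cmod t = e) by (apply Cmod_circ; lra).
assert (Hu := circ_u_nz th). assert (Hb := circ_u_bounds th).
set (rho := (cexp t - 1 - t)%C).
assert (Hr : Cmod rho <= 8 * e ^ 2) by (rewrite <- Hm; apply cexp_taylor1; lra).
replace ((/ u th) ^ 1 * (cexp t * (Ci * t)) - Ci)%C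
  with (Ci * ((t * t + t * rho + - rho) * / u th))%C.
2:{ unfold rho. rewrite Cpow_1_r. change (cexp t) with (cexp t).
    assert (E : cexp t = (u th + 1)%C) by (unfold u; fold t; ring). rewrite E. field. auto. }
rewrite !Cmod_mult, Cmod_Ci, Cmod_inv by auto.
assert (T : Cmod (t * t + t * rho + - rho) <= 10 * e ^ 2).
{ eapply Rle_trans; [apply Cmod_triangle|].
  eapply Rle_trans; [apply Rplus_le_compat_r, Cmod_triangle|].
  rewrite !Cmod_mult, Cmod_opp, Hm. nra. }
rewrite Rmult_1_l. apply Rmult_le_reg_r with (Cmod (u th)); [lra|].
rewrite Rmult_assoc, Rinv_l by lra. nra.
Qed.
End Circle.

Lemma cpoch_conj q N : cpoch (Cconj q) N = Cconj (cpoch q N).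
Proof.
induction N; cbn [cpoch].
- apply C_ext; unfold Re, Im; simpl; ring.
- rewrite IHN, Cmult_conj, Cminus_conj, Cpow_conj. f_equal. f_equal.
  apply C_ext; unfold Re, Im; simpl; ring.
Qed.

Lemma integrand_conj N m (t : C) : (1 <= N)%nat ->
  (forall j, (1 <= j <= N)%nat -> (cexp t ^ j)%C <> 1%C) ->
  integrand N m (Cconj t) = Cconj (integrand N m t).
Proof.
intros HN H. unfold integrand. rewrite cexp_conj, !Cmult_conj, cpoch_conj.
rewrite Cinv_conj by (apply cpoch_neq_0; auto).
replace (Cconj (cexp t) - 1)%C with (Cconj (cexp t - 1)%C)
  by (apply C_ext; unfold Re, Im; simpl; ring).
rewrite cpowz_conj; auto.
intros E. apply (H 1%nat); [lia|]. rewrite Cpow_1_r. apply Ceq_minus; auto.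
Qed.

(** The integrand is real on the real axis, so the imaginary part of a primitive is constant along a
    real segment that avoids 0. *)
Lemma star_prim_real_segment N m (a b : R) : (1 <= N)%nat -> a <= b ->
  (forall t, a <= t <= b -> t <> 0) ->
  Im (star_prim (dom_center N) (integrand N m) b) = Im (star_prim (dom_center N) (integrand N m) a).
Proof.
intros HN Hab Hn.
assert (HD : forall t, a <= t <= b -> dom N (RtoC t)) by (intros t Ht; left; apply Hn; auto).
assert (H : CInt (fun t => integrand N m t * 1)%C a b = 
  (star_prim (dom_center N) (integrand N m) b - star_prim (dom_center N) (integrand N m) a)%C).
{ apply (star_prim_int (dom N)  _ _ RtoC (fun _ => 1%C)); auto.
  - apply Copen_dom.
  - intros; apply dom_star; auto.
  - apply hol_integrand_dom; auto.
  - apply cder_RtoC.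
  - intros; apply gcont_const. }
apply (f_equal Im) in H. rewrite Im_minus in H.
replace (Im (CInt (fun t => integrand N m t * 1)%C a b)) with 0 in H; [lra|].
change (0 = RInt (fun t => Im (integrand N m t * 1)%C) a b).
symmetry. transitivity (RInt (fun _ => 0) a b).
- apply RInt_ext. intros t. rewrite Rmin_left, Rmax_right by auto. intros Ht.
  rewrite Cmult_1_r.
  assert (E : integrand N m (Cconj t) = Cconj (integrand N m t)).
  { apply integrand_conj; auto. intros j Hj. apply (dom_cexp_neq_1 N); auto. apply HD; lra. }
  replace (Cconj t) with (RtoC t) in E by (apply C_ext; unfold Re, Im; simpl; ring).
  apply (f_equal Im) in E. rewrite im_conj in E. lra.
- rewrite (RInt_const (V := R_CompleteNormedModule)). unfold scal; simpl; unfold mult; simpl. ring.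
Qed.

Lemma Cmod_small_eq_0 (z : C) (B e0 : R) : 0 < e0 -> 0 <= B ->
  (forall e, 0 < e <= e0 -> Cmod z <= B * e) -> z = 0%C.
Proof.
intros He HB H. apply Cmod_eq_0. assert (Z := Cmod_ge_0 z).
apply Rle_antisym; auto. apply le_epsilon. intros eps Heps.
set (e := Rmin e0 (eps / (B + 1))).
assert (E1 := Rmin_l e0 (eps / (B + 1))). assert (E2 := Rmin_r e0 (eps / (B + 1))).
fold e in E1, E2.
assert (0 < e) by (apply Rmin_pos; auto; apply Rdiv_lt_0_compat; lra).
specialize (H e ltac:(lra)).
apply (Rmult_le_compat_l (B + 1)) in E2; [|lra].
replace ((B + 1) * (eps / (B + 1))) with eps in E2 by (field; lra). lra.
Qed.

(* On a small circle [|t| = e], [u = e^t - 1], the lower half contributes the conjugate of the upper one; [Im] of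
   the primitive is constant along the real half-axes, so the endpoints may be moved to [X] and [- Y]. *)
Lemma laurent_coeff (N : nat) (m : Z) (M : nat) (b : nat -> C) (delta X Y : R) :
  (1 <= N)%nat -> Z.of_nat M = (m + Z.of_nat N)%Z -> 0 < delta -> 0 < X -> 0 < Y ->
  (forall u : C, 0 < Cmod u < delta -> forall eps, 0 < eps ->
     exists n0, forall n, (n0 <= n)%nat ->
       Cmod (csum (fun n => b n * u ^ n)%C n - u ^ N / cpoch (1 + u) N) < eps) ->
  b M = RtoC (Im (star_prim (dom_center N) (integrand N m) (- Y)%R
                  - star_prim (dom_center N) (integrand N m) X) / PI).
Proof.
intros HN HM Hdel HX HY Hb.
assert (P := PI_RGT_0). assert (NR : 1 <= INR N) by (apply (le_INR 1); auto).
set (G := star_prim (dom_center N) (integrand N m)).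
set (u1 := delta / 2).
assert (Hu1 : 0 < u1) by (unfold u1; lra).
destruct (series_tail_bound b u1 _ Hu1 (Hb u1 ltac:(rewrite Cmod_R, Rabs_pos_eq by lra; unfold u1; lra)))
  as [B [HB HbB]].
set (B2 := 2 * B / u1 ^ S M).
assert (HB2 : 0 <= B2).
{ apply Rmult_le_pos; [lra|]. left. apply Rinv_0_lt_compat, pow_lt; auto. }
(* Constraints on the radius: 1/16 for [cexp_sub_1_bounds], u1/4 so that |u| <= 2 e <= u1/2, PI/N to
   stay below the first pole, [X] and [Y] so that the endpoints can be moved outwards. *)
set (e0 := Rmin (Rmin (1 / 16) (u1 / 4)) (Rmin (PI / INR N) (Rmin X Y))).
assert (He0 : 0 < e0).
{ unfold e0. repeat apply Rmin_pos; try lra. apply Rdiv_lt_0_compat; lra. }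
(* The quantity does not depend on the radius [e], and every small [e] bounds it by O(e); hence it
   is 0. *)
assert (Hz : (2 * Ci * RtoC (Im (G (- Y)%R - G X)) - b M * (2 * PI * Ci))%C = 0%C).
{ apply Cmod_small_eq_0 with (B := 8 * PI * B2 + Cmod (b M) * (80 * PI)) (e0 := e0); auto.
  { assert (Hbm := Cmod_ge_0 (b M)). assert (0 <= PI * B2) by nra. nra. }
  intros e [He1 He2].
  assert (L : e <= 1 / 16 /\ e <= u1 / 4 /\ e <= PI / INR N /\ e <= X /\ e <= Y).
  { unfold e0 in He2. repeat split; eapply Rle_trans; try exact He2.
    - eapply Rle_trans; [apply Rmin_l|apply Rmin_l].
    - eapply Rle_trans; [apply Rmin_l|apply Rmin_r].
    - eapply Rle_trans; [apply Rmin_r|apply Rmin_l].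
    - eapply Rle_trans; [apply Rmin_r|]. eapply Rle_trans; [apply Rmin_r|apply Rmin_l].
    - eapply Rle_trans; [apply Rmin_r|]. eapply Rle_trans; [apply Rmin_r|apply Rmin_r]. }
  destruct L as [L1 [L2 [L3 [L4 L5]]]].
  assert (He : 0 < e <= 1 / 16) by lra.
  assert (LN : e < 2 * PI / INR N).
  { assert (0 < PI / INR N) by (apply Rdiv_lt_0_compat; lra).
    replace (2 * PI / INR N) with (2 * (PI / INR N)) by (unfold Rdiv; ring). lra. }
  assert (Hne : forall th j, (1 <= j <= N)%nat -> (cexp (circ e th) ^ j)%C <> 1%C).
  { intros th j Hj. apply (small_cexp_pow_neq_1 N); auto.
    - apply Cmod_gt_0. rewrite Cmod_circ; lra.
    - rewrite Cmod_circ; lra. }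
  set (F := fun th => (integrand N m (circ e th) * (Ci * circ e th))%C).
  assert (cF : forall th, ccont F th).
  { intros th. assert (Hc : ccont (circ e) th) by exact (cder_cont _ _ _ (cder_circ e th)).
    apply gcont_mult; [|apply gcont_mult; [apply gcont_const|exact Hc]].
    apply (gcont_comp _ _ (integrand N m) (circ e)); [|exact Hc].
    apply (hol_ccont (fun t => forall j, (1 <= j <= N)%nat -> (cexp t ^ j)%C <> 1%C)); auto.
    apply hol_integrand; auto. }
  assert (cFo : forall a b, ccont_on F a b) by (intros a' b' t _; apply cF).
  assert (T1 : CInt F 0 PI = (G (- e)%R - G e)%C).
  { replace (RtoC (- e)) with (circ e PI).
    2:{ rewrite circ_val, cos_PI, sin_PI. apply C_ext; unfold Re, Im; simpl; ring. }
    replace (RtoC e) with (circ e 0).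
    2:{ rewrite circ_val, cos_0, sin_0. apply C_ext; unfold Re, Im; simpl; ring. }
    apply (star_prim_int (dom N) _ _ (circ e) (fun th => Ci * circ e th)%C); try lra.
    - apply Copen_dom.
    - intros; apply dom_star; auto.
    - apply hol_integrand_dom; auto.
    - apply cder_circ.
    - intros t. apply gcont_mult; [apply gcont_const|exact (cder_cont _ _ _ (cder_circ e t))].
    - intros t Ht. unfold dom. rewrite circ_val. unfold Re, Im; simpl.
      assert (S0 : 0 <= sin t) by (apply sin_ge_0; lra).
      assert (S1 := SIN_bound t).
      destruct (Req_dec (sin t) 0) as [E|E].
      + left. assert (Q := sin2_cos2 t). unfold Rsqr in Q. rewrite E in Q.
        intros Ec. apply Rmult_integral in Ec. destruct Ec as [Ec|Ec]; [lra|].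
        rewrite Ec in Q. lra.
      + right. split; [apply Rmult_lt_0_compat; lra|]. nra. }
  assert (T2 : CInt F PI (2 * PI) = (- Cconj (CInt F 0 PI))%C).
  { assert (R1 := CInt_reflect F 0 PI (2 * PI)).
    replace (2 * PI - PI) with PI in R1 by ring. rewrite Rminus_0_r in R1.
    rewrite R1 by (try lra; apply cFo). clear R1.
    rewrite <- CInt_conj by (try lra; apply cFo).
    replace (- CInt (fun t => Cconj (F t)) 0 PI)%C
      with (-1 * CInt (fun t => Cconj (F t)) 0 PI)%C by ring.
    rewrite <- CInt_scal; [|lra|].
    2:{ intros t _. apply (gcont_ext _ _ (fun t => (Re (F t), - Im (F t)))); [reflexivity|].
        destruct (ccont_continuous F t (cF t)) as [Q1 Q2].
        apply continuous_ccont; unfold Re, Im in *; simpl; auto.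
        apply (continuous_opp (V := R_NormedModule)); auto. }
    apply CInt_ext; [lra|]. intros t _. unfold F.
    replace (circ e (2 * PI - t)) with (Cconj (circ e t)).
    2:{ rewrite !circ_val. rewrite cos_minus, sin_minus, cos_2PI, sin_2PI.
        apply C_ext; unfold Re, Im; simpl; ring. }
    rewrite integrand_conj by auto. rewrite !Cmult_conj.
    replace (Cconj Ci) with (- Ci)%C by (apply C_ext; unfold Re, Im; simpl; ring). ring. }
  assert (T3 : CInt F 0 (2 * PI) = (2 * Ci * RtoC (Im (G (- Y)%R - G X)))%C).
  { rewrite <- (CInt_Chasles F 0 PI (2 * PI)) by (try lra; apply cFo).
    rewrite T2, T1.
    assert (E1 : Im (G e) = Im (G X)).
    { symmetry. apply star_prim_real_segment; auto; intros; lra. }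
    assert (E2 : Im (G (- e)%R) = Im (G (- Y)%R)).
    { apply star_prim_real_segment; auto; try lra; intros; lra. }
    rewrite Im_minus, <- E1, <- E2, <- Im_minus.
    replace (G (- e)%R - G e + - Cconj (G (- e)%R - G e))%C
      with (G (- e)%R - G e - Cconj (G (- e)%R - G e))%C by ring.
    apply im_alt'. }
  (* The Laurent series is truncated at index M and divided by u^(M+1): the terms n < M integrate to
     0, the term n = M yields 2 pi i [b M] up to O(e), and the tail is bounded after the
     division. *)
  assert (Hsum := CInt_csum (fun n th => b n * circ_term e (M - n) th)%C 0 (2 * PI) (S M) ltac:(lra)).
  destruct Hsum as [S1 S2].
  { intros n _ t _. apply gcont_mult; [apply gcont_const|apply ccont_circ_term; auto]. }
  assert (S3 : csum (fun n => CInt (fun th => b n * circ_term e (M - n) th)%C 0 (2 * PI)) (S M)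
     = (b M * CInt (circ_term e 0) 0 (2 * PI))%C).
  { cbn [csum]. rewrite csum_0.
    - rewrite Nat.sub_diag. rewrite CInt_scal; [ring|lra|].
      intros t _; apply ccont_circ_term; auto.
    - intros n Hn. rewrite CInt_scal; [|lra|intros t _; apply ccont_circ_term; auto].
      replace (M - n)%nat with (S (M - n - 1)) by lia.
      rewrite CInt_circ_term_S by auto. ring. }
  set (Sm := fun t => csum (fun n => b n * circ_term e (M - n) t)%C (S M)) in *.
  assert (D1 : Cmod (CInt F 0 (2 * PI) - CInt Sm 0 (2 * PI)) <= 2 * (B2 * 2 * e) * (2 * PI - 0)).
  { assert (CM : ccont_on (fun t => -1 * Sm t)%C 0 (2 * PI))
      by (intros t Ht; apply gcont_mult; [apply gcont_const|exact (S2 t Ht)]).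
    replace (CInt F 0 (2 * PI) - CInt Sm 0 (2 * PI))%C
      with (CInt (fun t => F t + -1 * Sm t)%C 0 (2 * PI)).
    2:{ rewrite CInt_plus; [|lra|apply cFo|auto]. rewrite CInt_scal by (try lra; auto). ring. }
    apply CInt_bound_const; [lra| |].
    { intros t Ht. apply gcont_plus; [apply cF|exact (CM t Ht)]. }
    intros t _. set (w := circ e t). set (u := (cexp w - 1)%C).
    assert (Hu : u <> 0%C) by exact (circ_u_nz e He t).
    assert (Hub : e / 2 <= Cmod u <= 2 * e) by exact (circ_u_bounds e He t).
    set (V := (u ^ N / cpoch (1 + u) N)%C).
    assert (HV : Cmod (V - csum (fun n => b n * u ^ n)%C (S M)) <= B2 * Cmod u ^ S M).
    { apply (power_tail_limit b u V B u1); auto; [lra|].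
      intros eps Heps. apply Hb; auto. unfold u1 in *. lra. }
    replace (F t + -1 * Sm t)%C with
      ((/ u) ^ S M * (V - csum (fun n => b n * u ^ n)%C (S M)) * (cexp w * (Ci * w)))%C.
    - rewrite !Cmod_mult, Cmod_Ci, Cmod_cexp, Cmod_pow, Cmod_inv by auto.
      assert (Hw : Cmod w = e) by (apply Cmod_circ; lra). rewrite Hw.
      assert (Q1 : (/ Cmod u) ^ S M * Cmod (V - csum (fun n => b n * u ^ n)%C (S M)) <= B2).
      { apply Rle_trans with ((/ Cmod u) ^ S M * (B2 * Cmod u ^ S M)).
        - apply Rmult_le_compat_l; auto. apply pow_le. left. apply Rinv_0_lt_compat. lra.
        - right. transitivity (B2 * (/ Cmod u * Cmod u) ^ S M).
          + rewrite Rpow_mult_distr. ring.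
          + rewrite Rinv_l by lra. rewrite pow1. ring. }
      assert (Q2 : exp (Re w) <= 2).
      { assert (HR := Re_le_Cmod w). rewrite Hw in HR.
        assert (HR' := HR). apply Rabs_le_between in HR'.
        assert (X1 := exp_taylor1 (Re w) ltac:(lra)). nra. }
      assert (Q3 := exp_pos (Re w)). assert (Q4 := Cmod_ge_0 (V - csum (fun n => b n * u ^ n)%C (S M))).
      apply Rle_trans with (B2 * (exp (Re w) * (1 * e))).
      + apply Rmult_le_compat_r; auto. nra.
      + rewrite Rmult_1_l, Rmult_assoc. apply Rmult_le_compat_l; auto.
        apply Rmult_le_compat_r; lra.
    - assert (HF : F t = ((/ u) ^ S M * V * (cexp w * (Ci * w)))%C).
      { unfold F, integrand. fold w. fold u. unfold V.
        replace (1 + u)%C with (cexp w) by (unfold u; ring).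
        replace (- m - 1)%Z with (Z.of_nat N - Z.of_nat (S M))%Z by lia.
        rewrite cpowz_sub, Cpow_inv by auto. field. repeat split; try (apply Cpow_nz; auto).
        apply cpoch_neq_0. intros j Hj. apply Hne; auto. }
      assert (HS : Sm t = ((/ u) ^ S M * csum (fun n => b n * u ^ n)%C (S M) * (cexp w * (Ci * w)))%C).
      { unfold Sm. rewrite <- csum_scal, Cmult_comm, <- csum_scal. apply csum_ext.
        intros n Hn. unfold circ_term. fold w. fold u.
        replace (S M) with (S (M - n) + n)%nat by lia. rewrite Cpow_add_r.
        assert (Hnn : ((/ u) ^ n * u ^ n = 1)%C).
        { rewrite <- Cpow_mult_l, Cinv_l by auto. apply Cpow_1_l. }
        transitivity (b n * ((/ u) ^ S (M - n) * ((/ u) ^ n * u ^ n) * (cexp w * (Ci * w))))%C.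
        - rewrite Hnn. ring.
        - ring. }
      rewrite HF, HS. ring. }
  assert (D2 : Cmod (CInt (circ_term e 0) 0 (2 * PI) - 2 * PI * Ci) <= 2 * (20 * e) * (2 * PI - 0)).
  { assert (CI : ccont_on (fun _ => - Ci)%C 0 (2 * PI)) by (intros t _; apply gcont_const).
    replace (CInt (circ_term e 0) 0 (2 * PI) - 2 * PI * Ci)%C
      with (CInt (fun t => circ_term e 0 t + - Ci)%C 0 (2 * PI)).
    2:{ rewrite CInt_plus; [|lra|intros t _; apply ccont_circ_term; auto|auto].
        assert (E : CInt (fun _ => - Ci)%C 0 (2 * PI) = (- (2 * PI * Ci))%C); [|rewrite E; ring].
        apply C_ext; unfold CInt, Re, Im; simpl;
          rewrite (RInt_const (V := R_CompleteNormedModule));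
          unfold scal; simpl; unfold mult; simpl; ring. }
    apply CInt_bound_const; [lra| |].
    { intros t _. apply gcont_plus; [apply ccont_circ_term; auto|apply gcont_const]. }
    intros t _. apply circ_term_0_bound; auto. }
  rewrite <- T3.
  replace (CInt F 0 (2 * PI) - b M * (2 * PI * Ci))%C with
    ((CInt F 0 (2 * PI) - CInt Sm 0 (2 * PI)) +
      b M * (CInt (circ_term e 0) 0 (2 * PI) - 2 * PI * Ci))%C
    by (rewrite S1, S3; ring).
  eapply Rle_trans; [apply Cmod_triangle|]. rewrite Cmod_mult.
  assert (Hbm := Cmod_ge_0 (b M)). nra. }
set (k := Im (G (- Y)%R - G X)) in *.
assert (PC : RtoC PI <> 0%C) by (intros E; apply RtoC_inj in E; lra).
rewrite RtoC_div by lra.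
assert (E : (b M * PI)%C = k).
{ assert (E2 : (2 * Ci * (RtoC k - b M * PI))%C = 0%C) by (rewrite <- Hz; ring).
  apply Ceq_minus.
  destruct (Ceq_dec (b M * PI - k)%C 0%C) as [E|E]; auto. exfalso.
  revert E2. apply Cmult_neq_0.
  - apply Cmult_neq_0; [|apply Ci_nz]. intros E3; apply RtoC_inj in E3; lra.
  - intros E3. apply E. rewrite <- Copp_0, <- E3. ring. }
rewrite <- E. field. auto.
Qed.

(** * Power series: logarithm and dilogarithm *)

(** [Series] is total and carries no meaning for a divergent series, so summability travels
    separately as [dominated]. *)
Definition Cser (f : nat -> C) : C :=
  (Series (fun n => Re (f n)), Series (fun n => Im (f n))).

Definition dominated (f : nat -> C) : Prop :=
  exists g : nat -> R, ex_series g /\ forall n, Cmod (f n) <= g n.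

Lemma ex_series_dom (a g : nat -> R) : ex_series g -> (forall n, Rabs (a n) <= g n) -> ex_series a.
Proof. intros Hg H. exact (ex_series_le (V := R_CompleteNormedModule) a g H Hg). Qed.

Lemma dominated_ReIm f : dominated f ->
  ex_series (fun n => Re (f n)) /\ ex_series (fun n => Im (f n)).
Proof.
intros [g [Hg H]]. split; apply (ex_series_dom _ g Hg); intros n.
- eapply Rle_trans; [apply Re_le_Cmod|apply H].
- eapply Rle_trans; [apply Im_le_Cmod|apply H].
Qed.

Lemma Cser_ext f g : (forall n, f n = g n) -> Cser f = Cser g.
Proof. intros H. unfold Cser. f_equal; apply Series_ext; intros; now rewrite H. Qed.

Lemma dominated_plus f g : dominated f -> dominated g -> dominated (fun n => f n + g n)%C.
Proof.
intros [a [Ha Hf]] [b [Hb Hg]]. exists (fun n => a n + b n). split.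
- exact (ex_series_plus (V := R_NormedModule) a b Ha Hb).
- intros n. eapply Rle_trans; [apply Cmod_triangle|]. specialize (Hf n); specialize (Hg n). lra.
Qed.

Lemma dominated_scal (c : C) f : dominated f -> dominated (fun n => c * f n)%C.
Proof.
intros [a [Ha Hf]]. exists (fun n => Cmod c * a n). split.
- exact (ex_series_scal_l (Cmod c) a Ha).
- intros n. rewrite Cmod_mult. apply Rmult_le_compat_l; [apply Cmod_ge_0|auto].
Qed.

Lemma Cser_plus f g : dominated f -> dominated g ->
  Cser (fun n => f n + g n)%C = (Cser f + Cser g)%C.
Proof.
intros Hf Hg. destruct (dominated_ReIm f Hf), (dominated_ReIm g Hg).
apply C_ext; unfold Cser, Re, Im; simpl; apply Series_plus; auto.
Qed.

Lemma Cser_scal (c : C) f : dominated f -> Cser (fun n => c * f n)%C = (c * Cser f)%C.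
Proof.
intros Hf. destruct (dominated_ReIm f Hf) as [H1 H2].
assert (S : forall (k : R) a, ex_series a -> ex_series (fun n => k * a n))
  by (intros k a Ha; exact (ex_series_scal_l k a Ha)).
apply C_ext; unfold Cser, Re, Im; simpl; rewrite <- !Series_scal_l.
- apply Series_minus; auto.
- apply Series_plus; auto.
Qed.

Lemma Cser_bound f g : ex_series g -> (forall n, Cmod (f n) <= g n) ->
  Cmod (Cser f) <= 2 * Series g.
Proof.
intros Hg H.
assert (B : forall a : nat -> R, (forall n, Rabs (a n) <= g n) -> Rabs (Series a) <= Series g).
{ intros a Ha. eapply Rle_trans; [apply Series_Rabs|].
  - apply (ex_series_dom _ g); auto. intros n. rewrite Rabs_Rabsolu. auto.
  - apply Series_le; auto. intros n. split; [apply Rabs_pos|auto]. }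
eapply Rle_trans; [apply Cmod_le_ReIm|].
change (Rabs (Series (fun n => Re (f n))) + Rabs (Series (fun n => Im (f n))) <= 2 * Series g).
assert (B1 : Rabs (Series (fun n => Re (f n))) <= Series g).
{ apply B. intros n. eapply Rle_trans; [apply Re_le_Cmod|auto]. }
assert (B2 : Rabs (Series (fun n => Im (f n))) <= Series g).
{ apply B. intros n. eapply Rle_trans; [apply Im_le_Cmod|auto]. }
lra.
Qed.

Lemma dominated_S f : dominated f -> dominated (fun n => f (S n)).
Proof.
intros [g [Hg H]]. exists (fun n => g (S n)). split; auto.
apply (ex_series_incr_1 (V := R_NormedModule) g). auto.
Qed.

Lemma Cser_incr f : dominated f -> Cser f = (f 0%nat + Cser (fun n => f (S n)))%C.
Proof.
intros Hf. destruct (dominated_ReIm f Hf).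
apply C_ext; unfold Cser, Re, Im; simpl; rewrite Series_incr_1 by auto; auto.
Qed.

Lemma INR_S_pos n : 0 < INR (S n).
Proof. apply (lt_INR 0). lia. Qed.

Lemma INR_S_ge_1 n : 1 <= INR (S n).
Proof. apply (le_INR 1). lia. Qed.

Lemma dominated_pow (a : nat -> C) (w : C) (k : nat) : (forall n, Cmod (a n) <= 1) -> Cmod w < 1 ->
  dominated (fun n => a n * w ^ (k + n))%C.
Proof.
intros Ha Hw. exists (fun n => Cmod w ^ n). split.
- apply ex_series_geom. rewrite Rabs_pos_eq; auto. apply Cmod_ge_0.
- intros n. rewrite Cmod_mult, Cmod_pow, pow_add.
  assert (H0 := Cmod_ge_0 w). assert (Hk : Cmod w ^ k <= 1).
  { rewrite <- (pow1 k). apply pow_incr. lra. }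
  assert (0 <= Cmod w ^ n) by (apply pow_le; auto).
  assert (0 <= Cmod w ^ k) by (apply pow_le; auto).
  specialize (Ha n). assert (Q := Cmod_ge_0 (a n)).
  rewrite <- (Rmult_1_l (Cmod w ^ n)) at 2. rewrite <- Rmult_assoc.
  apply Rmult_le_compat_r; auto. nra.
Qed.

(** The natural bound is n (n+1) r^(n-1) |h|^2; it is stated multiplied by [r], which avoids the
    exponent n - 1 at n = 0. *)
Lemma pow_diff_remainder (w h : C) (r : R) n : 0 <= r -> Cmod w <= r -> Cmod (w + h) <= r ->
  Cmod ((w + h) ^ S n - w ^ S n - INR (S n) * w ^ n * h) * r
   <= INR n * INR (S n) * r ^ n * Cmod h ^ 2.
Proof.
intros Hr Hw Hwh. induction n.
- replace ((w + h) ^ 1 - w ^ 1 - INR 1 * w ^ 0 * h)%C with (RtoC 0) by (simpl; ring).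
  rewrite Cmod_0. simpl. lra.
- replace ((w + h) ^ S (S n) - w ^ S (S n) - INR (S (S n)) * w ^ S n * h)%C
    with ((w + h) * ((w + h) ^ S n - w ^ S n - INR (S n) * w ^ n * h)
           + INR (S n) * w ^ n * (h * h))%C.
  2:{ rewrite (S_INR (S n)), RtoC_plus. rewrite !Cpow_S. ring. }
  set (E := ((w + h) ^ S n - w ^ S n - INR (S n) * w ^ n * h)%C) in *.
  apply Rle_trans with ((r * Cmod E + INR (S n) * r ^ n * Cmod h ^ 2) * r).
  + apply Rmult_le_compat_r; auto.
    eapply Rle_trans; [apply Cmod_triangle|]. rewrite !Cmod_mult, Cmod_pow, Cmod_R.
    rewrite (Rabs_pos_eq (INR (S n))) by apply pos_INR.
    apply Rplus_le_compat.
    * apply Rmult_le_compat_r; [apply Cmod_ge_0|auto].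
    * replace (Cmod h ^ 2) with (Cmod h * Cmod h) by ring.
      apply Rmult_le_compat_r; [apply Rmult_le_pos; apply Cmod_ge_0|].
      apply Rmult_le_compat_l; [apply pos_INR|]. apply pow_incr. split; auto. apply Cmod_ge_0.
  + assert (X : r * (Cmod E * r) <= r * (INR n * INR (S n) * r ^ n * Cmod h ^ 2))
      by (apply Rmult_le_compat_l; auto).
    assert (Y : 0 <= INR (S n) * r ^ S n * Cmod h ^ 2).
    { repeat apply Rmult_le_pos; try apply Cmod_ge_0; try apply pow_le; auto; [apply pos_INR|lra]. }
    rewrite (S_INR (S n)). rewrite (S_INR n) in *. simpl in *. nra.
Qed.

(** n + 1 copies of s^n are at most 1 + s + ... + s^n, which is below the geometric sum. *)
Lemma INR_pow_le (s : R) n : 0 <= s < 1 -> INR (S n) * s ^ n <= / (1 - s).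
Proof.
intros Hs.
assert (H : INR (S n) * s ^ n * (1 - s) <= 1 - s ^ S n).
{ induction n.
  - simpl. lra.
  - assert (0 <= s ^ n) by (apply pow_le; lra).
    assert (s ^ S n <= 1) by (rewrite <- (pow1 (S n)); apply pow_incr; lra).
    rewrite (S_INR (S n)). simpl (s ^ S (S n)). simpl (s ^ S n) in *. nra. }
apply Rmult_le_reg_r with (1 - s); [lra|]. rewrite Rinv_l by lra.
assert (0 <= s ^ S n) by (apply pow_le; lra). lra.
Qed.

(** Write r = s^4: each of the two factors n + 1 is absorbed by one s^n, and a geometric series in
    s^2 remains. *)
Lemma ex_series_sq_geom (r : R) : 0 < r < 1 -> ex_series (fun n => INR (S n) * INR (S n) * r ^ n).
Proof.
intros Hr. set (q := sqrt r). set (s := sqrt q).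
assert (Hq : 0 < q < 1).
{ split; [apply sqrt_lt_R0; lra|]. rewrite <- sqrt_1. apply sqrt_lt_1; lra. }
assert (Hs : 0 < s < 1).
{ split; [apply sqrt_lt_R0; lra|]. rewrite <- sqrt_1. apply sqrt_lt_1; lra. }
assert (Eq : q * q = r) by (apply sqrt_sqrt; lra).
assert (Es : s * s = q) by (apply sqrt_sqrt; lra).
apply (ex_series_dom _ (fun n => / (1 - s) * / (1 - s) * q ^ n)).
- apply (ex_series_scal_l (/ (1 - s) * / (1 - s)) (fun n => q ^ n)).
  apply ex_series_geom. rewrite Rabs_pos_eq; lra.
- intros n. assert (B := INR_pow_le s n ltac:(lra)).
  assert (0 <= s ^ n) by (apply pow_le; lra). assert (0 < q ^ n) by (apply pow_lt; lra).
  assert (P := INR_S_pos n).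
  rewrite Rabs_pos_eq by (repeat apply Rmult_le_pos; try lra; apply pow_le; lra).
  rewrite <- Eq, Rpow_mult_distr.
  rewrite <- Es at 1. rewrite Rpow_mult_distr.
  replace (INR (S n) * INR (S n) * (s ^ n * s ^ n * q ^ n))
    with (INR (S n) * s ^ n * (INR (S n) * s ^ n) * q ^ n) by ring.
  apply Rmult_le_compat_r; [lra|]. apply Rmult_le_compat; auto; apply Rmult_le_pos; lra.
Qed.

(** Termwise differentiation of a power series. With [r] halfway between |w| and 1,
    [pow_diff_remainder] bounds the sum of the remainders by a multiple of |h|^2 that is uniform in
    h. *)
Lemma Cder_Cser (a : nat -> C) (w : C) : (forall n, Cmod (a n) <= 1) -> Cmod w < 1 ->
  dominated (fun n => a n * (INR (S n) * w ^ n))%C ->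
  Cder (fun w => Cser (fun n => a n * w ^ S n)%C) w (Cser (fun n => a n * (INR (S n) * w ^ n))%C).
Proof.
intros Ha Hw Hd1. set (r := (1 + Cmod w) / 2). assert (W0 := Cmod_ge_0 w).
assert (Hr : 1 / 2 <= r < 1) by (unfold r; lra).
set (Q := Series (fun n => INR (S n) * INR (S n) * r ^ n)).
assert (HQe : ex_series (fun n => INR (S n) * INR (S n) * r ^ n)) by (apply ex_series_sq_geom; lra).
assert (HQ : 0 <= Q).
{ unfold Q. replace 0 with (Series (fun _ => 0)) by (apply is_series_unique;
    assert (X := is_series_scal_l 0 _ _ (Series_correct _ HQe));
    eapply is_series_ext; [|rewrite <- (Rmult_0_l Q); exact X]; intros; unfold scal; simpl; unfold mult; simpl; ring).
  apply Series_le; auto. intros n. split; [lra|].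
  repeat apply Rmult_le_pos; try apply pos_INR. apply pow_le; lra. }
intros eps He. exists (Rmin (r - Cmod w) (eps / (4 * Q + 1))). split.
{ apply Rmin_pos; [unfold r; lra|]. apply Rdiv_lt_0_compat; lra. }
intros h Hh.
assert (L1 := Rmin_l (r - Cmod w) (eps / (4 * Q + 1))).
assert (L2 := Rmin_r (r - Cmod w) (eps / (4 * Q + 1))).
assert (H0 := Cmod_ge_0 h).
assert (Hwh : Cmod (w + h) <= r) by (eapply Rle_trans; [apply Cmod_triangle|lra]).
assert (D1 : dominated (fun n => a n * (w + h) ^ S n)%C) by (apply (dominated_pow a (w + h)%C 1); auto; lra).
assert (D2 : dominated (fun n => a n * w ^ S n)%C) by (apply (dominated_pow a w 1); auto).
replace (Cser (fun n => a n * (w + h) ^ S n)%C - Cser (fun n => a n * w ^ S n)%C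
  - Cser (fun n => a n * (INR (S n) * w ^ n))%C * h)%C
 with (Cser (fun n => a n * (w + h) ^ S n + (-1 * (a n * w ^ S n) + - h * (a n * (INR (S n) * w ^ n))))%C).
2:{ rewrite !Cser_plus, !Cser_scal; auto; repeat first [apply dominated_plus | apply dominated_scal]; auto. ring. }
eapply Rle_trans; [apply (Cser_bound _ (fun n => Cmod h ^ 2 * 2 * (INR (S n) * INR (S n) * r ^ n)))|].
- exact (ex_series_scal_l (Cmod h ^ 2 * 2) _ HQe).
- intros n.
  replace (a n * (w + h) ^ S n + (-1 * (a n * w ^ S n) + - h * (a n * (INR (S n) * w ^ n))))%C
    with (a n * ((w + h) ^ S n - w ^ S n - INR (S n) * w ^ n * h))%C by ring.
  rewrite Cmod_mult. assert (T := pow_diff_remainder w h r n ltac:(lra) ltac:(unfold r; lra) Hwh).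
  set (E := ((w + h) ^ S n - w ^ S n - INR (S n) * w ^ n * h)%C) in *.
  assert (E0 := Cmod_ge_0 E). specialize (Ha n). assert (A0 := Cmod_ge_0 (a n)).
  apply Rle_trans with (Cmod E); [nra|].
  assert (E2 : Cmod E <= 2 * (Cmod E * r)) by nra.
  eapply Rle_trans; [exact E2|].
  assert (T2 : INR n * INR (S n) * r ^ n * Cmod h ^ 2 <= INR (S n) * INR (S n) * r ^ n * Cmod h ^ 2).
  { apply Rmult_le_compat_r; [apply pow2_ge_0|]. apply Rmult_le_compat_r; [apply pow_le; lra|].
    apply Rmult_le_compat_r; [apply pos_INR|]. apply le_INR; lia. }
  lra.
- rewrite Series_scal_l. fold Q.
  assert (Hx : (4 * Q + 1) * Cmod h <= eps).
  { apply Rle_trans with ((4 * Q + 1) * (eps / (4 * Q + 1))).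
    - apply Rmult_le_compat_l; lra.
    - right; field; lra. }
  nra.
Qed.

Definition dilog (w : C) : C := Cser (fun n => RtoC (/ (INR (S n) * INR (S n))) * w ^ S n)%C.
Definition log1m (w : C) : C := (- Cser (fun n => RtoC (/ INR (S n)) * w ^ S n))%C.

Lemma inv_INR_le_1 n : 0 < / INR (S n) <= 1.
Proof.
assert (H := INR_S_ge_1 n). split; [apply Rinv_0_lt_compat; lra|].
rewrite <- Rinv_1. apply Rinv_le_contravar; lra.
Qed.

Lemma Cmod_inv_INR n : Cmod (/ INR (S n))%R <= 1.
Proof. rewrite Cmod_R. assert (H := inv_INR_le_1 n). rewrite Rabs_pos_eq; lra. Qed.

Lemma Cmod_inv_INR2 n : Cmod (/ (INR (S n) * INR (S n)))%R <= 1.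
Proof.
rewrite Cmod_R, Rinv_mult. assert (H := inv_INR_le_1 n). rewrite Rabs_pos_eq; nra.
Qed.

Lemma Cder_dilog (w : C) : Cmod w < 1 -> w <> 0%C -> Cder dilog w (- log1m w / w).
Proof.
intros Hw Hn.
assert (E : forall n, (RtoC (/ (INR (S n) * INR (S n))) * (INR (S n) * w ^ n))%C
  = (/ w * (RtoC (/ INR (S n)) * w ^ S n))%C).
{ intros n. assert (P := INR_S_pos n).
  rewrite Rinv_mult, RtoC_mult. rewrite (RtoC_inv (INR (S n))) by lra.
  assert (RtoC (INR (S n)) <> 0%C) by (intros X; apply RtoC_inj in X; lra).
  rewrite Cpow_S. field. auto. }
assert (D : dominated (fun n => RtoC (/ INR (S n)) * w ^ S n)%C).
{ apply (dominated_pow (fun n => RtoC (/ INR (S n))) w 1); auto. apply Cmod_inv_INR. }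
eapply gder_eq.
- apply (Cder_Cser (fun n => RtoC (/ (INR (S n) * INR (S n)))) w); auto.
  + apply Cmod_inv_INR2.
  + destruct (dominated_scal (/ w)%C _ D) as [g [Hg Hd]]. exists g. split; auto.
    intros n. rewrite E. apply Hd.
- rewrite (Cser_ext _ _ E), Cser_scal by auto. unfold log1m. field. auto.
Qed.

Lemma geom_Cser (w : C) : Cmod w < 1 -> dominated (fun n => w ^ n)%C /\
   (Cser (fun n => w ^ n)%C * (1 - w))%C = 1%C.
Proof.
intros Hw.
assert (D : dominated (fun n => w ^ n)%C).
{ destruct (dominated_pow (fun _ => 1%C) w 0) as [g [Hg H]]; auto.
  - intros; rewrite Cmod_1; lra.
  - exists g. split; auto. intros n. specialize (H n). rewrite Cmult_1_l in H. exact H. }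
split; auto.
assert (E : Cser (fun n => w ^ n)%C = (1 + w * Cser (fun n => w ^ n)%C)%C).
{ rewrite <- (Cser_scal w (fun n => w ^ n)%C D). exact (Cser_incr _ D). }
set (S := Cser (fun n => w ^ n)%C) in *.
replace (S * (1 - w))%C with (S - w * S)%C by ring. rewrite E at 1. ring.
Qed.

Lemma one_minus_nz (w : C) : Cmod w < 1 -> (1 - w)%C <> 0%C.
Proof.
intros Hw E. apply Ceq_minus in E. rewrite <- E, Cmod_1 in Hw. lra.
Qed.

Lemma Cder_log1m (w : C) : Cmod w < 1 -> Cder log1m w (- / (1 - w)).
Proof.
intros Hw. destruct (geom_Cser w Hw) as [D HS].
assert (E : forall n, (RtoC (/ INR (S n)) * (INR (S n) * w ^ n))%C = (w ^ n)%C).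
{ intros n. assert (P := INR_S_pos n). rewrite RtoC_inv by lra.
  assert (RtoC (INR (S n)) <> 0%C) by (intros X; apply RtoC_inj in X; lra). field. auto. }
unfold log1m. eapply gder_eq.
- apply (gder_ext _ _ (fun w => (-1) * Cser (fun n => RtoC (/ INR (S n)) * w ^ S n))%C); [intros; ring|].
  apply gder_mult; [apply gder_const|].
  apply (Cder_Cser (fun n => RtoC (/ INR (S n))) w); auto.
  + apply Cmod_inv_INR.
  + destruct D as [g [Hg Hd]]. exists g. split; auto. intros n. rewrite E. apply Hd.
- cbv beta. rewrite (Cser_ext _ _ E).
  assert (N := one_minus_nz w Hw). set (S := Cser (fun n => w ^ n)%C) in *.
  replace (/ (1 - w))%C with (S * (1 - w) * / (1 - w))%C by (rewrite HS; ring). field. auto.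
Qed.

Lemma cder_0_const (f : R -> C) a b : a <= b -> (forall t, a <= t <= b -> cder f t 0) -> f b = f a.
Proof.
intros Hab H. apply Ceq_minus. rewrite <- (CInt_FTC f (fun _ => 0%C) a b); auto.
- apply C_ext; unfold CInt, Re, Im; simpl;
    rewrite (RInt_const (V := R_CompleteNormedModule));
    unfold scal; simpl; unfold mult; simpl; ring.
- intros t _. apply gcont_const.
Qed.

Lemma Series_0 (a : nat -> R) : (forall n, a n = 0) -> Series a = 0.
Proof.
intros H. rewrite (Series_ext _ (fun n => 0 * a n)).
- rewrite Series_scal_l. ring.
- intros n. rewrite H. ring.
Qed.

Lemma Cser_0 : Cser (fun _ => 0%C) = 0%C.
Proof. apply C_ext; unfold Cser, Re, Im; simpl; apply Series_0; auto. Qed.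

Lemma log1m_0 : log1m 0 = 0%C.
Proof.
unfold log1m. rewrite (Cser_ext _ (fun _ => 0%C)), Cser_0; [ring|].
intros n. rewrite Cpow_S. ring.
Qed.

Lemma Cmod_scal_lt (t : R) (w : C) (b : R) : 0 <= t <= 1 -> Cmod w < b -> Cmod (t * w) < b.
Proof.
intros Ht Hw. rewrite Cmod_mult, Cmod_R, Rabs_pos_eq by lra. assert (H := Cmod_ge_0 w). nra.
Qed.

Lemma cder_line (w : C) t : cder (fun t => RtoC t * w)%C t w.
Proof.
eapply gder_eq; [apply gder_mult; [apply cder_RtoC|apply gder_const]|]. cbv beta; ring.
Qed.

Lemma cder_log1m_line (w : C) t : 0 <= t <= 1 -> Cmod w < 1 ->
  cder (fun t => log1m (RtoC t * w)) t (- / (1 - t * w) * w).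
Proof.
intros Ht Hw. apply (gder_comp _ _ log1m (fun t => RtoC t * w)%C); [|apply cder_line].
apply Cder_log1m. apply Cmod_scal_lt; auto.
Qed.

(** exp(- log1m (t w)) (1 - t w) has zero derivative in t and equals 1 at t = 0. *)
Lemma cexp_log1m (w : C) : Cmod w < 1 -> cexp (log1m w) = (1 - w)%C.
Proof.
intros Hw.
assert (E := cder_0_const (fun t => cexp (-1 * log1m (RtoC t * w)) * (1 - RtoC t * w))%C 0 1 ltac:(lra)).
cbv beta in E.
replace (1 * w)%C with w in E by ring. replace (0 * w)%C with (RtoC 0) in E by ring.
rewrite log1m_0 in E. replace (-1 * 0)%C with (RtoC 0) in E by ring. rewrite cexp_0 in E.
replace (-1 * log1m w)%C with (- log1m w)%C in E by ring. rewrite cexp_opp in E.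
transitivity (cexp (log1m w) * (1 * (1 - 0)))%C; [ring|]. rewrite <- E.
- field. apply cexp_neq_0.
- intros t Ht.
  assert (Hn : (1 - t * w)%C <> 0%C) by (apply one_minus_nz, Cmod_scal_lt; auto).
  eapply gder_eq.
  + apply gder_mult.
    * apply (gder_comp _ _ cexp (fun t => -1 * log1m (RtoC t * w))%C); [apply Cder_exp|].
      apply gder_mult; [apply gder_const|apply cder_log1m_line; auto].
    * apply (gder_ext _ _ (fun t => 1 + (-1) * (RtoC t * w))%C); [intros; ring|].
      apply gder_plus; [apply gder_const|]. apply gder_mult; [apply gder_const|apply cder_line].
  + cbv beta. field. auto.
Qed.

Lemma Re_one_minus_pos (w : C) : Cmod w < 1 -> 0 < Re (1 - w)%C.
Proof.
intros H. rewrite Re_minus. assert (R := Re_le_Cmod w). apply Rabs_le_between in R.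
unfold Re in *; simpl; lra.
Qed.

(** Along the segment from 0 to [w] the real part of 1 - t w stays positive, so the cosine of the
    argument never vanishes and, by the intermediate value theorem, the argument cannot reach pi/2
    or - pi/2. This identifies [log1m] with the principal branch. *)
Lemma Im_log1m_bound (w : C) : Cmod w < 1 -> - (PI / 2) < Im (log1m w) < PI / 2.
Proof.
intros Hw. set (g := fun t => Im (log1m (RtoC t * w))).
assert (P := PI_RGT_0).
assert (Hc : forall t, 0 <= t <= 1 -> continuity_pt g t).
{ intros t Ht. apply continuity_pt_filterlim.
  exact (proj2 (ccont_continuous _ t (cder_cont _ _ _ (cder_log1m_line w t Ht Hw)))). }
assert (Hcos : forall t, 0 <= t <= 1 -> cos (g t) <> 0).
{ intros t Ht E. assert (Hw' := Cmod_scal_lt t w 1 Ht Hw).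
  assert (X := cexp_log1m _ Hw'). apply (f_equal Re) in X.
  assert (Y := Re_one_minus_pos _ Hw'). rewrite <- X in Y. unfold cexp in Y.
  change (0 < exp (Re (log1m (t * w))) * cos (g t)) in Y. rewrite E in Y. lra. }
assert (G0 : g 0 = 0).
{ unfold g. replace (0 * w)%C with (RtoC 0) by ring. rewrite log1m_0. reflexivity. }
assert (G1 : g 1 = Im (log1m w)).
{ unfold g. replace (1 * w)%C with w by ring. reflexivity. }
rewrite <- G1.
assert (K : forall s : R, s = 1 \/ s = -1 -> s * g 1 < PI / 2).
{ intros s Hs. apply Rnot_le_lt. intros Hge.
  destruct Hge as [Hge|Hge].
  - destruct (Ranalysis5.IVT_interv (fun t => s * g t - PI / 2) 0 1) as [z [Hz E]]; try (cbv beta; rewrite ?G0; lra).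
    + intros a Ha. apply continuity_pt_minus; [|apply continuity_pt_const; intros ? ?; auto].
      apply continuity_pt_mult; [apply continuity_pt_const; intros ? ?; auto|auto].
    + apply (Hcos z Hz). destruct Hs; subst s.
      * replace (g z) with (PI / 2) by lra. apply cos_PI2.
      * replace (g z) with (- (PI / 2)) by lra. rewrite cos_neg. apply cos_PI2.
  - apply (Hcos 1 ltac:(lra)). destruct Hs; subst s.
    + replace (g 1) with (PI / 2) by lra. apply cos_PI2.
    + replace (g 1) with (- (PI / 2)) by lra. rewrite cos_neg. apply cos_PI2. }
assert (K1 := K 1 ltac:(auto)). assert (K2 := K (-1) ltac:(auto)). lra.
Qed.

Lemma log1m_principal (w : C) : Cmod w < 1 ->
  log1m w = (ln (Cmod (1 - w)), atan (Im (1 - w) / Re (1 - w))).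
Proof.
intros Hw. assert (E := cexp_log1m w Hw). assert (Hp := Re_one_minus_pos w Hw).
assert (HI := Im_log1m_bound w Hw).
apply C_ext.
- change (Re (log1m w) = ln (Cmod (1 - w))). now rewrite <- E, Cmod_cexp, ln_exp.
- change (Im (log1m w) = atan (Im (1 - w) / Re (1 - w))). rewrite <- E.
  change (Im (cexp (log1m w))) with (exp (Re (log1m w)) * sin (Im (log1m w))).
  change (Re (cexp (log1m w))) with (exp (Re (log1m w)) * cos (Im (log1m w))).
  assert (Hr := exp_pos (Re (log1m w))). set (r := exp (Re (log1m w))) in *.
  set (y := Im (log1m w)) in *.
  assert (Hcos : 0 < cos y) by (apply cos_gt_0; lra).
  replace (r * sin y / (r * cos y)) with (tan y).
  + symmetry. apply atan_tan. lra.
  + unfold tan. field. lra.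
Qed.

Definition zeta2 : R := Series (fun n => / (INR (S n) * INR (S n))).

Lemma telescoping_series (K : nat) : (1 <= K)%nat ->
  is_series (fun n => / INR (K + n) - / INR (K + S n)) (/ INR K).
Proof.
intros HK.
assert (E : forall n, sum_n (fun n => / INR (K + n) - / INR (K + S n)) n = / INR K - / INR (K + S n)).
{ induction n.
  - rewrite sum_O. rewrite Nat.add_0_r. auto.
  - rewrite sum_Sn, IHn. unfold plus; simpl. lra. }
apply (is_lim_seq_ext (fun n => / INR K - / INR (K + S n)) _ (/ INR K)); [intros; symmetry; apply E|].
replace (Finite (/ INR K)) with (Rbar_minus (/ INR K) 0) by (simpl; f_equal; ring).
apply is_lim_seq_minus'; [apply is_lim_seq_const|].
replace (Finite 0) with (Rbar_inv p_infty) by reflexivity.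
apply is_lim_seq_inv; [|discriminate].
apply (is_lim_seq_ext (fun n => INR (n + S K))); [intros; f_equal; lia|].
apply is_lim_seq_incr_n, is_lim_seq_INR.
Qed.

Lemma inv_sq_tail (K : nat) : (1 <= K)%nat ->
  ex_series (fun n => / (INR (S (K + n)) * INR (S (K + n)))) /\
  Series (fun n => / (INR (S (K + n)) * INR (S (K + n)))) <= / INR K.
Proof.
intros HK.
assert (B : forall n, 0 <= / (INR (S (K + n)) * INR (S (K + n))) <= / INR (K + n) - / INR (K + S n)).
{ intros n. replace (K + S n)%nat with (S (K + n)) by lia.
  assert (1 <= INR (K + n)) by (apply (le_INR 1); lia). rewrite S_INR.
  set (x := INR (K + n)) in *. split.
  - left. apply Rinv_0_lt_compat. nra.
  - replace (/ x - / (x + 1)) with (/ (x * (x + 1))) by (field; lra).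
    apply Rinv_le_contravar; nra. }
assert (T := telescoping_series K HK).
assert (Ex : ex_series (fun n => / INR (K + n) - / INR (K + S n))) by (eexists; exact T).
split.
- apply (ex_series_dom _ _ Ex). intros n. rewrite Rabs_pos_eq; apply B.
- rewrite <- (is_series_unique _ _ T). apply Series_le; auto.
Qed.

Lemma ex_series_inv_sq : ex_series (fun n => / (INR (S n) * INR (S n))).
Proof.
apply (ex_series_incr_1 (V := R_NormedModule)). exact (proj1 (inv_sq_tail 1 ltac:(lia))).
Qed.

(** The first ten terms sum to less than 1.5498 and the tail is at most 1/10. *)
Lemma zeta2_le : zeta2 <= 1.65.
Proof.
unfold zeta2. rewrite (Series_incr_n _ 10) by (try lia; apply ex_series_inv_sq).
assert (T := proj2 (inv_sq_tail 10 ltac:(lia))).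
eapply Rle_trans; [apply Rplus_le_compat_l; exact T|].
simpl. lra.
Qed.

Lemma zeta2_pos : 0 < zeta2.
Proof.
unfold zeta2. rewrite Series_incr_1 by apply ex_series_inv_sq.
assert (T : 0 <= Series (fun k => / (INR (S (S k)) * INR (S (S k))))).
{ rewrite <- (Series_0 (fun _ => 0)) by auto. apply Series_le.
  - intros n. split; [lra|]. left. apply Rinv_0_lt_compat.
    apply Rmult_lt_0_compat; apply INR_S_pos.
  - apply (proj1 (inv_sq_tail 1 ltac:(lia))). }
simpl in *. lra.
Qed.

Lemma dilog_term_le (w : C) n : Cmod w <= 1 ->
  Cmod (RtoC (/ (INR (S n) * INR (S n))) * w ^ S n) <= / (INR (S n) * INR (S n)).
Proof.
intros Hw. rewrite Cmod_mult, Cmod_pow, Cmod_R.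
assert (P := INR_S_pos n).
assert (Q : 0 < / (INR (S n) * INR (S n))) by (apply Rinv_0_lt_compat; nra).
rewrite Rabs_pos_eq by lra.
assert (Cmod w ^ S n <= 1) by (rewrite <- (pow1 (S n)); apply pow_incr; split; auto; apply Cmod_ge_0).
assert (0 <= Cmod w ^ S n) by (apply pow_le, Cmod_ge_0). nra.
Qed.

Lemma dominated_dilog (w : C) : Cmod w <= 1 ->
  dominated (fun n => RtoC (/ (INR (S n) * INR (S n))) * w ^ S n)%C.
Proof.
intros Hw. exists (fun n => / (INR (S n) * INR (S n))). split; [apply ex_series_inv_sq|].
intros n. apply dilog_term_le; auto.
Qed.

Lemma dilog_1 : dilog 1 = zeta2.
Proof.
unfold dilog, Cser, zeta2. apply C_ext; unfold Re, Im; simpl.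
- apply Series_ext. intros n. rewrite (Cpow_1_l n). simpl. ring.
- apply Series_0. intros n. rewrite (Cpow_1_l n). simpl. ring.
Qed.

Lemma Cser_incr_n f K : dominated f ->
  Cser f = (csum f K + Cser (fun n => f (K + n)%nat))%C /\ dominated (fun n => f (K + n)%nat).
Proof.
intros Hf. induction K.
- simpl. split; auto. rewrite Cplus_0_l. reflexivity.
- destruct IHK as [E D]. split.
  + rewrite E, Cser_incr by auto. cbn [csum].
    rewrite (Cser_ext (fun n => f (K + S n)%nat) (fun n => f (S K + n)%nat))
      by (intros; f_equal; lia).
    rewrite Nat.add_0_r. ring.
  + destruct (dominated_S _ D) as [g [Hg H]]. exists g. split; auto.
    intros n. replace (S K + n)%nat with (K + S n)%nat by lia. auto.
Qed.

Lemma Cmod_csum_le (f : nat -> C) (B : R) K :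
  (forall n, (n < K)%nat -> Cmod (f n) <= B) -> Cmod (csum f K) <= INR K * B.
Proof.
induction K; intros H.
- simpl. rewrite Cmod_0. lra.
- cbn [csum]. eapply Rle_trans; [apply Cmod_triangle|]. rewrite S_INR.
  assert (A := IHK (fun n Hn => H n ltac:(lia))). assert (A2 := H K ltac:(lia)). lra.
Qed.

Lemma Cmod_pow_minus_1 (w : C) n : Cmod w <= 1 -> Cmod (w ^ n - 1) <= INR n * Cmod (w - 1).
Proof.
intros Hw. induction n.
- simpl. replace (1 - 1)%C with (RtoC 0) by ring. rewrite Cmod_0. lra.
- rewrite Cpow_S, S_INR.
  replace (w * w ^ n - 1)%C with (w * (w ^ n - 1) + (w - 1))%C by ring.
  eapply Rle_trans; [apply Cmod_triangle|]. rewrite Cmod_mult.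
  assert (H := Cmod_ge_0 (w ^ n - 1)). assert (H0 := Cmod_ge_0 w). nra.
Qed.

(** Continuity at the boundary point 1 from within the closed disc. The first [K] terms move by at
    most |w - 1| each, and the rest is at most 4/K, below eps/2 once K > 8/eps. *)
Lemma dilog_near_1 (eps : R) : 0 < eps -> exists d, 0 < d /\
  forall w, Cmod w <= 1 -> Cmod (w - 1) < d -> Cmod (dilog w - zeta2) < eps.
Proof.
intros He.
destruct (nfloor_ex (8 / eps) ltac:(left; apply Rdiv_lt_0_compat; lra)) as [k [_ Hk]].
set (K := S k). assert (HK : 8 / eps < INR K) by (unfold K; rewrite S_INR; lra).
assert (KP : 0 < INR K) by apply INR_S_pos.
exists (eps / (2 * INR K)). split; [apply Rdiv_lt_0_compat; lra|].
intros w Hw Hd. rewrite <- dilog_1.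
assert (Dw := dominated_dilog w Hw).
assert (D1 := dominated_dilog 1 ltac:(rewrite Cmod_1; lra)).
unfold dilog. set (f := fun n => (RtoC (/ (INR (S n) * INR (S n))) * w ^ S n)%C) in *.
set (g := fun n => (RtoC (/ (INR (S n) * INR (S n))) * 1 ^ S n)%C) in *.
set (h := fun n => (f n + -1 * g n)%C).
assert (Dh : dominated h) by (apply dominated_plus; auto; apply dominated_scal; auto).
replace (Cser f - Cser g)%C with (Cser h).
2:{ unfold h. rewrite Cser_plus, Cser_scal; auto; [ring|apply dominated_scal; auto]. }
assert (Eh : forall n, h n = (RtoC (/ (INR (S n) * INR (S n))) * (w ^ S n - 1))%C).
{ intros n. unfold h, f, g. rewrite Cpow_1_l. ring. }
destruct (Cser_incr_n h K Dh) as [E Dt]. rewrite E.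
eapply Rle_lt_trans; [apply Cmod_triangle|].
assert (T1 : Cmod (csum h K) <= INR K * Cmod (w - 1)).
{ apply Cmod_csum_le. intros n _. rewrite Eh, Cmod_mult, Cmod_R, Rinv_mult.
  assert (Q := inv_INR_le_1 n). rewrite Rabs_pos_eq by nra.
  assert (T := Cmod_pow_minus_1 w (S n) Hw). assert (C0 := Cmod_ge_0 (w - 1)).
  assert (P := INR_S_pos n). assert (C1 := Cmod_ge_0 (w ^ S n - 1)).
  apply Rle_trans with (/ INR (S n) * (INR (S n) * Cmod (w - 1))).
  - apply Rmult_le_compat; auto; nra.
  - rewrite <- Rmult_assoc, Rinv_l by lra. lra. }
assert (T2 : Cmod (Cser (fun n => h (K + n)%nat)) <= 2 * (2 * / INR K)).
{ destruct (inv_sq_tail K ltac:(unfold K; lia)) as [X1 X2].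
  eapply Rle_trans.
  - apply (Cser_bound _ (fun n => 2 * / (INR (S (K + n)) * INR (S (K + n))))).
    + exact (ex_series_scal_l 2 _ X1).
    + intros n. rewrite Eh, Cmod_mult, Cmod_R.
      assert (P := INR_S_pos (K + n)).
      assert (Q : 0 < / (INR (S (K + n)) * INR (S (K + n)))) by (apply Rinv_0_lt_compat; nra).
      rewrite Rabs_pos_eq by lra. rewrite Rmult_comm. apply Rmult_le_compat_r; [lra|].
      eapply Rle_trans; [apply Cmod_triangle|]. rewrite Cmod_opp, Cmod_1, Cmod_pow.
      assert (Cmod w ^ S (K + n) <= 1)
        by (rewrite <- (pow1 (S (K + n))); apply pow_incr; split; auto; apply Cmod_ge_0).
      lra.
  - rewrite Series_scal_l. lra. }
assert (T3 : INR K * Cmod (w - 1) < eps / 2).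
{ replace (eps / 2) with (INR K * (eps / (2 * INR K))) by (field; lra).
  apply Rmult_lt_compat_l; auto. }
assert (T4 : / INR K < eps / 8).
{ replace (eps / 8) with (/ (8 / eps)) by (field; lra). apply Rinv_lt_contravar; auto.
  apply Rmult_lt_0_compat; auto. apply Rdiv_lt_0_compat; lra. }
lra.
Qed.

(** * Dilogarithm identities *)

Lemma Cmod_one_minus_line (w : C) t : 0 < t <= 1 -> Cmod (1 - w) < 1 -> Cmod (1 - t * w) < 1.
Proof.
intros Ht Hw. replace (1 - t * w)%C with (RtoC (1 - t) + t * (1 - w))%C
  by (rewrite RtoC_minus; ring).
eapply Rle_lt_trans; [apply Cmod_triangle|].
rewrite Cmod_mult, !Cmod_R, !Rabs_pos_eq by lra. nra.
Qed.

Lemma Cmod_dilog_le (w : C) : Cmod w <= 1 -> Cmod (dilog w) <= 4 * Cmod w.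
Proof.
intros Hw. assert (W0 := Cmod_ge_0 w).
eapply Rle_trans.
- apply (Cser_bound _ (fun n => Cmod w * / (INR (S n) * INR (S n)))).
  + exact (ex_series_scal_l (Cmod w) _ ex_series_inv_sq).
  + intros n. rewrite Cmod_mult, Cmod_pow, Cmod_R.
    assert (P := INR_S_pos n).
    assert (Q : 0 < / (INR (S n) * INR (S n))) by (apply Rinv_0_lt_compat; nra).
    rewrite Rabs_pos_eq, Rmult_comm by lra. apply Rmult_le_compat_r; [lra|].
    assert (X : Cmod w ^ n <= 1) by (rewrite <- (pow1 n); apply pow_incr; lra).
    simpl. nra.
- rewrite Series_scal_l. fold zeta2. assert (Z := zeta2_le). nra.
Qed.

Lemma Cmod_log1m_le (w : C) : Cmod w < 1 -> Cmod (log1m w) <= 2 * Cmod w / (1 - Cmod w).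
Proof.
intros Hw. assert (W0 := Cmod_ge_0 w). unfold log1m. rewrite Cmod_opp.
assert (G : is_series (fun n => Cmod w * Cmod w ^ n) (Cmod w * / (1 - Cmod w))).
{ apply (is_series_scal_l (Cmod w) (fun n => Cmod w ^ n) (/ (1 - Cmod w))).
  apply is_series_geom. rewrite Rabs_pos_eq; lra. }
eapply Rle_trans.
- apply (Cser_bound _ (fun n => Cmod w * Cmod w ^ n)).
  + eexists; exact G.
  + intros n. rewrite Cmod_mult, Cmod_pow, Cmod_R. assert (Q := inv_INR_le_1 n).
    rewrite Rabs_pos_eq by lra. change (Cmod w ^ S n) with (Cmod w * Cmod w ^ n).
    assert (X : 0 <= Cmod w ^ n) by (apply pow_le; lra).
    assert (0 <= Cmod w * Cmod w ^ n) by nra. nra.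
- rewrite (is_series_unique _ _ G). right. field. lra.
Qed.

(** The inequality 1 + u <= e^u at u = - log sqrt x: crude, but enough for products such as x log x
    to tend to 0. *)
Lemma neg_ln_le (x : R) : 0 < x <= 1 -> 0 <= - ln x <= 2 / sqrt x.
Proof.
intros Hx. assert (S0 : 0 < sqrt x) by (apply sqrt_lt_R0; lra). split.
- assert (H : ln x <= ln 1) by (apply Rcomplements.ln_le; lra). rewrite ln_1 in H. lra.
- assert (E : x = sqrt x * sqrt x) by (symmetry; apply sqrt_sqrt; lra).
  rewrite E at 1. rewrite ln_mult by auto.
  assert (I : / sqrt x = exp (- ln (sqrt x))) by (rewrite exp_Ropp, exp_ln; auto).
  assert (J := exp_ineq1_le (- ln (sqrt x))). unfold Rdiv. rewrite I. lra.
Qed.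

(** The left side, taken at t w, has zero derivative in t on (0, 1], so it equals its limit as t
    tends to 0: there the first dilogarithm vanishes, the second tends to zeta(2), and the product
    of logarithms is O(sqrt t). *)
Lemma dilog_reflection (w : C) : w <> 0%C -> Cmod w < 1 -> Cmod (1 - w) < 1 ->
  (dilog w + dilog (1 - w) + log1m (1 - w) * log1m w)%C = zeta2.
Proof.
intros Hn Hw Hw1.
assert (W0 : 0 < Cmod w) by (apply Cmod_gt_0; auto).
set (phi := fun t => (dilog (RtoC t * w) + dilog (1 - RtoC t * w)
   + log1m (1 - RtoC t * w) * log1m (RtoC t * w))%C).
assert (Hphi : forall t, 0 < t <= 1 -> phi 1 = phi t).
{ intros t0 Ht0. apply cder_0_const; [lra|]. intros t Ht.
  assert (A1 := Cmod_one_minus_line w t ltac:(lra) Hw1).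
  assert (A2 := Cmod_scal_lt t w 1 ltac:(lra) Hw).
  assert (N1 : (RtoC t * w)%C <> 0%C).
  { apply Cmult_neq_0; auto. intros X; apply RtoC_inj in X; lra. }
  assert (N2 : (1 - RtoC t * w)%C <> 0%C) by (apply one_minus_nz; auto).
  assert (Dm : cder (fun t => 1 - RtoC t * w)%C t (- w)).
  { eapply gder_eq.
    - apply (gder_ext _ _ (fun t => 1 + (-1) * (RtoC t * w))%C); [intros; ring|].
      apply gder_plus; [apply gder_const|]. apply gder_mult; [apply gder_const|apply cder_line].
    - cbv beta; ring. }
  eapply gder_eq.
  - apply gder_plus; [apply gder_plus|apply gder_mult].
    + apply (gder_comp _ _ dilog (fun t => RtoC t * w)%C); [apply Cder_dilog; auto|apply cder_line].
    + apply (gder_comp _ _ dilog (fun t => 1 - RtoC t * w)%C); [apply Cder_dilog; auto|apply Dm].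
    + apply (gder_comp _ _ log1m (fun t => 1 - RtoC t * w)%C); [apply Cder_log1m; auto|apply Dm].
    + apply (gder_comp _ _ log1m (fun t => RtoC t * w)%C); [apply Cder_log1m; auto|apply cder_line].
  - cbv beta. replace (1 - (1 - t * w))%C with (t * w)%C by ring. field. split; [exact N2|].
    split; auto. intros X. apply N1. rewrite X. ring. }
assert (E1 : phi 1 = (dilog w + dilog (1 - w) + log1m (1 - w) * log1m w)%C).
{ unfold phi. replace (1 * w)%C with w by ring. reflexivity. }
rewrite <- E1. apply Ceq_minus.
set (B := 4 * Cmod w + (2 / sqrt (Cmod w) + PI) * (2 * Cmod w / (1 - Cmod w))).
assert (PI0 := PI_RGT_0).
assert (SW : 0 < sqrt (Cmod w)) by (apply sqrt_lt_R0; auto).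
assert (HB : 0 < B).
{ unfold B. assert (0 < 2 / sqrt (Cmod w)) by (apply Rdiv_lt_0_compat; lra).
  assert (0 < 2 * Cmod w / (1 - Cmod w)) by (apply Rdiv_lt_0_compat; lra).
  assert (0 < (2 / sqrt (Cmod w) + PI) * (2 * Cmod w / (1 - Cmod w))) by (apply Rmult_lt_0_compat; lra).
  lra. }
apply Cmod_eq_0. apply Rle_antisym; [|apply Cmod_ge_0].
apply le_epsilon. intros eps He. rewrite Rplus_0_l.
destruct (dilog_near_1 (eps / 2)) as [d [Hd Hd1]]; [lra|].
set (e := Rmin 1 (Rmin (eps / (2 * B)) (d / (2 * Cmod w)))).
assert (He1 : e <= 1) by apply Rmin_l.
assert (He2 : e <= eps / (2 * B)) by (eapply Rle_trans; [apply Rmin_r|apply Rmin_l]).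
assert (He3 : e <= d / (2 * Cmod w)) by (eapply Rle_trans; [apply Rmin_r|apply Rmin_r]).
assert (He0 : 0 < e).
{ unfold e. repeat apply Rmin_pos; try lra; apply Rdiv_lt_0_compat; lra. }
(* A square, so that the bound 2 / sqrt (t |w|) on the logarithm becomes a multiple of 1/e. *)
set (t := e * e). assert (Ht : 0 < t <= 1) by (unfold t; nra).
assert (Hte : t <= e) by (unfold t; nra).
rewrite (Hphi t Ht). unfold phi.
assert (A1 := Cmod_one_minus_line w t ltac:(lra) Hw1).
assert (A2 := Cmod_scal_lt t w 1 ltac:(lra) Hw).
assert (M1 : Cmod (t * w) = t * Cmod w) by (rewrite Cmod_mult, Cmod_R, Rabs_pos_eq; lra).
replace (dilog (t * w) + dilog (1 - t * w) + log1m (1 - t * w) * log1m (t * w) - zeta2)%C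
  with (dilog (t * w) + log1m (1 - t * w) * log1m (t * w) + (dilog (1 - t * w) - zeta2))%C by ring.
eapply Rle_trans; [apply Cmod_triangle|].
assert (T1 : Cmod (dilog (1 - t * w) - zeta2) < eps / 2).
{ apply Hd1; [lra|]. replace (1 - t * w - 1)%C with (- (t * w))%C by ring.
  rewrite Cmod_opp, M1.
  apply Rle_lt_trans with (d / (2 * Cmod w) * Cmod w).
  - apply Rmult_le_compat_r; lra.
  - replace (d / (2 * Cmod w) * Cmod w) with (d / 2) by (field; lra). lra. }
assert (T2 : Cmod (dilog (t * w) + log1m (1 - t * w) * log1m (t * w)) <= B * e).
{ eapply Rle_trans; [apply Cmod_triangle|]. rewrite Cmod_mult.
  assert (X1 : Cmod (dilog (t * w)) <= 4 * (t * Cmod w)) by (rewrite <- M1; apply Cmod_dilog_le; lra).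
  assert (X2 : Cmod (log1m (t * w)) <= t * (2 * Cmod w / (1 - Cmod w))).
  { eapply Rle_trans; [apply Cmod_log1m_le; auto|]. rewrite M1.
    replace (t * (2 * Cmod w / (1 - Cmod w))) with (2 * (t * Cmod w) / (1 - Cmod w)) by (unfold Rdiv; ring).
    apply Rmult_le_compat_l; [nra|]. apply Rinv_le_contravar; nra. }
  assert (X3 : Cmod (log1m (1 - t * w)) <= (2 / sqrt (Cmod w) + PI) / e).
  { rewrite log1m_principal by auto. replace (1 - (1 - t * w))%C with (t * w)%C by ring.
    eapply Rle_trans; [apply Cmod_pair_le|]. rewrite M1.
    assert (L := neg_ln_le (t * Cmod w) ltac:(nra)).
    rewrite (Rabs_left1 (ln _)) by lra.
    assert (AT := atan_bound (Im (t * w) / Re (t * w))).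
    assert (AT' : Rabs (atan (Im (t * w) / Re (t * w))) <= PI) by (apply Rabs_le; lra).
    assert (SE : sqrt (t * Cmod w) = e * sqrt (Cmod w)).
    { rewrite sqrt_mult by nra. unfold t. rewrite sqrt_square; lra. }
    rewrite SE in L.
    replace ((2 / sqrt (Cmod w) + PI) / e) with (2 / (e * sqrt (Cmod w)) + PI / e) by (field; lra).
    assert (PI <= PI / e).
    { rewrite <- (Rmult_1_r PI) at 1. apply Rmult_le_compat_l; [lra|].
      rewrite <- Rinv_1. apply Rinv_le_contravar; lra. }
    lra. }
  assert (K0 : 0 <= 2 * Cmod w / (1 - Cmod w)) by (apply Rlt_le, Rdiv_lt_0_compat; lra).
  assert (X4 : Cmod (log1m (1 - t * w)) * Cmod (log1m (t * w))
     <= (2 / sqrt (Cmod w) + PI) / e * (t * (2 * Cmod w / (1 - Cmod w)))).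
  { apply Rmult_le_compat; auto; apply Cmod_ge_0. }
  replace ((2 / sqrt (Cmod w) + PI) / e * (t * (2 * Cmod w / (1 - Cmod w))))
    with ((2 / sqrt (Cmod w) + PI) * (2 * Cmod w / (1 - Cmod w)) * e) in X4
    by (unfold t; field; lra).
  unfold B. nra. }
assert (B * e <= eps / 2).
{ replace (eps / 2) with (B * (eps / (2 * B))) by (field; lra). apply Rmult_le_compat_l; lra. }
lra.
Qed.

Lemma Cmod_cexp_lt_1 (z : C) : Re z < 0 -> Cmod (cexp z) < 1.
Proof. intros H. rewrite Cmod_cexp, <- exp_0. apply exp_increasing; auto. Qed.

Lemma Re_scal (x : R) (z : C) : Re (x * z)%C = x * Re z.
Proof. unfold Re; simpl; ring. Qed.

Lemma Im_scal (x : R) (z : C) : Im (x * z)%C = x * Im z.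
Proof. unfold Im; simpl; ring. Qed.

Lemma cder_cexp_line (z : C) x : cder (fun t => cexp (RtoC t * z)) x (cexp (x * z) * z).
Proof. apply (gder_comp _ _ cexp (fun t => RtoC t * z)%C); [apply Cder_exp|apply cder_line]. Qed.

Lemma cder_dilog_exp (z : C) (x : R) : Re z < 0 -> 0 < x ->
  cder (fun t => dilog (cexp (RtoC t * z))) x (- z * log1m (cexp (x * z))).
Proof.
intros Hz Hx. assert (Hm : Cmod (cexp (x * z)) < 1) by (apply Cmod_cexp_lt_1; rewrite Re_scal; nra).
assert (Hn := cexp_neq_0 (x * z)).
eapply gder_eq.
- apply (gder_comp _ _ dilog (fun t => cexp (RtoC t * z))); [apply Cder_dilog; auto|].
  apply cder_cexp_line.
- cbv beta. field. auto.
Qed.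

(** * Bounds for the reciprocal of the q-factorial *)

Fixpoint rsum (f : nat -> R) (M : nat) : R :=
  match M with O => 0 | S k => rsum f k + f k end.

Lemma rsum_le f g M : (forall n, (n < M)%nat -> f n <= g n) -> rsum f M <= rsum g M.
Proof.
induction M; intros H; simpl; [lra|].
assert (A := IHM (fun n Hn => H n ltac:(lia))). assert (A2 := H M ltac:(lia)). lra.
Qed.

Lemma rsum_ext f g M : (forall n, (n < M)%nat -> f n = g n) -> rsum f M = rsum g M.
Proof.
induction M; intros H; simpl; [lra|].
rewrite (IHM (fun n Hn => H n ltac:(lia))), (H M ltac:(lia)). lra.
Qed.

Lemma Cmod_inv_cpoch (q : C) N : (forall j, (1 <= j <= N)%nat -> (q ^ j)%C <> 1%C) ->
  Cmod (/ cpoch q N) = exp (rsum (fun j => - ln (Cmod (1 - q ^ S j))) N).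
Proof.
intros H. rewrite Cmod_inv by (apply cpoch_neq_0; auto).
induction N.
- simpl. rewrite Cmod_1, exp_0. field.
- cbn [cpoch rsum]. rewrite Cmod_mult, Rinv_mult, IHN by (intros; apply H; lia).
  rewrite exp_plus. f_equal. rewrite exp_Ropp, exp_ln; auto.
  apply Cmod_gt_0. intros E. apply (H (S N)); [lia|]. symmetry. apply Ceq_minus; auto.
Qed.

Lemma is_derive_MVT (f f' : R -> R) x y : x < y -> (forall t, x <= t <= y -> is_derive f t (f' t)) ->
  exists c, x <= c <= y /\ f y - f x = f' c * (y - x).
Proof.
intros Hxy H. destruct (MVT_gen f x y f') as [c [Hc E]].
- rewrite Rmin_left, Rmax_right by lra. intros t Ht. apply H; lra.
- rewrite Rmin_left, Rmax_right by lra. intros t Ht.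
  apply continuity_pt_filterlim, (ex_derive_continuous (V := R_NormedModule)).
  eexists; apply H; lra.
- rewrite Rmin_left, Rmax_right in Hc by lra. exists c; auto.
Qed.

(* A one-sided Lipschitz bound suffices, which allows [h] to blow up at [0]. *)
Lemma riemann_upper (h B : R -> R) (B0 M : R) (N : nat) : (1 <= N)%nat ->
  (forall x, 0 < x <= 1 -> is_derive B x (h x)) ->
  (forall x y, 0 < x <= y -> y <= 1 -> h y - h x <= M * (y - x)) -> 0 <= M ->
  (forall eps, 0 < eps -> exists d, 0 < d /\ forall x, 0 < x < d -> Rabs (B x - B0) < eps) ->
  rsum (fun j => h (INR (S j) / INR N)) N <= INR N * (B 1 - B0) + M.
Proof.
intros HN HB Hh HM H0.
assert (NP : 1 <= INR N) by (apply (le_INR 1); auto).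
assert (Cell : forall x y, 0 < x < y -> y <= 1 -> h y * (y - x) <= B y - B x + M * (y - x) ^ 2).
{ intros x y Hx Hy. destruct (is_derive_MVT B h x y) as [c [Hc E]]; [lra| |].
  - intros t Ht. apply HB; lra.
  - assert (Hcy : 0 < c <= y) by lra. assert (T := Hh c y Hcy Hy). rewrite E.
    assert (M * (y - c) <= M * (y - x)) by (apply Rmult_le_compat_l; lra).
    assert (h y * (y - x) <= (h c + M * (y - x)) * (y - x)) by (apply Rmult_le_compat_r; lra).
    lra. }
(* In the first cell [h] may be unbounded at 0, so the cell starts at a small x > 0 and [B0] is
   approached in the limit. *)
assert (Cell0 : forall y, 0 < y <= 1 -> h y * y <= B y - B0 + M * y ^ 2).
{ intros y Hy. apply le_epsilon. intros eps He.
  destruct (H0 (eps / 2)) as [d [Hd Hd1]]; [lra|].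
  set (x := Rmin (d / 2) (Rmin (y / 2) (eps / (2 * (1 + Rabs (h y)))))).
  assert (A0 := Rabs_pos (h y)).
  assert (X1 : x <= d / 2) by apply Rmin_l.
  assert (X2 : x <= y / 2) by (eapply Rle_trans; [apply Rmin_r|apply Rmin_l]).
  assert (X3 : x <= eps / (2 * (1 + Rabs (h y)))) by (eapply Rle_trans; [apply Rmin_r|apply Rmin_r]).
  assert (X0 : 0 < x).
  { unfold x. repeat apply Rmin_pos; try lra. apply Rdiv_lt_0_compat; lra. }
  assert (T := Cell x y ltac:(lra) ltac:(lra)).
  specialize (Hd1 x ltac:(lra)). apply Rabs_lt_between in Hd1.
  assert (Y : h y * x <= eps / 2).
  { apply Rle_trans with (Rabs (h y) * x).
    - apply Rmult_le_compat_r; [lra|apply Rle_abs].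
    - apply Rle_trans with (Rabs (h y) * (eps / (2 * (1 + Rabs (h y))))).
      + apply Rmult_le_compat_l; auto.
      + replace (eps / 2) with ((1 + Rabs (h y)) * (eps / (2 * (1 + Rabs (h y))))) by (field; lra).
        apply Rmult_le_compat_r; [|lra]. left. apply Rdiv_lt_0_compat; lra. }
  assert (M * (y - x) ^ 2 <= M * y ^ 2) by (apply Rmult_le_compat_l; nra).
  lra. }
assert (P : forall k, (k < N)%nat -> 
  rsum (fun j => h (INR (S j) / INR N)) (S k) <= INR N * (B (INR (S k) / INR N) - B0) + M * (INR (S k) / INR N)).
{ intros k. induction k; intros Hk.
  - simpl. rewrite Rplus_0_l.
    assert (Y : 0 < 1 / INR N <= 1).
    { split; [apply Rdiv_lt_0_compat; lra|]. apply Rmult_le_reg_r with (INR N); [lra|].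
      unfold Rdiv. rewrite Rmult_assoc, Rinv_l; lra. }
    assert (T := Cell0 (1 / INR N) Y).
    apply (Rmult_le_compat_l (INR N)) in T; [|lra].
    replace (INR N * (h (1 / INR N) * (1 / INR N))) with (h (1 / INR N)) in T by (field; lra).
    replace (INR N * (B (1 / INR N) - B0 + M * (1 / INR N) ^ 2))
      with (INR N * (B (1 / INR N) - B0) + M * (1 / INR N)) in T by (field; lra).
    exact T.
  - cbn [rsum]. cbn [rsum] in IHk. specialize (IHk ltac:(lia)).
    set (x := INR (S k) / INR N) in *. set (y := INR (S (S k)) / INR N).
    assert (E : y - x = 1 / INR N).
    { unfold x, y. rewrite (S_INR (S k)). field. lra. }
    assert (X0 : 0 < x) by (apply Rdiv_lt_0_compat; [apply INR_S_pos|lra]).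
    assert (Y1 : y <= 1).
    { unfold y. apply Rmult_le_reg_r with (INR N); [lra|].
      unfold Rdiv. rewrite Rmult_assoc, Rinv_l, Rmult_1_r, Rmult_1_l by lra. apply le_INR. lia. }
    assert (I : 0 < 1 / INR N) by (apply Rdiv_lt_0_compat; lra).
    assert (T := Cell x y ltac:(lra) Y1). rewrite E in T.
    apply (Rmult_le_compat_l (INR N)) in T; [|lra].
    replace (INR N * (h y * (1 / INR N))) with (h y) in T by (field; lra).
    replace (INR N * (B y - B x + M * (1 / INR N) ^ 2))
      with (INR N * (B y - B x) + M * (y - x)) in T by (rewrite E; field; lra).
    lra. }
destruct N; [lia|]. specialize (P N ltac:(lia)).
replace (INR (S N) / INR (S N)) with 1 in P by (field; lra). lra.
Qed.

Lemma exp_le (x y : R) : x <= y -> exp x <= exp y.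
Proof. intros [H| ->]; [left; apply exp_increasing; auto|right; auto]. Qed.

(* [- log |1 - e^(x z)|], the summand of [log |1/(q)_N|] at [x = j/N], and its primitive in [x]. *)
Definition hlog (z : C) (x : R) : R := - Re (log1m (cexp (x * z))).
Definition Bd (z : C) (x : R) : R := Re (dilog (cexp (x * z)) / z).

Lemma Re_neg_nz (z : C) : Re z < 0 -> z <> 0%C.
Proof. intros H E. rewrite E in H. unfold Re in H; simpl in H. lra. Qed.

Lemma is_derive_Bd (z : C) x : Re z < 0 -> 0 < x -> is_derive (Bd z) x (hlog z x).
Proof.
intros Hz Hx. assert (Hn := Re_neg_nz z Hz).
assert (D : cder (fun t => dilog (cexp (RtoC t * z)) * / z)%C x (- log1m (cexp (x * z)))).
{ eapply gder_eq; [apply gder_mult; [apply cder_dilog_exp; auto|apply gder_const]|].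
  cbv beta. field. auto. }
exact (proj1 (cder_is_derive _ _ _ D)).
Qed.

Lemma is_derive_hlog (z : C) x : Re z < 0 -> 0 < x ->
  is_derive (hlog z) x (Re (z * cexp (x * z) / (1 - cexp (x * z)))).
Proof.
intros Hz Hx.
assert (Hm : Cmod (cexp (x * z)) < 1) by (apply Cmod_cexp_lt_1; rewrite Re_scal; nra).
assert (Hn := one_minus_nz _ Hm).
assert (D : cder (fun t => -1 * log1m (cexp (RtoC t * z)))%C x (z * cexp (x * z) / (1 - cexp (x * z)))).
{ eapply gder_eq.
  - apply gder_mult; [apply gder_const|].
    apply (gder_comp _ _ log1m (fun t => cexp (RtoC t * z))); [apply Cder_log1m; auto|].
    apply cder_cexp_line.
  - cbv beta. field. auto. }
assert (T := proj1 (cder_is_derive _ _ _ D)).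
eapply is_derive_ext; [|exact T]. intros t. unfold hlog. cbv beta.
unfold Re; simpl; ring.
Qed.

Lemma hlog_ln (z : C) x : Re z < 0 -> 0 < x -> hlog z x = - ln (Cmod (1 - cexp (x * z))).
Proof.
intros Hz Hx.
assert (Hm : Cmod (cexp (x * z)) < 1) by (apply Cmod_cexp_lt_1; rewrite Re_scal; nra).
unfold hlog. rewrite log1m_principal by auto. reflexivity.
Qed.

Lemma Bd_limit_0 (z : C) : Re z < 0 -> forall eps, 0 < eps ->
  exists d, 0 < d /\ forall x, 0 < x < d -> Rabs (Bd z x - Re (zeta2 / z)) < eps.
Proof.
intros Hz eps He. assert (Hn := Re_neg_nz z Hz).
assert (Zp : 0 < Cmod z) by (apply Cmod_gt_0; auto).
destruct (dilog_near_1 (eps * Cmod z)) as [d [Hd Hd1]]; [apply Rmult_lt_0_compat; auto|].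
destruct (cder_cont _ _ _ (cder_cexp_line z 0) d Hd) as [d2 [Hd2 Hd3]].
exists d2. split; auto. intros x Hx.
unfold Bd. rewrite <- Re_minus. eapply Rle_lt_trans; [apply Re_le_Cmod|].
replace (dilog (cexp (x * z)) / z - zeta2 / z)%C with ((dilog (cexp (x * z)) - zeta2) * / z)%C
  by (field; auto).
rewrite Cmod_mult, Cmod_inv by auto.
apply Rmult_lt_reg_r with (Cmod z); auto. rewrite Rmult_assoc, Rinv_l, Rmult_1_r by lra.
apply Hd1.
- left. apply Cmod_cexp_lt_1. rewrite Re_scal. nra.
- specialize (Hd3 x). rewrite Cmod_R, Rabs_pos_eq in Hd3 by lra. specialize (Hd3 ltac:(lra)).
  rewrite Rplus_0_l in Hd3. replace (0 * z)%C with (RtoC 0) in Hd3 by ring.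
  rewrite cexp_0 in Hd3. exact Hd3.
Qed.

(* The exponential growth rate in [N] of [|1/(q)_N|] at [q = e^(z/N)]. *)
Definition growth (z : C) : R := Re ((dilog (cexp z) - zeta2) / z).

Lemma cexp_div_pow (z : C) (N j : nat) : (1 <= N)%nat ->
  (cexp (z * / RtoC (INR N)) ^ j)%C = cexp (RtoC (INR j / INR N) * z).
Proof.
intros HN. rewrite cexp_pow. f_equal.
assert (1 <= INR N) by (apply (le_INR 1); auto).
rewrite RtoC_div by lra. field. intros X; apply RtoC_inj in X; lra.
Qed.

Lemma cexp_pow_neq_1_left (z : C) N j : Re z < 0 -> (1 <= N)%nat -> (1 <= j)%nat ->
  (cexp (z * / RtoC (INR N)) ^ j)%C <> 1%C.
Proof.
intros Hz HN Hj E. rewrite cexp_div_pow in E by auto.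
assert (1 <= INR N) by (apply (le_INR 1); auto). assert (1 <= INR j) by (apply (le_INR 1); auto).
assert (Cmod (cexp (RtoC (INR j / INR N) * z)) < 1).
{ apply Cmod_cexp_lt_1. rewrite Re_scal. assert (0 < INR j / INR N) by (apply Rdiv_lt_0_compat; lra). nra. }
rewrite E, Cmod_1 in *. lra.
Qed.

(** The last hypothesis bounds the derivative of [hlog z] from above, which is the one-sided
    Lipschitz condition of [riemann_upper]. [M] is the error of the Riemann sum and does not grow
    with N. *)
Lemma cpoch_bound_left (z : C) (M : R) (N : nat) : Re z < 0 -> 0 <= M -> (1 <= N)%nat ->
  (forall x, 0 < x <= 1 -> Re (z * cexp (x * z) / (1 - cexp (x * z))) <= M) ->
  Cmod (/ cpoch (cexp (z * / RtoC (INR N))) N) <= exp (INR N * growth z + M).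
Proof.
intros Hz HM HN Hd. assert (Hn := Re_neg_nz z Hz).
assert (NP : 1 <= INR N) by (apply (le_INR 1); auto).
rewrite Cmod_inv_cpoch by (intros; apply cexp_pow_neq_1_left; auto; lia).
apply exp_le.
rewrite (rsum_ext _ (fun j => hlog z (INR (S j) / INR N))).
2:{ intros j _. rewrite cexp_div_pow, hlog_ln; auto.
    apply Rdiv_lt_0_compat; [apply INR_S_pos|lra]. }
replace (growth z) with (Bd z 1 - Re (zeta2 / z)).
2:{ unfold Bd, growth. rewrite <- Re_minus. f_equal. replace (1 * z)%C with z by ring. field. auto. }
apply riemann_upper; auto.
- intros x Hx. apply is_derive_Bd; auto. lra.
- intros x y Hx Hy. destruct (Req_dec x y) as [->|Hne]; [lra|].
  destruct (is_derive_MVT (hlog z) (fun x => Re (z * cexp (x * z) / (1 - cexp (x * z)))) x y) as [c [Hc E]].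
  + lra.
  + intros t Ht. apply is_derive_hlog; auto. lra.
  + rewrite E. apply Rmult_le_compat_r; [lra|]. apply Hd. lra.
- apply Bd_limit_0; auto.
Qed.

Definition mkC (a b : R) : C := (a, b).

Lemma cexp_pair (a b : R) : cexp (mkC a b) = mkC (exp a * cos b) (exp a * sin b).
Proof. reflexivity. Qed.

Lemma Cmod2 (z : C) : Cmod z ^ 2 = Re z ^ 2 + Im z ^ 2.
Proof. apply Cmod2_alt. Qed.

(** With z = - k + i y and e^(x z) = r (c + i s), r > 0, this shows that the derivative of [hlog]
    has the sign of - (k (c - r) + y s). *)
Lemma hlog_deriv_formula (k y r c s : R) : c * c + s * s = 1 -> 0 < (1 - r * c) ^ 2 + (r * s) ^ 2 ->
  Re (mkC (- k) y * mkC (r * c) (r * s) / (1 - mkC (r * c) (r * s)))%C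
  = - r * (k * (c - r) + y * s) / ((1 - r * c) ^ 2 + (r * s) ^ 2).
Proof.
intros H HD. unfold Cdiv, Cinv, Cmult, Cminus, Cplus, Copp, Re; simpl.
set (D := (1 + - (r * c)) * ((1 + - (r * c)) * 1) + (0 + - (r * s)) * ((0 + - (r * s)) * 1)).
assert (ED : (1 - r * c) * ((1 - r * c) * 1) + r * s * (r * s * 1) = D) by (unfold D; ring).
rewrite ED. assert (D <> 0) by (rewrite <- ED; simpl in HD; lra).
apply Rmult_eq_reg_r with D; auto.
replace (- r * (k * (c - r) + y * s) / D * D) with (- r * (k * (c - r) + y * s)) by (field; auto).
transitivity (- r * (k * (c - r * (c * c + s * s)) + y * s)); [field; auto|rewrite H; ring].
Qed.

(** Before x y reaches pi/2 the cosine and the sine are nonnegative with sum at least 1, and k <= y,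
    so the derivative is at most 0, however singular near x = 0. Afterwards [D0] keeps e^(x z) away
    from 1. *)
Lemma hlog_deriv_le (k y x D0 : R) : 0 < k <= y -> 0 < x <= 1 -> 0 < D0 ->
  (PI / 2 <= x * y -> D0 <= Cmod (1 - cexp (x * mkC (- k) y)) ^ 2) ->
  Re (mkC (- k) y * cexp (x * mkC (- k) y) / (1 - cexp (x * mkC (- k) y)))%C <= (2 * k + y) / D0.
Proof.
intros Hk Hx HD0 HD. assert (P := PI_RGT_0).
assert (E : (x * mkC (- k) y)%C = mkC (- (x * k)) (x * y)) by (apply C_ext; unfold Re, Im; simpl; ring).
rewrite E in *. rewrite cexp_pair in *.
set (r := exp (- (x * k))) in *. set (c := cos (x * y)) in *. set (s := sin (x * y)) in *.
assert (Hr0 : 0 < r) by apply exp_pos.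
assert (Hr1 : r < 1) by (unfold r; rewrite <- exp_0; apply exp_increasing; nra).
assert (Hcs : c * c + s * s = 1) by (assert (T := sin2_cos2 (x * y)); unfold Rsqr in T; unfold c, s; lra).
assert (Hc : -1 <= c <= 1) by apply COS_bound. assert (Hs : -1 <= s <= 1) by apply SIN_bound.
assert (HDp : 0 < (1 - r * c) ^ 2 + (r * s) ^ 2).
{ assert (0 < 1 - r * c) by nra. assert (0 <= (r * s) ^ 2) by apply pow2_ge_0.
  assert (0 < (1 - r * c) ^ 2) by (apply pow_lt; auto). lra. }
rewrite hlog_deriv_formula by auto.
set (D := (1 - r * c) ^ 2 + (r * s) ^ 2) in *.
assert (Pos : 0 <= (2 * k + y) / D0) by (apply Rlt_le, Rdiv_lt_0_compat; lra).
destruct (Rle_dec (PI / 2) (x * y)) as [Hb|Hb].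
- specialize (HD Hb).
  assert (ED : Cmod (1 - mkC (r * c) (r * s)) ^ 2 = D)
    by (rewrite Cmod2; unfold D, Re, Im; simpl; ring).
  rewrite ED in HD.
  apply Rle_trans with ((2 * k + y) / D).
  + apply Rmult_le_compat_r; [left; apply Rinv_0_lt_compat; auto|].
    assert (X : - (k * (c - r) + y * s) <= 2 * k + y) by nra.
    assert (X2 : 0 <= 2 * k + y) by lra.
    replace (- r * (k * (c - r) + y * s)) with (r * - (k * (c - r) + y * s)) by ring.
    apply Rle_trans with (r * (2 * k + y)); [apply Rmult_le_compat_l; lra|nra].
  + apply Rmult_le_compat_l; [lra|]. apply Rinv_le_contravar; lra.
- assert (C0 : 0 <= c) by (apply cos_ge_0; nra).
  assert (S0 : 0 <= s) by (apply sin_ge_0; nra).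
  assert (CS : 1 <= c + s) by nra.
  assert (X : 0 <= k * (c - r) + y * s) by nra.
  eapply Rle_trans; [|exact Pos]. unfold Rdiv.
  assert (0 < / D) by (apply Rinv_0_lt_compat; auto).
  assert (0 <= r * (k * (c - r) + y * s)) by nra. nra.
Qed.

(** Where the cosine is nonpositive, the distance to 1 is at least 1. In the last quadrant, 1 has
    distance |sin (x y)| from the line through 0 of angle x y, and this is at least |sin y| because
    x y <= y < 2 pi. *)
Lemma Cmod_one_minus_ge_sin (k y x : R) : 0 < k -> 0 < x <= 1 -> 3 * (PI / 2) < y < 2 * PI ->
  PI / 2 <= x * y -> sin y ^ 2 <= Cmod (1 - cexp (x * mkC (- k) y)) ^ 2.
Proof.
intros Hk Hx Hy Hb. assert (P := PI_RGT_0).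
assert (E : (x * mkC (- k) y)%C = mkC (- (x * k)) (x * y)) by (apply C_ext; unfold Re, Im; simpl; ring).
rewrite E, cexp_pair, Cmod2. unfold Re, Im; simpl.
set (r := exp (- (x * k))). assert (Hr0 : 0 < r) by apply exp_pos.
assert (T := sin2_cos2 (x * y)). unfold Rsqr in T.
set (b := x * y) in *. set (c := cos b) in *. set (s := sin b) in *.
assert (S1 := SIN_bound y).
destruct (Rle_dec b (3 * (PI / 2))) as [H|H].
- assert (c <= 0) by (apply cos_le_0; auto). nra.
- assert (S2 : sin (2 * PI - y) <= sin (2 * PI - b)) by (apply sin_incr_1; unfold b in *; nra).
  assert (S3 : 0 <= sin (2 * PI - y)) by (apply sin_ge_0; lra).
  rewrite !sin_minus, sin_2PI, cos_2PI in *. fold s in S2.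
  assert (sin y ^ 2 <= s ^ 2) by nra.
  assert (0 <= (r - c) ^ 2) by apply pow2_ge_0. nra.
Qed.

Lemma growth_formula (k y : R) (L : C) : 0 < k ->
  Re ((L - zeta2) / mkC (- k) y)%C = (k * (zeta2 - Re L) + y * Im L) / (k ^ 2 + y ^ 2).
Proof.
intros Hk. unfold Cdiv, Cinv, Re, Im; simpl.
assert (k * k + y * y <> 0) by nra. field. nra.
Qed.

(** The first term of the series is at least 0.9 r with r = e^(-k), and all others together are at
    most (zeta(2) - 1) r <= 0.65 r. *)
Lemma Re_dilog_ge_0 (k y : R) : 0 < k -> 0 < 2 * PI - y <= 1 / 10 -> 0 <= Re (dilog (cexp (mkC (- k) y))).
Proof.
intros Hk Hy. set (w := cexp (mkC (- k) y)).
assert (Hw : Cmod w < 1) by (apply Cmod_cexp_lt_1; unfold Re; simpl; lra).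
assert (W0 : Cmod w = exp (- k)) by (unfold w; rewrite Cmod_cexp; reflexivity).
set (r := exp (- k)) in *. assert (Hr : 0 < r) by apply exp_pos.
assert (D := dominated_dilog w ltac:(lra)). destruct (dominated_ReIm _ D) as [D1 _].
change (0 <= Series (fun n => Re (RtoC (/ (INR (S n) * INR (S n))) * w ^ S n)%C)).
rewrite Series_incr_1 by auto.
assert (E0 : Re (RtoC (/ (INR 1 * INR 1)) * w ^ 1)%C = r * cos y).
{ rewrite Cpow_1_r, Re_scal. change (Re w) with (r * cos y). simpl. field. }
rewrite E0.
assert (Cy : 0.9 <= cos y).
{ replace (cos y) with (cos (2 * PI - y)).
  - assert (T := one_minus_cos_le (2 * PI - y)). nra.
  - rewrite cos_minus, cos_2PI, sin_2PI. ring. }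
assert (Tl : Rabs (Series (fun n => Re (RtoC (/ (INR (S (S n)) * INR (S (S n)))) * w ^ S (S n))%C))
   <= r * (zeta2 - 1)).
{ assert (Ez : zeta2 - 1 = Series (fun n => / (INR (S (S n)) * INR (S (S n))))).
  { unfold zeta2. rewrite (Series_incr_1 (fun n => / (INR (S n) * INR (S n)))) by apply ex_series_inv_sq.
    replace (/ (INR 1 * INR 1)) with 1 by (simpl; field). ring. }
  rewrite Ez, <- Series_scal_l.
  assert (B : forall n, Rabs (Re (RtoC (/ (INR (S (S n)) * INR (S (S n)))) * w ^ S (S n))%C)
     <= r * / (INR (S (S n)) * INR (S (S n)))).
  { intros n. eapply Rle_trans; [apply Re_le_Cmod|].
    rewrite Cmod_mult, Cmod_pow, Cmod_R, W0.
    assert (Pn := INR_S_pos (S n)).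
    assert (Q : 0 < / (INR (S (S n)) * INR (S (S n)))) by (apply Rinv_0_lt_compat; nra).
    rewrite Rabs_pos_eq, Rmult_comm by lra. apply Rmult_le_compat_r; [lra|].
    assert (X : r ^ S n <= 1) by (rewrite <- (pow1 (S n)); apply pow_incr; lra).
    change (r ^ S (S n)) with (r * r ^ S n). nra. }
  assert (Ex : ex_series (fun n => r * / (INR (S (S n)) * INR (S (S n))))).
  { apply (ex_series_scal_l r (fun n => / (INR (S (S n)) * INR (S (S n))))).
    apply (ex_series_incr_1 (V := R_NormedModule) (fun n => / (INR (S n) * INR (S n)))).
    apply ex_series_inv_sq. }
  eapply Rle_trans; [apply Series_Rabs|].
  - apply (ex_series_dom _ _ Ex). intros n. rewrite Rabs_Rabsolu. apply B.
  - apply Series_le; auto. intros n. split; [apply Rabs_pos|apply B]. }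
apply Rabs_le_between in Tl. assert (Z := zeta2_le). nra.
Qed.

Lemma sum_f_R0_nonpos (a : nat -> R) n : (forall k, (k <= n)%nat -> a k <= 0) -> sum_f_R0 a n <= 0.
Proof.
induction n; intros H; simpl; [apply H; lia|].
assert (A := IHn (fun k Hk => H k ltac:(lia))). assert (A2 := H (S n) ltac:(lia)). lra.
Qed.

(** The first 30 terms are nonpositive, since n (2 pi - y) <= 3 < pi for n <= 30; the tail is at
    most 1/30. *)
Lemma Im_dilog_le (k y : R) : 0 < k -> 0 < 2 * PI - y <= 1 / 10 -> Im (dilog (cexp (mkC (- k) y))) <= / 30.
Proof.
intros Hk Hy. set (w := cexp (mkC (- k) y)).
assert (Hw : Cmod w < 1) by (apply Cmod_cexp_lt_1; unfold Re; simpl; lra).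
assert (D := dominated_dilog w ltac:(lra)). destruct (dominated_ReIm _ D) as [_ D1].
change (Series (fun n => Im (RtoC (/ (INR (S n) * INR (S n))) * w ^ S n)%C) <= / 30).
rewrite (Series_incr_n _ 30) by (auto; lia).
replace (/ 30) with (0 + / INR 30) by (simpl; field).
apply Rplus_le_compat.
- apply sum_f_R0_nonpos. intros n Hn. rewrite Im_scal.
  assert (Pn := INR_S_pos n).
  assert (Q : 0 < / (INR (S n) * INR (S n))) by (apply Rinv_0_lt_compat; nra).
  unfold w. rewrite cexp_pow.
  replace (INR (S n) * mkC (- k) y)%C with (mkC (- (INR (S n) * k)) (INR (S n) * y))
    by (apply C_ext; unfold Re, Im; simpl; ring).
  rewrite cexp_pair. change (Im (mkC (exp (- (INR (S n) * k)) * cos (INR (S n) * y)) (exp (- (INR (S n) * k)) * sin (INR (S n) * y))))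
    with (exp (- (INR (S n) * k)) * sin (INR (S n) * y)).
  assert (Pe := exp_pos (- (INR (S n) * k))).
  assert (Sn : sin (INR (S n) * y) <= 0).
  { replace (INR (S n) * y) with (- (INR (S n) * (2 * PI - y)) + 2 * INR (S n) * PI) by ring.
    rewrite sin_period, sin_neg.
    assert (0 <= sin (INR (S n) * (2 * PI - y))); [|lra].
    assert (INR (S n) <= INR 30) by (apply le_INR; lia).
    assert (E30 : INR 30 = 30) by (simpl; ring).
    assert (P3 := PI2_3_2). apply sin_ge_0; nra. }
  assert (exp (- (INR (S n) * k)) * sin (INR (S n) * y) <= 0) by nra. nra.
- destruct (inv_sq_tail 30 ltac:(lia)) as [X1 X2]. eapply Rle_trans; [|exact X2].
  apply Rle_trans with (Series (fun n => Rabs (Im (RtoC (/ (INR (S (30 + n)) * INR (S (30 + n)))) * w ^ S (30 + n))%C))).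
  + eapply Rle_trans; [apply Rle_abs|]. apply Series_Rabs.
    apply (ex_series_dom _ _ X1). intros n. rewrite Rabs_Rabsolu.
    eapply Rle_trans; [apply Im_le_Cmod|]. apply dilog_term_le; lra.
  + apply Series_le; auto. intros n. split; [apply Rabs_pos|].
    eapply Rle_trans; [apply Im_le_Cmod|]. apply dilog_term_le; lra.
Qed.

Definition rcp (z : C) (N : nat) : C := (/ cpoch (cexp (z * / RtoC (INR N))) N)%C.

(** If pi were at most 3.12, then sin (pi/24) < 0.13, and two uses of the doubling formula would
    make cos (pi/6) at least 0.867, more than sqrt 3 / 2. *)
Lemma PI_gt_312 : 3.12 < PI.
Proof.
assert (P := PI_RGT_0). assert (P4 := PI_4).
destruct (Rle_dec PI 3.12) as [H|H]; [exfalso|lra].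
set (u := PI / 24).
assert (S1 : 0 <= sin u <= 0.13).
{ split; [apply sin_ge_0; unfold u; lra|].
  assert (sin u < u) by (apply sin_lt_x; unfold u; lra). unfold u in *; lra. }
assert (C2 : 0.9662 <= cos (2 * u)) by (rewrite cos_2a_sin; nra).
assert (C4 : 0.867 <= cos (2 * (2 * u))) by (rewrite cos_2a_cos; nra).
replace (2 * (2 * u)) with (PI / 6) in C4 by (unfold u; field).
rewrite cos_PI6 in C4. assert (T := sqrt_sqrt 3 ltac:(lra)). nra.
Qed.

(** The horizontal edge of the contour at a height just below 2 pi, left of the imaginary axis.
    There Li2(e^z) has nonnegative real part and imaginary part at most 1/30, which gives the rate;
    the term with [sin y] is the Riemann sum error. *)
Lemma rcp_horizontal_left (k y : R) (N : nat) : 0 < k <= y -> 0 < 2 * PI - y <= 1 / 10 -> (1 <= N)%nat ->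
  Cmod (rcp (mkC (- k) y) N) <= exp (INR N * ((1.65 * k + y / 30) / (k ^ 2 + y ^ 2)) + 3 * y / sin y ^ 2).
Proof.
intros Hk Hy HN. assert (P := PI_gt_312). assert (NP : 1 <= INR N) by (apply (le_INR 1); auto).
assert (Hs : 0 < sin y ^ 2).
{ assert (sin y < 0) by (apply sin_lt_0; lra). nra. }
assert (Rz : Re (mkC (- k) y) = - k) by reflexivity.
eapply Rle_trans; [apply (cpoch_bound_left _ ((2 * k + y) / sin y ^ 2))|].
- rewrite Rz; lra.
- apply Rlt_le, Rdiv_lt_0_compat; lra.
- auto.
- intros x Hx. apply hlog_deriv_le; auto.
  intros Hb. apply Cmod_one_minus_ge_sin; auto; lra.
- apply exp_le, Rplus_le_compat.
  + apply Rmult_le_compat_l; [lra|]. unfold growth. rewrite growth_formula by lra.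
    apply Rmult_le_compat_r.
    * left. apply Rinv_0_lt_compat. nra.
    * assert (A1 := Re_dilog_ge_0 k y ltac:(lra) Hy). assert (A2 := Im_dilog_le k y ltac:(lra) Hy).
      assert (Z := zeta2_le). nra.
  + unfold Rdiv. apply Rmult_le_compat_r; [left; apply Rinv_0_lt_compat; auto|]. lra.
Qed.

Lemma Cmod_cpoch_reflect (q q' : C) (rho : R) n : (q' * Cconj q)%C = 1%C -> Cmod q = exp rho ->
  Cmod (cpoch q n) = exp (rho * (INR n * (INR n + 1) / 2)) * Cmod (cpoch q' n).
Proof.
intros Hq Hr.
assert (Hq0 : Cconj q <> 0%C).
{ intros E. rewrite E in Hq. apply C1_nz. rewrite <- Hq. ring. }
induction n.
- simpl. rewrite Cmod_1. replace (rho * (0 * (0 + 1) / 2)) with 0 by field. rewrite exp_0. ring.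
- cbn [cpoch]. rewrite !Cmod_mult, IHn, S_INR.
  replace (rho * ((INR n + 1) * (INR n + 1 + 1) / 2))
    with (rho * (INR n * (INR n + 1) / 2) + INR (S n) * rho) by (rewrite S_INR; field).
  rewrite exp_plus.
  assert (E : Cmod (1 - q ^ S n) = exp (INR (S n) * rho) * Cmod (1 - q' ^ S n)).
  { rewrite <- (Cmod_conj (1 - q ^ S n)).
    replace (Cconj (1 - q ^ S n)%C) with (- (Cconj q ^ S n * (1 - q' ^ S n)))%C.
    - rewrite Cmod_opp, Cmod_mult, Cmod_pow, Cmod_conj, Hr. f_equal.
      clear. induction n; [simpl; rewrite !Rmult_1_r, Rmult_1_l; auto|].
      rewrite (S_INR (S n)), Rmult_plus_distr_r, exp_plus, <- IHn, Rmult_1_l. simpl. ring.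
    - rewrite Cminus_conj, Cpow_conj.
      assert (X : (q' ^ S n * Cconj q ^ S n = 1)%C).
      { rewrite <- Cpow_mult_l, Hq. apply Cpow_1_l. }
      replace (Cconj 1) with (RtoC 1) by (apply C_ext; unfold Re, Im; simpl; ring).
      transitivity (q' ^ S n * Cconj q ^ S n - Cconj q ^ S n)%C; [ring|rewrite X; ring]. }
  rewrite E. ring.
Qed.

(* [q -> 1/conj q] multiplies [|1 - q^j|] by [|q|^j]. *)
Lemma rcp_reflect (k y : R) (N : nat) : 0 < k -> (1 <= N)%nat ->
  Cmod (rcp (mkC k y) N) <= exp (- (INR N * k / 2)) * Cmod (rcp (mkC (- k) y) N).
Proof.
intros Hk HN. assert (NP : 1 <= INR N) by (apply (le_INR 1); auto).
assert (NC : RtoC (INR N) <> 0%C) by (intros X; apply RtoC_inj in X; lra).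
assert (Iv : (/ RtoC (INR N))%C = RtoC (/ INR N)) by (rewrite RtoC_inv; auto; lra).
set (q := cexp (mkC k y * / RtoC (INR N))). set (q' := cexp (mkC (- k) y * / RtoC (INR N))).
assert (Hq : (q' * Cconj q)%C = 1%C).
{ unfold q, q'. rewrite <- cexp_conj, <- cexp_add, Iv.
  replace (mkC (- k) y * (/ INR N)%R + Cconj (mkC k y * (/ INR N)%R))%C with (RtoC 0)
    by (apply C_ext; unfold mkC, Re, Im; simpl; ring). apply cexp_0. }
assert (Hr : Cmod q = exp (k / INR N)).
{ unfold q. rewrite Cmod_cexp, Iv. f_equal. unfold mkC, Re; simpl. unfold Rdiv. ring. }
assert (Hn' : forall j, (1 <= j <= N)%nat -> (q' ^ j)%C <> 1%C).
{ intros j Hj. apply cexp_pow_neq_1_left; auto; try lia. unfold mkC, Re; simpl; lra. }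
assert (E := Cmod_cpoch_reflect q q' _ N Hq Hr).
assert (P' : 0 < Cmod (cpoch q' N)) by (apply Cmod_gt_0, cpoch_neq_0; auto).
assert (Hn : cpoch q N <> 0%C).
{ apply Cmod_gt_0. rewrite E. apply Rmult_lt_0_compat; auto. apply exp_pos. }
unfold rcp. fold q q'. rewrite !Cmod_inv by (auto; apply cpoch_neq_0; auto).
rewrite E, Rinv_mult, <- exp_Ropp.
apply Rmult_le_compat_r; [left; apply Rinv_0_lt_compat; auto|].
apply exp_le. replace (k / INR N * (INR N * (INR N + 1) / 2)) with (k * (INR N + 1) / 2) by (field; lra).
nra.
Qed.

(** Reflection gains - k/2 in the rate. As y >= 6, the part 1.65 k / (k^2 + y^2) is below k/2 and
    the rest is at most 1 / (30 y) < 1/100. *)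
Lemma rcp_horizontal_right (k y : R) (N : nat) : 0 < k <= y -> 0 < 2 * PI - y <= 1 / 10 -> (1 <= N)%nat ->
  Cmod (rcp (mkC k y) N) <= exp (INR N * (1 / 100) + 3 * y / sin y ^ 2).
Proof.
intros Hk Hy HN. assert (P := PI_gt_312). assert (NP : 1 <= INR N) by (apply (le_INR 1); auto).
eapply Rle_trans; [apply rcp_reflect; auto; lra|].
eapply Rle_trans; [apply Rmult_le_compat_l; [left; apply exp_pos|apply rcp_horizontal_left; auto]|].
rewrite <- exp_plus. apply exp_le.
assert (B : (1.65 * k + y / 30) / (k ^ 2 + y ^ 2) <= k / 2 + 1 / 100).
{ apply Rmult_le_reg_r with (k ^ 2 + y ^ 2); [nra|].
  unfold Rdiv at 1. rewrite Rmult_assoc, Rinv_l, Rmult_1_r by nra.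
  assert (6 <= y) by lra. assert (36 <= y ^ 2) by nra.
  assert (y / 30 <= y ^ 2 / 100) by nra. assert (0 <= k ^ 2) by nra. nra. }
apply (Rmult_le_compat_l (INR N)) in B; lra.
Qed.

Lemma Series_ge_0 (a : nat -> R) : (forall n, 0 <= a n) -> ex_series a -> 0 <= Series a.
Proof.
intros Ha He. rewrite <- (Series_0 (fun _ => 0)) by auto. apply Series_le; auto.
intros n. split; [lra|auto].
Qed.

(** |1 - q^j| >= 1 - |q|^j reduces to real q, where [hlog] is decreasing and the Riemann sum error
    is 0. There Li2 is nonnegative, which leaves the rate zeta(2) / k. *)
Lemma rcp_left (k y : R) (N : nat) : 0 < k -> (1 <= N)%nat ->
  Cmod (rcp (mkC (- k) y) N) <= exp (INR N * (1.65 / k)).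
Proof.
intros Hk HN. assert (NP : 1 <= INR N) by (apply (le_INR 1); auto).
assert (R1 : Re (mkC (- k) y) < 0) by (unfold mkC, Re; simpl; lra).
assert (R2 : Re (mkC (- k) 0) < 0) by (unfold mkC, Re; simpl; lra).
apply Rle_trans with (Cmod (rcp (mkC (- k) 0) N)).
- unfold rcp. rewrite !Cmod_inv_cpoch by (intros; apply cexp_pow_neq_1_left; auto; lia).
  apply exp_le, rsum_le. intros j Hj. rewrite !cexp_div_pow by auto.
  assert (X : 0 < INR (S j) / INR N) by (apply Rdiv_lt_0_compat; [apply INR_S_pos|lra]).
  set (s := INR (S j) / INR N) in *.
  assert (M1 : Cmod (cexp (s * mkC (- k) y)) = exp (- (s * k)))
    by (rewrite Cmod_cexp, Re_scal; f_equal; unfold mkC, Re; simpl; ring).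
  assert (E0 : cexp (s * mkC (- k) 0) = RtoC (exp (- (s * k)))).
  { rewrite <- cexp_RtoC. f_equal. apply C_ext; unfold mkC, Re, Im; simpl; ring. }
  rewrite E0, <- RtoC_minus, Cmod_R.
  assert (X1 : exp (- (s * k)) < 1) by (rewrite <- exp_0; apply exp_increasing; nra).
  rewrite Rabs_pos_eq by lra. apply Ropp_le_contravar, Rcomplements.ln_le; [lra|].
  assert (T := Cmod_triangle_inv 1 (cexp (s * mkC (- k) y))). rewrite Cmod_1, M1 in T. lra.
- eapply Rle_trans; [apply (cpoch_bound_left _ 0)|]; auto; try lra.
  + intros s Hs.
    assert (E0 : cexp (s * mkC (- k) 0) = mkC (exp (- (s * k)) * 1) (exp (- (s * k)) * 0)).
    { apply C_ext; unfold cexp, mkC, Re, Im; simpl;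
      replace (s * 0 + 0 * - k) with 0 by ring; rewrite ?cos_0, ?sin_0;
      replace (s * - k - 0 * 0) with (- (s * k)) by ring; ring. }
    rewrite E0. set (r := exp (- (s * k))).
    assert (X0 : 0 < r) by apply exp_pos.
    assert (X1 : r < 1) by (unfold r; rewrite <- exp_0; apply exp_increasing; nra).
    assert (D0 : 0 < (1 - r * 1) ^ 2 + (r * 0) ^ 2) by nra.
    rewrite hlog_deriv_formula by (auto; ring).
    unfold Rdiv. assert (0 < / ((1 - r * 1) ^ 2 + (r * 0) ^ 2)) by (apply Rinv_0_lt_compat; auto).
    assert (Y : 0 <= r * (k * (1 - r) + 0 * 0)) by (apply Rmult_le_pos; [lra|nra]).
    assert (0 <= r * (k * (1 - r) + 0 * 0) * / ((1 - r * 1) ^ 2 + (r * 0) ^ 2)) by (apply Rmult_le_pos; lra). lra.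
  + apply exp_le. rewrite Rplus_0_r. apply Rmult_le_compat_l; [lra|].
    unfold growth. rewrite growth_formula by auto.
    assert (A : 0 <= Re (dilog (cexp (mkC (- k) 0)))).
    { replace (cexp (mkC (- k) 0)) with (RtoC (exp (- k)))
        by (rewrite <- cexp_RtoC; reflexivity).
      assert (H0 := exp_pos (- k)).
      assert (H1 : exp (- k) < 1) by (rewrite <- exp_0; apply exp_increasing; lra).
      assert (Dm := dominated_dilog (RtoC (exp (- k))) ltac:(rewrite Cmod_R, Rabs_pos_eq; lra)).
      apply Series_ge_0; [|apply (dominated_ReIm _ Dm)].
      intros n. rewrite <- (RtoC_pow (exp (- k)) (S n)), Re_scal, re_RtoC.
      assert (Pn := INR_S_pos n).
      apply Rmult_le_pos; [left; apply Rinv_0_lt_compat; nra|apply pow_le; lra]. }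
    assert (Z := zeta2_le). apply Rmult_le_reg_r with (k ^ 2 + 0 ^ 2); [nra|].
    unfold Rdiv at 1. rewrite Rmult_assoc, Rinv_l, Rmult_1_r by nra.
    replace (1.65 / k * (k ^ 2 + 0 ^ 2)) with (1.65 * k) by (field; lra). nra.
Qed.

Lemma rcp_right (k y : R) (N : nat) : 0 < k -> (1 <= N)%nat ->
  Cmod (rcp (mkC k y) N) <= exp (INR N * (1.65 / k - k / 2)).
Proof.
intros Hk HN. eapply Rle_trans; [apply rcp_reflect; auto|].
eapply Rle_trans; [apply Rmult_le_compat_l; [left; apply exp_pos|apply rcp_left; auto]|].
rewrite <- exp_plus. apply exp_le. lra.
Qed.

(** * The exponent along the ray through the saddle point *)

Lemma scal_mkC (s a b : R) : (s * mkC a b)%C = mkC (s * a) (s * b).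
Proof. apply C_ext; unfold mkC, Re, Im; simpl; ring. Qed.

(** 0.65 bounds zeta(2) - 1: all terms after the first carry a factor [rho ^ 2]. *)
Lemma Re_dilog_mult_le (w c : C) (rho : R) : Cmod w <= rho <= 1 ->
  Re (dilog w * c) <= Cmod c * (rho + 0.65 * rho ^ 2).
Proof.
intros Hw. assert (W0 := Cmod_ge_0 w). assert (C0 := Cmod_ge_0 c).
assert (D := dominated_dilog w ltac:(lra)).
unfold dilog. rewrite Cmult_comm, <- (Cser_scal c) by auto.
assert (Dc := dominated_scal c _ D). destruct (dominated_ReIm _ Dc) as [D1 _].
set (g := fun n => Cmod c * (/ (INR (S n) * INR (S n)) * rho ^ S n)).
assert (Hg : forall n, Rabs (Re (c * (RtoC (/ (INR (S n) * INR (S n))) * w ^ S n))%C) <= g n).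
{ intros n. eapply Rle_trans; [apply Re_le_Cmod|]. unfold g.
  rewrite !Cmod_mult, Cmod_pow, Cmod_R. assert (Pn := INR_S_pos n).
  assert (Q : 0 < / (INR (S n) * INR (S n))) by (apply Rinv_0_lt_compat; nra).
  rewrite (Rabs_pos_eq (/ _)) by lra.
  apply Rmult_le_compat_l; auto. apply Rmult_le_compat_l; [lra|]. apply pow_incr. lra. }
assert (Eg : ex_series g).
{ apply (ex_series_dom _ (fun n => Cmod c * / (INR (S n) * INR (S n)))).
  - exact (ex_series_scal_l (Cmod c) _ ex_series_inv_sq).
  - intros n. unfold g. assert (Pn := INR_S_pos n).
    assert (Q : 0 < / (INR (S n) * INR (S n))) by (apply Rinv_0_lt_compat; nra).
    assert (X : 0 <= rho ^ S n) by (apply pow_le; lra).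
    assert (X1 : rho ^ S n <= 1) by (rewrite <- (pow1 (S n)); apply pow_incr; lra).
    rewrite Rabs_pos_eq by (apply Rmult_le_pos; auto; nra).
    apply Rmult_le_compat_l; auto. nra. }
change (Series (fun n => Re (c * (RtoC (/ (INR (S n) * INR (S n))) * w ^ S n))%C)
  <= Cmod c * (rho + 0.65 * rho ^ 2)).
apply Rle_trans with (Series g).
{ eapply Rle_trans; [apply Rle_abs|]. eapply Rle_trans; [apply Series_Rabs|].
  - apply (ex_series_dom _ _ Eg). intros n. rewrite Rabs_Rabsolu. auto.
  - apply Series_le; auto. intros n. split; [apply Rabs_pos|auto]. }
unfold g. rewrite Series_scal_l. apply Rmult_le_compat_l; auto.
assert (Ex : ex_series (fun n => rho ^ 2 * / (INR (S (S n)) * INR (S (S n))))).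
{ apply (ex_series_scal_l (rho ^ 2) (fun n => / (INR (S (S n)) * INR (S (S n))))).
  apply (ex_series_incr_1 (V := R_NormedModule) (fun n => / (INR (S n) * INR (S n)))).
  apply ex_series_inv_sq. }
assert (B : forall n, 0 <= / (INR (S (S n)) * INR (S (S n))) * rho ^ S (S n)
   <= rho ^ 2 * / (INR (S (S n)) * INR (S (S n)))).
{ intros n. assert (Pn := INR_S_pos (S n)).
  assert (Q : 0 < / (INR (S (S n)) * INR (S (S n)))) by (apply Rinv_0_lt_compat; nra).
  assert (X1 : rho ^ n <= 1) by (rewrite <- (pow1 n); apply pow_incr; lra).
  assert (X0 : 0 <= rho ^ n) by (apply pow_le; lra).
  replace (rho ^ S (S n)) with (rho ^ 2 * rho ^ n) by (simpl; ring).
  assert (0 <= rho ^ 2 * rho ^ n <= rho ^ 2) by nra.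
  split; [apply Rmult_le_pos; lra|]. rewrite Rmult_comm. apply Rmult_le_compat_r; lra. }
assert (Ez : zeta2 - 1 = Series (fun n => / (INR (S (S n)) * INR (S (S n))))).
{ unfold zeta2. rewrite (Series_incr_1 (fun n => / (INR (S n) * INR (S n)))) by apply ex_series_inv_sq.
  replace (/ (INR 1 * INR 1)) with 1 by (simpl; field). ring. }
rewrite (Series_incr_1 (fun n => / (INR (S n) * INR (S n)) * rho ^ S n)).
2:{ apply (ex_series_incr_1 (V := R_NormedModule) (fun n => / (INR (S n) * INR (S n)) * rho ^ S n)).
    apply (ex_series_dom _ _ Ex). intros n. rewrite Rabs_pos_eq; apply B. }
apply Rplus_le_compat.
- simpl. right. field.
- eapply Rle_trans; [apply Series_le; [apply B|exact Ex]|].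
  rewrite Series_scal_l, <- Ez. assert (Z := zeta2_le). assert (0 <= rho ^ 2) by nra. nra.
Qed.

Section Ray.
Variables x y : R.
Hypothesis Hx : 1.6 <= x <= 1.61.
Hypothesis Hy : 7 * PI / 3 <= y <= 5 * PI / 2.

Let z0 := mkC (- x) y.
(** The parameter at which the ray through z0 has the height of the horizontal edge of the
    contour. *)
Let s1 := (2 * PI - / 20) / y.

Lemma ray_y_bounds : 7.28 <= y <= 10.
Proof. assert (P := PI_gt_312). assert (P4 := PI_4). lra. Qed.

Lemma ray_s1_bounds : 0.79 <= s1 <= 6 / 7 /\ s1 * y = 2 * PI - / 20.
Proof.
assert (P := PI_gt_312). assert (P4 := PI_4). assert (Y := ray_y_bounds).
assert (E : s1 * y = 2 * PI - / 20) by (unfold s1; field; lra).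
repeat split; auto; apply Rmult_le_reg_r with y; lra.
Qed.

(** On the ray |e^(t s z0)| = exp(- t s x), and t s y >= pi/2 forces this below exp(- (pi/2) x / y)
    whatever s is. So the Riemann sum error is uniform for s <= 16. *)
Lemma rcp_ray (s : R) (N : nat) : 0 < s <= 16 -> (1 <= N)%nat ->
  Cmod (rcp (s * z0) N) <= 
    exp (INR N * growth (s * z0) + 16 * (2 * x + y) / (1 - exp (- (PI / 2 * (x / y)))) ^ 2).
Proof.
intros Hs HN. assert (NP : 1 <= INR N) by (apply (le_INR 1); auto).
assert (Y := ray_y_bounds). assert (P := PI_gt_312).
assert (Q : 0 < PI / 2 * (x / y)) by (apply Rmult_lt_0_compat; [lra|apply Rdiv_lt_0_compat; lra]).
assert (E1 : exp (- (PI / 2 * (x / y))) < 1) by (rewrite <- exp_0; apply exp_increasing; lra).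
set (D0 := (1 - exp (- (PI / 2 * (x / y)))) ^ 2).
assert (HD0 : 0 < D0) by (unfold D0; apply pow_lt; lra).
assert (Ez : (s * z0)%C = mkC (- (s * x)) (s * y)) by (unfold z0; rewrite scal_mkC; f_equal; ring).
rewrite Ez.
assert (Rz : Re (mkC (- (s * x)) (s * y)) = - (s * x)) by reflexivity.
eapply Rle_trans; [apply (cpoch_bound_left _ ((2 * (s * x) + s * y) / D0))|].
- rewrite Rz; nra.
- apply Rlt_le, Rdiv_lt_0_compat; nra.
- auto.
- intros t Ht. apply hlog_deriv_le; auto; [nra|].
  intros Hb. set (w := cexp (t * mkC (- (s * x)) (s * y))).
  assert (Hw : Cmod w <= exp (- (PI / 2 * (x / y)))).
  { unfold w. rewrite Cmod_cexp, Re_scal, Rz. apply exp_le.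
    assert (PI / 2 * (x / y) <= t * (s * x)); [|lra].
    replace (t * (s * x)) with (t * (s * y) * (x / y)) by (field; lra).
    apply Rmult_le_compat_r; auto. left. apply Rdiv_lt_0_compat; lra. }
  assert (T := Cmod_triangle_inv 1 w). rewrite Cmod_1 in T. unfold D0. apply pow_incr. lra.
- apply exp_le, Rplus_le_compat_l. unfold Rdiv.
  apply Rmult_le_compat_r; [left; apply Rinv_0_lt_compat; auto|]. nra.
Qed.

Lemma z0_nz : z0 <> 0%C.
Proof. apply Re_neg_nz. unfold z0, mkC, Re; simpl; lra. Qed.

Lemma growth_ray (s : R) : 0 < s -> growth (s * z0) = (Bd z0 s - Re (zeta2 / z0)) / s.
Proof.
intros Hs. unfold growth, Bd. rewrite <- Re_minus.
assert (N := z0_nz). assert (Ns : RtoC s <> 0%C) by (intros X; apply RtoC_inj in X; lra).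
replace ((dilog (cexp (s * z0)) - zeta2) / (s * z0))%C
  with (RtoC (/ s) * (dilog (cexp (s * z0)) / z0 - zeta2 / z0))%C
  by (rewrite RtoC_inv by lra; field; auto).
rewrite Re_scal. field. lra.
Qed.

(** 1.76 is 1.1 times 1.6, a lower bound for s x on the far part of the ray. The exponential is
    doubled three times from 0.22, where e^c >= 1 + c + c^2/2 is used. *)
Lemma exp_176 : exp (Ropp 1.76) <= 0.175.
Proof.
assert (E : 1 + 0.11 <= exp 0.11) by (apply exp_ineq1_le).
assert (T := exp_taylor1 0.11 ltac:(rewrite Rabs_pos_eq; lra)).
assert (H : 1.2442 <= exp 0.22).
{ destruct (is_derive_MVT (fun t => exp t - 1 - t - t ^ 2 / 2) (fun t => exp t - 1 - t) 0 0.22) as [c [Hc E2]].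
  - lra.
  - intros t Ht. auto_derive; auto. field.
  - rewrite exp_0 in E2. assert (X := exp_ineq1_le c). nra. }
assert (H2 : 1.548 <= exp 0.44) by (replace 0.44 with (0.22 + 0.22) by lra; rewrite exp_plus; nra).
assert (H4 : 2.396 <= exp 0.88) by (replace 0.88 with (0.44 + 0.44) by lra; rewrite exp_plus; nra).
assert (H8 : 5.74 <= exp 1.76) by (replace 1.76 with (0.88 + 0.88) by lra; rewrite exp_plus; nra).
rewrite exp_Ropp. apply Rle_trans with (/ 5.74); [apply Rinv_le_contravar; lra|lra].
Qed.

(** Far out, both summands of the rate are bounded separately by absolute values; dividing by s >=
    1.1 brings the result just below 0.0677, the lower bound for the rate at z0. *)
Lemma ray_far (s : R) : 1.1 <= s -> growth (s * z0) <= 0.0676.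
Proof.
intros Hs. assert (Y := ray_y_bounds). assert (N := z0_nz).
assert (Ns : RtoC s <> 0%C) by (intros X; apply RtoC_inj in X; lra).
set (n2 := x ^ 2 + y ^ 2).
assert (Hn2 : 55.55 <= n2) by (unfold n2; nra).
assert (M2 : Cmod z0 ^ 2 = n2) by (rewrite Cmod2; unfold z0, mkC, Re, Im, n2; simpl; ring).
assert (M0 := Cmod_ge_0 z0). assert (M : 7.45 <= Cmod z0) by nra.
unfold growth.
replace ((dilog (cexp (s * z0)) - zeta2) / (s * z0))%C
  with (RtoC (/ s) * (dilog (cexp (s * z0)) * / z0 - RtoC zeta2 * / z0))%C
  by (rewrite RtoC_inv by lra; field; auto).
rewrite Re_scal, Re_minus, Re_scal.
assert (R1 : Re (/ z0)%C = - x / n2).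
{ unfold z0, mkC, Cinv, Re, n2; simpl. f_equal. f_equal. ring. }
assert (R2 : Re (dilog (cexp (s * z0)) * / z0) <= / Cmod z0 * (0.175 + 0.65 * 0.175 ^ 2)).
{ rewrite <- Cmod_inv by auto. apply Re_dilog_mult_le. split; [|lra].
  rewrite Cmod_cexp, Re_scal. eapply Rle_trans; [|apply exp_176]. apply exp_le.
  unfold z0, mkC, Re; simpl. nra. }
assert (R3 : / Cmod z0 <= / 7.45) by (apply Rinv_le_contravar; lra).
assert (R4 : x / n2 <= 1.61 / 55.55).
{ apply Rle_trans with (1.61 / n2); unfold Rdiv.
  - apply Rmult_le_compat_r; [left; apply Rinv_0_lt_compat|]; lra.
  - apply Rmult_le_compat_l; [lra|]. apply Rinv_le_contravar; lra. }
assert (R5 : 0 <= x / n2) by (apply Rlt_le, Rdiv_lt_0_compat; lra).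
rewrite R1. replace (- x / n2) with (- (x / n2)) by (unfold Rdiv; ring).
assert (Z := zeta2_le). assert (Zp := zeta2_pos).
assert (V : zeta2 * (x / n2) <= 1.65 * (1.61 / 55.55)) by (apply Rmult_le_compat; lra).
apply Rmult_le_reg_l with s; [lra|]. rewrite <- Rmult_assoc, Rinv_r, Rmult_1_l by lra.
lra.
Qed.

Definition dhlog (s : R) : R := Re (z0 * cexp (s * z0) / (1 - cexp (s * z0)))%C.

(** Put t = s y - 2 pi, which runs through [- 1/20, 3 pi/4]. The sign of x (c - r) + y v is checked
    on three ranges: t <= 0, where c is near 1; up to pi/2, where c + v >= 1; and up to 3 pi/4,
    where v >= 0.7 and y is much larger than x. *)
Lemma dhlog_neg (s : R) : s1 <= s <= 1.1 -> dhlog s < 0.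
Proof.
intros Hs. assert (Y := ray_y_bounds). destruct ray_s1_bounds as [S1 S2].
assert (P := PI_gt_312). assert (P4 := PI_4).
unfold dhlog.
assert (E : (s * z0)%C = mkC (- (s * x)) (s * y)) by (unfold z0; rewrite scal_mkC; f_equal; ring).
rewrite E, cexp_pair. unfold z0.
set (r := exp (- (s * x))). set (c := cos (s * y)). set (v := sin (s * y)).
assert (Hr0 : 0 < r) by apply exp_pos.
assert (Hr1 : r <= 1 / 2).
{ unfold r. rewrite exp_Ropp. apply Rle_trans with (/ 2); [|lra]. apply Rinv_le_contravar; [lra|].
  assert (T := exp_ineq1_le (s * x)). nra. }
assert (Hc : -1 <= c <= 1) by apply COS_bound.
assert (Hcs : c * c + v * v = 1) by (assert (T := sin2_cos2 (s * y)); unfold Rsqr in T; unfold c, v; lra).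
assert (HDp : 0 < (1 - r * c) ^ 2 + (r * v) ^ 2).
{ assert (0 < 1 - r * c) by nra. assert (0 <= (r * v) ^ 2) by apply pow2_ge_0.
  assert (0 < (1 - r * c) ^ 2) by (apply pow_lt; auto). lra. }
rewrite hlog_deriv_formula by auto.
set (t := s * y - 2 * PI).
assert (Ht : - / 20 <= t <= 3 * (PI / 4)) by (unfold t; nra).
assert (Ec : c = cos t) by (unfold c, t; rewrite cos_minus, cos_2PI, sin_2PI; ring).
assert (Ev : v = sin t) by (unfold v, t; rewrite sin_minus, cos_2PI, sin_2PI; ring).
assert (K : 0 < x * (c - r) + y * v).
{ destruct (Rle_dec t 0) as [H0|H0]; [|destruct (Rle_dec t (PI / 2)) as [H1|H1]].
  - assert (T1 := one_minus_cos_le t). assert (T2 := Rabs_sin_le t).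
    rewrite (Rabs_left1 t) in T2 by lra. apply Rabs_le_between in T2.
    rewrite <- Ec in T1. rewrite <- Ev in T2. assert (t ^ 2 <= / 400) by nra.
    assert (0.998 <= c) by lra. assert (- / 20 <= v) by lra. nra.
  - assert (0 <= c) by (rewrite Ec; apply cos_ge_0; lra).
    assert (0 <= v) by (rewrite Ev; apply sin_ge_0; lra).
    assert (1 <= c + v) by nra. nra.
  - assert (A : cos (3 * (PI / 4)) <= c) by (rewrite Ec; apply cos_decr_1; lra).
    assert (B : sin (3 * (PI / 4)) <= v) by (rewrite Ev; apply sin_decr_1; lra).
    replace (3 * (PI / 4)) with (PI - PI / 4) in A, B by field.
    rewrite cos_minus, cos_PI, sin_PI, cos_PI4 in A. rewrite sin_minus, cos_PI, sin_PI, sin_PI4 in B.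
    assert (Q : 1.4 <= sqrt 2) by (assert (T := sqrt_sqrt 2 ltac:(lra)); assert (T0 := sqrt_pos 2); nra).
    assert (Q2 : sqrt 2 <= 1.42) by (assert (T := sqrt_sqrt 2 ltac:(lra)); assert (T0 := sqrt_pos 2); nra).
    assert (I : 0.7 <= 1 / sqrt 2).
    { apply Rmult_le_reg_r with (sqrt 2); [lra|]. unfold Rdiv. rewrite Rmult_assoc, Rinv_l; lra. }
    assert (I2 : 1 / sqrt 2 <= 0.72).
    { apply Rmult_le_reg_r with (sqrt 2); [lra|]. unfold Rdiv. rewrite Rmult_assoc, Rinv_l; lra. }
    assert (-0.72 <= c) by lra. assert (0.7 <= v) by lra. nra. }
assert (D := Rinv_0_lt_compat _ HDp). unfold Rdiv.
assert (0 < r * (x * (c - r) + y * v) * / ((1 - r * c) ^ 2 + (r * v) ^ 2))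
  by (apply Rmult_lt_0_compat; auto; apply Rmult_lt_0_compat; auto).
lra.
Qed.

Hypothesis Hsaddle : hlog z0 1 = growth z0.
Hypothesis Hval : 0.0677 <= growth z0.

(** [pm s] is the growth rate at s z0, and [kk s] is s^2 times its derivative. Since kk' = s
    [dhlog s] < 0 on [s1, 1.1] and kk 1 = 0 by [Hsaddle], the rate increases up to s = 1 and
    decreases after it. *)
Let pm (s : R) := (Bd z0 s - Re (zeta2 / z0)) / s.
Let kk (s : R) := s * hlog z0 s - (Bd z0 s - Re (zeta2 / z0)).

Lemma Re_z0_neg : Re z0 < 0.
Proof. unfold z0, mkC, Re; simpl; lra. Qed.

Lemma derive_kk s : 0 < s -> derivable_pt_lim kk s (s * dhlog s).
Proof.
intros Hs. apply is_derive_Reals. unfold kk.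
assert (D1 := is_derive_hlog z0 s Re_z0_neg Hs). assert (D2 := is_derive_Bd z0 s Re_z0_neg Hs).
assert (D : is_derive (fun s => s * hlog z0 s - (Bd z0 s - Re (zeta2 / z0))) s
  ((1 * hlog z0 s + s * dhlog s) - (hlog z0 s - 0))).
{ apply (is_derive_minus (V := R_NormedModule)).
  - apply (is_derive_mult (fun s => s) (hlog z0)); [apply (is_derive_id (K := R_AbsRing))|exact D1|].
    intros; apply Rmult_comm.
  - apply (is_derive_minus (V := R_NormedModule)); [exact D2|apply (is_derive_const (V := R_NormedModule))]. }
replace (s * dhlog s) with ((1 * hlog z0 s + s * dhlog s) - (hlog z0 s - 0)) by ring. exact D.
Qed.

Lemma derive_pm s : 0 < s -> derivable_pt_lim pm s (kk s / s ^ 2).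
Proof.
intros Hs. apply is_derive_Reals. unfold pm.
assert (D2 := is_derive_Bd z0 s Re_z0_neg Hs).
assert (D : is_derive (fun s => (Bd z0 s - Re (zeta2 / z0)) / s) s
  (((hlog z0 s - 0) * s - (Bd z0 s - Re (zeta2 / z0)) * 1) / s ^ 2)).
{ apply (is_derive_div (fun s => Bd z0 s - Re (zeta2 / z0)) (fun s => s)).
  - apply (is_derive_minus (V := R_NormedModule)); [exact D2|apply (is_derive_const (V := R_NormedModule))].
  - apply (is_derive_id (K := R_AbsRing)).
  - lra. }
replace (kk s / s ^ 2) with (((hlog z0 s - 0) * s - (Bd z0 s - Re (zeta2 / z0)) * 1) / s ^ 2); auto.
unfold kk. field. lra.
Qed.

Lemma kk_1 : kk 1 = 0.
Proof.
unfold kk. rewrite Hsaddle. assert (E := growth_ray 1 ltac:(lra)).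
replace (1 * z0)%C with z0 in E by ring. rewrite E. field.
Qed.

Lemma kk_decreasing a b : s1 <= a < b -> b <= 1.1 -> kk b < kk a.
Proof.
intros Ha Hb. destruct ray_s1_bounds as [S1 _].
destruct (MVT_cor2 kk (fun s => s * dhlog s) a b) as [c [E Hc]]; [lra| |].
- intros c Hc. apply derive_kk. lra.
- assert (T := dhlog_neg c ltac:(lra)). assert (c * dhlog c < 0) by nra. nra.
Qed.

Lemma pm_mono a b : s1 <= a < b -> (b <= 1 -> pm a < pm b) /\ (1 <= a -> b <= 1.1 -> pm b < pm a).
Proof.
intros Ha. destruct ray_s1_bounds as [S1 _].
destruct (MVT_cor2 pm (fun s => kk s / s ^ 2) a b) as [c [E Hc]]; [lra| |].
- intros c Hc. apply derive_pm. lra.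
- assert (I : 0 < / c ^ 2) by (apply Rinv_0_lt_compat; nra). split; intros.
  + assert (K := kk_decreasing c 1 ltac:(lra) ltac:(lra)). rewrite kk_1 in K.
    assert (0 < kk c / c ^ 2) by (apply Rmult_lt_0_compat; auto). nra.
  + assert (K := kk_decreasing 1 c ltac:(lra) ltac:(lra)). rewrite kk_1 in K.
    assert (kk c / c ^ 2 < 0) by (unfold Rdiv; nra). nra.
Qed.

Lemma ray_gap (d : R) : 0 < d -> exists c, 0 < c /\
  forall s, s1 <= s -> d <= Rabs (s - 1) -> growth (s * z0) <= growth z0 - c.
Proof.
intros Hd. destruct ray_s1_bounds as [S1 _].
set (e := Rmin d (Rmin (1 - s1) 0.1)).
assert (E1 : e <= d) by apply Rmin_l.
assert (E2 : e <= 1 - s1) by (eapply Rle_trans; [apply Rmin_r|apply Rmin_l]).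
assert (E3 : e <= 0.1) by (eapply Rle_trans; [apply Rmin_r|apply Rmin_r]).
assert (E0 : 0 < e) by (unfold e; repeat apply Rmin_pos; lra).
assert (P1 : growth z0 = pm 1).
{ unfold pm. rewrite <- (growth_ray 1) by lra. f_equal. ring. }
destruct (pm_mono (1 - e) 1 ltac:(lra)) as [L1 _]. specialize (L1 ltac:(lra)).
destruct (pm_mono 1 (1 + e) ltac:(lra)) as [_ L2]. specialize (L2 ltac:(lra) ltac:(lra)).
(* 0.0001 is the margin 0.0677 - 0.0676 left by [ray_far] for s >= 1.1; the other two terms cover s
   below 1.1 by monotonicity. *)
exists (Rmin 0.0001 (Rmin (pm 1 - pm (1 - e)) (pm 1 - pm (1 + e)))).
assert (F1 : Rmin 0.0001 (Rmin (pm 1 - pm (1 - e)) (pm 1 - pm (1 + e))) <= 0.0001) by apply Rmin_l.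
assert (F2 : Rmin 0.0001 (Rmin (pm 1 - pm (1 - e)) (pm 1 - pm (1 + e))) <= pm 1 - pm (1 - e))
  by (eapply Rle_trans; [apply Rmin_r|apply Rmin_l]).
assert (F3 : Rmin 0.0001 (Rmin (pm 1 - pm (1 - e)) (pm 1 - pm (1 + e))) <= pm 1 - pm (1 + e))
  by (eapply Rle_trans; [apply Rmin_r|apply Rmin_r]).
split; [repeat apply Rmin_pos; lra|].
intros s Hs Hsd.
destruct (Rle_dec 1.1 s) as [H|H].
{ assert (T := ray_far s H). lra. }
rewrite growth_ray by lra. fold (pm s). rewrite P1.
unfold Rabs in Hsd. destruct (Rcase_abs (s - 1)).
- assert (pm s <= pm (1 - e)); [|lra].
  destruct (Req_dec s (1 - e)) as [->|]; [lra|].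
  destruct (pm_mono s (1 - e) ltac:(lra)) as [T _]. specialize (T ltac:(lra)). lra.
- assert (pm s <= pm (1 + e)); [|lra].
  destruct (Req_dec s (1 + e)) as [->|]; [lra|].
  destruct (pm_mono (1 + e) s ltac:(lra)) as [_ T]. specialize (T ltac:(lra) ltac:(lra)). lra.
Qed.
End Ray.

(** * Asymptotic expansions in powers of 1/N *)

Notation eps N := (/ INR N).

Lemma eps_bounds N : (1 <= N)%nat -> 0 < eps N <= 1.
Proof.
intros H. destruct N; [lia|]. apply inv_INR_le_1.
Qed.

Lemma eps_INR N : (1 <= N)%nat -> eps N * INR N = 1.
Proof. intros H. apply Rinv_l. apply not_0_INR. lia. Qed.

(** Polynomials in 1/N, generated by closure so that neither degrees nor coefficients have to be
    tracked; [isP_coeffs] extracts the coefficients at the end. *)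
Inductive isP : (nat -> C) -> Prop :=
| isP_const (c : C) : isP (fun _ => c)
| isP_eps F : isP F -> isP (fun N => RtoC (eps N) * F N)%C
| isP_plus F G : isP F -> isP G -> isP (fun N => F N + G N)%C
| isP_ext F G : isP F -> (forall N, F N = G N) -> isP G.

Lemma isP_scal (c : C) F : isP F -> isP (fun N => c * F N)%C.
Proof.
induction 1 as [c'|F HF IH|F G HF IHF HG IHG|F G HF IHF E].
- apply (isP_ext (fun _ => (c * c')%C)); [apply isP_const|auto].
- apply (isP_ext (fun N => RtoC (eps N) * (c * F N))%C); [apply isP_eps; auto|intros; ring].
- apply (isP_ext (fun N => c * F N + c * G N)%C); [apply isP_plus; auto|intros; ring].
- apply (isP_ext (fun N => c * F N)%C); auto. intros; now rewrite E.
Qed.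

Lemma isP_mult F G : isP F -> isP G -> isP (fun N => F N * G N)%C.
Proof.
intros HF HG. induction HF as [c'|F HF IH|F1 F2 HF IHF HG' IHG|F1 F2 HF IHF E].
- apply isP_scal; auto.
- apply (isP_ext (fun N => RtoC (eps N) * (F N * G N))%C); [apply isP_eps; auto|intros; ring].
- apply (isP_ext (fun N => F1 N * G N + F2 N * G N)%C); [apply isP_plus; auto|intros; ring].
- apply (isP_ext (fun N => F1 N * G N)%C); auto. intros; now rewrite E.
Qed.

Lemma isP_bounded F : isP F -> exists B, forall N, (1 <= N)%nat -> Cmod (F N) <= B.
Proof.
induction 1 as [c'|F HF [B IH]|F G HF [B1 IHF] HG [B2 IHG]|F G HF [B IHF] E].
- exists (Cmod c'). intros; lra.
- exists B. intros N HN. rewrite Cmod_mult, Cmod_R. assert (T := eps_bounds N HN).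
  rewrite Rabs_pos_eq by lra. specialize (IH N HN). assert (Q := Cmod_ge_0 (F N)). nra.
- exists (B1 + B2). intros N HN. eapply Rle_trans; [apply Cmod_triangle|].
  specialize (IHF N HN). specialize (IHG N HN). lra.
- exists B. intros N HN. rewrite <- E. auto.
Qed.

Lemma isP_coeffs F : isP F -> exists (d : nat -> C) K, forall N,
  F N = csum (fun i => d i * RtoC (eps N) ^ i)%C K.
Proof.
assert (Pad : forall (d : nat -> C) K L (x : C), (K <= L)%nat ->
  csum (fun i => (if (i <? K)%nat then d i else RtoC 0) * x ^ i)%C L = csum (fun i => d i * x ^ i)%C K).
{ intros d K L x H. induction L.
  - assert (K = 0)%nat by lia. subst. reflexivity.
  - destruct (Nat.eq_dec K (S L)) as [->|].
    + apply csum_ext. intros n Hn. apply Nat.ltb_lt in Hn. now rewrite Hn.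
    + cbn [csum]. rewrite IHL by lia.
      replace (L <? K)%nat with false by (symmetry; apply Nat.ltb_ge; lia). ring. }
induction 1 as [c'|F HF [d [K IH]]|F G HF [d1 [K1 IHF]] HG [d2 [K2 IHG]]|F G HF [d [K IHF]] E].
- exists (fun _ => c'), 1%nat. intros N. simpl. ring.
- exists (fun i => match i with O => RtoC 0 | S j => d j end), (S K). intros N. rewrite IH.
  clear IH. induction K; [simpl; ring|].
  change (csum ?f (S (S K))) with (csum f (S K) + f (S K))%C. rewrite <- IHK.
  cbn [csum]. rewrite Cpow_S. ring.
- exists (fun i => (if (i <? K1)%nat then d1 i else RtoC 0) + (if (i <? K2)%nat then d2 i else RtoC 0))%C, (K1 + K2)%nat.
  intros N. rewrite IHF, IHG, <- (Pad d1 K1 (K1 + K2)%nat), <- (Pad d2 K2 (K1 + K2)%nat) by lia.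
  induction (K1 + K2)%nat; [simpl; ring|]. cbn [csum]. rewrite <- IHn. ring.
- exists d, K. intros N. rewrite <- E. auto.
Qed.

(* [u] agrees with a polynomial in [1/N] up to [O (N^(-L))]. *)
Definition aord (L : nat) (u : nat -> C) : Prop :=
  exists P, isP P /\ exists B, 0 <= B /\ forall N, (1 <= N)%nat -> Cmod (u N - P N) <= B * eps N ^ L.

Definition aseq (u : nat -> C) : Prop := forall L, aord L u.

Lemma eps_pow_pos N L : (1 <= N)%nat -> 0 < eps N ^ L <= 1.
Proof.
intros H. assert (T := eps_bounds N H). split; [apply pow_lt; lra|].
rewrite <- (pow1 L). apply pow_incr. lra.
Qed.

Lemma isP_aord P L : isP P -> aord L P.
Proof.
intros H. exists P. split; auto. exists 0. split; [lra|]. intros N HN.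
replace (P N - P N)%C with (RtoC 0) by ring. rewrite Cmod_0. lra.
Qed.

Lemma aord_O (B : R) L u : (forall N, (1 <= N)%nat -> Cmod (u N) <= B * eps N ^ L) -> aord L u.
Proof.
intros H. exists (fun _ => 0%C). split; [apply isP_const|]. exists (Rabs B). split; [apply Rabs_pos|].
intros N HN. replace (u N - 0)%C with (u N) by ring. eapply Rle_trans; [apply H; auto|].
apply Rmult_le_compat_r; [left; apply eps_pow_pos; auto|apply Rle_abs].
Qed.

Lemma aord_ext L u v : (forall N, (1 <= N)%nat -> u N = v N) -> aord L u -> aord L v.
Proof.
intros E [P [HP [B [HB H]]]]. exists P. split; auto. exists B. split; auto. intros N HN.
rewrite <- E by auto. auto.
Qed.

Lemma aord_plus L u v : aord L u -> aord L v -> aord L (fun N => u N + v N)%C.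
Proof.
intros [P [HP [B [HB H]]]] [Q [HQ [D [HD K]]]].
exists (fun N => P N + Q N)%C. split; [apply isP_plus; auto|]. exists (B + D). split; [lra|].
intros N HN. replace (u N + v N - (P N + Q N))%C with ((u N - P N) + (v N - Q N))%C by ring.
eapply Rle_trans; [apply Cmod_triangle|]. specialize (H N HN). specialize (K N HN). lra.
Qed.

Lemma aord_mult L u v : aord L u -> aord L v -> aord L (fun N => u N * v N)%C.
Proof.
intros [P [HP [B [HB H]]]] [Q [HQ [D [HD K]]]].
destruct (isP_bounded P HP) as [p Hp]. destruct (isP_bounded Q HQ) as [q Hq].
exists (fun N => P N * Q N)%C. split; [apply isP_mult; auto|].
assert (p0 : 0 <= p) by (eapply Rle_trans; [apply Cmod_ge_0|apply (Hp 1%nat); lia]).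
assert (q0 : 0 <= q) by (eapply Rle_trans; [apply Cmod_ge_0|apply (Hq 1%nat); lia]).
exists (B * (D + q) + p * D). split; [nra|].
intros N HN. replace (u N * v N - P N * Q N)%C with ((u N - P N) * v N + P N * (v N - Q N))%C by ring.
specialize (H N HN). specialize (K N HN). specialize (Hp N HN). specialize (Hq N HN).
assert (E := eps_pow_pos N L HN). set (e := eps N ^ L) in *.
assert (V : Cmod (v N) <= D + q).
{ replace (v N) with ((v N - Q N) + Q N)%C by ring. eapply Rle_trans; [apply Cmod_triangle|]. nra. }
eapply Rle_trans; [apply Cmod_triangle|]. rewrite !Cmod_mult.
assert (X1 : Cmod (u N - P N) * Cmod (v N) <= B * e * (D + q)) by (apply Rmult_le_compat; auto; apply Cmod_ge_0).
assert (X2 : Cmod (P N) * Cmod (v N - Q N) <= p * (D * e)) by (apply Rmult_le_compat; auto; apply Cmod_ge_0).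
lra.
Qed.

Lemma aord_const L (c : C) : aord L (fun _ => c).
Proof. apply isP_aord, isP_const. Qed.

Lemma aord_eps L u : aord L u -> aord (S L) (fun N => RtoC (eps N) * u N)%C.
Proof.
intros [P [HP [B [HB H]]]]. exists (fun N => RtoC (eps N) * P N)%C. split; [apply isP_eps; auto|].
exists B. split; auto. intros N HN.
replace (RtoC (eps N) * u N - RtoC (eps N) * P N)%C with (RtoC (eps N) * (u N - P N))%C by ring.
rewrite Cmod_mult, Cmod_R. assert (T := eps_bounds N HN). rewrite Rabs_pos_eq by lra.
specialize (H N HN). simpl. nra.
Qed.

Lemma aord_weaken L L' u : (L' <= L)%nat -> aord L u -> aord L' u.
Proof.
intros HL [P [HP [B [HB H]]]]. exists P. split; auto. exists B. split; auto. intros N HN.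
eapply Rle_trans; [apply H; auto|]. apply Rmult_le_compat_l; auto.
replace L with (L' + (L - L'))%nat by lia. rewrite pow_add.
assert (T := eps_pow_pos N L' HN). assert (T2 := eps_pow_pos N (L - L') HN). nra.
Qed.

Lemma aord_csum L (f : nat -> nat -> C) K : (forall i, (i < K)%nat -> aord L (f i)) ->
  aord L (fun N => csum (fun i => f i N) K).
Proof.
induction K; intros H; cbn [csum]; [apply aord_const|].
apply aord_plus; [apply IHK; intros; apply H; lia|apply H; lia].
Qed.

(** * Taylor and Euler-Maclaurin expansions *)

Lemma ccont_bounded f a b : a <= b -> ccont_on f a b ->
  exists M, 0 <= M /\ forall t, a <= t <= b -> Cmod (f t) <= M.
Proof.
intros Hab H.
assert (G : forall p : R -> R, (forall t, a <= t <= b -> continuous p t) ->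
  exists M, 0 <= M /\ forall t, a <= t <= b -> Rabs (p t) <= M).
{ intros p Hp. 
  destruct (continuity_ab_maj (fun t => Rabs (p t)) a b Hab) as [m [Hm _]].
  - intros c Hc. apply (continuity_pt_comp p Rabs); [apply continuity_pt_filterlim, Hp; auto|apply Rcontinuity_abs].
  - exists (Rabs (p m)). split; [apply Rabs_pos|auto]. }
destruct (G (fun t => Re (f t))) as [M1 [P1 H1]]; [intros t Ht; apply (ccont_continuous f t (H t Ht))|].
destruct (G (fun t => Im (f t))) as [M2 [P2 H2]]; [intros t Ht; apply (ccont_continuous f t (H t Ht))|].
exists (M1 + M2). split; [lra|]. intros t Ht. eapply Rle_trans; [apply Cmod_le_ReIm|].
specialize (H1 t Ht). specialize (H2 t Ht). lra.
Qed.

Lemma cder_comp_real (f : R -> C) (g : R -> R) t l k : cder f (g t) l -> is_derive g t k ->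
  cder (fun t => f (g t)) t (l * RtoC k).
Proof.
intros Hf Hg. destruct (cder_is_derive _ _ _ Hf) as [D1 D2].
apply is_derive_cder; unfold Re, Im in *; simpl in *.
- evar_last; [apply (is_derive_comp (fun u => fst (f u)) g t); eauto|].
  unfold scal; simpl; unfold mult; simpl. ring.
- evar_last; [apply (is_derive_comp (fun u => snd (f u)) g t); eauto|].
  unfold scal; simpl; unfold mult; simpl. ring.
Qed.

Lemma cder_mvt (f f' : R -> C) (a b M : R) :
  (forall t, Rmin a b <= t <= Rmax a b -> cder f t (f' t) /\ Cmod (f' t) <= M) ->
  Cmod (f b - f a) <= 2 * M * Rabs (b - a).
Proof.
intros H.
assert (G : forall p : C -> R, (forall z w, p (z - w)%C = p z - p w) -> (forall z, Rabs (p z) <= Cmod z) ->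
  (forall t, Rmin a b <= t <= Rmax a b -> is_derive (fun t => p (f t)) t (p (f' t))) ->
  Rabs (p (f b - f a)%C) <= M * Rabs (b - a)).
{ intros p P1 P3 D. destruct (MVT_gen (fun t => p (f t)) a b (fun t => p (f' t))) as [c [Hc E]].
  - intros t Ht. apply D. lra.
  - intros t Ht. apply continuity_pt_filterlim, (ex_derive_continuous (V := R_NormedModule)).
    eexists; apply D; auto.
  - rewrite P1. cbv beta in E. rewrite E, Rabs_mult. apply Rmult_le_compat_r; [apply Rabs_pos|].
    eapply Rle_trans; [apply P3|apply H; auto]. }
eapply Rle_trans; [apply Cmod_le_ReIm|].
assert (A1 := G Re Re_minus Re_le_Cmod (fun t Ht => proj1 (cder_is_derive _ _ _ (proj1 (H t Ht))))).
assert (A2 := G Im Im_minus Im_le_Cmod (fun t Ht => proj2 (cder_is_derive _ _ _ (proj1 (H t Ht))))).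
lra.
Qed.

(* [F 0] with all its derivatives. *)
Definition chain (F : nat -> R -> C) (a b : R) : Prop :=
  forall k x, a <= x <= b -> cder (F k) x (F (S k) x).

Lemma chain_shift F a b : chain F a b -> chain (fun k => F (S k)) a b.
Proof. intros H k x Hx. apply H; auto. Qed.

Lemma chain_cont F a b k : chain F a b -> ccont_on (F k) a b.
Proof. intros H t Ht. exact (cder_cont _ _ _ (H k t Ht)). Qed.

Definition taylor (F : nat -> R -> C) (x t : R) (K : nat) : C :=
  csum (fun k => F k x * RtoC (t ^ k / INR (fact k)))%C K.

Lemma cder_pow_fact (k : nat) t : cder (fun t => RtoC (t ^ S k / INR (fact (S k)))) t (t ^ k / INR (fact k))%R.
Proof.
assert (F1 := INR_fact_neq_0 k). assert (F2 := INR_S_pos k).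
apply is_derive_cder; unfold Re, Im; simpl.
- change (fact k + k * fact k)%nat with (fact (S k)).
  apply (is_derive_ext (fun t => t ^ S k / INR (fact (S k)))); [intros; reflexivity|].
  auto_derive; auto. replace (fact k + k * fact k)%nat with (fact (S k)) by reflexivity.
  rewrite fact_simpl, mult_INR. change (match k with 0%nat => 1 | S _ => INR k + 1 end) with (INR (S k)).
  simpl pred. field. split; auto. lra.
- apply (is_derive_const (V := R_NormedModule)).
Qed.

Lemma cder_taylor F x t K : cder (fun t => taylor F x t (S K)) t (taylor (fun k => F (S k)) x t K).
Proof.
induction K.
- unfold taylor; simpl. apply (gder_ext _ _ (fun _ => F 0%nat x)); [intros; simpl; unfold Rdiv; rewrite Rinv_1, Rmult_1_l; ring|].
  apply gder_const.
- apply (gder_ext _ _ (fun t => taylor F x t (S K) + F (S K) x * RtoC (t ^ S K / INR (fact (S K))))%C); [reflexivity|].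
  eapply gder_eq; [apply gder_plus; [exact IHK|]|].
  + apply gder_mult; [apply gder_const|apply cder_pow_fact].
  + unfold taylor; cbn [csum]. cbv beta. ring.
Qed.

Lemma taylor_0 F x K : taylor F x 0 (S K) = F 0%nat x.
Proof.
unfold taylor. induction K.
- simpl. unfold Rdiv. rewrite Rinv_1, Rmult_1_l. ring.
- cbn [csum] in *. rewrite IHK. simpl. unfold Rdiv. rewrite !Rmult_0_l. ring.
Qed.

(** Each of the K integrations of the remainder costs the factor 2 of [cder_mvt], hence 2^K in place
    of 1/K!. The increment [t] may be negative, as the expansion at the right end of a cell
    requires. *)
Lemma taylor_bound K : forall F a b M x t, chain F a b -> (forall u, a <= u <= b -> Cmod (F K u) <= M) ->
  a <= x <= b -> a <= x + t <= b ->
  Cmod (F 0%nat (x + t)%R - taylor F x t K) <= 2 ^ K * M * Rabs t ^ K.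
Proof.
induction K; intros F a b M x t HF HM Hx Hxt.
- unfold taylor; simpl. replace (F 0%nat (x + t)%R - 0)%C with (F 0%nat (x + t)%R) by ring.
  rewrite !Rmult_1_l, Rmult_1_r. auto.
- set (phi := fun u => (F 0%nat (x + u)%R + -1 * taylor F x u (S K))%C).
  assert (E : (F 0%nat (x + t)%R - taylor F x t (S K) = phi t - phi 0)%C).
  { unfold phi. rewrite taylor_0, Rplus_0_r. ring. }
  rewrite E.
  eapply Rle_trans; [apply (cder_mvt phi (fun u => F 1%nat (x + u)%R + -1 * taylor (fun k => F (S k)) x u K)%C
     0 t (2 ^ K * M * Rabs t ^ K))|].
  + intros u Hu.
    assert (Hu2 : Rabs u <= Rabs t).
    { unfold Rmin, Rmax in Hu. destruct (Rle_dec 0 t);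
        [rewrite !Rabs_pos_eq by lra|rewrite !Rabs_left1 by lra]; lra. }
    assert (Hu3 : a <= x + u <= b).
    { unfold Rmin, Rmax in Hu. destruct (Rle_dec 0 t); lra. }
    split.
    * assert (D1 : cder (fun u => F 0%nat (x + u)%R) u (F 1%nat (x + u)%R)).
      { assert (D := HF 0%nat (x + u) Hu3).
        intros e He. destruct (D e He) as [d [Hd Hd2]]. exists d. split; auto.
        intros h Hh. replace (x + (u + h)) with (x + u + h) by ring. auto. }
      eapply gder_eq; [apply gder_plus; [exact D1|apply gder_mult; [apply gder_const|apply cder_taylor]]|].
      cbv beta. rewrite Cmult_0_l, Cplus_0_l. reflexivity.
    * replace (F 1%nat (x + u)%R + -1 * taylor (fun k => F (S k)) x u K)%C
        with (F 1%nat (x + u)%R - taylor (fun k => F (S k)) x u K)%C by ring.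
      assert (M0 : 0 <= M) by (eapply Rle_trans; [apply Cmod_ge_0|apply (HM x Hx)]).
      eapply Rle_trans; [apply (IHK (fun k => F (S k)) a b M x u (chain_shift _ _ _ HF)); auto|].
      apply Rmult_le_compat_l; [apply Rmult_le_pos; auto; apply pow_le; lra|].
      apply pow_incr. split; auto. apply Rabs_pos.
  + rewrite Rminus_0_r. simpl. right. ring.
Qed.

Definition rsumN (f : R -> C) (N : nat) : C := csum (fun j => f (INR (S j) / INR N)) N.

Lemma csum_plus f g M : csum (fun n => f n + g n)%C M = (csum f M + csum g M)%C.
Proof. induction M; simpl; [ring|rewrite IHM; ring]. Qed.

Lemma csum_swap (f : nat -> nat -> C) M K :
  csum (fun i => csum (fun j => f i j) K) M = csum (fun j => csum (fun i => f i j) M) K.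
Proof.
induction M; simpl.
- rewrite csum_0; auto.
- rewrite IHM, <- csum_plus. reflexivity.
Qed.

Lemma csum_shift f K : csum f (S K) = (f 0%nat + csum (fun k => f (S k)) K)%C.
Proof. induction K; [simpl; ring|]. cbn [csum] in *. rewrite IHK. ring. Qed.

(** The coefficients in F(x) - F(x - h) = sum over k of [emc k] h^(k+1) F^(k+1)(x). *)
Definition emc (k : nat) : R := - (-1) ^ S k / INR (fact (S k)).

(* Taylor expansion of the antiderivative [F 0] at the right end of each cell. *)
Lemma rsumN_identity F K : chain F 0 1 -> exists B, 0 <= B /\ forall N, (1 <= N)%nat ->
  Cmod (INR N * (F 0%nat 1 - F 0%nat 0)
    - csum (fun k => RtoC (emc k) * (RtoC (eps N) ^ k * rsumN (F (S k)) N))%C (S K))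
  <= B * eps N ^ K.
Proof.
intros HF.
destruct (ccont_bounded (F (S (S K))) 0 1 ltac:(lra) (chain_cont F 0 1 (S (S K)) HF)) as [M [M0 HM]].
exists (2 ^ S (S K) * M). split; [apply Rmult_le_pos; auto; apply pow_le; lra|].
intros N HN. assert (En := eps_bounds N HN). assert (EI := eps_INR N HN).
assert (NP : 1 <= INR N) by (apply (le_INR 1); auto).
set (e := eps N) in *.
assert (Tel : forall n, csum (fun j => F 0%nat (INR (S j) / INR N)%R - F 0%nat (INR j / INR N)%R)%C n
  = (F 0%nat (INR n / INR N)%R - F 0%nat 0)%C).
{ induction n.
  - simpl. unfold Rdiv. rewrite Rmult_0_l. ring.
  - cbn [csum]. rewrite IHn. ring. }
specialize (Tel N). replace (INR N / INR N) with 1 in Tel by (field; lra).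
rewrite <- Tel.
set (T := fun j k => (RtoC (emc k) * (RtoC e ^ S k * F (S k) (INR (S j) / INR N)%R))%C).
assert (Ek : csum (fun k => RtoC (emc k) * (RtoC e ^ k * rsumN (F (S k)) N))%C (S K)
  = (INR N * csum (fun j => csum (T j) (S K)) N)%C).
{ unfold T. rewrite csum_swap, <- csum_scal. apply csum_ext. intros k Hk.
  unfold rsumN. rewrite <- !csum_scal. apply csum_ext. intros j Hj.
  rewrite Cpow_S. transitivity ((RtoC e * RtoC (INR N)) * (RtoC (emc k) * (RtoC e ^ k * F (S k) (INR (S j) / INR N)%R)))%C.
  - rewrite <- RtoC_mult, EI. ring.
  - ring. }
rewrite Ek.
set (D := fun j => (F 0%nat (INR (S j) / INR N)%R - F 0%nat (INR j / INR N)%R - csum (T j) (S K))%C).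
replace (INR N * csum (fun j => F 0%nat (INR (S j) / INR N)%R - F 0%nat (INR j / INR N)%R)%C N
  - INR N * csum (fun j => csum (T j) (S K)) N)%C with (INR N * csum D N)%C.
2:{ unfold D. rewrite (csum_ext _ (fun j => (F 0%nat (INR (S j) / INR N)%R - F 0%nat (INR j / INR N)%R) + -1 * csum (T j) (S K))%C)
      by (intros; ring).
    rewrite csum_plus, csum_scal. ring. }
rewrite Cmod_mult, Cmod_R, Rabs_pos_eq by lra.
assert (Hcs : Cmod (csum D N) <= INR N * (2 ^ S (S K) * M * e ^ S (S K))).
{ apply Cmod_csum_le. intros j Hj. unfold D.
  set (x := INR (S j) / INR N).
  assert (Ex : x + - e = INR j / INR N).
  { unfold x, e. rewrite S_INR. field. lra. }
  assert (J0 := pos_INR j). assert (J1 : INR (S j) <= INR N) by (apply le_INR; lia).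
  assert (Hx : 0 <= x <= 1).
  { split; [apply Rdiv_le_0_compat; [apply pos_INR|lra]|].
    apply Rmult_le_reg_r with (INR N); [lra|]. unfold x, Rdiv. rewrite Rmult_assoc, Rinv_l; lra. }
  assert (Hx2 : 0 <= x + - e <= 1).
  { split; [rewrite Ex; apply Rdiv_le_0_compat; lra|lra]. }
  assert (B := taylor_bound (S (S K)) F 0 1 M x (- e) HF HM Hx Hx2).
  rewrite Rabs_Ropp, (Rabs_pos_eq e) in B by lra. rewrite Ex in B.
  rewrite <- Cmod_opp. eapply Rle_trans; [right|exact B]. f_equal.
  unfold taylor. rewrite (csum_shift (fun k => F k x * RtoC ((- e) ^ k / INR (fact k)))%C). cbv beta.
  replace ((- e) ^ 0 / INR (fact 0)) with 1 by (simpl; field).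
  assert (Es : csum (fun k => F (S k) x * RtoC ((- e) ^ S k / INR (fact (S k))))%C (S K) = (-1 * csum (T j) (S K))%C).
  { rewrite <- csum_scal. apply csum_ext. intros k Hk. unfold T, emc. fold x.
    rewrite <- RtoC_pow. transitivity (F (S k) x * (RtoC (-1) * RtoC (- (-1) ^ S k / INR (fact (S k))) * RtoC (e ^ S k)))%C; [|ring].
    rewrite <- !RtoC_mult. f_equal. f_equal.
    replace (- e) with (-1 * e) by ring. rewrite Rpow_mult_distr. unfold Rdiv. ring. }
  rewrite Es. ring. }
apply (Rmult_le_compat_l (INR N)) in Hcs; [|lra]. eapply Rle_trans; [exact Hcs|]. right.
transitivity (2 ^ S (S K) * M * e ^ K * ((e * INR N) * (e * INR N))); [simpl; ring|rewrite EI; ring].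
Qed.

Lemma emc_0 : emc 0 = 1.
Proof. unfold emc. simpl. field. Qed.

(** The error of the right-endpoint sum of F' against N times its integral; the family [F] has the
    antiderivative at index 0. *)
Definition em_rem (F : nat -> R -> C) (N : nat) : C :=
  (rsumN (F 1%nat) N - INR N * (F 0%nat 1 - F 0%nat 0))%C.

(** [rsumN_identity] solved for the sum of F': the sums of the higher derivatives carry extra powers
    of 1/N, and each is again an exact difference plus its own [em_rem]. This recursion stands in
    for the Bernoulli numbers. *)
Lemma em_rem_identity F K : chain F 0 1 -> exists B, 0 <= B /\ forall N, (1 <= N)%nat ->
  Cmod (em_rem F N - csum (fun k => RtoC (- emc (S k)) * (RtoC (eps N) ^ k * (F (S k) 1 - F (S k) 0)
     + RtoC (eps N) * (RtoC (eps N) ^ k * em_rem (fun i => F (S k + i)%nat) N)))%C K)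
  <= B * eps N ^ K.
Proof.
intros HF. destruct (rsumN_identity F K HF) as [B [HB H]]. exists B. split; auto.
intros N HN. specialize (H N HN). rewrite <- Cmod_opp. eapply Rle_trans; [right|exact H]. f_equal.
rewrite csum_shift. cbv beta. rewrite emc_0. unfold em_rem at 1.
assert (E : csum (fun k => RtoC (emc (S k)) * (RtoC (eps N) ^ S k * rsumN (F (S (S k))) N))%C K
 = (-1 * csum (fun k => RtoC (- emc (S k)) * (RtoC (eps N) ^ k * (F (S k) 1 - F (S k) 0)
     + RtoC (eps N) * (RtoC (eps N) ^ k * em_rem (fun i => F (S k + i)%nat) N)))%C K)%C).
{ rewrite <- csum_scal. apply csum_ext. intros k Hk. unfold em_rem.
  replace (S k + 1)%nat with (S (S k)) by lia. rewrite Nat.add_0_r.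
  rewrite RtoC_opp, Cpow_S.
  transitivity (RtoC (emc (S k)) * (RtoC (eps N) ^ k * (RtoC (eps N) * RtoC (INR N) * (F (S k) 1 - F (S k) 0)
     + RtoC (eps N) * (rsumN (F (S (S k))) N - INR N * (F (S k) 1 - F (S k) 0)))))%C; [ring|].
  rewrite <- RtoC_mult, eps_INR by auto. ring. }
rewrite E. simpl. ring.
Qed.

(** Induction on the order: every remainder on the right of [em_rem_identity] comes with a factor
    1/N, so expanding all of them to order L expands the left side to order L + 1. *)
Lemma em_aseq F : chain F 0 1 -> aseq (em_rem F).
Proof.
intros HF L. revert F HF. induction L; intros F HF.
- destruct (em_rem_identity F 0 HF) as [B [HB H]]. apply (aord_O B). intros N HN.
  specialize (H N HN). simpl csum in H. replace (em_rem F N - 0)%C with (em_rem F N) in H by ring. auto.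
- destruct (em_rem_identity F (S L) HF) as [B [HB H]].
  set (Sm := fun N => csum (fun k => RtoC (- emc (S k)) * (RtoC (eps N) ^ k * (F (S k) 1 - F (S k) 0)
     + RtoC (eps N) * (RtoC (eps N) ^ k * em_rem (fun i => F (S k + i)%nat) N)))%C (S L)) in *.
  apply (aord_ext _ (fun N => (em_rem F N - Sm N) + Sm N)%C); [intros; ring|].
  apply aord_plus; [apply (aord_O B); auto|].
  assert (Pw : forall k L, aord L (fun N => RtoC (eps N) ^ k)%C).
  { intros k L'. apply isP_aord. induction k; [exact (isP_const 1%C)|].
    apply (isP_ext (fun N => RtoC (eps N) * RtoC (eps N) ^ k)%C); [apply isP_eps; auto|reflexivity]. }
  apply aord_csum. intros k Hk. apply aord_mult; [apply aord_const|]. apply aord_plus.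
  + apply aord_mult; [apply Pw|apply aord_const].
  + apply aord_eps, aord_mult; [apply Pw|]. apply IHL. intros j x Hx.
    replace (S k + S j)%nat with (S (S k + j)) by lia. apply HF; auto.
Qed.

(** Only the first correction, (F'(1) - F'(0)) / 2, is made explicit; it enters the leading constant
    of the expansion. *)
Lemma em_rem_limit F : chain F 0 1 -> exists B, 0 <= B /\ forall N, (1 <= N)%nat ->
  Cmod (em_rem F N - / 2 * (F 1%nat 1 - F 1%nat 0)) <= B * eps N.
Proof.
intros HF. destruct (em_rem_identity F 1 HF) as [B [HB H]].
assert (HF1 : chain (fun i => F (1 + i)%nat) 0 1) by exact (chain_shift F 0 1 HF).
destruct (em_rem_identity _ 0 HF1) as [D [HD H1]].
exists (B + D). split; [lra|]. intros N HN. specialize (H N HN). specialize (H1 N HN).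
assert (T := eps_bounds N HN).
cbn [csum] in H, H1. rewrite pow_1 in H. simpl pow in H1.
set (r := em_rem (fun i => F (1 + i)%nat) N) in *.
replace (r - 0)%C with r in H1 by ring.
assert (E1 : - emc 1 = / 2) by (unfold emc; simpl; field). rewrite E1 in H.
replace (em_rem F N - / 2 * (F 1%nat 1 - F 1%nat 0))%C with
 ((em_rem F N - (0 + RtoC (/ 2) * (RtoC (eps N) ^ 0 * (F 1%nat 1 - F 1%nat 0) + RtoC (eps N) * (RtoC (eps N) ^ 0 * r))))
   + RtoC (/ 2) * (RtoC (eps N) * r))%C.
2:{ rewrite (RtoC_inv 2) by lra. simpl. ring. }
eapply Rle_trans; [apply Cmod_triangle|]. rewrite !Cmod_mult, !Cmod_R.
rewrite (Rabs_pos_eq (/ 2)), (Rabs_pos_eq (eps N)) by lra. nra.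
Qed.

Lemma small_eps (B c : R) : (forall N, (1 <= N)%nat -> c <= B * eps N) -> c <= 0.
Proof.
intros H. apply le_epsilon. intros e He. rewrite Rplus_0_l.
destruct (nfloor_ex (Rabs B / e)) as [k [_ Hk]].
{ apply Rdiv_le_0_compat; [apply Rabs_pos|auto]. }
eapply Rle_trans; [apply (H (S k)); lia|].
assert (P := INR_S_pos k). rewrite <- S_INR in Hk.
apply Rmult_le_reg_r with (INR (S k)); auto. rewrite Rmult_assoc, Rinv_l, Rmult_1_r by lra.
apply Rle_trans with (Rabs B); [apply Rle_abs|].
apply (Rmult_lt_compat_r e) in Hk; auto. unfold Rdiv in Hk.
rewrite Rmult_assoc, Rinv_l in Hk by lra. lra.
Qed.

Definition epoly (d : nat -> C) (N r : nat) : C := csum (fun i => d i * RtoC (eps N) ^ i)%C r.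

Lemma epoly_S d N r : epoly d N (S r) = (d 0%nat + RtoC (eps N) * epoly (fun i => d (S i)) N r)%C.
Proof.
unfold epoly. rewrite csum_shift, <- csum_scal. f_equal; [simpl; ring|].
apply csum_ext. intros n _. rewrite Cpow_S. ring.
Qed.

Lemma epoly_bounded d r : exists B, 0 <= B /\ forall N, (1 <= N)%nat -> Cmod (epoly d N r) <= B.
Proof.
revert d. induction r; intros d.
- exists 0. split; [lra|]. intros. unfold epoly; simpl. rewrite Cmod_0. lra.
- destruct (IHr (fun i => d (S i))) as [B [HB H]]. exists (Cmod (d 0%nat) + B).
  split; [assert (T := Cmod_ge_0 (d 0%nat)); lra|]. intros N HN. rewrite epoly_S.
  eapply Rle_trans; [apply Cmod_triangle|]. rewrite Cmod_mult, Cmod_R.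
  assert (T := eps_bounds N HN). rewrite Rabs_pos_eq by lra. specialize (H N HN).
  assert (Q := Cmod_ge_0 (epoly (fun i => d (S i)) N r)). nra.
Qed.

(** Uniqueness of asymptotic coefficients: letting N grow shows [d 0] = 0, and cancelling a factor
    1/N leaves the shifted polynomial. *)
Lemma epoly_small_0 r : forall d B, (forall N, (1 <= N)%nat -> Cmod (epoly d N r) <= B * eps N ^ r) ->
  forall i, (i < r)%nat -> d i = 0%C.
Proof.
induction r; intros d B H i Hi; [lia|].
destruct (epoly_bounded (fun i => d (S i)) r) as [D [HD HE]].
assert (D0 : d 0%nat = 0%C).
{ apply Cmod_eq_0. apply Rle_antisym; [|apply Cmod_ge_0]. apply (small_eps (Rabs B + D)).
  intros N HN. specialize (H N HN). rewrite epoly_S in H.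
  assert (T := eps_bounds N HN). specialize (HE N HN).
  assert (X := Cmod_triangle (d 0%nat + RtoC (eps N) * epoly (fun i => d (S i)) N r)
     (- (RtoC (eps N) * epoly (fun i => d (S i)) N r))).
  replace (d 0%nat + RtoC (eps N) * epoly (fun i => d (S i)) N r + - (RtoC (eps N) * epoly (fun i => d (S i)) N r))%C
    with (d 0%nat) in X by ring.
  rewrite Cmod_opp, Cmod_mult, Cmod_R, Rabs_pos_eq in X by lra.
  assert (Y : B * eps N ^ S r <= Rabs B * eps N).
  { apply Rle_trans with (Rabs B * eps N ^ S r).
    - apply Rmult_le_compat_r; [left; apply eps_pow_pos; auto|apply Rle_abs].
    - apply Rmult_le_compat_l; [apply Rabs_pos|]. simpl. assert (E := eps_pow_pos N r HN). nra. }
  nra. }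
destruct i; [exact D0|]. apply (IHr (fun i => d (S i)) B); [|lia].
intros N HN. specialize (H N HN). rewrite epoly_S, D0, Cplus_0_l, Cmod_mult, Cmod_R in H.
assert (T := eps_bounds N HN). rewrite Rabs_pos_eq in H by lra. simpl in H.
apply Rmult_le_reg_l with (eps N); lra.
Qed.

Lemma epoly_truncate d K r : exists B, 0 <= B /\ forall N, (1 <= N)%nat ->
  Cmod (epoly d N K - epoly (fun i => if (i <? K)%nat then d i else RtoC 0) N r) <= B * eps N ^ r.
Proof.
revert d K. induction r; intros d K.
- destruct (epoly_bounded d K) as [B [HB H]]. exists B. split; auto. intros N HN.
  unfold epoly at 2. simpl. replace (epoly d N K - 0)%C with (epoly d N K) by ring.
  rewrite Rmult_1_r. auto.
- destruct K.
  + exists 0. split; [lra|]. intros N HN.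
    unfold epoly. rewrite (csum_0 (fun i => ((if (i <? 0)%nat then d i else RtoC 0) * RtoC (eps N) ^ i)%C)).
    * simpl. replace (0 - 0)%C with (RtoC 0) by ring. rewrite Cmod_0. lra.
    * intros n _. simpl. ring.
  + destruct (IHr (fun i => d (S i)) K) as [B [HB H]]. exists B. split; auto. intros N HN.
    rewrite !epoly_S. simpl (if (0 <? S K)%nat then _ else _).
    change (epoly (fun i => if (S i <? S K)%nat then d (S i) else RtoC 0) N r)
      with (epoly (fun i => if (i <? K)%nat then d (S i) else RtoC 0) N r).
    replace (d 0%nat + eps N * epoly (fun i => d (S i)) N K -
       (d 0%nat + eps N * epoly (fun i => if (i <? K)%nat then d (S i) else RtoC 0) N r))%C
      with (RtoC (eps N) * (epoly (fun i => d (S i)) N K - epoly (fun i => if (i <? K)%nat then d (S i) else RtoC 0) N r))%C by ring.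
    rewrite Cmod_mult, Cmod_R. assert (T := eps_bounds N HN). rewrite Rabs_pos_eq by lra.
    specialize (H N HN). simpl. nra.
Qed.

(** [aseq] provides a separate polynomial for each order. Choose one for each r; by uniqueness their
    coefficients agree on the common range, so the diagonal sequence [D (S i) i] serves all orders
    at once. *)
Lemma aseq_coeffs u : aseq u -> exists c : nat -> C, forall r, exists B, 0 <= B /\
  forall N, (1 <= N)%nat -> Cmod (u N - epoly c N r) <= B * eps N ^ r.
Proof.
intros H.
assert (H1 : forall r, exists d : nat -> C, exists B, 0 <= B /\
   forall N, (1 <= N)%nat -> Cmod (u N - epoly d N r) <= B * eps N ^ r).
{ intros r. destruct (H r) as [P [HP [B [HB HE]]]]. destruct (isP_coeffs P HP) as [d [K Hd]].
  destruct (epoly_truncate d K r) as [D [HD HT]].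
  eexists. exists (B + D). split; [lra|]. intros N HN. specialize (HE N HN). specialize (HT N HN).
  rewrite Hd in HE. fold (epoly d N K) in HE.
  match goal with |- Cmod (?a - ?b) <= _ => replace (a - b)%C with ((a - epoly d N K) + (epoly d N K - b))%C by ring end.
  eapply Rle_trans; [apply Cmod_triangle|]. rewrite Rmult_plus_distr_r. apply Rplus_le_compat; eassumption. }
set (D := fun r => proj1_sig (constructive_indefinite_description _ (H1 r))).
assert (HD : forall r, exists B, 0 <= B /\
   forall N, (1 <= N)%nat -> Cmod (u N - epoly (D r) N r) <= B * eps N ^ r)
  by (intros r; exact (proj2_sig (constructive_indefinite_description _ (H1 r)))).
exists (fun i => D (S i) i).
assert (Trunc : forall r k, (k <= r)%nat -> exists B, 0 <= B /\
   forall N, (1 <= N)%nat -> Cmod (u N - epoly (D r) N k) <= B * eps N ^ k).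
{ intros r k Hk.
  destruct (HD r) as [B [HB HE]].
  destruct (epoly_truncate (D r) r k) as [B2 [HB2 HT]].
  exists (B + B2). split; [lra|]. intros N HN. specialize (HE N HN). specialize (HT N HN).
  replace (epoly (D r) N k) with (epoly (fun i => if (i <? r)%nat then D r i else RtoC 0) N k).
  2:{ apply csum_ext. intros n Hn.
      replace (n <? r)%nat with true by (symmetry; apply Nat.ltb_lt; lia). auto. }
  match goal with |- Cmod (?a - ?b) <= _ => replace (a - b)%C with ((a - epoly (D r) N r) + (epoly (D r) N r - b))%C by ring end.
  eapply Rle_trans; [apply Cmod_triangle|]. rewrite Rmult_plus_distr_r. apply Rplus_le_compat; [|exact HT].
  eapply Rle_trans; [exact HE|]. apply Rmult_le_compat_l; auto.
  replace r with (k + (r - k))%nat by lia. rewrite pow_add.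
  assert (T1 := eps_pow_pos N k HN). assert (T2 := eps_pow_pos N (r - k) HN). nra. }
intros r. destruct (HD r) as [B [HB HE]]. exists B. split; auto. intros N HN.
replace (epoly (fun i => D (S i) i) N r) with (epoly (D r) N r); auto.
apply csum_ext. intros i Hi. f_equal.
destruct (Trunc r (S i) ltac:(lia)) as [B1 [HB1 HE1]]. destruct (HD (S i)) as [B2 [HB2 HE2]].
apply Ceq_minus. apply (epoly_small_0 (S i) (fun j => D r j - D (S i) j)%C (B1 + B2)); [|lia].
intros M HM. specialize (HE1 M HM). specialize (HE2 M HM).
replace (epoly (fun j => D r j - D (S i) j)%C M (S i))
  with (- (u M - epoly (D r) M (S i)) + (u M - epoly (D (S i)) M (S i)))%C.
2:{ unfold epoly. rewrite (csum_ext (fun i0 => (D r i0 - D (S i) i0) * RtoC (eps M) ^ i0)%C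
      (fun i0 => D r i0 * RtoC (eps M) ^ i0 + -1 * (D (S i) i0 * RtoC (eps M) ^ i0))%C) by (intros; ring).
    rewrite csum_plus, csum_scal. ring. }
eapply Rle_trans; [apply Cmod_triangle|]. rewrite Cmod_opp. lra.
Qed.

Lemma coeff_0_limit u (c : nat -> C) (l : C) (B B' : R) :
  (forall N, (1 <= N)%nat -> Cmod (u N - epoly c N 1) <= B * eps N ^ 1) ->
  (forall N, (1 <= N)%nat -> Cmod (u N - l) <= B' * eps N) -> c 0%nat = l.
Proof.
intros H1 H2. apply Ceq_minus.
refine (epoly_small_0 1 (fun _ => c 0%nat - l)%C (B + B') _ 0%nat ltac:(lia)). intros N HN.
specialize (H1 N HN). specialize (H2 N HN). unfold epoly in *; simpl in *.
match goal with |- Cmod ?z <= _ => replace z with (- (u N - (0 + c 0%nat * 1)) + (u N - l))%C by ring end.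
eapply Rle_trans; [apply Cmod_triangle|]. rewrite Cmod_opp. lra.
Qed.

(** * Stirling's expansion *)

(** log (1 + x) stands at index 1 and its antiderivative at index 0, as [em_rem] expects. *)
Definition log_chain (k : nat) (x : R) : C :=
  match k with
  | O => RtoC ((1 + x) * ln (1 + x) - x)
  | S O => RtoC (ln (1 + x))
  | S (S j) => RtoC ((-1) ^ j * INR (fact j) * (/ (1 + x)) ^ S j)
  end.

Lemma cder_real (f : R -> R) x l : is_derive f x l -> cder (fun t => RtoC (f t)) x l.
Proof.
intros H. apply is_derive_cder; unfold Re, Im; simpl; auto.
apply (is_derive_const (V := R_NormedModule)).
Qed.

Lemma log_chain_deriv k x : -1 < x -> cder (log_chain k) x (log_chain (S k) x).
Proof.
intros Hx. destruct k as [|[|j]].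
- apply (cder_real (fun x => (1 + x) * ln (1 + x) - x)). auto_derive; [lra|]. field. lra.
- apply (cder_real (fun x => ln (1 + x))). auto_derive; [lra|]. simpl. field. lra.
- apply (cder_real (fun x => (-1) ^ j * INR (fact j) * (/ (1 + x)) ^ S j)).
  evar_last.
  + apply (is_derive_scal (fun x => (/ (1 + x)) ^ S j)). apply is_derive_pow.
    apply (is_derive_inv (fun x => 1 + x)); [|lra]. auto_derive; [auto|reflexivity].
  + rewrite fact_simpl, mult_INR. unfold scal; simpl; unfold mult; simpl.
    change (match j with 0%nat => 1 | S _ => INR j + 1 end) with (INR (S j)). field. lra.
Qed.

Lemma log_chain_chain b : chain log_chain 0 b.
Proof. intros k x Hx. apply log_chain_deriv. lra. Qed.

(** What remains of log N! after N log N - N + (log N)/2; the limit will be log sqrt (2 pi). *)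
Definition stir (N : nat) : R := ln (INR (fact N)) - INR N * ln (INR N) + INR N - / 2 * ln (INR N).

Lemma ln_fact_add N n : (1 <= N)%nat ->
  ln (INR (fact (N + n))) = ln (INR (fact N)) + rsum (fun j => ln (INR N + INR (S j))) n.
Proof.
intros HN. induction n.
- rewrite Nat.add_0_r. simpl. lra.
- replace (N + S n)%nat with (S (N + n)) by lia. rewrite fact_simpl, mult_INR, ln_mult.
  + rewrite IHn. cbn [rsum]. rewrite !S_INR, plus_INR.
    replace (INR N + (INR n + 1)) with (INR N + INR n + 1) by ring. ring.
  + apply INR_S_pos.
  + apply INR_fact_lt_0.
Qed.

Lemma csum_RtoC (f : nat -> R) n : csum (fun j => RtoC (f j)) n = RtoC (rsum f n).
Proof. induction n; simpl; auto. now rewrite IHn, RtoC_plus. Qed.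

(* Euler-Maclaurin on [ln (1 + x)] compares [ln (2N)!] with [ln N!], which avoids the singularity of [ln] at [0]. *)
Lemma stir_double N : (1 <= N)%nat -> RtoC (stir (2 * N) - stir N) = (em_rem log_chain N - RtoC (/ 2 * ln 2))%C.
Proof.
intros HN. assert (NP : 1 <= INR N) by (apply (le_INR 1); auto).
unfold em_rem, rsumN, log_chain. rewrite csum_RtoC.
rewrite <- RtoC_minus, <- RtoC_mult, <- !RtoC_minus. f_equal.
unfold stir. replace (2 * N)%nat with (N + N)%nat by lia.
rewrite ln_fact_add, plus_INR by auto.
replace (INR N + INR N) with (2 * INR N) by ring. rewrite ln_mult by lra.
assert (E : rsum (fun j => ln (INR N + INR (S j))) N = INR N * ln (INR N) + rsum (fun j => ln (1 + INR (S j) / INR N)) N).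
{ assert (G : forall n, rsum (fun j => ln (INR N + INR (S j))) n = INR n * ln (INR N) + rsum (fun j => ln (1 + INR (S j) / INR N)) n).
  { induction n; [simpl; ring|]. cbn [rsum]. rewrite IHn, (S_INR n).
    assert (P := INR_S_pos n). rewrite <- S_INR.
    replace (INR N + INR (S n)) with (INR N * (1 + INR (S n) / INR N)) by (field; lra).
    assert (0 < INR (S n) / INR N) by (apply Rdiv_lt_0_compat; lra).
    rewrite ln_mult by lra. rewrite (S_INR n). ring. }
  apply G. }
rewrite E. rewrite Rplus_0_r, ln_1. replace (1 + 1) with 2 by ring. field.
Qed.

(** The term (log N)/2 is such that (N + 1/2) log (1 + 1/N) = 1 + O(1/N^2), so the increments are
    summable. The Taylor remainder of order 3 gives the constant 1/4 + 16 + 8, rounded up to 25. *)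
Lemma stir_step N : (1 <= N)%nat -> Rabs (stir (S N) - stir N) <= 25 * eps N ^ 2.
Proof.
intros HN. assert (NP : 1 <= INR N) by (apply (le_INR 1); auto).
assert (T := eps_bounds N HN). assert (EI := eps_INR N HN).
set (e := eps N) in *.
assert (E : stir (S N) - stir N = 1 - (INR N + / 2) * ln (1 + e)).
{ unfold stir. rewrite fact_simpl, mult_INR, ln_mult; [|apply INR_S_pos|apply INR_fact_lt_0].
  rewrite S_INR. replace (INR N + 1) with (INR N * (1 + e)) by (rewrite Rmult_plus_distr_l, (Rmult_comm _ e), EI; ring).
  rewrite ln_mult by lra. 
  replace (INR N * (1 + e)) with (INR N + e * INR N) by ring. rewrite EI. field. }
rewrite E.
assert (B := taylor_bound 3 (fun k => log_chain (S k)) 0 e 2 0 e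
   (fun k x Hx => log_chain_chain e (S k) x Hx)).
assert (B' : Cmod (log_chain 1 (0 + e) - taylor (fun k => log_chain (S k)) 0 e 3) <= 2 ^ 3 * 2 * Rabs e ^ 3).
{ apply B; try lra. intros u Hu. simpl. rewrite Cmod_R.
  assert (I : 0 < / (1 + u) <= 1).
  { split; [apply Rinv_0_lt_compat; lra|]. rewrite <- Rinv_1. apply Rinv_le_contravar; lra. }
  set (v := / (1 + u)) in *. assert (v * (v * (v * 1)) <= 1) by nra. assert (0 <= v * (v * (v * 1))) by nra.
  rewrite Rabs_pos_eq; lra. }

assert (E2 : (log_chain 1 (0 + e) - taylor (fun k => log_chain (S k)) 0 e 3)%C = RtoC (ln (1 + e) - (e - e ^ 2 / 2))).
{ unfold taylor, log_chain; simpl. rewrite Rplus_0_l, Rplus_0_r, ln_1, Rinv_1.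
  rewrite <- !RtoC_mult, <- !RtoC_plus, <- RtoC_minus. f_equal. field. }
rewrite E2, Cmod_R, (Rabs_pos_eq e) in B' by lra.
set (rho := ln (1 + e) - (e - e ^ 2 / 2)) in *.
replace (1 - (INR N + / 2) * ln (1 + e)) with (e ^ 2 / 4 - (INR N + / 2) * rho).
2:{ replace (ln (1 + e)) with (rho + (e - e ^ 2 / 2)) by (unfold rho; ring).
    transitivity (e ^ 2 / 4 - (INR N + / 2) * rho + (1 - e * INR N) * (1 - e / 2)); [rewrite EI; ring|field]. }
eapply Rle_trans; [apply Rabs_triang|]. rewrite Rabs_Ropp, Rabs_mult, !Rabs_pos_eq by nra.
assert (X : (INR N + / 2) * Rabs rho <= (INR N + / 2) * (2 ^ 3 * 2 * e ^ 3)) by (apply Rmult_le_compat_l; lra).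
replace ((INR N + / 2) * (2 ^ 3 * 2 * e ^ 3)) with (16 * e ^ 2 * (e * INR N) + 8 * e ^ 3) in X by field.
rewrite EI in X. assert (0 <= e ^ 2) by nra. assert (e ^ 3 <= e ^ 2) by (simpl; nra). lra.
Qed.

(** Since 1/N^2 <= 2 (1/N - 1/(N+1)), the sequence stir N + 50/N decreases and stir N - 50/N
    increases; the supremum of the latter is the limit, with the stated error. *)
Lemma stir_limit : exists Tinf : R, forall N, (1 <= N)%nat -> Rabs (stir N - Tinf) <= 50 * eps N.
Proof.
set (U := fun n => stir (S n) + 50 * eps (S n)). set (V := fun n => stir (S n) - 50 * eps (S n)).
assert (Step : forall n, U (S n) <= U n /\ V n <= V (S n)).
{ intros n. assert (H := stir_step (S n) ltac:(lia)). apply Rabs_le_between in H.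
  assert (P := INR_S_pos n).
  assert (I : eps (S n) ^ 2 <= 2 * (eps (S n) - eps (S (S n)))).
  { rewrite (S_INR (S n)). assert (1 <= INR (S n)) by apply INR_S_ge_1.
    set (x := INR (S n)) in *. replace (2 * (/ x - / (x + 1))) with (2 / (x * (x + 1))) by (field; lra).
    rewrite pow_inv. replace (/ x ^ 2) with (2 / (x * (2 * x))) by (field; lra).
    apply Rmult_le_compat_l; [lra|]. apply Rinv_le_contravar; nra. }
  unfold U, V. lra. }
assert (UV : forall n, V n <= U n).
{ intros n. unfold U, V. assert (T := inv_INR_le_1 n). lra. }
assert (Vm : forall n k, V n <= V (n + k)%nat).
{ intros n k. induction k; [rewrite Nat.add_0_r; lra|]. rewrite Nat.add_succ_r.
  assert (T := proj2 (Step (n + k)%nat)). lra. }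
assert (Um : forall n k, U (n + k)%nat <= U n).
{ intros n k. induction k; [rewrite Nat.add_0_r; lra|]. rewrite Nat.add_succ_r.
  assert (T := proj1 (Step (n + k)%nat)). lra. }
assert (VU : forall n m, V n <= U m).
{ intros n m. eapply Rle_trans; [apply (Vm n m)|]. eapply Rle_trans; [apply UV|].
  rewrite Nat.add_comm. apply Um. }
destruct (completeness (fun x => exists n, x = V n)) as [l [L1 L2]].
- exists (U 0%nat). intros x [n ->]. apply VU.
- exists (V 0%nat), 0%nat. auto.
- exists l. intros N HN. destruct N; [lia|].
  assert (A : V N <= l) by (apply L1; exists N; auto).
  assert (B : l <= U N) by (apply L2; intros x [n ->]; apply VU).
  unfold U, V in *. apply Rabs_le. lra.
Qed.

Lemma eps_double N k : (1 <= N)%nat -> eps (2 ^ k * N) = (/ 2) ^ k * eps N.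
Proof. intros HN. rewrite mult_INR, pow_INR, Rinv_mult, pow_inv. simpl. reflexivity. Qed.

(** In an expansion T + sum of t_i N^(-i), doubling N multiplies the i-th term by 2^(-i); so t_i =
    c_i / (2^(-i) - 1), with c_i the coefficients of stir (2 N) - stir N, and convergence of [stir]
    gives c_0 = 0. The error W then satisfies W(2 N) - W(N) = O(N^(-L-1)) and tends to 0, so summing
    over the doublings of N bounds W(N). *)
Lemma stir_aseq : aseq (fun N => RtoC (stir N)).
Proof.
destruct stir_limit as [Tinf HT].
assert (Hd : aseq (fun N => RtoC (stir (2 * N) - stir N))).
{ intros L. apply (aord_ext L (fun N => em_rem log_chain N + - RtoC (/ 2 * ln 2))%C).
  - intros N HN. rewrite stir_double by auto. ring.
  - apply aord_plus; [apply em_aseq, log_chain_chain|apply aord_const]. }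
destruct (aseq_coeffs _ Hd) as [c Hc].
assert (c0 : c 0%nat = 0%C).
{ destruct (Hc 1%nat) as [B [HB H1]].
  apply (coeff_0_limit _ c 0 B 100 H1). intros N HN.
  assert (A1 := HT N HN). assert (A2 := HT (2 * N)%nat ltac:(lia)).
  rewrite <- RtoC_minus, Cmod_R, Rminus_0_r.
  assert (E := eps_double N 1 HN). change (2 ^ 1 * N)%nat with (2 * N)%nat in E.
  rewrite E in A2. assert (T := eps_bounds N HN).
  apply Rabs_le_between in A1. apply Rabs_le_between in A2. apply Rabs_le. lra. }
intros L. destruct (Hc (S L)) as [B [HB HE]].
set (t := fun i => (c i * / RtoC ((/ 2) ^ i - 1))%C).
exists (fun N => RtoC Tinf + epoly (fun i => if Nat.eqb i 0 then 0 else t i) N (S L))%C. split.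
{ apply isP_plus; [apply isP_const|]. unfold epoly. generalize (S L) as K. intros K.
  induction K; [exact (isP_const 0%C)|]. cbn [csum]. apply isP_plus; [exact IHK|].
  apply isP_scal. clear. induction K; [exact (isP_const 1%C)|].
  apply (isP_ext (fun N => RtoC (eps N) * RtoC (eps N) ^ K)%C); [apply isP_eps; auto|reflexivity]. }
exists (2 * B). split; [lra|]. intros N HN.
set (p := fun N => epoly (fun i => if Nat.eqb i 0 then RtoC 0 else t i) N (S L)).
set (W := fun N => (RtoC (stir N) - (RtoC Tinf + p N))%C).
change (Cmod (W N) <= 2 * B * eps N ^ L).
assert (Wd : forall M, (1 <= M)%nat -> Cmod (W (2 * M)%nat - W M) <= B * eps M ^ S L).
{ intros M HM. specialize (HE M HM). eapply Rle_trans; [right|exact HE]. f_equal.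
  unfold W. assert (Ep : (p (2 * M)%nat - p M)%C = epoly c M (S L)).
  { unfold p, epoly.
    replace (csum (fun i => (if Nat.eqb i 0 then RtoC 0 else t i) * RtoC (eps (2 * M)) ^ i)%C (S L)
       - csum (fun i => (if Nat.eqb i 0 then RtoC 0 else t i) * RtoC (eps M) ^ i)%C (S L))%C
     with (csum (fun i => (if Nat.eqb i 0 then RtoC 0 else t i) * RtoC (eps (2 * M)) ^ i
       + -1 * ((if Nat.eqb i 0 then RtoC 0 else t i) * RtoC (eps M) ^ i))%C (S L))
     by (rewrite csum_plus, csum_scal; ring).
    apply csum_ext. intros i _.
    assert (E := eps_double M 1 HM). change (2 ^ 1 * M)%nat with (2 * M)%nat in E. rewrite pow_1 in E.
    rewrite E, RtoC_mult, Cpow_mult_l, <- (RtoC_pow (/ 2)).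
    destruct i; [simpl; rewrite c0; ring|]. simpl Nat.eqb. cbv iota. unfold t.
    assert (Nz : RtoC ((/ 2) ^ S i - 1) <> 0%C).
    { intros X. apply RtoC_inj in X.
      assert ((/ 2) ^ i <= 1) by (rewrite <- (pow1 i); apply pow_incr; lra).
      assert (0 <= (/ 2) ^ i) by (apply pow_le; lra). simpl in X. lra. }
    rewrite RtoC_minus in *. field. auto. }
  rewrite <- Ep, RtoC_minus. ring. }
assert (Wk : forall k, Cmod (W N) <= Cmod (W (2 ^ k * N)%nat) + 2 * B * eps N ^ L * (1 - (/ 2) ^ k)).
{ induction k.
  - simpl (2 ^ 0)%nat. rewrite Nat.mul_1_l. simpl. lra.
  - eapply Rle_trans; [exact IHk|].
    assert (Hk : (1 <= 2 ^ k * N)%nat) by (assert (2 ^ k <> 0)%nat by (apply Nat.pow_nonzero; lia); nia).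
    assert (A := Wd _ Hk). replace (2 * (2 ^ k * N))%nat with (2 ^ S k * N)%nat in A by (simpl; lia).
    assert (X := Cmod_triangle_inv (W (2 ^ k * N)%nat) (W (2 ^ S k * N)%nat)).
    rewrite Cmod_minus_sym in X.
    assert (Y : eps (2 ^ k * N) ^ S L <= (/ 2) ^ k * eps N ^ L).
    { rewrite eps_double by auto. simpl. rewrite Rpow_mult_distr.
      assert (T := eps_bounds N HN). assert (T2 := eps_pow_pos N L HN).
      assert (T3 : 0 <= (/ 2) ^ k) by (apply pow_le; lra).
      assert (T4 : 0 <= ((/ 2) ^ k) ^ L <= 1).
      { split; [apply pow_le; auto|]. rewrite <- (pow1 L). apply pow_incr. split; auto.
        rewrite <- (pow1 k). apply pow_incr; lra. }
      assert (0 <= ((/ 2) ^ k) ^ L * eps N ^ L <= eps N ^ L) by nra.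
      assert (0 <= (/ 2) ^ k * eps N <= (/ 2) ^ k) by nra. nra. }
    apply (Rmult_le_compat_l B) in Y; auto.
    change ((/ 2) ^ S k) with (/ 2 * (/ 2) ^ k). rewrite (Cmod_minus_sym (W (2 ^ S k * N)%nat)) in A.
    rewrite (Cmod_minus_sym (W (2 ^ S k * N)%nat)) in X. lra. }
apply le_epsilon. intros e He.
destruct (epoly_bounded (fun i => t (S i)) L) as [D [HD HpD]].
assert (Wsm : forall M, (1 <= M)%nat -> Cmod (W M) <= (50 + D) * eps M).
{ intros M HM. unfold W, p. rewrite epoly_S. simpl Nat.eqb. cbv iota.
  assert (A := HT M HM). specialize (HpD M HM). assert (T := eps_bounds M HM).
  match goal with |- Cmod ?z <= _ => replace z
    with (RtoC (stir M - Tinf) + - (RtoC (eps M) * epoly (fun i => t (S i)) M L))%C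
    by (rewrite RtoC_minus; ring) end.
  eapply Rle_trans; [apply Cmod_triangle|]. rewrite Cmod_opp, Cmod_mult, !Cmod_R, (Rabs_pos_eq (eps M)) by lra.
  nra. }
assert (Pw := eps_pow_pos N L HN).
destruct (nfloor_ex ((50 + D) / e)) as [k [_ Hk]]; [apply Rdiv_le_0_compat; lra|].
eapply Rle_trans; [apply (Wk (S k))|].
assert (Hn : (1 <= 2 ^ S k * N)%nat) by (assert (2 ^ S k <> 0)%nat by (apply Nat.pow_nonzero; lia); nia).
assert (A := Wsm _ Hn).
assert (T3 : 0 <= (/ 2) ^ S k) by (apply pow_le; lra).
assert (HS : (50 + D) * eps (2 ^ S k * N) <= e).
{ assert (Hi : INR (S k) <= INR (2 ^ S k * N)).
  { apply le_INR. assert (S k < 2 ^ S k)%nat by (apply Nat.pow_gt_lin_r; lia). nia. }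
  assert (Ps := INR_S_pos k). rewrite <- S_INR in Hk.
  assert (eps (2 ^ S k * N) <= eps (S k)) by (apply Rinv_le_contravar; lra).
  apply Rle_trans with ((50 + D) * eps (S k)); [apply Rmult_le_compat_l; lra|].
  apply Rmult_le_reg_r with (INR (S k)); auto. rewrite Rmult_assoc, Rinv_l, Rmult_1_r by lra.
  apply (Rmult_lt_compat_r e) in Hk; auto. unfold Rdiv in Hk. rewrite Rmult_assoc, Rinv_l in Hk; lra. }
assert (0 <= 2 * B * eps N ^ L) by (apply Rmult_le_pos; lra). nra.
Qed.

(** * Expansions near the saddle point *)

Notation qv N s := (INR N * s ^ 2).

(* Polynomials in [1/N], [s] and [N s^2]: the saddle scaling is [s ~ N^(-1/2)], so these monomials
   have orders 2, 1 and 0 in [N^(-1/2)]. *)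
Inductive isQ : (nat -> R -> C) -> Prop :=
| isQ_const (c : C) : isQ (fun _ _ => c)
| isQ_eps F : isQ F -> isQ (fun N s => RtoC (eps N) * F N s)%C
| isQ_s F : isQ F -> isQ (fun N s => RtoC s * F N s)%C
| isQ_q F : isQ F -> isQ (fun N s => RtoC (qv N s) * F N s)%C
| isQ_plus F G : isQ F -> isQ G -> isQ (fun N s => F N s + G N s)%C
| isQ_ext F G : isQ F -> (forall N s, F N s = G N s) -> isQ G.

Lemma isQ_scal (c : C) F : isQ F -> isQ (fun N s => c * F N s)%C.
Proof.
induction 1 as [c'|F HF IH|F HF IH|F HF IH|F G HF IHF HG IHG|F G HF IHF E].
- exact (isQ_const (c * c')%C).
- apply (isQ_ext (fun N s => RtoC (eps N) * (c * F N s))%C); [apply isQ_eps; auto|intros; ring].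
- apply (isQ_ext (fun N s => RtoC s * (c * F N s))%C); [apply isQ_s; auto|intros; ring].
- apply (isQ_ext (fun N s => RtoC (qv N s) * (c * F N s))%C); [apply isQ_q; auto|intros; ring].
- apply (isQ_ext (fun N s => c * F N s + c * G N s)%C); [apply isQ_plus; auto|intros; ring].
- apply (isQ_ext (fun N s => c * F N s)%C); auto. intros; now rewrite E.
Qed.

Lemma isQ_mult F G : isQ F -> isQ G -> isQ (fun N s => F N s * G N s)%C.
Proof.
intros HF HG. induction HF as [c'|F HF IH|F HF IH|F HF IH|F1 F2 HF IHF HG' IHG|F1 F2 HF IHF E].
- apply isQ_scal; auto.
- apply (isQ_ext (fun N s => RtoC (eps N) * (F N s * G N s))%C); [apply isQ_eps; auto|intros; ring].
- apply (isQ_ext (fun N s => RtoC s * (F N s * G N s))%C); [apply isQ_s; auto|intros; ring].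
- apply (isQ_ext (fun N s => RtoC (qv N s) * (F N s * G N s))%C); [apply isQ_q; auto|intros; ring].
- apply (isQ_ext (fun N s => F1 N s * G N s + F2 N s * G N s)%C); [apply isQ_plus; auto|intros; ring].
- apply (isQ_ext (fun N s => F1 N s * G N s)%C); auto. intros; now rewrite E.
Qed.

Lemma isP_isQ F : isP F -> isQ (fun N _ => F N).
Proof.
induction 1 as [c'|F HF IH|F G HF IHF HG IHG|F G HF IHF E].
- apply isQ_const.
- apply (isQ_eps (fun N _ => F N)); auto.
- apply (isQ_plus (fun N _ => F N) (fun N _ => G N)); auto.
- apply (isQ_ext (fun N _ => F N)); auto.
Qed.

Lemma qv_ge_0 N s : 0 <= qv N s.
Proof. apply Rmult_le_pos; [apply pos_INR|apply pow2_ge_0]. Qed.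

Lemma one_qv_pow N s D E : 1 <= (1 + qv N s) ^ D /\ (1 + qv N s) ^ D <= (1 + qv N s) ^ (D + E).
Proof.
assert (Q := qv_ge_0 N s). assert (A : forall k, 1 <= (1 + qv N s) ^ k) by (intros k; apply pow_R1_Rle; lra).
split; auto. rewrite pow_add. assert (T := A D). assert (T2 := A E). nra.
Qed.

Lemma isQ_bounded F : isQ F -> exists B D, 0 <= B /\ forall N s, (1 <= N)%nat -> Rabs s <= 1 ->
  Cmod (F N s) <= B * (1 + qv N s) ^ D.
Proof.
induction 1 as [c'|F HF IH|F HF IH|F HF IH|F G HF IHF HG IHG|F G HF IHF E].
- exists (Cmod c'), 0%nat. split; [apply Cmod_ge_0|]. intros. simpl. lra.
- destruct IH as [B [D [HB H]]]. exists B, D. split; auto. intros N s HN Hs.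
  rewrite Cmod_mult, Cmod_R. assert (T := eps_bounds N HN). rewrite Rabs_pos_eq by lra.
  specialize (H N s HN Hs). assert (Q := Cmod_ge_0 (F N s)). nra.
- destruct IH as [B [D [HB H]]]. exists B, D. split; auto. intros N s HN Hs.
  rewrite Cmod_mult, Cmod_R. specialize (H N s HN Hs). assert (Q := Cmod_ge_0 (F N s)).
  assert (P := Rabs_pos s). nra.
- destruct IH as [B [D [HB H]]]. exists B, (S D). split; auto. intros N s HN Hs.
  rewrite Cmod_mult, Cmod_R. assert (T := qv_ge_0 N s). rewrite Rabs_pos_eq by lra.
  specialize (H N s HN Hs). assert (Q := Cmod_ge_0 (F N s)).
  change ((1 + qv N s) ^ S D) with ((1 + qv N s) * (1 + qv N s) ^ D).
  apply Rle_trans with ((1 + qv N s) * (B * (1 + qv N s) ^ D)); [|right; ring].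
  apply Rmult_le_compat; auto; lra.
- destruct IHF as [B [D [HB H]]]. destruct IHG as [B2 [D2 [HB2 H2]]].
  exists (B + B2), (D + D2)%nat. split; [lra|]. intros N s HN Hs.
  eapply Rle_trans; [apply Cmod_triangle|]. specialize (H N s HN Hs). specialize (H2 N s HN Hs).
  assert (T1 := proj2 (one_qv_pow N s D D2)). assert (T2 := proj2 (one_qv_pow N s D2 D)).
  rewrite (Nat.add_comm D2) in T2. nra.
- destruct IHF as [B [D [HB H]]]. exists B, D. split; auto. intros. rewrite <- E. auto.
Qed.

Definition eta (N : nat) : R := sqrt (eps N).

Lemma eta_bounds N : (1 <= N)%nat -> 0 < eta N <= 1 /\ eta N ^ 2 = eps N.
Proof.
intros HN. assert (T := eps_bounds N HN). unfold eta. split; [split|].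
- apply sqrt_lt_R0; lra.
- rewrite <- sqrt_1. apply sqrt_le_1; lra.
- simpl. rewrite Rmult_1_r. apply sqrt_sqrt; lra.
Qed.

Lemma eta_pow_pos N L : (1 <= N)%nat -> 0 < eta N ^ L <= 1.
Proof.
intros H. assert (T := proj1 (eta_bounds N H)). split; [apply pow_lt; lra|].
rewrite <- (pow1 L). apply pow_incr. lra.
Qed.

(** |s| = [eta N] sqrt q with q = N s^2, and sqrt q <= 1 + q: a power of s is a power of N^(-1/2) up
    to a polynomial in q. *)
Lemma abs_s_le_eta N s : (1 <= N)%nat -> Rabs s <= eta N * (1 + qv N s).
Proof.
intros HN. destruct (eta_bounds N HN) as [E1 E2]. assert (EI := eps_INR N HN).
assert (Hs : s ^ 2 = Rabs s ^ 2) by (symmetry; apply pow2_abs).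
assert (E : eta N ^ 2 * qv N s = Rabs s ^ 2) by (rewrite E2, <- Hs; rewrite <- Rmult_assoc, EI; ring).
assert (P := Rabs_pos s). assert (Q := qv_ge_0 N s). set (q := qv N s) in *. set (h := eta N) in *.
apply Rnot_lt_le. intros X.
assert (Z : 0 <= h * (1 + q)) by nra.
assert (Y : (h * (1 + q)) ^ 2 < Rabs s ^ 2) by (set (k := h * (1 + q)) in *; clearbody k; nra).
rewrite <- E, Rpow_mult_distr in Y.
assert (h ^ 2 * q <= h ^ 2 * (1 + q) ^ 2) by (apply Rmult_le_compat_l; nra). lra.
Qed.

Section Asy.
Variable dl : R.
Hypothesis Hdl : 0 < dl <= 1.

(* The factor [exp (b q)], [q = N s^2], is absorbed by the Gaussian weight as long as [b] is less than its rate. *)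
Definition asyL (b : R) (L : nat) (H : nat -> R -> C) : Prop :=
  exists P, isQ P /\ exists B D, 0 <= B /\ forall N s, (1 <= N)%nat -> Rabs s <= dl ->
    Cmod (H N s - P N s) <= B * eta N ^ L * (1 + qv N s) ^ D * exp (b * qv N s).

Definition asy b H := forall L, asyL b L H.

Lemma exp_qv_ge_1 b N s : 0 <= b -> 1 <= exp (b * qv N s).
Proof.
intros Hb. rewrite <- exp_0. apply exp_le. apply Rmult_le_pos; auto. apply qv_ge_0.
Qed.

Lemma isQ_asyL b L P : isQ P -> asyL b L P.
Proof.
intros H. exists P. split; auto. exists 0, 0%nat. split; [lra|]. intros N s HN Hs.
replace (P N s - P N s)%C with (RtoC 0) by ring. rewrite Cmod_0. lra.
Qed.

Lemma asyL_O b L H B D : 0 <= B -> (forall N s, (1 <= N)%nat -> Rabs s <= dl ->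
  Cmod (H N s) <= B * eta N ^ L * (1 + qv N s) ^ D * exp (b * qv N s)) -> asyL b L H.
Proof.
intros HB HH. exists (fun _ _ => 0%C). split; [apply isQ_const|]. exists B, D. split; auto.
intros N s HN Hs. replace (H N s - 0)%C with (H N s) by ring. auto.
Qed.

Lemma asyL_ext b L H G : (forall N s, (1 <= N)%nat -> Rabs s <= dl -> H N s = G N s) ->
  asyL b L H -> asyL b L G.
Proof.
intros E [P [HP [B [D [HB HE]]]]]. exists P. split; auto. exists B, D. split; auto. intros N s HN Hs.
rewrite <- E by auto. auto.
Qed.

Lemma asyL_weaken b b' L H : 0 <= b <= b' -> asyL b L H -> asyL b' L H.
Proof.
intros Hb [P [HP [B [D [HB HE]]]]]. exists P. split; auto. exists B, D. split; auto. intros N s HN Hs.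
eapply Rle_trans; [apply HE; auto|]. assert (Q := qv_ge_0 N s).
apply Rmult_le_compat_l.
- apply Rmult_le_pos; [apply Rmult_le_pos; auto; left; apply eta_pow_pos; auto|].
  apply pow_le. lra.
- apply exp_le. nra.
Qed.

Lemma asyL_plus b L H G : asyL b L H -> asyL b L G -> asyL b L (fun N s => H N s + G N s)%C.
Proof.
intros [P [HP [B [D [HB HE]]]]] [P2 [HP2 [B2 [D2 [HB2 HE2]]]]].
exists (fun N s => P N s + P2 N s)%C. split; [apply isQ_plus; auto|].
exists (B + B2), (D + D2)%nat. split; [lra|]. intros N s HN Hs.
specialize (HE N s HN Hs). specialize (HE2 N s HN Hs).
replace (H N s + G N s - (P N s + P2 N s))%C with ((H N s - P N s) + (G N s - P2 N s))%C by ring.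
eapply Rle_trans; [apply Cmod_triangle|].
assert (T1 := proj2 (one_qv_pow N s D D2)). assert (T2 := proj2 (one_qv_pow N s D2 D)).
rewrite (Nat.add_comm D2) in T2. assert (E0 := exp_pos (b * qv N s)).
assert (E1 := proj1 (eta_pow_pos N L HN)).
assert (X1 : B * eta N ^ L * (1 + qv N s) ^ D * exp (b * qv N s) <= B * eta N ^ L * (1 + qv N s) ^ (D + D2) * exp (b * qv N s)).
{ apply Rmult_le_compat_r; [lra|]. apply Rmult_le_compat_l; auto. nra. }
assert (X2 : B2 * eta N ^ L * (1 + qv N s) ^ D2 * exp (b * qv N s) <= B2 * eta N ^ L * (1 + qv N s) ^ (D + D2) * exp (b * qv N s)).
{ apply Rmult_le_compat_r; [lra|]. apply Rmult_le_compat_l; auto. nra. }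
lra.
Qed.

(** The rates in q add. The approximating polynomials are themselves bounded by powers of 1 + q
    ([isQ_bounded]), which is why the error bound carries such a power. *)
Lemma asyL_mult b b' L H G : 0 <= b -> 0 <= b' -> asyL b L H -> asyL b' L G ->
  asyL (b + b') L (fun N s => H N s * G N s)%C.
Proof.
intros Hb Hb' [P [HP [B [D [HB HE]]]]] [P2 [HP2 [B2 [D2 [HB2 HE2]]]]].
destruct (isQ_bounded P HP) as [p [Dp [Hp HpE]]]. destruct (isQ_bounded P2 HP2) as [p2 [Dp2 [Hp2 HpE2]]].
exists (fun N s => P N s * P2 N s)%C. split; [apply isQ_mult; auto|].
exists (B * (B2 + p2) + p * B2), (D + D2 + Dp + Dp2)%nat. split; [nra|]. intros N s HN Hs.
specialize (HE N s HN Hs). specialize (HE2 N s HN Hs).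
specialize (HpE N s HN ltac:(lra)). specialize (HpE2 N s HN ltac:(lra)).
replace (H N s * G N s - P N s * P2 N s)%C
  with ((H N s - P N s) * (G N s - P2 N s) + (H N s - P N s) * P2 N s + P N s * (G N s - P2 N s))%C by ring.
eapply Rle_trans; [apply Cmod_triangle|]. eapply Rle_trans; [apply Rplus_le_compat_r, Cmod_triangle|].
rewrite !Cmod_mult.
replace (exp ((b + b') * qv N s)) with (exp (b * qv N s) * exp (b' * qv N s)) by (rewrite <- exp_plus; f_equal; ring).
assert (A1 := exp_qv_ge_1 b N s Hb). assert (A2 := exp_qv_ge_1 b' N s Hb').
assert (E1 := eta_pow_pos N L HN).
assert (W := fun D E => one_qv_pow N s D E).
set (x := 1 + qv N s) in *. set (h := eta N ^ L) in *. set (e1 := exp (b * qv N s)) in *. set (e2 := exp (b' * qv N s)) in *.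
rewrite !pow_add.
assert (X1 := proj1 (W D 0%nat)). assert (X2 := proj1 (W D2 0%nat)).
assert (X3 := proj1 (W Dp 0%nat)). assert (X4 := proj1 (W Dp2 0%nat)).
set (y1 := x ^ D) in *. set (y2 := x ^ D2) in *. set (y3 := x ^ Dp) in *. set (y4 := x ^ Dp2) in *.
clearbody x h e1 e2 y1 y2 y3 y4.
assert (M1 : Cmod (H N s - P N s) * Cmod (G N s - P2 N s) <= (B * h * y1 * e1) * (B2 * h * y2 * e2))
  by (apply Rmult_le_compat; auto; apply Cmod_ge_0).
assert (M2 : Cmod (H N s - P N s) * Cmod (P2 N s) <= (B * h * y1 * e1) * (p2 * y4))
  by (apply Rmult_le_compat; auto; apply Cmod_ge_0).
assert (M3 : Cmod (P N s) * Cmod (G N s - P2 N s) <= (p * y3) * (B2 * h * y2 * e2))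
  by (apply Rmult_le_compat; auto; apply Cmod_ge_0).
assert (one : forall a c, 0 <= a -> 1 <= c -> a <= a * c) by (intros; nra).
assert (pos : 0 <= y1 /\ 0 <= y2 /\ 0 <= y3 /\ 0 <= y4 /\ 0 <= e1 /\ 0 <= e2 /\ 0 <= h) by (repeat split; lra).
assert (yy : 1 <= y3 * y4) by nra. assert (yy2 : 1 <= y2 * y3) by nra. assert (yy3 : 1 <= y1 * y4) by nra.
assert (Z0 : 0 <= h * y1 * y2 * (e1 * e2)) by (repeat apply Rmult_le_pos; lra).
assert (N1 : (B * h * y1 * e1) * (B2 * h * y2 * e2) <= B * B2 * h * (y1 * y2 * y3 * y4) * (e1 * e2)).
{ apply Rle_trans with (B * B2 * (h * y1 * y2 * (e1 * e2)) * h); [right; ring|].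
  apply Rle_trans with (B * B2 * (h * y1 * y2 * (e1 * e2)) * (y3 * y4)); [|right; ring].
  apply Rmult_le_compat_l; [|lra]. apply Rmult_le_pos; auto. nra. }
assert (N2 : (B * h * y1 * e1) * (p2 * y4) <= B * p2 * h * (y1 * y2 * y3 * y4) * (e1 * e2)).
{ assert (Z : 0 <= B * p2 * h * y1 * y4 * e1) by (repeat apply Rmult_le_pos; lra).
  apply Rle_trans with (B * p2 * h * y1 * y4 * e1 * (y2 * y3 * e2)); [|right; ring].
  apply Rle_trans with (B * p2 * h * y1 * y4 * e1); [right; ring|]. apply one; auto. nra. }
assert (N3 : (p * y3) * (B2 * h * y2 * e2) <= p * B2 * h * (y1 * y2 * y3 * y4) * (e1 * e2)).
{ assert (Z : 0 <= p * B2 * h * y2 * y3 * e2) by (repeat apply Rmult_le_pos; lra).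
  apply Rle_trans with (p * B2 * h * y2 * y3 * e2 * (y1 * y4 * e1)); [|right; ring].
  apply Rle_trans with (p * B2 * h * y2 * y3 * e2); [right; ring|]. apply one; auto. nra. }
lra.
Qed.

Lemma asyL_const b L (c : C) : asyL b L (fun _ _ => c).
Proof. apply isQ_asyL, isQ_const. Qed.

Lemma asyL_csum b L (f : nat -> nat -> R -> C) K : (forall i, (i < K)%nat -> asyL b L (f i)) ->
  asyL b L (fun N s => csum (fun i => f i N s) K).
Proof.
induction K; intros H; cbn [csum]; [apply asyL_const|].
apply asyL_plus; [apply IHK; intros; apply H; lia|apply H; lia].
Qed.

Lemma aseq_asyL L u : aseq u -> asyL 0 L (fun N _ => u N).
Proof.
intros H. destruct (H L) as [P [HP [B [HB HE]]]].
exists (fun N _ => P N). split; [apply isP_isQ; auto|]. exists B, 0%nat. split; auto.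
intros N s HN Hs. eapply Rle_trans; [apply HE; auto|]. rewrite Rmult_0_l, exp_0. simpl pow at 3.
rewrite !Rmult_1_r. apply Rmult_le_compat_l; auto.
destruct (eta_bounds N HN) as [E1 E2]. apply pow_incr. rewrite <- E2. simpl. split; nra.
Qed.

Lemma cexp_taylor (z : C) L :
  Cmod (cexp z - csum (fun k => z ^ k * RtoC (1 ^ k / INR (fact k)))%C L) <= 2 ^ L * (Cmod z ^ L * exp (Cmod z)) * 1.
Proof.
set (F := fun k t => (z ^ k * cexp (RtoC t * z))%C).
assert (HF : chain F 0 1).
{ intros k x Hx. unfold F. eapply gder_eq.
  - apply gder_mult; [apply gder_const|apply cder_cexp_line].
  - cbv beta. rewrite Cpow_S. ring. }
assert (T := taylor_bound L F 0 1 (Cmod z ^ L * exp (Cmod z)) 0 1 HF).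
assert (B : forall u, 0 <= u <= 1 -> Cmod (F L u) <= Cmod z ^ L * exp (Cmod z)).
{ intros u Hu. unfold F. rewrite Cmod_mult, Cmod_pow, Cmod_cexp, Re_scal.
  apply Rmult_le_compat_l; [apply pow_le, Cmod_ge_0|]. apply exp_le.
  assert (R := Re_le_Cmod z). apply Rabs_le_between in R. assert (Z := Cmod_ge_0 z). nra. }
specialize (T B ltac:(lra) ltac:(lra)). rewrite Rabs_R1, pow1 in T.
unfold F at 1 in T. rewrite Rplus_0_l in T.
replace (z ^ 0 * cexp (1 * z))%C with (cexp z) in T
  by (replace (1 * z)%C with z by ring; simpl; ring).
unfold taylor, F in T.
erewrite csum_ext; [exact T|]. intros n Hn. cbv beta. replace (0 * z)%C with (RtoC 0) by ring.
rewrite cexp_0. ring.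
Qed.

Lemma asy_pow L R k : asyL 0 L R -> asyL 0 L (fun N s => R N s ^ k)%C.
Proof.
intros H. induction k; [exact (asyL_const 0 L 1%C)|].
apply (asyL_ext 0 L (fun N s => R N s * R N s ^ k)%C); [reflexivity|].
replace 0 with (0 + 0) by ring. apply asyL_mult; auto; lra.
Qed.

(** The two bounds on the exponent have different roles: the first makes the L-th Taylor remainder
    of exp of order eta^L, the second keeps exp |R| below exp (b q) up to a constant. *)
Lemma asy_cexp b R B D B' : 0 <= b -> asy 0 R -> 0 <= B ->
  (forall N s, (1 <= N)%nat -> Rabs s <= dl -> Cmod (R N s) <= B * eta N * (1 + qv N s) ^ D) ->
  (forall N s, (1 <= N)%nat -> Rabs s <= dl -> Cmod (R N s) <= b * qv N s + B') ->
  asy b (fun N s => cexp (R N s)).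
Proof.
intros Hb HR HB H1 H2 L.
set (T := fun N s => csum (fun k => R N s ^ k * RtoC (1 ^ k / INR (fact k)))%C L).
apply (asyL_ext b L (fun N s => (cexp (R N s) - T N s) + T N s)%C); [intros; ring|].
apply asyL_plus.
- apply (asyL_O b L _ (2 ^ L * (B ^ L * exp B')) (D * L)).
  { repeat apply Rmult_le_pos; try (apply pow_le; lra). left; apply exp_pos. }
  intros N s HN Hs. eapply Rle_trans; [apply cexp_taylor|]. rewrite Rmult_1_r, Rmult_assoc, Rmult_assoc.
  rewrite Rmult_assoc. rewrite Rmult_assoc. apply Rmult_le_compat_l; [apply pow_le; lra|].
  specialize (H1 N s HN Hs). specialize (H2 N s HN Hs).
  apply Rle_trans with ((B * eta N * (1 + qv N s) ^ D) ^ L * exp (b * qv N s + B')).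
  + apply Rmult_le_compat; [apply pow_le, Cmod_ge_0|left; apply exp_pos| |apply exp_le; auto].
    apply pow_incr. split; auto. apply Cmod_ge_0.
  + right. rewrite !Rpow_mult_distr, exp_plus, <- pow_mult. ring.
- apply (asyL_weaken 0); [lra|]. apply asyL_csum. intros k Hk.
  replace 0 with (0 + 0) by ring. apply asyL_mult; try lra; [apply asy_pow; auto|apply asyL_const].
Qed.
End Asy.

(** * Gaussian integrals *)

Lemma pow_exp_bound n (c : R) : 0 < c -> exists B, 0 < B /\ forall q, 0 <= q -> (1 + q) ^ n <= B * exp (c * q).
Proof.
intros Hc. destruct n.
- exists 1. split; [lra|]. intros q Hq. simpl. rewrite <- exp_0 at 1. rewrite Rmult_1_l. apply exp_le. nra.
- set (d := c / INR (S n)). assert (P := INR_S_pos n).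
  assert (Hd : 0 < d) by (apply Rdiv_lt_0_compat; auto).
  exists ((/ d + 1) ^ S n). split; [apply pow_lt; assert (0 < / d) by (apply Rinv_0_lt_compat; auto); lra|].
  intros q Hq. replace (exp (c * q)) with (exp (d * q) ^ S n).
  + rewrite <- Rpow_mult_distr. apply pow_incr. split; [lra|].
    assert (T := exp_ineq1_le (d * q)). assert (I : 0 < / d) by (apply Rinv_0_lt_compat; auto).
    assert (E : / d * d = 1) by (apply Rinv_l; lra). apply Rle_trans with ((/ d + 1) * (1 + d * q)).
    * replace ((/ d + 1) * (1 + d * q)) with (/ d + 1 + (/ d * d) * q + d * q) by ring. rewrite E. nra.
    * apply Rmult_le_compat_l; lra.
  + replace (c * q) with (INR (S n) * (d * q)) by (unfold d; field; lra).
    generalize (S n) as k. intros k. induction k; [simpl; rewrite Rmult_0_l, exp_0; auto|].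
    rewrite S_INR, Rmult_plus_distr_r, exp_plus, <- IHk, Rmult_1_l. simpl. ring.
Qed.

Definition esmall (u : nat -> C) : Prop :=
  forall L, exists B, forall N, (1 <= N)%nat -> Cmod (u N) <= B * eps N ^ L.

Lemma esmall_aseq u : esmall u -> aseq u.
Proof. intros H L. destruct (H L) as [B HB]. apply (aord_O B); auto. Qed.

(** Decay in sqrt N is the rate available: the Gaussian is cut off at s = dl, and its tail is
    estimated by an exponential in sqrt N dl. *)
Lemma esmall_exp (u : nat -> C) (B c : R) (p : nat) : 0 < c -> 0 <= B ->
  (forall N, (1 <= N)%nat -> Cmod (u N) <= B * INR N ^ p * exp (- (c * sqrt (INR N)))) -> esmall u.
Proof.
intros Hc HB H L. destruct (pow_exp_bound (2 * (p + L)) c Hc) as [D [HD HE]].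
exists (B * D). intros N HN. eapply Rle_trans; [apply H; auto|].
rewrite Rmult_assoc, (Rmult_assoc B). apply Rmult_le_compat_l; auto.
assert (NP : 1 <= INR N) by (apply (le_INR 1); auto).
set (r := sqrt (INR N)). assert (Er : r * r = INR N) by (apply sqrt_sqrt; lra).
assert (Hr : 0 <= r) by apply sqrt_pos. specialize (HE r Hr).
assert (X : INR N ^ (p + L) <= D * exp (c * r)).
{ eapply Rle_trans; [|exact HE]. rewrite pow_mult. apply pow_incr. split; [lra|]. rewrite <- Er. simpl. nra. }
rewrite exp_Ropp. assert (Pe := exp_pos (c * r)). assert (Pn : 0 < INR N ^ L) by (apply pow_lt; lra).
rewrite pow_add in X. rewrite pow_inv.
apply Rmult_le_reg_r with (exp (c * r) * INR N ^ L); [apply Rmult_lt_0_compat; auto|].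
replace (INR N ^ p * / exp (c * r) * (exp (c * r) * INR N ^ L)) with (INR N ^ p * INR N ^ L) by (field; lra).
replace (D * / INR N ^ L * (exp (c * r) * INR N ^ L)) with (D * exp (c * r)) by (field; lra). exact X.
Qed.

(** e^(-u) <= 1/(1 + u) compares the Gaussian with an arctangent integral, which already has the
    scaling 1/sqrt N. *)
Lemma gauss_bound (c dl : R) (N : nat) : 0 < c -> 0 < dl -> (1 <= N)%nat ->
  ex_RInt (fun s => exp (- (c * qv N s))) (- dl) dl /\
  sqrt (INR N) * RInt (fun s => exp (- (c * qv N s))) (- dl) dl <= PI / sqrt c.
Proof.
intros Hc Hdl HN. assert (NP : 1 <= INR N) by (apply (le_INR 1); auto).
set (w := sqrt (c * INR N)). assert (Ew : w * w = c * INR N) by (apply sqrt_sqrt; nra).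
assert (Hw : 0 < w) by (apply sqrt_lt_R0; nra).
assert (Ex : ex_RInt (fun s => exp (- (c * qv N s))) (- dl) dl).
{ apply (ex_RInt_continuous (V := R_CompleteNormedModule)). intros z _.
  apply (ex_derive_continuous (V := R_NormedModule)). auto_derive. auto. }
split; auto.
assert (A : is_RInt (fun s => / (1 + (w * s) ^ 2)) (- dl) dl (/ w * atan (w * dl) - / w * atan (w * - dl))).
{ apply (is_RInt_derive (V := R_CompleteNormedModule) (fun s => / w * atan (w * s)) (fun s => / (1 + (w * s) ^ 2))).
  - intros x _. auto_derive; auto. field. split; nra.
  - intros x _. apply (ex_derive_continuous (V := R_NormedModule)). auto_derive. nra. }
assert (Le : RInt (fun s => exp (- (c * qv N s))) (- dl) dl <= / w * atan (w * dl) - / w * atan (w * - dl)).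
{ rewrite <- (is_RInt_unique _ _ _ _ A). apply RInt_le; [lra|auto|eexists; exact A|].
  intros s _. rewrite exp_Ropp. apply Rinv_le_contravar; [nra|].
  replace ((w * s) ^ 2) with (c * qv N s) by (transitivity ((w * w) * s ^ 2); [rewrite Ew; ring|ring]).
  apply exp_ineq1_le. }
assert (B1 := atan_bound (w * dl)). assert (B2 := atan_bound (w * - dl)).
assert (Es : sqrt (INR N) * / w = / sqrt c).
{ unfold w. rewrite sqrt_mult by lra. field. split; apply Rgt_not_eq, sqrt_lt_R0; lra. }
assert (Hs : 0 < sqrt (INR N)) by (apply sqrt_lt_R0; lra).
assert (Hc2 : 0 < / sqrt c) by (apply Rinv_0_lt_compat, sqrt_lt_R0; auto).
apply (Rmult_le_compat_l (sqrt (INR N))) in Le; [|lra].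
replace (sqrt (INR N) * (/ w * atan (w * dl) - / w * atan (w * - dl)))
  with (sqrt (INR N) * / w * (atan (w * dl) - atan (w * - dl))) in Le by ring.
rewrite Es in Le. unfold Rdiv. nra.
Qed.

Section Gaussian.
Variable al : C.
Hypothesis Hal : 0 < Re al.

(** The integral of exp(- al v^2) from 0 to V, rescaled to [0, 1] so that V becomes a parameter
    under the integral. [gE] is its companion in the classical evaluation: al gI^2 + gE does not
    depend on V. *)
Definition gI (V : R) : C := (RtoC V * CInt (fun t => cexp (- al * RtoC (V ^ 2 * t ^ 2))) 0 1)%C.
Definition gE (V : R) : C := CInt (fun t => cexp (- al * RtoC (V ^ 2 * (1 + t ^ 2))) * RtoC (/ (1 + t ^ 2)))%C 0 1.

Lemma Cmod_gauss (x : R) : Cmod (cexp (- al * RtoC x)) = exp (- (Re al * x)).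
Proof. rewrite Cmod_cexp. f_equal. unfold Re; simpl; ring. Qed.

Lemma cder_gauss_comp (g : R -> R) (t l : R) : is_derive g t l ->
  cder (fun t => cexp (- al * RtoC (g t))) t (cexp (- al * RtoC (g t)) * (- al * RtoC l)).
Proof.
intros H. apply (gder_comp _ _ cexp (fun t => - al * RtoC (g t))%C); [apply Cder_exp|].
eapply gder_eq; [apply gder_mult; [apply gder_const|apply cder_real; exact H]|]. cbv beta; ring.
Qed.

Lemma Ccont_real2 (u v : R) : Ccont (fun p : C => RtoC (Re p)) (u, v) /\ Ccont (fun p : C => RtoC (Im p)) (u, v).
Proof.
split; [|apply Ccont_snd]. apply (Ccont_fst RtoC u v). exact (cder_cont _ _ _ (cder_RtoC u)).
Qed.

Lemma cder_gI V : cder gI V (cexp (- al * RtoC (V ^ 2))).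
Proof.
set (F := fun p : C => cexp (- al * RtoC (Re p ^ 2 * Im p ^ 2))).
set (F1 := fun p : C => (cexp (- al * RtoC (Re p ^ 2 * Im p ^ 2)) * (- al * RtoC (2 * Re p * Im p ^ 2)))%C).
assert (D : cder (fun u => CInt (fun t => F (u, t)) 0 1) V (CInt (fun t => F1 (V, t)) 0 1)).
{ apply (cder_CInt_param F F1 0 1 V 1); try lra.
  - intros u t _ _. unfold F, F1, Re, Im; cbn [fst snd].
    apply (cder_gauss_comp (fun u => u ^ 2 * t ^ 2)). auto_derive; auto. ring.
  - intros u _ t _. unfold F, Re, Im; cbn [fst snd].
    eapply cder_cont. apply (cder_gauss_comp (fun t => u ^ 2 * t ^ 2)). auto_derive; [auto|reflexivity].
  - intros t _. destruct (Ccont_real2 V t) as [C1 C2].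
    assert (C3 : Ccont (fun p : C => (- al * RtoC (Re p ^ 2 * Im p ^ 2))%C) (V, t)).
    { apply (gcont_ext _ _ (fun p : C => - al * ((RtoC (Re p) * RtoC (Re p)) * (RtoC (Im p) * RtoC (Im p))))%C).
      - intros p. rewrite <- !RtoC_mult. do 2 f_equal. ring.
      - repeat first [apply gcont_mult | apply gcont_const]; assumption. }
    apply gcont_mult; [exact (gcont_comp _ _ cexp _ _ (Ccont_exp _) C3)|].
    apply (gcont_ext _ _ (fun p : C => - al * (RtoC 2 * (RtoC (Re p) * (RtoC (Im p) * RtoC (Im p)))))%C).
    + intros p. rewrite <- !RtoC_mult. do 2 f_equal. ring.
    + repeat first [apply gcont_mult | apply gcont_const]; assumption. }
assert (DG : forall t, cder (fun t => F (V, t)) t (cexp (- al * RtoC (V ^ 2 * t ^ 2)) * (- al * RtoC (2 * V ^ 2 * t)))).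
{ intros t. unfold F, Re, Im; cbn [fst snd].
  apply (cder_gauss_comp (fun t => V ^ 2 * t ^ 2)). auto_derive; auto. ring. }
assert (CF : ccont_on (fun t => F (V, t)) 0 1) by (intros t _; exact (cder_cont _ _ _ (DG t))).
assert (CR : forall (g : R -> R) t l, is_derive g t l -> ccont (fun t => RtoC (g t)) t)
  by (intros g t l H; exact (cder_cont _ _ _ (cder_real g t l H))).
assert (CF1 : ccont_on (fun t => F1 (V, t)) 0 1).
{ intros t _. unfold F1, Re, Im; cbn [fst snd]. apply gcont_mult; [exact (cder_cont _ _ _ (DG t))|].
  apply gcont_mult; [apply gcont_const|].
  apply (CR (fun t => 2 * V * t ^ 2) t (2 * V * (2 * t))). auto_derive; auto. ring. }
unfold gI. eapply gder_eq; [apply gder_mult; [apply cder_RtoC|exact D]|]. cbv beta.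
change (CInt (fun t => cexp (- al * RtoC (V ^ 2 * t ^ 2))) 0 1) with (CInt (fun t => F (V, t)) 0 1).
assert (E : CInt (fun t => F (V, t) + RtoC V * F1 (V, t))%C 0 1 = (1 * CInt (fun t => F (V, t)) 0 1 + V * CInt (fun t => F1 (V, t)) 0 1)%C).
{ rewrite CInt_plus, CInt_scal; try lra; auto; [ring|].
  intros t Ht. apply gcont_mult; [apply gcont_const|exact (CF1 t Ht)]. }
rewrite <- E. rewrite (CInt_FTC (fun t => RtoC t * F (V, t))%C).
- unfold F, Re, Im; cbn [fst snd]. replace (V ^ 2 * 1 ^ 2) with (V ^ 2) by ring. ring.
- lra.
- intros t _. eapply gder_eq; [apply gder_mult; [apply cder_RtoC|apply DG]|]. cbv beta.
  unfold F, F1, Re, Im; cbn [fst snd]. replace (2 * V ^ 2 * t) with (2 * V * V * t) by ring.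
  replace (2 * V * t ^ 2) with (2 * V * t * t) by ring. rewrite !RtoC_mult. ring.
- intros t Ht. apply gcont_plus; [exact (CF t Ht)|]. apply gcont_mult; [apply gcont_const|exact (CF1 t Ht)].
Qed.

Lemma gI_0 : gI 0 = 0%C.
Proof. unfold gI. ring. Qed.

Lemma gI_odd V : gI (- V) = (- gI V)%C.
Proof. unfold gI. rewrite RtoC_opp. replace ((- V) ^ 2) with (V ^ 2) by ring. ring. Qed.

Lemma ccont_gauss (c : R) s : ccont (fun t => cexp (- al * RtoC (c * t ^ 2))) s.
Proof.
eapply cder_cont. apply (cder_gauss_comp (fun t => c * t ^ 2)). auto_derive; [auto|reflexivity].
Qed.

Lemma gI_tail V W : 1 <= V <= W -> Cmod (gI W - gI V) <= 2 / Re al * exp (- (Re al * V)).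
Proof.
intros H. set (a := Re al) in *.
assert (CG : ccont_on (fun v => cexp (- al * RtoC (v ^ 2))) V W).
{ intros t _. apply (gcont_ext _ _ (fun t => cexp (- al * RtoC (1 * t ^ 2)))); [intros; do 3 f_equal; ring|apply ccont_gauss]. }
rewrite <- (CInt_FTC gI (fun v => cexp (- al * RtoC (v ^ 2))) V W) by (try lra; auto; intros; apply cder_gI).
assert (A : is_RInt (fun v => exp (- (a * v))) V W (- / a * exp (- (a * W)) - - / a * exp (- (a * V)))).
{ apply (is_RInt_derive (V := R_CompleteNormedModule) (fun v => - / a * exp (- (a * v))) (fun v => exp (- (a * v)))).
  - intros x _. auto_derive; auto. field. lra.
  - intros x _. apply (ex_derive_continuous (V := R_NormedModule)). auto_derive. auto. }
eapply Rle_trans; [apply (CInt_bound _ (fun v => exp (- (a * v)))); [lra|auto|eexists; exact A|]|].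
- intros t Ht. rewrite Cmod_gauss. apply exp_le. fold a. assert (0 < a) by exact Hal.
  apply Ropp_le_contravar, Rmult_le_compat_l; [lra|]. simpl. nra.
- rewrite (is_RInt_unique _ _ _ _ A). assert (E := exp_pos (- (a * W))).
  assert (I : 0 < / a) by (apply Rinv_0_lt_compat; exact Hal). unfold Rdiv.
  assert (E2 := exp_pos (- (a * V))). nra.
Qed.

Lemma gI_limit : exists M : C, forall V, 1 <= V -> Cmod (gI V - M) <= 4 / Re al * exp (- (Re al * V)).
Proof.
set (a := Re al) in *.
assert (I : 0 < / a) by (apply Rinv_0_lt_compat; auto).
assert (Dec : forall e, 0 < e -> exists n0 : nat, forall n, (n0 <= n)%nat -> 2 / a * exp (- (a * INR (S n))) < e).
{ intros e He. destruct (nfloor_ex (2 / (a * a * e))) as [k [_ Hk]].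
  { apply Rdiv_le_0_compat; [lra|]. apply Rmult_lt_0_compat; nra. }
  exists k. intros n Hn. assert (Hkn : 2 / (a * a * e) < INR (S n)).
  { rewrite S_INR. assert (INR k <= INR n) by (apply le_INR; auto). lra. }
  rewrite exp_Ropp. assert (X := exp_ineq1_le (a * INR (S n))).
  assert (Ps := INR_S_pos n). assert (Pa : 0 < a * INR (S n)) by nra.
  assert (Pe := exp_pos (a * INR (S n))).
  apply Rmult_lt_reg_r with (exp (a * INR (S n))); auto.
  rewrite Rmult_assoc, Rinv_l, Rmult_1_r by lra.
  apply Rlt_le_trans with (e * (a * INR (S n))); [|apply Rmult_le_compat_l; lra].
  apply (Rmult_lt_compat_l (a * e)) in Hkn; [|nra].
  replace (a * e * (2 / (a * a * e))) with (2 / a) in Hkn by (field; lra). lra. }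
assert (Cau : forall p : C -> R, (forall z w, p (z - w)%C = p z - p w) -> (forall z, Rabs (p z) <= Cmod z) ->
  { l : R | Un_cv (fun n => p (gI (INR (S n)))) l }).
{ intros p P1 P3. apply Rcomplete.R_complete. intros e He. destruct (Dec e He) as [n0 Hn0]. exists n0.
  assert (G : forall n m, (n0 <= n)%nat -> (n <= m)%nat -> Rabs (p (gI (INR (S m))) - p (gI (INR (S n)))) < e).
  { intros n m Hn Hm. rewrite <- P1. eapply Rle_lt_trans; [apply P3|]. eapply Rle_lt_trans; [|apply (Hn0 n Hn)].
    apply gI_tail. split; [apply INR_S_ge_1|apply le_INR; lia]. }
  intros n m Hn Hm. unfold R_dist. destruct (Nat.le_ge_cases n m); [|apply G; auto].
  rewrite Rabs_minus_sym. apply G; auto. }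
destruct (Cau Re Re_minus Re_le_Cmod) as [l1 H1]. destruct (Cau Im Im_minus Im_le_Cmod) as [l2 H2].
exists (l1, l2). intros V HV.
apply le_epsilon. intros e He.
destruct (H1 (e / 2)) as [n1 D1]; [lra|]. destruct (H2 (e / 2)) as [n2 D2]; [lra|].
destruct (nfloor_ex V) as [k [_ Hk]]; [lra|].
set (n := (n1 + n2 + k)%nat).
specialize (D1 n ltac:(unfold n; lia)). specialize (D2 n ltac:(unfold n; lia)). unfold R_dist in D1, D2.
assert (HVn : V <= INR (S n)).
{ rewrite S_INR. assert (INR k <= INR n) by (apply le_INR; unfold n; lia). lra. }
assert (T := gI_tail V (INR (S n)) ltac:(lra)). fold a in T.
set (G := gI (INR (S n))) in *.
replace (gI V - (l1, l2))%C with (- (G - gI V) + (G - (l1, l2)))%C by ring.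
eapply Rle_trans; [apply Cmod_triangle|]. rewrite Cmod_opp.
assert (X : Cmod (G - (l1, l2)) <= e).
{ eapply Rle_trans; [apply Cmod_le_ReIm|]. rewrite Re_minus, Im_minus.
  change (Re (l1, l2)) with l1. change (Im (l1, l2)) with l2. lra. }
assert (0 < / a * exp (- (a * V))) by (apply Rmult_lt_0_compat; auto; apply exp_pos).
unfold Rdiv in *. nra.
Qed.

End Gaussian.

Section GaussianValue.
Variable al : C.
Hypothesis Hal : 0 < Re al.

Lemma cder_gE V : cder (gE al) V (- RtoC 2 * al * cexp (- al * RtoC (V ^ 2)) * gI al V)%C.
Proof.
set (F := fun p : C => (cexp (- al * RtoC (Re p ^ 2 * (1 + Im p ^ 2))) * RtoC (/ (1 + Im p ^ 2)))%C).
set (F1 := fun p : C => (RtoC (Re p) * (cexp (- al * RtoC (Re p ^ 2 * (1 + Im p ^ 2))) * (- al * RtoC 2)))%C).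
assert (Pt : forall t, 1 + t ^ 2 <> 0) by (intros t; nra).
assert (Ct : forall t, ccont (fun t => RtoC (/ (1 + t ^ 2))) t).
{ intros t. eapply cder_cont. apply cder_real. auto_derive; [apply Pt|reflexivity]. }
assert (D : cder (fun u => CInt (fun t => F (u, t)) 0 1) V (CInt (fun t => F1 (V, t)) 0 1)).
{ apply (cder_CInt_param F F1 0 1 V 1); try lra.
  - intros u t _ _. unfold F, F1, Re, Im; cbn [fst snd].
    eapply gder_eq; [apply gder_mult; [|apply gder_const]|].
    + apply (cder_gauss_comp al (fun u => u ^ 2 * (1 + t ^ 2)) u (2 * u * (1 + t ^ 2))). auto_derive; auto. ring.
    + cbv beta. assert (E : (RtoC (1 + t ^ 2) * RtoC (/ (1 + t ^ 2)) = 1)%C)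
        by (rewrite <- RtoC_mult, Rinv_r by apply Pt; auto).
      rewrite (RtoC_mult (2 * u)), (RtoC_mult 2 u).
      set (w := cexp _). set (p := RtoC (1 + t ^ 2)) in *. set (q := RtoC (/ (1 + t ^ 2))) in *.
      transitivity (RtoC u * (w * (- al * RtoC 2)) * (p * q))%C; [ring|rewrite E; ring].
  - intros u _ t _. unfold F, Re, Im; cbn [fst snd]. apply gcont_mult; [|apply Ct].
    eapply cder_cont. apply (cder_gauss_comp al (fun t => u ^ 2 * (1 + t ^ 2))). auto_derive; [auto|reflexivity].
  - intros t _. destruct (Ccont_real2 V t) as [C1 C2].
    assert (C3 : Ccont (fun p : C => (- al * RtoC (Re p ^ 2 * (1 + Im p ^ 2)))%C) (V, t)).
    { apply (gcont_ext _ _ (fun p : C => - al * ((RtoC (Re p) * RtoC (Re p)) * (1 + RtoC (Im p) * RtoC (Im p))))%C).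
      - intros p. rewrite <- !RtoC_mult, <- RtoC_plus, <- RtoC_mult. do 2 f_equal. ring.
      - repeat first [apply gcont_mult | apply gcont_plus | apply gcont_const]; assumption. }
    apply gcont_mult; [exact C1|].
    apply gcont_mult; [exact (gcont_comp _ _ cexp _ _ (Ccont_exp _) C3)|apply gcont_const]. }
eapply gder_eq; [exact D|].
unfold gI. rewrite (CInt_ext _ (fun t => (RtoC V * (cexp (- al * RtoC (V ^ 2)) * (- al * RtoC 2))) * cexp (- al * RtoC (V ^ 2 * t ^ 2)))%C).
- rewrite CInt_scal; [ring|lra|]. intros t _. apply ccont_gauss.
- lra.
- intros t _. unfold F1, Re, Im; cbn [fst snd].
  replace (- al * RtoC (V ^ 2 * (1 + t ^ 2)))%C with (- al * RtoC (V ^ 2) + - al * RtoC (V ^ 2 * t ^ 2))%C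
    by (replace (V ^ 2 * (1 + t ^ 2)) with (V ^ 2 + V ^ 2 * t ^ 2) by ring; rewrite RtoC_plus; ring).
  rewrite cexp_add. ring.
Qed.

(* The derivative in [V] vanishes: the classical evaluation of the Gaussian integral without polar coordinates. *)
Lemma gauss_identity V : 0 <= V -> (al * gI al V ^ 2 + gE al V)%C = RtoC (PI / 4).
Proof.
intros HV. transitivity (al * gI al 0 ^ 2 + gE al 0)%C.
- apply (cder_0_const (fun V => al * gI al V ^ 2 + gE al V)%C 0 V HV). intros t _.
  eapply gder_eq.
  + apply gder_plus; [|apply cder_gE]. apply gder_mult; [apply gder_const|].
    apply (gder_ext _ _ (fun V => gI al V * gI al V)%C); [intros; simpl; ring|].
    apply gder_mult; apply cder_gI.
  + cbv beta. ring.
- rewrite gI_0. unfold gE.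
  rewrite (CInt_ext _ (fun t => RtoC (/ (1 + t ^ 2)))).
  + rewrite (CInt_FTC (fun t => RtoC (atan t))).
    * rewrite atan_1, atan_0. rewrite <- RtoC_minus, Rminus_0_r. simpl. ring.
    * lra.
    * intros t _. apply cder_real. auto_derive; auto. field. nra.
    * intros t _. eapply cder_cont. apply cder_real. auto_derive; [nra|reflexivity].
  + lra.
  + intros t _. replace (0 ^ 2 * (1 + t ^ 2)) with 0 by ring.
    replace (- al * 0)%C with (RtoC 0) by ring. rewrite cexp_0. ring.
Qed.

Lemma Cmod_gE_le V : Cmod (gE al V) <= 2 * exp (- (Re al * V ^ 2)).
Proof.
eapply Rle_trans; [apply (CInt_bound_const _ (exp (- (Re al * V ^ 2))))|lra]; [lra| |].
- intros t _. apply gcont_mult.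
  + eapply cder_cont. apply (cder_gauss_comp al (fun t => V ^ 2 * (1 + t ^ 2))). auto_derive; [auto|reflexivity].
  + eapply cder_cont. apply cder_real. auto_derive; [nra|reflexivity].
- intros t Ht. rewrite Cmod_mult, (Cmod_gauss al), Cmod_R.
  assert (I : 0 < / (1 + t ^ 2) <= 1).
  { split; [apply Rinv_0_lt_compat; nra|]. rewrite <- Rinv_1. apply Rinv_le_contravar; nra. }
  rewrite Rabs_pos_eq by lra.
  assert (E : exp (- (Re al * (V ^ 2 * (1 + t ^ 2)))) <= exp (- (Re al * V ^ 2))).
  { apply exp_le. apply Ropp_le_contravar, Rmult_le_compat_l; [lra|]. assert (0 <= (V * t) ^ 2) by apply pow2_ge_0. nra. }
  assert (P := exp_pos (- (Re al * (V ^ 2 * (1 + t ^ 2))))). nra.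
Qed.

(* Selects the square root of [PI / (4 al)]: [cos x >= 1 - x^2/2], and [h] below is a primitive of
   [(3/(4a^2) - v^4) exp (-a v^2)]. *)
Lemma Re_gI_ge_0 V : Rabs (Im al) <= Re al -> 0 <= V -> 0 <= Re (gI al V).
Proof.
intros Hi HV. set (a := Re al) in *. set (b := Im al) in *. assert (Ha : 0 < a) by exact Hal.
assert (Hb : b ^ 2 <= a ^ 2) by (rewrite <- (pow2_abs b); apply pow_incr; split; [apply Rabs_pos|auto]).
set (h := fun v => (v ^ 3 / (2 * a) + 3 * v / (4 * a ^ 2)) * exp (- (a * v ^ 2))).
assert (Dh : forall v, is_derive h v ((3 / (4 * a ^ 2) - v ^ 4) * exp (- (a * v ^ 2)))).
{ intros v. unfold h. auto_derive; auto. simpl. set (e := exp _). field. lra. }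
assert (DI : forall v, is_derive (fun v => Re (gI al v)) v (exp (- (a * v ^ 2)) * cos (b * v ^ 2))).
{ intros v. destruct (cder_is_derive _ _ _ (cder_gI al v)) as [D _]. evar_last; [exact D|].
  unfold cexp, Re, Im; simpl. fold (Re al) (Im al). fold a b.
  replace (- a * (v * (v * 1)) - - b * 0) with (- (a * (v * (v * 1)))) by ring.
  replace (- a * 0 + - b * (v * (v * 1))) with (- (b * (v * (v * 1)))) by ring. rewrite cos_neg. reflexivity. }
destruct (MVT_gen (fun v => Re (gI al v) - b ^ 2 / 2 * h v) 0 V
  (fun v => exp (- (a * v ^ 2)) * cos (b * v ^ 2) - b ^ 2 / 2 * ((3 / (4 * a ^ 2) - v ^ 4) * exp (- (a * v ^ 2)))))
  as [c [Hc E]].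
- intros v _. apply (is_derive_minus (V := R_NormedModule)); auto.
  apply (is_derive_scal h _ (b ^ 2 / 2)). auto.
- intros v _. apply continuity_pt_filterlim.
  apply (ex_derive_continuous (V := R_NormedModule) (fun v => Re (gI al v) - b ^ 2 / 2 * h v)). eexists.
  exact (is_derive_minus (V := R_NormedModule) (fun v => Re (gI al v)) (fun v => b ^ 2 / 2 * h v) v _ _ (DI v)
    (is_derive_scal h v (b ^ 2 / 2) _ (Dh v))).
- assert (H0 : Re (gI al 0) - b ^ 2 / 2 * h 0 = 0).
  { rewrite gI_0. unfold h, Re; simpl. unfold Rdiv. ring. }
  assert (HhV : 0 <= h V).
  { unfold h. apply Rmult_le_pos; [|left; apply exp_pos].
    apply Rplus_le_le_0_compat; apply Rdiv_le_0_compat; try nra; apply pow_le; auto. }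
  assert (Hder : 0 <= exp (- (a * c ^ 2)) * cos (b * c ^ 2) - b ^ 2 / 2 * ((3 / (4 * a ^ 2) - c ^ 4) * exp (- (a * c ^ 2)))).
  { assert (Pe := exp_pos (- (a * c ^ 2))). assert (Cc := one_minus_cos_le (b * c ^ 2)).
    replace (b ^ 2 / 2 * ((3 / (4 * a ^ 2) - c ^ 4) * exp (- (a * c ^ 2))))
      with (exp (- (a * c ^ 2)) * (3 / 8 * (b ^ 2 / a ^ 2) - b ^ 2 * c ^ 4 / 2)) by (field; lra).
    rewrite <- Rmult_minus_distr_l. apply Rmult_le_pos; [lra|].
    assert (b ^ 2 / a ^ 2 <= 1).
    { apply Rmult_le_reg_r with (a ^ 2); [apply pow_lt; auto|]. unfold Rdiv. rewrite Rmult_assoc, Rinv_l; [lra|].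
      apply pow_nonzero; lra. }
    replace (b ^ 2 * c ^ 4 / 2) with ((b * c ^ 2) ^ 2 / 2) by (unfold Rdiv; ring). simpl in *. lra. }
  assert (Hb2 : 0 <= b ^ 2 / 2 * h V) by (apply Rmult_le_pos; [apply Rdiv_le_0_compat; [apply pow2_ge_0|lra]|auto]).
  rewrite H0, !Rminus_0_r in E. nra.
Qed.

(** Since [gE] tends to 0, the limit of [gI] is a square root of pi / (4 al); Re M >= 0, inherited
    from [Re_gI_ge_0], tells which one. *)
Lemma gauss_limit : Rabs (Im al) <= Re al -> exists M : C, (al * M ^ 2)%C = RtoC (PI / 4) /\ 0 <= Re M /\
  forall V, 1 <= V -> Cmod (gI al V - M) <= 4 / Re al * exp (- (Re al * V)).
Proof.
intros Hi. destruct (gI_limit al Hal) as [M HM]. exists M.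
set (a := Re al) in *. assert (Ha : 0 < a) by exact Hal. assert (I : 0 < / a) by (apply Rinv_0_lt_compat; auto).
assert (Small : forall N, (1 <= N)%nat -> exp (- (a * INR N)) <= / a * eps N).
{ intros N HN. assert (NP : 1 <= INR N) by (apply (le_INR 1); auto).
  rewrite <- Rinv_mult, exp_Ropp. apply Rinv_le_contravar; [nra|].
  assert (T := exp_ineq1_le (a * INR N)). lra. }
assert (HN1 : forall N, (1 <= N)%nat -> Cmod (gI al (INR N) - M) <= 4 / a * (/ a * eps N)).
{ intros N HN. eapply Rle_trans; [apply HM; apply (le_INR 1); auto|].
  apply Rmult_le_compat_l; [apply Rdiv_le_0_compat; lra|apply Small; auto]. }
split; [|split; auto].
- apply Ceq_minus, Cmod_eq_0, Rle_antisym; [|apply Cmod_ge_0]. set (D := 4 / a * / a).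
  assert (HD : 0 <= D) by (unfold D, Rdiv; nra).
  apply (small_eps (Cmod al * (D * (2 * Cmod M + D)) + 2 * / a)). intros N HN.
  assert (H1 := HN1 N HN). assert (E := eps_bounds N HN). assert (NP : 1 <= INR N) by (apply (le_INR 1); auto).
  assert (H2 : Cmod (gE al (INR N)) <= 2 * (/ a * eps N)).
  { eapply Rle_trans; [apply Cmod_gE_le|]. apply Rmult_le_compat_l; [lra|].
    eapply Rle_trans; [|apply (Small N HN)]. apply exp_le. fold a. simpl. apply Ropp_le_contravar, Rmult_le_compat_l; nra. }
  assert (H3 := gauss_identity (INR N) ltac:(lra)). rewrite <- H3.
  set (G := gI al (INR N)) in *.
  replace (al * M ^ 2 - (al * G ^ 2 + gE al (INR N)))%C
    with (- (al * ((G - M) * (2 * M + (G - M))) + gE al (INR N)))%C by (simpl; ring).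
  rewrite Cmod_opp. eapply Rle_trans; [apply Cmod_triangle|]. rewrite !Cmod_mult.
  assert (H4 : Cmod (2 * M + (G - M)) <= 2 * Cmod M + D).
  { eapply Rle_trans; [apply Cmod_triangle|]. rewrite Cmod_mult, Cmod_R, (Rabs_pos_eq 2) by lra.
    assert (D * eps N <= D) by nra. fold D in H1. unfold D in *. lra. }
  assert (H5 : Cmod (G - M) <= D * eps N) by (unfold D; lra).
  assert (Cmod (G - M) * Cmod (2 * M + (G - M)) <= D * eps N * (2 * Cmod M + D))
    by (apply Rmult_le_compat; auto; apply Cmod_ge_0).
  assert (P := Cmod_ge_0 al). nra.
- apply Ropp_le_cancel. rewrite Ropp_0. apply (small_eps (4 / a * / a)). intros N HN.
  specialize (HN1 N HN). assert (P := Re_gI_ge_0 (INR N) Hi (pos_INR N)).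
  assert (Q := Re_le_Cmod (gI al (INR N) - M)%C). rewrite Re_minus in Q. apply Rabs_le_between in Q. lra.
Qed.
End GaussianValue.

(** * The Wallis integrals of sin^n over [0, pi/2] and the constant in Stirling's formula *)

Fixpoint wallis (n : nat) : R :=
  match n with
  | 0 => PI / 2
  | S k => match k with 0 => 1 | S j => INR k / INR n * wallis j end
  end.

Lemma ex_RInt_sin_pow n : ex_RInt (fun t => sin t ^ n) 0 (PI / 2).
Proof.
apply (ex_RInt_continuous (V := R_CompleteNormedModule)). intros z _.
apply (ex_derive_continuous (V := R_NormedModule)). auto_derive. auto.
Qed.

Lemma wallis_RInt n : RInt (fun t => sin t ^ n) 0 (PI / 2) = wallis n /\
  RInt (fun t => sin t ^ S n) 0 (PI / 2) = wallis (S n).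
Proof.
induction n as [|n [IH1 IH2]].
- split.
  + simpl. rewrite (RInt_const (V := R_CompleteNormedModule)). unfold scal; simpl; unfold mult; simpl. lra.
  + apply is_RInt_unique. evar_last.
    * apply (is_RInt_derive (V := R_CompleteNormedModule) (fun t => - cos t) (fun t => sin t ^ 1)).
      -- intros x _. auto_derive; auto. simpl. ring.
      -- intros x _. apply (ex_derive_continuous (V := R_NormedModule)). auto_derive. auto.
    * rewrite cos_PI2, cos_0. unfold minus, plus, opp; simpl. ring.
- split; auto.
  assert (A : is_RInt (fun t => INR (S (S n)) * sin t ^ S (S n) - INR (S n) * sin t ^ n) 0 (PI / 2) 0).
  { evar_last.
    - apply (is_RInt_derive (V := R_CompleteNormedModule) (fun t => - cos t * sin t ^ S n)
        (fun t => INR (S (S n)) * sin t ^ S (S n) - INR (S n) * sin t ^ n)).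
      + intros x _. auto_derive; auto. change (match n with 0%nat => 1 | S _ => INR n + 1 end) with (INR (S n)). rewrite (S_INR (S n)).
        assert (E := sin2_cos2 x). unfold Rsqr in E.
        assert (Ec : cos x * cos x = 1 - sin x * sin x) by lra.
        match goal with |- ?u = ?v => change (@eq R u v) end.
        transitivity (sin x * sin x * sin x ^ n - cos x * cos x * (INR (S n) * sin x ^ n));
          [|rewrite Ec]; set (k := INR (S n)); simpl pow; ring.
      + intros x _. apply (ex_derive_continuous (V := R_NormedModule)). auto_derive. auto.
    - rewrite cos_PI2, cos_0, sin_0. unfold minus, plus, opp; simpl. ring. }
  apply (is_RInt_unique (V := R_CompleteNormedModule)) in A.
  assert (Ex : forall c k, ex_RInt (fun t => c * sin t ^ k) 0 (PI / 2))
    by (intros c k; apply (ex_RInt_scal (V := R_NormedModule) (fun t => sin t ^ k)), ex_RInt_sin_pow).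
  rewrite (RInt_minus (V := R_CompleteNormedModule) (fun t => INR (S (S n)) * sin t ^ S (S n)) (fun t => INR (S n) * sin t ^ n)) in A
    by apply Ex.
  assert (Sc : forall c k, RInt (fun t => c * sin t ^ k) 0 (PI / 2) = c * RInt (fun t => sin t ^ k) 0 (PI / 2)).
  { intros c k. apply (RInt_scal (V := R_CompleteNormedModule) (fun t => sin t ^ k)). apply ex_RInt_sin_pow. }
  rewrite !Sc, IH1 in A. unfold minus, plus, opp in A; simpl in A.
  change (wallis (S (S n))) with (INR (S n) / INR (S (S n)) * wallis n).
  assert (P := INR_S_pos (S n)). apply Rmult_eq_reg_l with (INR (S (S n))); [|lra].
  unfold Rdiv. rewrite <- !Rmult_assoc, (Rmult_comm (INR (S (S n))) (INR (S n))), (Rmult_assoc (INR (S n))), Rinv_r, Rmult_1_r by lra.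
  simpl. simpl in A. lra.
Qed.

Lemma wallis_decr n : 0 < wallis (S n) <= wallis n.
Proof.
split.
- assert (G : forall n, 0 < wallis n /\ 0 < wallis (S n)).
  { induction n0 as [|k [I1 I2]]; [simpl; assert (P := PI_RGT_0); lra|]. split; auto.
    change (wallis (S (S k))) with (INR (S k) / INR (S (S k)) * wallis k).
    apply Rmult_lt_0_compat; auto. apply Rdiv_lt_0_compat; apply INR_S_pos. }
  apply G.
- destruct (wallis_RInt n) as [<- <-]. assert (P := PI_RGT_0).
  apply RInt_le; [lra|apply ex_RInt_sin_pow|apply ex_RInt_sin_pow|]. intros x Hx.
  assert (S1 : 0 <= sin x) by (apply sin_ge_0; lra). assert (S2 := SIN_bound x).
  assert (0 <= sin x ^ n) by (apply pow_le; auto). simpl. nra.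
Qed.

Lemma wallis_prod n : INR (S n) * (wallis n * wallis (S n)) = PI / 2.
Proof.
induction n; [simpl; lra|]. rewrite <- IHn.
change (wallis (S (S n))) with (INR (S n) / INR (S (S n)) * wallis n).
assert (P := INR_S_pos (S n)). field. lra.
Qed.

(** Monotonicity squeezes the square between products of consecutive terms, whose values
    [wallis_prod] gives. *)
Lemma wallis_bounds n : PI / 2 <= INR (S (S n)) * wallis (S n) ^ 2 <= PI / 2 + PI / 2 * / INR (S n).
Proof.
assert (P := INR_S_pos n). assert (PP := PI_RGT_0).
assert (A := wallis_prod n). assert (B := wallis_prod (S n)).
destruct (wallis_decr n) as [D1 D2]. destruct (wallis_decr (S n)) as [D3 D4].
rewrite (S_INR (S n)) in *. set (x := INR (S n)) in *. set (u := wallis n) in *. set (v := wallis (S n)) in *.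
set (w := wallis (S (S n))) in *. simpl. rewrite Rmult_1_r. split.
- rewrite <- B. apply Rmult_le_compat_l; [lra|]. apply Rmult_le_compat_l; lra.
- apply Rle_trans with ((x + 1) * (u * v)); [apply Rmult_le_compat_l; [lra|nra]|].
  rewrite <- A. right. field. lra.
Qed.

Lemma wallis_odd n : wallis (2 * n + 1) = 4 ^ n * INR (fact n) ^ 2 / INR (fact (2 * n + 1)).
Proof.
induction n; [simpl; field|].
replace (2 * S n + 1)%nat with (S (S (2 * n + 1))) by lia.
change (wallis (S (S (2 * n + 1)))) with (INR (S (2 * n + 1)) / INR (S (S (2 * n + 1))) * wallis (2 * n + 1)).
rewrite IHn, !fact_simpl, !mult_INR. replace (S (2 * n + 1)) with (2 * (n + 1))%nat by lia.
assert (P := INR_fact_neq_0 (2 * n + 1)). assert (P2 := INR_S_pos (2 * (n + 1))).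
assert (P3 := INR_S_pos n). assert (P4 : INR (2 * (n + 1)) = 2 * INR (S n)) by (replace (n + 1)%nat with (S n) by lia; rewrite mult_INR; f_equal; simpl; lra).
rewrite P4. change (4 ^ S n) with (4 * 4 ^ n). set (x := INR (S n)) in *. field. repeat split; first [assumption|lra].
Qed.


Lemma ln_sandwich (x u : R) : 0 < x -> x - 1 <= u -> / x - 1 <= u -> Rabs (ln x) <= u.
Proof.
intros Hx H1 H2. assert (L : forall y, 0 < y -> ln y <= y - 1).
{ intros y Hy. assert (T := exp_ineq1_le (ln y)). rewrite exp_ln in T; lra. }
assert (A := L x Hx). assert (B := L (/ x) (Rinv_0_lt_compat x Hx)). rewrite ln_Rinv in B by auto.
apply Rabs_le. lra.
Qed.

Lemma ln_wallis n : (1 <= n)%nat -> 2 * ln (wallis (2 * n + 1)) + ln (INR (2 * n + 2)) =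
  2 * (2 * stir n - stir (2 * n)) + ln (4 * (INR n * (INR n + 1)) / (2 * INR n + 1) ^ 2) - ln 4.
Proof.
intros Hn. assert (NP : 1 <= INR n) by (apply (le_INR 1); auto).
assert (F : forall k, 0 < INR (fact k)) by (intros; apply lt_0_INR, lt_O_fact).
rewrite wallis_odd. replace (2 * n + 1)%nat with (S (2 * n)) by lia.
rewrite fact_simpl, mult_INR. unfold stir. rewrite S_INR, !plus_INR, !mult_INR. simpl (INR 2).
replace (1 + 1) with 2 by ring.
assert (E4 : ln 4 = 2 * ln 2) by (replace 4 with (2 * 2) by ring; rewrite ln_mult by lra; ring).
assert (F1 := F n). assert (F2 := F (2 * n)%nat).
assert (P4 : 0 < 4 ^ n) by (apply pow_lt; lra).
assert (Ef : 0 < INR (fact n) ^ 2) by (apply pow_lt; auto).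
unfold Rdiv. rewrite !(ln_mult _ (/ _)), !ln_Rinv, (ln_mult (4 ^ n)), ln_pow, (ln_mult (2 * INR n + 1)) by
  first [assumption | apply Rmult_lt_0_compat; first [assumption | nra] | apply Rinv_0_lt_compat; first [apply pow_lt; lra | nra] | apply pow_lt; lra | lra | nra].
simpl (INR (fact n) ^ 2). simpl ((2 * INR n + 1) ^ 2). rewrite !Rmult_1_r.
replace (2 * INR n + 2) with (2 * (INR n + 1)) by ring.
rewrite !ln_mult by (first [lra | nra]). rewrite E4. field.
Qed.

(** In [ln_wallis] the left side tends to log (pi/2) and the right side to 2 T - log 4. Every
    estimate is O(1/n), with total constant 250 + 2, rounded up to 260. *)
Lemma stir_value (T : R) : (forall N, (1 <= N)%nat -> Rabs (stir N - T) <= 50 * eps N) -> exp (2 * T) = 2 * PI.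
Proof.
intros H. assert (PP := PI_RGT_0).
enough (E : 2 * T = ln (2 * PI)) by (rewrite E, exp_ln; lra).
apply Rminus_diag_uniq.
enough (A : Rabs (2 * T - ln (2 * PI)) <= 0) by (apply Rabs_le_between in A; lra).
apply (small_eps 260). intros n Hn. assert (NP : 1 <= INR n) by (apply (le_INR 1); auto).
assert (L := ln_wallis n Hn). assert (W := wallis_bounds (2 * n)). assert (Wp := proj1 (wallis_decr (2 * n))).
assert (H1 := H n Hn). assert (H2 := H (2 * n)%nat ltac:(lia)).
replace (S (2 * n)) with (2 * n + 1)%nat in * by lia. replace (S (2 * n + 1)) with (2 * n + 2)%nat in * by lia.
rewrite !plus_INR, !mult_INR in *. simpl (INR 2) in *. simpl (INR 1) in *. replace (1 + 1) with 2 in * by ring.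
set (x := INR n) in *. set (w := wallis (2 * n + 1)) in *.
assert (I : 0 < / x) by (apply Rinv_0_lt_compat; lra).
assert (I2 : / (2 * x) = / 2 * / x) by (field; lra). rewrite I2 in H2.
assert (I3 : 0 < / (2 * x + 1) <= / x) by (split; [apply Rinv_0_lt_compat; lra|apply Rinv_le_contravar; lra]).
assert (Lw : 2 * ln w + ln (2 * x + 2) = ln ((2 * x + 2) * w ^ 2)).
{ rewrite ln_mult, ln_pow by (try apply pow_lt; lra). simpl INR. ring. }
set (q := (2 * x + 2) * w ^ 2 / (PI / 2)).
assert (Eq : (2 * x + 2) * w ^ 2 = q * (PI / 2)) by (unfold q; field; lra).
rewrite Eq in W.
assert (Hq1 : 1 <= q) by nra. assert (Hq2 : q <= 1 + / (2 * x + 1)) by nra.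
assert (Lq : Rabs (ln q) <= / x).
{ apply ln_sandwich; [lra|lra|]. assert (/ q <= 1) by (rewrite <- Rinv_1; apply Rinv_le_contravar; lra). lra. }
rewrite Lw, Eq in L. rewrite ln_mult in L by lra.
assert (Lr : Rabs (ln (4 * (x * (x + 1)) / (2 * x + 1) ^ 2)) <= / x).
{ assert (P1 : 0 < (2 * x + 1) ^ 2) by (apply pow_lt; lra).
  assert (P2 : 0 < 4 * (x * (x + 1))) by nra. apply ln_sandwich.
  - apply Rdiv_lt_0_compat; auto.
  - apply Rle_trans with 0; [|lra]. apply Rle_minus. apply Rmult_le_reg_r with ((2 * x + 1) ^ 2); auto.
    unfold Rdiv. rewrite Rmult_assoc, Rinv_l by lra. nra.
  - replace (/ (4 * (x * (x + 1)) / (2 * x + 1) ^ 2) - 1) with (/ (4 * (x * (x + 1)))) by (field; lra).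
    apply Rinv_le_contravar; nra. }
assert (Ep : ln (2 * PI) = ln (PI / 2) + ln 4) by (rewrite <- ln_mult by lra; f_equal; field).
rewrite Ep. apply Rabs_le_between in Lq. apply Rabs_le_between in Lr. apply Rabs_le_between in H1. apply Rabs_le_between in H2.
apply Rabs_le. lra.
Qed.

(** * Laplace's method *)

Lemma small_eta (B c : R) : (forall N, (1 <= N)%nat -> c <= B * eta N) -> c <= 0.
Proof.
intros H. apply (small_eps B). intros N HN. specialize (H (N * N)%nat ltac:(nia)).
replace (eta (N * N)) with (eps N) in H; auto.
assert (NP : 1 <= INR N) by (apply (le_INR 1); auto). assert (I := eps_bounds N HN).
unfold eta. rewrite mult_INR, Rinv_mult, sqrt_square; lra.
Qed.

Lemma aseq_plus u v : aseq u -> aseq v -> aseq (fun N => u N + v N)%C.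
Proof. intros H1 H2 L. apply aord_plus; auto. Qed.

Lemma aseq_mult u v : aseq u -> aseq v -> aseq (fun N => u N * v N)%C.
Proof. intros H1 H2 L. apply aord_mult; auto. Qed.

Lemma aseq_const (c : C) : aseq (fun _ => c).
Proof. intros L. apply aord_const. Qed.

Lemma aseq_eps u : aseq u -> aseq (fun N => RtoC (eps N) * u N)%C.
Proof. intros H L. apply (aord_weaken (S L)); [lia|]. apply aord_eps. auto. Qed.

Lemma aseq_ext u v : (forall N, (1 <= N)%nat -> u N = v N) -> aseq u -> aseq v.
Proof. intros E H L. apply (aord_ext L u); auto. Qed.

Lemma ccont_RtoC s : ccont RtoC s.
Proof. exact (cder_cont _ _ _ (cder_RtoC s)). Qed.

Lemma ccont_qv N s : ccont (fun s => RtoC (qv N s)) s.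
Proof. eapply cder_cont. apply cder_real. auto_derive; [auto|reflexivity]. Qed.

Lemma isQ_ccont P : isQ P -> forall N s, ccont (P N) s.
Proof.
induction 1 as [c'|F HF IH|F HF IH|F HF IH|F G HF IHF HG IHG|F G HF IHF E]; intros N s.
- apply gcont_const.
- apply gcont_mult; [apply gcont_const|apply IH].
- apply gcont_mult; [apply ccont_RtoC|apply IH].
- apply gcont_mult; [apply ccont_qv|apply IH].
- apply gcont_plus; [apply IHF|apply IHG].
- apply (gcont_ext _ _ (F N)); [intros; apply E|apply IHF].
Qed.

Section Laplace.
Variables (dl : R) (al : C).
Hypothesis Hdl : 0 < dl <= 1.
Hypothesis Hal : 0 < Re al.

(** The factor sqrt N normalizes the Gaussian integral, so that it has a nonzero limit. *)
Definition laplace (H : nat -> R -> C) (N : nat) : C :=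
  (RtoC (sqrt (INR N)) * CInt (fun s => H N s * cexp (- al * RtoC (qv N s)))%C (- dl) dl)%C.

Lemma ccont_qexp N s : ccont (fun s => cexp (- al * RtoC (qv N s))) s.
Proof. apply ccont_gauss. Qed.

Lemma laplace_ext H G N : (forall s, Rabs s <= dl -> H N s = G N s) -> laplace H N = laplace G N.
Proof.
intros E. unfold laplace. f_equal. apply CInt_ext; [lra|]. intros s Hs. rewrite E; auto.
apply Rabs_le. lra.
Qed.

Lemma laplace_plus H G N : ccont_on (H N) (- dl) dl -> ccont_on (G N) (- dl) dl ->
  laplace (fun N s => H N s + G N s)%C N = (laplace H N + laplace G N)%C.
Proof.
intros CH CG. unfold laplace. rewrite <- Cmult_plus_distr_l. f_equal.
rewrite <- CInt_plus; [|lra| |].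
- apply CInt_ext; [lra|]. intros s _. ring.
- intros s Hs. apply gcont_mult; [apply CH; auto|apply ccont_qexp].
- intros s Hs. apply gcont_mult; [apply CG; auto|apply ccont_qexp].
Qed.

Lemma laplace_scal (c : nat -> C) H N : ccont_on (H N) (- dl) dl ->
  laplace (fun N s => c N * H N s)%C N = (c N * laplace H N)%C.
Proof.
intros CH. unfold laplace. rewrite (CInt_ext _ (fun s => c N * (H N s * cexp (- al * RtoC (qv N s))))%C).
- rewrite CInt_scal; [ring|lra|]. intros s Hs. apply gcont_mult; [apply CH; auto|apply ccont_qexp].
- lra.
- intros s _. ring.
Qed.

Definition moment (n : nat) : nat -> C := laplace (fun _ s => RtoC (s ^ n)).

Lemma ccont_pow n s : ccont (fun s => RtoC (s ^ n)) s.
Proof. eapply cder_cont. apply cder_real. auto_derive; [auto|reflexivity]. Qed.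

(** The boundary term of the integration by parts in [moment_rec]; it is exponentially small in
    N. *)
Definition bdry (n N : nat) : C :=
  (RtoC (sqrt (INR N)) * ((RtoC (dl ^ n) - RtoC ((- dl) ^ n)) * cexp (- al * RtoC (qv N dl))))%C.

Lemma al_neq_0 : al <> 0%C.
Proof. intros E. rewrite E in Hal. unfold Re in Hal; simpl in Hal. lra. Qed.

Lemma moment_rec n N : (1 <= N)%nat ->
  (2 * al * RtoC (INR N) * moment (S (S n)) N)%C = (RtoC (INR (S n)) * moment n N - bdry (S n) N)%C.
Proof.
intros HN. unfold moment, laplace, bdry.
set (w := fun s => cexp (- al * RtoC (qv N s))).
assert (DF : forall s, cder (fun s => RtoC (s ^ S n) * w s)%C s
   (RtoC (INR (S n)) * (RtoC (s ^ n) * w s) + (- 2 * al * RtoC (INR N)) * (RtoC (s ^ S (S n)) * w s))%C).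
{ intros s. eapply gder_eq.
  - apply gder_mult; [apply (cder_real (fun s => s ^ S n) s (INR (S n) * s ^ n))|].
    + auto_derive; auto. change (match n with 0%nat => 1 | S _ => INR n + 1 end) with (INR (S n)). ring.
    + apply (cder_gauss_comp al (fun s => qv N s) s (INR N * (2 * s))). auto_derive; auto. ring.
  - cbv beta. fold (w s). rewrite !RtoC_mult.
    replace (RtoC (s ^ S (S n))) with (RtoC s * RtoC (s ^ S n))%C by (rewrite <- RtoC_mult; reflexivity). ring. }
assert (CI : forall k, ccont_on (fun s => RtoC (s ^ k) * w s)%C (- dl) dl).
{ intros k s _. apply gcont_mult; [apply ccont_pow|apply ccont_qexp]. }
assert (E := CInt_FTC _ _ (- dl) dl ltac:(lra) (fun t _ => DF t)).
rewrite CInt_plus, !CInt_scal in E; try lra; auto.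
- assert (Ew : w (- dl) = w dl) by (unfold w; do 3 f_equal; ring). rewrite Ew in E.
  specialize (E ltac:(intros t Ht; apply gcont_plus; apply gcont_mult; first [apply gcont_const | apply CI; auto])).
  fold (w dl). change (fun s => RtoC (s ^ n) * cexp (- al * RtoC (qv N s)))%C with (fun s => RtoC (s ^ n) * w s)%C.
  change (fun s => RtoC (s ^ S (S n)) * cexp (- al * RtoC (qv N s)))%C with (fun s => RtoC (s ^ S (S n)) * w s)%C.
  set (A := CInt (fun s => RtoC (s ^ n) * w s)%C (- dl) dl) in *.
  set (B := CInt (fun s => RtoC (s ^ S (S n)) * w s)%C (- dl) dl) in *.
  transitivity (RtoC (sqrt (INR N)) * (RtoC (INR (S n)) * A - (RtoC (INR (S n)) * A + - 2 * al * INR N * B)))%C; [ring|].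
  rewrite E. ring.
- intros s Hs. apply gcont_mult; [apply gcont_const|apply CI; auto].
- intros s Hs. apply gcont_mult; [apply gcont_const|apply CI; auto].
Qed.

Lemma moment_1 N : (1 <= N)%nat -> moment 1 N = 0%C.
Proof.
intros HN. assert (NP : 1 <= INR N) by (apply (le_INR 1); auto).
unfold moment, laplace. set (w := fun s => cexp (- al * RtoC (qv N s))).
set (c := (- 2 * al * RtoC (INR N))%C).
assert (Hc : c <> 0%C).
{ unfold c. apply Cmult_neq_0; [apply Cmult_neq_0; [|exact al_neq_0]|].
  - intros E. apply (f_equal Re) in E. unfold Re in E; simpl in E. lra.
  - intros E. apply RtoC_inj in E. lra. }
assert (E := CInt_FTC w (fun s => c * (RtoC (s ^ 1) * w s))%C (- dl) dl ltac:(lra)).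
rewrite CInt_scal in E.
- assert (Ew : w (- dl) = w dl) by (unfold w; do 3 f_equal; ring). rewrite Ew in E.
  replace (w dl - w dl)%C with (RtoC 0) in E by ring.
  change (fun s => RtoC (s ^ 1) * cexp (- al * RtoC (qv N s)))%C with (fun s => RtoC (s ^ 1) * w s)%C.
  assert (X := E ltac:(intros t _; eapply gder_eq;
     [apply (cder_gauss_comp al (fun s => qv N s) t (INR N * (2 * t))); auto_derive; auto; ring|
      fold (w t); unfold c; rewrite !RtoC_mult; replace (t ^ 1) with t by ring; ring])
     ltac:(intros t _; apply gcont_mult; [apply gcont_const|apply gcont_mult; [apply ccont_pow|apply ccont_qexp]])).
  set (A := CInt (fun s => RtoC (s ^ 1) * w s)%C (- dl) dl) in *.
  replace A with (/ c * (c * A))%C by (field; auto). rewrite X. ring.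
- lra.
- intros t _. apply gcont_mult; [apply ccont_pow|apply ccont_qexp].
Qed.

Lemma Cmod_gI_le V : 0 <= V -> Cmod (gI al V) <= 2 * V.
Proof.
intros HV. unfold gI. rewrite Cmod_mult, Cmod_R, Rabs_pos_eq by auto.
assert (T : Cmod (CInt (fun t => cexp (- al * RtoC (V ^ 2 * t ^ 2))) 0 1) <= 2 * 1 * (1 - 0)).
{ apply CInt_bound_const; [lra|intros t _; apply ccont_gauss|]. intros t _. rewrite (Cmod_gauss al).
  rewrite <- exp_0. apply exp_le. assert (0 <= V ^ 2 * t ^ 2) by (apply Rmult_le_pos; apply pow2_ge_0). nra. }
nra.
Qed.

Lemma moment_0 N : (1 <= N)%nat -> moment 0 N = (2 * gI al (sqrt (INR N) * dl))%C.
Proof.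
intros HN. unfold moment, laplace. set (r := sqrt (INR N)).
assert (Er : r ^ 2 = INR N) by (simpl; rewrite Rmult_1_r; apply sqrt_sqrt, pos_INR).
transitivity (gI al (r * dl) - gI al (r * - dl))%C.
- rewrite <- (CInt_FTC (fun s => gI al (r * s)) (fun s => RtoC r * (RtoC (s ^ 0) * cexp (- al * RtoC (qv N s))))%C (- dl) dl).
  + rewrite CInt_scal; [reflexivity|lra|]. intros s _. apply gcont_mult; [apply ccont_pow|apply ccont_qexp].
  + lra.
  + intros t _.
    eapply gder_eq; [apply (cder_comp_real (gI al) (fun s => r * s) t _ r (cder_gI al (r * t)))|].
    * auto_derive; auto. ring.
    * cbv beta. replace ((r * t) ^ 2) with (qv N t) by (rewrite <- Er; ring). simpl pow. ring.
  + intros t _. apply gcont_mult; [apply gcont_const|apply gcont_mult; [apply ccont_pow|apply ccont_qexp]].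
- replace (r * - dl) with (- (r * dl)) by ring. rewrite gI_odd. ring.
Qed.

Variable M : C.
Hypothesis HM : forall V, 1 <= V -> Cmod (gI al V - M) <= 4 / Re al * exp (- (Re al * V)).

Lemma gI_M : exists B, 0 <= B /\ forall V, 0 <= V -> Cmod (gI al V - M) <= B * exp (- (Re al * V)).
Proof.
exists (4 / Re al + (2 + Cmod M) * exp (Re al)).
assert (Pa : 0 < 4 / Re al) by (apply Rdiv_lt_0_compat; lra).
assert (Pm := Cmod_ge_0 M). assert (Pe := exp_pos (Re al)).
assert (P1 : 0 <= (2 + Cmod M) * exp (Re al)) by nra.
split; [lra|]. intros V HV. assert (PV := exp_pos (- (Re al * V))).
destruct (Rle_lt_dec 1 V) as [H|H].
- eapply Rle_trans; [apply HM; auto|]. nra.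
- assert (G := Cmod_gI_le V HV).
  apply Rle_trans with (2 + Cmod M); [eapply Rle_trans; [apply Cmod_triangle|]; rewrite Cmod_opp; lra|].
  assert (X : 1 <= exp (Re al) * exp (- (Re al * V))).
  { rewrite <- exp_plus, <- exp_0 at 1. apply exp_le. nra. }
  nra.
Qed.

Lemma sqrt_le_id x : 1 <= x -> 1 <= sqrt x <= x.
Proof.
intros H. split; [rewrite <- sqrt_1; apply sqrt_le_1; lra|].
assert (E : sqrt x * sqrt x = x) by (apply sqrt_sqrt; lra).
assert (1 <= sqrt x) by (rewrite <- sqrt_1; apply sqrt_le_1; lra). nra.
Qed.

Lemma esmall_scaled_bdry k n : esmall (fun N => RtoC (INR N ^ k) * bdry n N)%C.
Proof.
apply (esmall_exp _ 2 (Re al * dl ^ 2) (S k)); [apply Rmult_lt_0_compat; [exact Hal|apply pow_lt; lra]|lra|].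
intros N HN. assert (NP : 1 <= INR N) by (apply (le_INR 1); auto).
destruct (sqrt_le_id (INR N) NP) as [S1 S2].
unfold bdry. rewrite !Cmod_mult, !Cmod_R, (Cmod_gauss al), (Rabs_pos_eq (sqrt _)) by lra.
rewrite Rabs_pos_eq by (apply pow_le; lra).
assert (E : exp (- (Re al * qv N dl)) <= exp (- (Re al * dl ^ 2 * sqrt (INR N)))).
{ apply exp_le. apply Ropp_le_contravar. rewrite Rmult_assoc. apply Rmult_le_compat_l; [lra|].
  assert (0 <= dl ^ 2) by apply pow2_ge_0. nra. }
assert (D : Cmod (RtoC (dl ^ n) - RtoC ((- dl) ^ n)) <= 2).
{ assert (P : forall x, Rabs x <= 1 -> Rabs (x ^ n) <= 1).
  { intros x Hx. rewrite <- RPow_abs, <- (pow1 n). apply pow_incr. split; [apply Rabs_pos|auto]. }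
  eapply Rle_trans; [apply Cmod_triangle|]. rewrite Cmod_opp, !Cmod_R.
  assert (A1 := P dl ltac:(apply Rabs_le; lra)). assert (A2 := P (- dl) ltac:(apply Rabs_le; lra)). lra. }
assert (Pk : 0 < INR N ^ k) by (apply pow_lt; lra). assert (Pe := exp_pos (- (Re al * qv N dl))).
set (e1 := exp (- (Re al * qv N dl))) in *. set (e2 := exp (- (Re al * dl ^ 2 * sqrt (INR N)))) in *.
replace (2 * INR N ^ S k * e2) with (INR N ^ k * (INR N * (2 * e2))) by (simpl; ring).
apply Rmult_le_compat_l; [lra|]. apply Rmult_le_compat; try lra.
- apply Rmult_le_pos; [apply Cmod_ge_0|lra].
- apply Rmult_le_compat; try lra. apply Cmod_ge_0.
Qed.

Lemma moment_step n N : (1 <= N)%nat ->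
  (RtoC (INR N) * moment (S (S n)) N)%C = (RtoC (INR (S n) / 2) * / al * moment n N + RtoC (- / 2) * / al * bdry (S n) N)%C.
Proof.
intros HN. assert (E := moment_rec n N HN). assert (A := al_neq_0).
replace (RtoC (INR N) * moment (S (S n)) N)%C with (/ 2 * / al * (2 * al * RtoC (INR N) * moment (S (S n)) N))%C
  by (field; auto).
rewrite E. unfold Rdiv. rewrite RtoC_mult, RtoC_opp, RtoC_inv by lra. ring.
Qed.

(** The zeroth moment is a constant up to an exponentially small tail, and the first vanishes by
    symmetry. Integration by parts ([moment_step]) trades a factor N s^2 for a constant, which gives
    the higher moments and then the powers N^k. *)
Lemma scaled_moment_aseq k : forall i, aseq (fun N => RtoC (INR N ^ k) * moment (i + 2 * k) N)%C.
Proof.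
induction k.
- enough (G : forall i, aseq (moment i) /\ aseq (moment (S i))).
  { intros i. replace (i + 2 * 0)%nat with i by lia. apply (aseq_ext (moment i)); [|apply (G i)].
    intros N HN. change (INR N ^ 0) with 1. set (u := moment i N). ring. }
  assert (A := al_neq_0).
  induction i as [|i [I1 I2]].
  + split.
    * destruct gI_M as [B [HB HG]].
      apply (aseq_ext (fun N => 2 * M + 2 * (gI al (sqrt (INR N) * dl) - M))%C).
      { intros N HN. rewrite moment_0 by auto. ring. }
      apply aseq_plus; [apply aseq_const|]. apply esmall_aseq.
      apply (esmall_exp _ (2 * B) (Re al * dl) 0); [nra|lra|]. intros N HN.
      rewrite Cmod_mult, Cmod_R, (Rabs_pos_eq 2) by lra. simpl. rewrite Rmult_1_r, Rmult_assoc.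
      apply Rmult_le_compat_l; [lra|]. eapply Rle_trans; [apply HG|].
      { apply Rmult_le_pos; [apply sqrt_pos|lra]. }
      right. f_equal. f_equal. ring.
    * apply (aseq_ext (fun _ => 0%C)); [intros; rewrite moment_1; auto|apply aseq_const].
  + split; auto.
    apply (aseq_ext (fun N => RtoC (eps N) * (RtoC (INR (S i) / 2) * / al * moment i N + RtoC (- / 2) * / al * (RtoC (INR N ^ 0) * bdry (S i) N)))%C).
    { intros N HN. replace (RtoC (INR N ^ 0) * bdry (S i) N)%C with (bdry (S i) N) by (simpl; ring).
      rewrite <- moment_step by auto. rewrite Cmult_assoc, <- RtoC_mult, eps_INR by auto. ring. }
    apply aseq_eps, aseq_plus.
    * apply (aseq_mult (fun _ => RtoC (INR (S i) / 2) * / al)%C); [apply aseq_const|auto].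
    * apply (aseq_mult (fun _ => RtoC (- / 2) * / al)%C); [apply aseq_const|]. apply esmall_aseq, esmall_scaled_bdry.
- intros i.
  apply (aseq_ext (fun N => RtoC (INR (S (i + 2 * k)) / 2) * / al * (RtoC (INR N ^ k) * moment (i + 2 * k) N)
     + RtoC (- / 2) * / al * (RtoC (INR N ^ k) * bdry (S (i + 2 * k)) N))%C).
  { intros N HN. replace (i + 2 * S k)%nat with (S (S (i + 2 * k))) by lia.
    transitivity (RtoC (INR N ^ k) * (RtoC (INR N) * moment (S (S (i + 2 * k))) N))%C.
    - rewrite moment_step by auto. ring.
    - simpl. rewrite RtoC_mult. ring. }
  apply aseq_plus.
  + apply (aseq_mult (fun _ => RtoC (INR (S (i + 2 * k)) / 2) * / al)%C); [apply aseq_const|apply IHk].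
  + apply (aseq_mult (fun _ => RtoC (- / 2) * / al)%C); [apply aseq_const|]. apply esmall_aseq, esmall_scaled_bdry.
Qed.

(** Generalized over a prefix s^i q^k, so that the induction only moves factors of the polynomial
    into the prefix. *)
Lemma laplace_isQ_monomial P : isQ P -> forall i k, aseq (laplace (fun N s => RtoC (s ^ i) * (RtoC (qv N s ^ k) * P N s))%C).
Proof.
assert (CM : forall i k P N, isQ P -> ccont_on (fun s => RtoC (s ^ i) * (RtoC (qv N s ^ k) * P N s))%C (- dl) dl).
{ intros i k P0 N HP s _. apply gcont_mult; [apply ccont_pow|apply gcont_mult; [|apply isQ_ccont; auto]].
  eapply cder_cont. apply cder_real. auto_derive; [auto|reflexivity]. }
induction 1 as [c|F HF IH|F HF IH|F HF IH|F G HF IHF HG IHG|F G HF IHF E]; intros i k.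
- apply (aseq_ext (fun N => c * (RtoC (INR N ^ k) * moment (i + 2 * k) N))%C).
  + intros N HN. unfold moment.
    rewrite <- (laplace_scal (fun N => RtoC (INR N ^ k)) (fun _ s => RtoC (s ^ (i + 2 * k)))) by (intros s _; apply ccont_pow).
    rewrite <- (laplace_scal (fun _ => c) (fun N s => RtoC (INR N ^ k) * RtoC (s ^ (i + 2 * k)))%C).
    * apply laplace_ext. intros s _. rewrite Rpow_mult_distr, <- pow_mult, pow_add, !RtoC_mult. ring.
    * intros s _. apply gcont_mult; [apply gcont_const|apply ccont_pow].
  + apply (aseq_mult (fun _ => c)); [apply aseq_const|apply scaled_moment_aseq].
- apply (aseq_ext (fun N => RtoC (eps N) * laplace (fun N s => RtoC (s ^ i) * (RtoC (qv N s ^ k) * F N s)) N)%C); [|apply aseq_eps, IH].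
  intros N HN. rewrite <- (laplace_scal (fun N => RtoC (eps N))) by (apply CM; auto). apply laplace_ext. intros s _. ring.
- apply (aseq_ext (laplace (fun N s => RtoC (s ^ S i) * (RtoC (qv N s ^ k) * F N s))%C)); [|apply IH].
  intros N HN. apply laplace_ext. intros s _. simpl. rewrite RtoC_mult. ring.
- apply (aseq_ext (laplace (fun N s => RtoC (s ^ i) * (RtoC (qv N s ^ S k) * F N s))%C)); [|apply IH].
  intros N HN. apply laplace_ext. intros s _. rewrite <- tech_pow_Rmult, (RtoC_mult (qv N s)). ring.
- apply (aseq_ext (fun N => laplace (fun N s => RtoC (s ^ i) * (RtoC (qv N s ^ k) * F N s)) N +
     laplace (fun N s => RtoC (s ^ i) * (RtoC (qv N s ^ k) * G N s)) N)%C); [|apply aseq_plus; auto].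
  intros N HN. rewrite <- laplace_plus by (apply CM; auto). apply laplace_ext. intros s _. ring.
- apply (aseq_ext (laplace (fun N s => RtoC (s ^ i) * (RtoC (qv N s ^ k) * F N s))%C)); [|apply IHF].
  intros N HN. apply laplace_ext. intros s _. rewrite E. ring.
Qed.

Lemma laplace_isQ P : isQ P -> aseq (laplace P).
Proof.
intros H. apply (aseq_ext (laplace (fun N s => RtoC (s ^ 0) * (RtoC (qv N s ^ 0) * P N s))%C)).
- intros N HN. apply laplace_ext. intros s _. simpl. ring.
- apply laplace_isQ_monomial; auto.
Qed.

Variable b : R.
Hypothesis Hb : 0 <= b < Re al.

Lemma laplace_bound D : exists K, 0 <= K /\ forall H B N, (1 <= N)%nat -> 0 <= B -> ccont_on (H N) (- dl) dl ->
  (forall s, Rabs s <= dl -> Cmod (H N s) <= B * (1 + qv N s) ^ D * exp (b * qv N s)) ->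
  Cmod (laplace H N) <= K * B.
Proof.
(* Half of the spare rate Re al - b absorbs the power of 1 + q; the other half leaves an integrable
   Gaussian. *)
set (c := (Re al - b) / 2). assert (Hc : 0 < c) by (unfold c; lra).
destruct (pow_exp_bound D c Hc) as [E [HE0 HE]].
assert (Sc : 0 < sqrt c) by (apply sqrt_lt_R0; auto).
exists (2 * E * (PI / sqrt c)). split.
{ assert (P := PI_RGT_0). apply Rmult_le_pos; [lra|]. apply Rdiv_le_0_compat; lra. }
intros H B N HN HB CH HH. destruct (gauss_bound c dl N Hc (proj1 Hdl) HN) as [Ex G].
unfold laplace. rewrite Cmod_mult, Cmod_R, Rabs_pos_eq by apply sqrt_pos.
assert (T : Cmod (CInt (fun s => H N s * cexp (- al * RtoC (qv N s)))%C (- dl) dl) <=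
  2 * RInt (fun s => (B * E) * exp (- (c * qv N s))) (- dl) dl).
{ apply CInt_bound; [lra| | |].
  - intros s Hs. apply gcont_mult; [apply CH; auto|apply ccont_qexp].
  - apply (ex_RInt_scal (V := R_NormedModule) (fun s => exp (- (c * qv N s)))). auto.
  - intros s Hs. rewrite Cmod_mult, (Cmod_gauss al). specialize (HH s ltac:(apply Rabs_le; lra)).
    assert (Q := qv_ge_0 N s). specialize (HE _ Q).
    set (q := qv N s) in *. assert (P1 := exp_pos (- (Re al * q))). assert (P2 := exp_pos (b * q)).
    assert (P3 := exp_pos (c * q)).
    assert (Ee : exp (- (c * q)) = exp (c * q) * (exp (b * q) * exp (- (Re al * q)))).
    { rewrite <- !exp_plus. f_equal. unfold c. field. }
    rewrite Ee. apply Rle_trans with (B * (1 + q) ^ D * exp (b * q) * exp (- (Re al * q))).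
    + apply Rmult_le_compat_r; lra.
    + replace (B * E * (exp (c * q) * (exp (b * q) * exp (- (Re al * q))))) with
        (B * (E * exp (c * q)) * exp (b * q) * exp (- (Re al * q))) by ring.
      apply Rmult_le_compat_r; [lra|]. apply Rmult_le_compat_r; [lra|]. apply Rmult_le_compat_l; lra. }
rewrite (RInt_scal (V := R_CompleteNormedModule) (fun s => exp (- (c * qv N s)))) in T by auto.
unfold scal in T; simpl in T; unfold mult in T; simpl in T.
set (r := sqrt (INR N)) in *. set (I := RInt _ _ _) in *.
assert (Pr : 0 <= r) by apply sqrt_pos.
apply Rle_trans with (r * (2 * (B * E * I))); [apply Rmult_le_compat_l; auto|].
replace (r * (2 * (B * E * I))) with ((2 * E * B) * (r * I)) by ring.
replace (2 * E * (PI / sqrt c) * B) with ((2 * E * B) * (PI / sqrt c)) by ring.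
apply Rmult_le_compat_l; [apply Rmult_le_pos; lra|exact G].
Qed.

Theorem laplace_aseq H : asy dl b H -> (forall N, (1 <= N)%nat -> ccont_on (H N) (- dl) dl) -> aseq (laplace H).
Proof.
(* Order 2 L in eta = N^(-1/2) is order L in 1/N. *)
intros HH CH L. destruct (HH (2 * L)%nat) as [P [HP [B [D [HB HE]]]]].
destruct (laplace_bound D) as [K [HK HL]].
assert (CD : forall N, (1 <= N)%nat -> ccont_on (fun s => H N s + - 1 * P N s)%C (- dl) dl).
{ intros N HN s Hs. apply gcont_plus; [apply CH; auto|]. apply gcont_mult; [apply gcont_const|apply isQ_ccont; auto]. }
apply (aord_ext L (fun N => laplace P N + laplace (fun N s => H N s + - 1 * P N s) N)%C).
- intros N HN. rewrite <- laplace_plus; [|intros s _; apply isQ_ccont; auto|apply CD; auto].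
  apply laplace_ext. intros s _. ring.
- apply aord_plus; [apply laplace_isQ; auto|]. apply (aord_O (K * B)). intros N HN.
  rewrite Rmult_assoc. apply HL; auto.
  + apply Rmult_le_pos; auto. left. apply eps_pow_pos; auto.
  + intros s Hs. specialize (HE N s HN Hs). rewrite pow_mult, (proj2 (eta_bounds N HN)) in HE.
    eapply Rle_trans; [right|exact HE]. f_equal. ring.
Qed.

(** Identifies the leading coefficient: replacing [H] by its limit [h] costs O(eta), which is enough
    because the expansion is already known to exist. *)
Theorem laplace_limit H (h : C) (B : R) (D : nat) : 0 <= B -> (forall N, (1 <= N)%nat -> ccont_on (H N) (- dl) dl) ->
  (forall N s, (1 <= N)%nat -> Rabs s <= dl -> Cmod (H N s - h) <= B * eta N * (1 + qv N s) ^ D * exp (b * qv N s)) ->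
  exists K, 0 <= K /\ forall N, (1 <= N)%nat -> Cmod (laplace H N - h * (2 * M)) <= K * eta N.
Proof.
intros HB CH HH. destruct (laplace_bound D) as [K [HK HL]]. destruct gI_M as [B1 [HB1 HG]].
exists (K * B + Cmod h * (2 * B1) * / (Re al * dl)).
assert (Pd : 0 < / (Re al * dl)) by (apply Rinv_0_lt_compat; nra).
assert (Ph := Cmod_ge_0 h). assert (Pb : 0 <= Cmod h * (2 * B1) * / (Re al * dl)) by (apply Rmult_le_pos; [nra|lra]).
split; [nra|].
intros N HN. assert (CD : ccont_on (fun s => H N s + - h)%C (- dl) dl).
{ intros s Hs. apply gcont_plus; [apply CH; auto|apply gcont_const]. }
assert (E : laplace H N = (laplace (fun N s => H N s + - h) N + h * moment 0 N)%C).
{ unfold moment. rewrite <- (laplace_scal (fun _ => h) (fun _ s => RtoC (s ^ 0))) by (intros s _; apply ccont_pow).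
  rewrite <- laplace_plus; [|auto|intros s _; apply gcont_mult; [apply gcont_const|apply ccont_pow]].
  apply laplace_ext. intros s _. simpl. ring. }
rewrite E, moment_0 by auto. destruct (eta_bounds N HN) as [He1 He2].
set (V := sqrt (INR N) * dl). set (A := laplace _ N).
replace (A + h * (2 * gI al V) - h * (2 * M))%C with (A + h * (2 * (gI al V - M)))%C by ring.
eapply Rle_trans; [apply Cmod_triangle|]. rewrite Rmult_plus_distr_r. apply Rplus_le_compat.
- rewrite Rmult_assoc. apply HL; auto; [nra|]. intros s Hs. apply HH; auto.
- rewrite !Cmod_mult, Cmod_R, (Rabs_pos_eq 2) by lra. rewrite !Rmult_assoc. apply Rmult_le_compat_l; auto.
  apply Rmult_le_compat_l; [lra|].
  assert (NP : 1 <= INR N) by (apply (le_INR 1); auto).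
  assert (Sr : 0 < sqrt (INR N)) by (apply sqrt_lt_R0; lra).
  eapply Rle_trans; [apply HG; unfold V; nra|]. apply Rmult_le_compat_l; auto.
  rewrite exp_Ropp. unfold eta, V. rewrite sqrt_inv, <- Rinv_mult.
  apply Rinv_le_contravar; [apply Rmult_lt_0_compat; nra|].
  assert (T := exp_ineq1_le (Re al * (sqrt (INR N) * dl))). nra.
Qed.
End Laplace.

(** * The logarithm of the q-Pochhammer factors along the saddle ray *)

Lemma cder_CInt_end (f : R -> C) a x : (forall t, ccont f t) -> cder (fun x => CInt f a x) x (f x).
Proof.
intros H.
assert (G : forall p : R -> R, (forall t, continuous p t) -> is_derive (fun x => RInt p a x) x (p x)).
{ intros p Hp. apply (is_derive_RInt (V := R_NormedModule) p (fun x => RInt p a x) a x); [|apply Hp].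
  exists (mkposreal 1 Rlt_0_1). intros u _. apply (RInt_correct (V := R_CompleteNormedModule)).
  apply (ex_RInt_continuous (V := R_CompleteNormedModule)). intros t _. apply Hp. }
apply is_derive_cder; unfold CInt, Re, Im; cbn [fst snd]; apply G; intros t; apply (ccont_continuous _ _ (H t)).
Qed.

Section Saddle.
Variable z0 : C.
Hypothesis Hz : Re z0 < 0.

(** e_k(xi) is, up to the factor z0^k, the k-th derivative of e_0(xi) = (e^(xi z0) - 1) / (xi z0).
    The integral form is smooth through xi = 0 without a case distinction. *)
Definition ek (k : nat) (xi : R) : C := CInt (fun t => RtoC (t ^ k) * cexp (RtoC (xi * t) * z0))%C 0 1.

Lemma ccont_ek_integrand k xi t : ccont (fun t => RtoC (t ^ k) * cexp (RtoC (xi * t) * z0))%C t.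
Proof.
apply gcont_mult; [apply ccont_pow|]. eapply cder_cont.
apply (cder_comp_real (fun u => cexp (RtoC u * z0)) (fun t => xi * t)); [apply cder_cexp_line|].
auto_derive; [auto|reflexivity].
Qed.

Lemma cder_ek k xi : cder (ek k) xi (z0 * ek (S k) xi).
Proof.
set (F := fun p : C => (RtoC (Im p ^ k) * cexp (RtoC (Re p * Im p) * z0))%C).
set (F1 := fun p : C => (z0 * (RtoC (Im p ^ S k) * cexp (RtoC (Re p * Im p) * z0)))%C).
eapply gder_eq.
- apply (cder_CInt_param F F1 0 1 xi 1); try lra.
  + intros u t _ _. unfold F, F1, Re, Im; cbn [fst snd]. eapply gder_eq.
    * apply gder_mult; [apply gder_const|].
      apply (cder_comp_real (fun v => cexp (RtoC v * z0)) (fun u => u * t)); [apply cder_cexp_line|].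
      auto_derive; [auto|reflexivity].
    * cbv beta. simpl pow. rewrite !RtoC_mult. ring.
  + intros u _ t _. exact (ccont_ek_integrand k u t).
  + intros t _. destruct (Ccont_real2 xi t) as [C1 C2]. unfold F1.
    apply gcont_mult; [apply gcont_const|]. apply gcont_mult.
    * apply (gcont_ext _ _ (fun p : C => (RtoC (Im p)) ^ S k)%C); [intros p; now rewrite RtoC_pow|].
      assert (G : forall j, Ccont (fun p : C => (RtoC (Im p)) ^ j)%C (xi, t)).
      { induction j; [exact (gcont_const _ _ (1%C) _)|].
        exact (gcont_mult _ _ (fun p : C => RtoC (Im p)) (fun p : C => RtoC (Im p) ^ j)%C _ C2 IHj). }
      apply G.
    * apply (gcont_comp _ _ cexp); [apply Ccont_exp|]. apply gcont_mult; [|apply gcont_const].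
      apply (gcont_ext _ _ (fun p : C => RtoC (Re p) * RtoC (Im p))%C); [intros p; now rewrite RtoC_mult|].
      apply gcont_mult; assumption.
- unfold F1, ek, Re, Im; cbn [fst snd]. rewrite CInt_scal; [reflexivity|lra|].
  intros t _. exact (ccont_ek_integrand (S k) xi t).
Qed.

Lemma ek0_eq xi : (RtoC xi * z0 * ek 0 xi)%C = (cexp (RtoC xi * z0) - 1)%C.
Proof.
unfold ek. rewrite <- CInt_scal; [|lra|intros t _; exact (ccont_ek_integrand 0 xi t)].
rewrite (CInt_FTC (fun t => cexp (RtoC (xi * t) * z0))).
- rewrite Rmult_1_r, Rmult_0_r, Cmult_0_l, cexp_0. reflexivity.
- lra.
- intros t _. eapply gder_eq.
  + apply (cder_comp_real (fun u => cexp (RtoC u * z0)) (fun t => xi * t)); [apply cder_cexp_line|].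
    auto_derive; [auto|reflexivity].
  + cbv beta. simpl pow. rewrite Rmult_1_r. ring.
- intros t _. apply gcont_mult; [apply gcont_const|exact (ccont_ek_integrand 0 xi t)].
Qed.

Lemma ek0_0 : ek 0 0 = 1%C.
Proof.
unfold ek. rewrite (CInt_ext _ (fun _ => 1%C)).
- rewrite (CInt_FTC RtoC); [rewrite <- RtoC_minus; f_equal; ring|lra|intros; apply cder_RtoC|intros t _; apply gcont_const].
- lra.
- intros t _. rewrite Rmult_0_l, Cmult_0_l, cexp_0. simpl. ring.
Qed.

Lemma ek0_neq_0 xi : ek 0 xi <> 0%C.
Proof.
intros E. destruct (Req_dec xi 0) as [->|H].
- rewrite ek0_0 in E. apply RtoC_inj in E. lra.
- assert (X := ek0_eq xi). rewrite E in X.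
  assert (Y : cexp (RtoC xi * z0) = 1%C) by (apply Ceq_minus; rewrite <- X; ring).
  apply (f_equal Cmod) in Y. rewrite Cmod_cexp, Re_scal, Cmod_1, <- exp_0 in Y.
  apply exp_inv in Y. apply Rmult_integral in Y. destruct Y; lra.
Qed.

Lemma ek1_eq xi : (RtoC xi * z0 * ek 1 xi)%C = (cexp (RtoC xi * z0) - ek 0 xi)%C.
Proof.
assert (Z := Re_neg_nz z0 Hz).
assert (D1 : cder (fun x => RtoC x * z0 * ek 0 x)%C xi (z0 * ek 0 xi + RtoC xi * z0 * (z0 * ek 1 xi))).
{ eapply gder_eq; [apply gder_mult; [apply cder_line|apply cder_ek]|]. cbv beta; ring. }
assert (D2 : cder (fun x => RtoC x * z0 * ek 0 x)%C xi (z0 * cexp (RtoC xi * z0))).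
{ apply (gder_ext _ _ (fun x => cexp (RtoC x * z0) + - (1))%C); [intros; rewrite ek0_eq; reflexivity|].
  eapply gder_eq; [apply gder_plus; [apply cder_cexp_line|apply gder_const]|]. ring. }
assert (E : (z0 * ek 0 xi + RtoC xi * z0 * (z0 * ek 1 xi))%C = (z0 * cexp (RtoC xi * z0))%C).
{ destruct (cder_is_derive _ _ _ D1) as [A1 A2]. destruct (cder_is_derive _ _ _ D2) as [B1 B2].
  apply is_derive_unique in A1, A2, B1, B2. apply C_ext; congruence. }
replace (RtoC xi * z0 * ek 1 xi)%C with (/ z0 * (z0 * ek 0 xi + RtoC xi * z0 * (z0 * ek 1 xi)) - ek 0 xi)%C by (field; auto).
rewrite E. field. auto.
Qed.

(** The logarithmic derivative of e_0. *)
Definition dlam (xi : R) : C := (z0 * (ek 1 xi * / ek 0 xi))%C.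

Lemma cder_inv_ek0 xi : cder (fun x => / ek 0 x)%C xi (- (z0 * (ek 1 xi * (/ ek 0 xi * / ek 0 xi)))).
Proof.
eapply gder_eq; [apply (gder_comp _ _ Cinv (ek 0)); [apply Cder_inv, ek0_neq_0|apply cder_ek]|].
cbv beta. field. apply ek0_neq_0.
Qed.

Lemma ccont_dlam xi : ccont dlam xi.
Proof.
apply gcont_mult; [apply gcont_const|apply gcont_mult].
- exact (cder_cont _ _ _ (cder_ek 1 xi)).
- exact (cder_cont _ _ _ (cder_inv_ek0 xi)).
Qed.

(* [lam xi = log ((1 - e^(xi z0)) / xi)], continued smoothly through [xi = 0]. *)
Definition lam (xi : R) : C := (log1m (cexp z0) + CInt dlam 1 xi)%C.
Definition Lam (xi : R) : C := CInt lam 0 xi.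

Lemma cder_lam xi : cder lam xi (dlam xi).
Proof.
eapply gder_eq; [apply gder_plus; [apply gder_const|apply cder_CInt_end, ccont_dlam]|]. ring.
Qed.

Lemma cder_Lam xi : cder Lam xi (lam xi).
Proof. apply cder_CInt_end. intros t. exact (cder_cont _ _ _ (cder_lam t)). Qed.

Lemma lam_1 : lam 1 = log1m (cexp z0).
Proof. unfold lam. rewrite CInt_point. ring. Qed.

Lemma Cmod_cexp_ray xi : 0 < xi -> Cmod (cexp (RtoC xi * z0)) < 1.
Proof. intros H. apply Cmod_cexp_lt_1. rewrite Re_scal. nra. Qed.

Lemma cder_ln xi : 0 < xi -> cder (fun x => RtoC (ln x)) xi (RtoC (/ xi)).
Proof. intros H. apply cder_real. auto_derive; [auto|field; lra]. Qed.

Lemma cder_log1m_ray xi : 0 < xi ->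
  cder (fun x => log1m (cexp (RtoC x * z0))) xi (dlam xi + RtoC (/ xi)).
Proof.
intros H. assert (M := Cmod_cexp_ray xi H). assert (NZ := one_minus_nz _ M).
eapply gder_eq; [apply (gder_comp _ _ log1m (fun x => cexp (RtoC x * z0))); [apply Cder_log1m; auto|apply cder_cexp_line]|].
cbv beta. assert (E0 := ek0_eq xi). assert (E1 := ek1_eq xi). assert (N0 := ek0_neq_0 xi).
assert (Nx : RtoC xi <> 0%C) by (intros X; apply RtoC_inj in X; lra).
assert (Z := Re_neg_nz z0 Hz). unfold dlam. rewrite RtoC_inv by lra.
set (w := cexp (RtoC xi * z0)) in *.
replace (1 - w)%C with (- (RtoC xi * z0 * ek 0 xi))%C by (rewrite E0; ring).
replace (ek 1 xi) with (/ RtoC xi * / z0 * (w - ek 0 xi))%C by (rewrite <- E1; field; auto).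
field. auto.
Qed.

Lemma lam_eq xi : 0 < xi -> (RtoC (ln xi) + lam xi)%C = log1m (cexp (RtoC xi * z0)).
Proof.
intros H. set (f := fun x => (RtoC (ln x) + lam x + - 1 * log1m (cexp (RtoC x * z0)))%C).
assert (D : forall t, 0 < t -> cder f t 0).
{ intros t Ht. eapply gder_eq.
  - apply gder_plus; [apply gder_plus; [apply cder_ln; auto|apply cder_lam]|].
    apply gder_mult; [apply gder_const|apply cder_log1m_ray; auto].
  - cbv beta; ring. }
assert (E : f xi = f 1).
{ destruct (Rle_lt_dec xi 1).
  - symmetry. apply (cder_0_const f xi 1); auto. intros t Ht. apply D. lra.
  - apply (cder_0_const f 1 xi); [lra|]. intros t Ht. apply D. lra. }
unfold f in E. rewrite ln_1, lam_1 in E. rewrite Cmult_1_l in E.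
replace (RtoC (ln xi) + lam xi)%C with (RtoC (ln xi) + lam xi + - 1 * log1m (cexp (RtoC xi * z0)) + log1m (cexp (RtoC xi * z0)))%C by ring.
rewrite E. ring.
Qed.

Lemma cexp_lam xi : cexp (lam xi) = (- z0 * ek 0 xi)%C.
Proof.
set (f := fun x => (cexp (- 1 * lam x) * ek 0 x)%C).
assert (D : forall t, cder f t 0).
{ intros t. eapply gder_eq.
  - apply gder_mult; [|apply cder_ek]. apply (gder_comp _ _ cexp (fun x => - 1 * lam x)%C); [apply Cder_exp|].
    apply gder_mult; [apply gder_const|apply cder_lam].
  - cbv beta. unfold dlam. field. apply ek0_neq_0. }
assert (E : f xi = f 1).
{ destruct (Rle_lt_dec xi 1); [symmetry; apply cder_0_const|apply cder_0_const]; auto; lra. }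
assert (Z := Re_neg_nz z0 Hz).
assert (M := Cmod_cexp_ray 1 Rlt_0_1). rewrite Cmult_1_l in M. assert (NZ := one_minus_nz _ M).
assert (E1 : f 1 = (- / z0)%C).
{ unfold f. rewrite lam_1. assert (X := ek0_eq 1). rewrite !Cmult_1_l in X.
  replace (- 1 * log1m (cexp z0))%C with (- log1m (cexp z0))%C by ring.
  rewrite cexp_opp, cexp_log1m by auto.
  replace (ek 0 1) with (/ z0 * (cexp z0 - 1))%C by (rewrite <- X; field; auto). field. auto. }
rewrite E1 in E. unfold f in E.
replace (- 1 * lam xi)%C with (- lam xi)%C in E by ring. rewrite cexp_opp in E.
assert (N := cexp_neq_0 (lam xi)).
replace (ek 0 xi) with (cexp (lam xi) * (/ cexp (lam xi) * ek 0 xi))%C by (field; auto).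
rewrite E. field. auto.
Qed.

Lemma one_minus_cexp xi : 0 < xi -> (1 - cexp (RtoC xi * z0))%C = (RtoC xi * cexp (lam xi))%C.
Proof. intros H. rewrite cexp_lam. assert (E := ek0_eq xi). transitivity (- (RtoC xi * z0 * ek 0 xi))%C; [rewrite E|]; ring. Qed.

(** [lam 0] is a logarithm of - z0. Its branch is inherited by continuity from xi > 0, where
    [lam xi] and the principal [log1m] have the same imaginary part because log xi is real. *)
Lemma Im_lam_0 : - (PI / 2) <= Im (lam 0) <= PI / 2.
Proof.
assert (B : forall xi, 0 < xi -> - (PI / 2) < Im (lam xi) < PI / 2).
{ intros xi H. assert (T := Im_log1m_bound _ (Cmod_cexp_ray xi H)). rewrite <- lam_eq in T by auto.
  generalize dependent (lam xi). intros u T. unfold Im in *. cbn [snd Cplus RtoC] in T. lra. }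
assert (G : forall e, 0 < e -> exists xi, 0 < xi /\ Rabs (Im (lam xi) - Im (lam 0)) < e).
{ intros e He. destruct (cder_cont _ _ _ (cder_lam 0) e He) as [d [Hd H]].
  exists (d / 2). split; [lra|]. specialize (H (d / 2)). rewrite Cmod_R, Rabs_pos_eq, Rplus_0_l in H by lra.
  specialize (H ltac:(lra)). rewrite <- Im_minus. eapply Rle_lt_trans; [apply Im_le_Cmod|exact H]. }
split; apply le_epsilon; intros e He; destruct (G e He) as [xi [H1 H2]]; specialize (B xi H1);
  apply Rabs_lt_between in H2; lra.
Qed.

(** x log x - x + Lam x + Li2(e^(x z0)) / z0 has zero derivative for x > 0, so its value at 1 is its
    limit zeta(2) / z0 at 0. *)
Lemma Lam_1 : Lam 1 = (1 + (zeta2 - dilog (cexp z0)) / z0)%C.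
Proof.
assert (Z := Re_neg_nz z0 Hz).
set (f := fun x => (RtoC (x * ln x - x) + Lam x + / z0 * dilog (cexp (RtoC x * z0)))%C).
assert (D : forall t, 0 < t -> cder f t 0).
{ intros t Ht. eapply gder_eq.
  - apply gder_plus; [apply gder_plus; [apply (cder_real (fun x => x * ln x - x) t (ln t))|apply cder_Lam]|].
    + auto_derive; auto. field. lra.
    + apply gder_mult; [apply gder_const|apply cder_dilog_exp; auto].
  - cbv beta. rewrite <- lam_eq by auto. field. auto. }
enough (E : f 1 = (/ z0 * zeta2)%C).
{ unfold f in E. rewrite ln_1, Rmult_0_r, Rminus_0_l, Cmult_1_l in E.
  transitivity (RtoC (- (1)) + Lam 1 + / z0 * dilog (cexp z0) + 1 - / z0 * dilog (cexp z0))%C; [rewrite RtoC_opp; ring|].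
  rewrite E. field. auto. }
apply Ceq_minus, Cmod_eq_0, Rle_antisym; [|apply Cmod_ge_0].
apply le_epsilon. intros e He. rewrite Rplus_0_l.
assert (Pi : 0 < Cmod (/ z0)) by (apply Cmod_gt_0; intros X; apply (Cinv_nz z0); auto).
destruct (dilog_near_1 (e / (4 * Cmod (/ z0)))) as [d1 [Hd1 H1]]; [apply Rdiv_lt_0_compat; lra|].
destruct (cder_cont _ _ _ (cder_cexp_line z0 0) d1 Hd1) as [d2 [Hd2 H2]].
destruct (cder_cont _ _ _ (cder_Lam 0) (e / 4) ltac:(lra)) as [d3 [Hd3 H3]].
(* x <= (e/12)^2 gives |x log x - x| <= 3 sqrt x <= e/4. *)
set (x := Rmin (Rmin (d2 / 2) (d3 / 2)) (Rmin 1 ((e / 12) ^ 2))).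
assert (Hx : 0 < x /\ x <= d2 / 2 /\ x <= d3 / 2 /\ x <= 1 /\ x <= (e / 12) ^ 2).
{ unfold x. split; [repeat apply Rmin_pos; try lra; apply pow_lt; lra|].
  assert (A1 := Rmin_l (Rmin (d2 / 2) (d3 / 2)) (Rmin 1 ((e / 12) ^ 2))).
  assert (A2 := Rmin_r (Rmin (d2 / 2) (d3 / 2)) (Rmin 1 ((e / 12) ^ 2))).
  assert (A3 := Rmin_l (d2 / 2) (d3 / 2)). assert (A4 := Rmin_r (d2 / 2) (d3 / 2)).
  assert (A5 := Rmin_l 1 ((e / 12) ^ 2)). assert (A6 := Rmin_r 1 ((e / 12) ^ 2)). lra. }
destruct Hx as [X0 [X1 [X2 [X3 X4]]]].
assert (E : f 1 = f x) by (apply (cder_0_const f x 1); auto; intros t Ht; apply D; lra).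
rewrite E. unfold f.
specialize (H2 x). rewrite Cmod_R, Rabs_pos_eq, Rplus_0_l, Cmult_0_l, cexp_0 in H2 by lra. specialize (H2 ltac:(lra)).
specialize (H3 x). rewrite Cmod_R, Rabs_pos_eq, Rplus_0_l in H3 by lra. specialize (H3 ltac:(lra)).
assert (HL0 : Lam 0 = 0%C) by apply CInt_point. rewrite HL0 in H3.
specialize (H1 (cexp (RtoC x * z0)) ltac:(left; apply Cmod_cexp_ray; auto) H2).
replace (RtoC (x * ln x - x) + Lam x + / z0 * dilog (cexp (x * z0)) - / z0 * zeta2)%C with
  (RtoC (x * ln x - x) + ((Lam x - 0) + / z0 * (dilog (cexp (x * z0)) - zeta2)))%C by ring.
eapply Rle_trans; [apply Cmod_triangle|]. rewrite Cmod_R.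
assert (T : Cmod ((Lam x - 0) + / z0 * (dilog (cexp (x * z0)) - zeta2)) <= e / 4 + e / 4).
{ eapply Rle_trans; [apply Cmod_triangle|]. rewrite Cmod_mult. apply Rplus_le_compat; [lra|].
  replace (e / 4) with (Cmod (/ z0) * (e / (4 * Cmod (/ z0)))) by (field; lra). apply Rmult_le_compat_l; lra. }
assert (T2 : Rabs (x * ln x - x) <= 3 * sqrt x).
{ assert (Lx := neg_ln_le x (conj X0 X3)). assert (Sx : sqrt x * sqrt x = x) by (apply sqrt_sqrt; lra).
  assert (S0 : 0 < sqrt x) by (apply sqrt_lt_R0; auto).
  assert (ln x <= 0) by (rewrite <- ln_1; apply ln_le; lra).
  assert (- (x * ln x) <= 2 * sqrt x).
  { apply Rle_trans with (x * (2 / sqrt x)); [nra|]. rewrite <- Sx at 1. right. field. lra. }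
  assert (sqrt x <= 1) by (rewrite <- sqrt_1; apply sqrt_le_1; lra).
  rewrite Rabs_left1 by nra. nra. }
assert (T3 : sqrt x <= e / 12).
{ rewrite <- (sqrt_pow2 (e / 12)) by lra. apply sqrt_le_1; lra. }
lra.
Qed.

End Saddle.

(* A class of functions closed under differentiation: it yields all derivatives at once, as a [chain].
   [SInv] stands for [1/e_0], [SRec] for [1/(1+x)]. *)
Inductive sx : Type :=
| SCst (c : C) | SVar | SEk (k : nat) | SInv | SRec | SLam | Slam
| SAdd (p q : sx) | SMul (p q : sx).

Section SaddleExpr.
Variable z0 : C.
Hypothesis Hz : Re z0 < 0.

Fixpoint ev (p : sx) (x : R) : C :=
  match p with
  | SCst c => c
  | SVar => RtoC x
  | SEk k => ek z0 k x
  | SInv => (/ ek z0 0 x)%C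
  | SRec => RtoC (/ (1 + x))
  | SLam => Lam z0 x
  | Slam => lam z0 x
  | SAdd p q => (ev p x + ev q x)%C
  | SMul p q => (ev p x * ev q x)%C
  end.

Fixpoint dv (p : sx) : sx :=
  match p with
  | SCst c => SCst 0
  | SVar => SCst 1
  | SEk k => SMul (SCst z0) (SEk (S k))
  | SInv => SMul (SCst (- z0)) (SMul (SEk 1) (SMul SInv SInv))
  | SRec => SMul (SCst (- 1)) (SMul SRec SRec)
  | SLam => Slam
  | Slam => SMul (SCst z0) (SMul (SEk 1) SInv)
  | SAdd p q => SAdd (dv p) (dv q)
  | SMul p q => SAdd (SMul (dv p) q) (SMul p (dv q))
  end.

Lemma ev_dv p x : -1 < x -> cder (ev p) x (ev (dv p) x).
Proof.
intros Hx. induction p as [c| |k| | | | |p IHp q IHq|p IHp q IHq]; cbn [ev dv].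
- exact (gder_const _ _ c x).
- exact (cder_RtoC x).
- apply cder_ek.
- eapply gder_eq; [exact (cder_inv_ek0 z0 Hz x)|]. ring.
- eapply gder_eq; [apply (cder_real (fun x => / (1 + x)) x (- (/ (1 + x) * / (1 + x))))|].
  + auto_derive; [lra|]. field. lra.
  + rewrite RtoC_opp, RtoC_mult. ring.
- apply cder_Lam; auto.
- apply cder_lam; auto.
- exact (gder_plus _ _ _ _ _ _ _ IHp IHq).
- exact (gder_mult _ _ _ _ _ _ _ IHp IHq).
Qed.

Definition chn (p : sx) (k : nat) : R -> C := ev (Nat.iter k dv p).

Lemma chn_chain p a b : -1 < a -> chain (chn p) a b.
Proof. intros Ha k x Hx. apply ev_dv. lra. Qed.

Fixpoint npow (p : sx) (n : nat) : sx := match n with O => SCst 1 | S k => SMul p (npow p k) end.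

(** [sx] has no general inverse, so an expression for the reciprocal is passed along for negative
    exponents. *)
Definition zpow (p pinv : sx) (m : Z) : sx :=
  match m with Z0 => SCst 1 | Zpos k => npow p (Pos.to_nat k) | Zneg k => npow pinv (Pos.to_nat k) end.

Lemma ev_npow p n x : ev (npow p n) x = (ev p x ^ n)%C.
Proof. induction n; simpl; auto. now rewrite IHn. Qed.

Lemma ev_zpow p pinv m x : ev p x <> 0%C -> ev pinv x = (/ ev p x)%C -> ev (zpow p pinv m) x = cpowz (ev p x) m.
Proof.
intros Hp E. destruct m; simpl; rewrite ?ev_npow; auto.
rewrite E. now apply Cpow_inv.
Qed.

Definition dlamk (k : nat) : sx := Nat.iter k dv Slam.

(** An antiderivative of x^k times the k-th derivative of [lam], by repeated integration by
    parts. *)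
Fixpoint anti (k : nat) : sx :=
  match k with
  | O => SLam
  | S j => SAdd (SMul (npow SVar (S j)) (dlamk j)) (SMul (SCst (- RtoC (INR (S j)))) (anti j))
  end.

Lemma ev_dv_npow n x : ev (dv (npow SVar (S n))) x = (RtoC (INR (S n)) * RtoC (x ^ n))%C.
Proof.
induction n.
- simpl. ring.
- change (npow SVar (S (S n))) with (SMul SVar (npow SVar (S n))). cbn [dv ev] in *. rewrite IHn.
  rewrite ev_npow, (S_INR (S n)), RtoC_plus. cbn [ev]. rewrite <- RtoC_pow. simpl pow. rewrite RtoC_mult. ring.
Qed.

Lemma ev_dv_anti k x : ev (dv (anti k)) x = (RtoC (x ^ k) * ev (dlamk k) x)%C.
Proof.
induction k.
- simpl. ring.
- cbn [anti]. change (ev (dv (SAdd (SMul (npow SVar (S k)) (dlamk k)) (SMul (SCst (- RtoC (INR (S k)))) (anti k)))) x)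
    with ((ev (dv (npow SVar (S k))) x * ev (dlamk k) x + ev (npow SVar (S k)) x * ev (dlamk (S k)) x)
      + (0 * ev (anti k) x + - RtoC (INR (S k)) * ev (dv (anti k)) x))%C.
  rewrite IHk, ev_dv_npow, ev_npow. cbn [ev]. rewrite <- RtoC_pow. ring.
Qed.

Definition xg (N j : nat) : R := INR (S j) / INR N.

Lemma xg_bounds N j : (1 <= N)%nat -> (j < N)%nat -> 0 < xg N j <= 1.
Proof.
intros HN Hj. assert (NP : 1 <= INR N) by (apply (le_INR 1); auto). assert (P := INR_S_pos j).
unfold xg. split; [apply Rdiv_lt_0_compat; lra|].
apply Rmult_le_reg_r with (INR N); [lra|]. unfold Rdiv. rewrite Rmult_assoc, Rinv_l, Rmult_1_r, Rmult_1_l by lra.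
apply le_INR. lia.
Qed.

(* The [k]-th derivative in [s] of [sum_j log ((1+s) exp (lam (x_j (1+s))))], with [x_j = (j+1)/N]. *)
Definition phi (N k : nat) (s : R) : C :=
  (RtoC (INR N) * log_chain (S k) s + csum (fun j => RtoC (xg N j ^ k) * ev (dlamk k) (xg N j * (1 + s))) N)%C.

Lemma cder_csum (f f' : nat -> R -> C) n s : (forall i, (i < n)%nat -> cder (f i) s (f' i s)) ->
  cder (fun s => csum (fun i => f i s) n) s (csum (fun i => f' i s) n).
Proof.
intros H. induction n; cbn [csum]; [exact (gder_const _ _ 0%C s)|].
apply gder_plus; [apply IHn; intros; apply H; lia|apply H; lia].
Qed.

Lemma phi_chain N : (1 <= N)%nat -> chain (phi N) (- / 2) (/ 2).
Proof.
intros HN k s Hs. unfold phi. eapply gder_eq.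
- apply gder_plus.
  + apply gder_mult; [apply gder_const|apply log_chain_deriv; lra].
  + apply (cder_csum (fun j s => RtoC (xg N j ^ k) * ev (dlamk k) (xg N j * (1 + s)))%C
     (fun j s => RtoC (xg N j ^ S k) * ev (dlamk (S k)) (xg N j * (1 + s)))%C).
    intros j Hj. assert (X := xg_bounds N j HN Hj). eapply gder_eq.
    * apply gder_mult; [apply gder_const|].
      apply (cder_comp_real (ev (dlamk k)) (fun s => xg N j * (1 + s)) s (ev (dv (dlamk k)) (xg N j * (1 + s))) (xg N j)); [apply ev_dv; nra|].
      auto_derive; auto. ring.
    * cbv beta. change (dv (dlamk k)) with (dlamk (S k)). simpl pow. rewrite RtoC_mult. ring.
- cbv beta. ring.
Qed.

Lemma phi_bound k : exists M, 0 <= M /\ forall N s, (1 <= N)%nat -> - / 2 <= s <= / 2 -> Cmod (phi N k s) <= M * INR N.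
Proof.
destruct (ccont_bounded (ev (dlamk k)) 0 2 ltac:(lra)) as [M1 [HM1 H1]].
{ intros t Ht. exact (cder_cont _ _ _ (ev_dv (dlamk k) t ltac:(lra))). }
destruct (ccont_bounded (log_chain (S k)) (- / 2) (/ 2) ltac:(lra)) as [M2 [HM2 H2]].
{ intros t Ht. exact (cder_cont _ _ _ (log_chain_deriv (S k) t ltac:(lra))). }
exists (M2 + M1). split; [lra|]. intros N s HN Hs. assert (NP : 1 <= INR N) by (apply (le_INR 1); auto).
unfold phi. eapply Rle_trans; [apply Cmod_triangle|]. rewrite Cmod_mult, Cmod_R, Rabs_pos_eq by lra.
assert (A := H2 s Hs).
assert (B : Cmod (csum (fun j => RtoC (xg N j ^ k) * ev (dlamk k) (xg N j * (1 + s)))%C N) <= INR N * M1).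
{ apply Cmod_csum_le. intros j Hj. assert (X := xg_bounds N j HN Hj).
  rewrite Cmod_mult, Cmod_R. assert (Y := H1 (xg N j * (1 + s)) ltac:(nra)).
  assert (Z : 0 <= xg N j ^ k <= 1) by (split; [apply pow_le; lra|rewrite <- (pow1 k); apply pow_incr; lra]).
  rewrite Rabs_pos_eq by lra. assert (P := Cmod_ge_0 (ev (dlamk k) (xg N j * (1 + s)))). nra. }
nra.
Qed.

(* The coefficient of [N s^k / k!] in the exponent; [coefA 1 = 0] is the saddle point equation. *)
Definition coefA (k : nat) : C := (log_chain (S k) 0 + (ev (anti k) 1 - ev (anti k) 0))%C.
Definition remA (k : nat) : nat -> C := em_rem (chn (anti k)).

Lemma phi_at_0 N k : phi N k 0 = (RtoC (INR N) * coefA k + remA k N)%C.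
Proof.
unfold phi, coefA, remA, em_rem, rsumN.
replace (csum (fun j => chn (anti k) 1%nat (INR (S j) / INR N)) N)
  with (csum (fun j => RtoC (xg N j ^ k) * ev (dlamk k) (xg N j * (1 + 0)))%C N).
- change (chn (anti k) 0%nat) with (ev (anti k)). ring.
- apply csum_ext. intros j _. rewrite Rplus_0_r, Rmult_1_r. symmetry. exact (ev_dv_anti k _).
Qed.

Lemma remA_aseq k : aseq (remA k).
Proof. apply em_aseq, chn_chain. lra. Qed.

Lemma remA_limit k : exists B, 0 <= B /\ forall N, (1 <= N)%nat ->
  Cmod (remA k N - / 2 * (ev (dv (anti k)) 1 - ev (dv (anti k)) 0)) <= B * eps N.
Proof. exact (em_rem_limit (chn (anti k)) (chn_chain (anti k) 0 1 ltac:(lra))). Qed.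

Lemma remA_bounded k : exists B, 0 <= B /\ forall N, (1 <= N)%nat -> Cmod (remA k N) <= B.
Proof.
destruct (remA_limit k) as [B [HB H]].
set (l := (/ 2 * (ev (dv (anti k)) 1 - ev (dv (anti k)) 0))%C) in *.
exists (B + Cmod l). assert (P := Cmod_ge_0 l). split; [lra|]. intros N HN. specialize (H N HN).
assert (T := eps_bounds N HN). replace (remA k N) with (remA k N - l + l)%C by ring.
eapply Rle_trans; [apply Cmod_triangle|]. nra.
Qed.

Definition alphaS : C := (/ 2 * coefA 2)%C.

(** [phi N 0] is the logarithm of (q)_N up to the factor N!/N^N. Here its opposite is normalized:
    [coefA 0] cancels the part of order N at s = 0, and the Gaussian exponent is taken out. *)
Definition expo (N : nat) (s : R) : C :=
  (RtoC (INR N) * coefA 0 + alphaS * RtoC (qv N s) - phi N 0 s)%C.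

Hypothesis Hsaddle : coefA 1 = 0%C.

(** Taylor expansion of [phi] in s. The linear term of order N is absent by the saddle equation, and
    the terms N s^k with k >= 3 are written as (N s^2) s^(k-2), so that only monomials in N s^2 and
    s with bounded coefficients occur. *)
Lemma expo_taylor K : exists M, 0 <= M /\ forall N s, (1 <= N)%nat -> Rabs s <= / 2 ->
  Cmod (expo N s + (remA 0 N + RtoC s * remA 1 N + RtoC (s ^ 2 / 2) * remA 2 N
    + csum (fun i => RtoC (qv N s) * (RtoC (s ^ S i / INR (fact (S (S (S i))))) * coefA (S (S (S i))))
         + RtoC (s ^ S (S (S i)) / INR (fact (S (S (S i))))) * remA (S (S (S i))) N)%C K)) <= M * (qv N s * Rabs s ^ S K).
Proof.
destruct (phi_bound (S (S (S K)))) as [M [HM HP]].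
exists (2 ^ S (S (S K)) * M). split; [apply Rmult_le_pos; auto; apply pow_le; lra|].
intros N s HN Hs. assert (Hs' := Hs). apply Rabs_le_between in Hs'.
assert (T := taylor_bound (S (S (S K))) (phi N) (- / 2) (/ 2) (M * INR N) 0 s (phi_chain N HN)
  (fun u Hu => HP N u HN Hu) ltac:(lra) ltac:(lra)).
rewrite Rplus_0_l in T. rewrite <- Cmod_opp.
assert (NP : 1 <= INR N) by (apply (le_INR 1); auto).
replace (2 ^ S (S (S K)) * M * (qv N s * Rabs s ^ S K)) with (2 ^ S (S (S K)) * (M * INR N) * Rabs s ^ S (S (S K))).
2:{ replace (Rabs s ^ S (S (S K))) with (s ^ 2 * Rabs s ^ S K); [ring|].
    rewrite <- (pow2_abs s). simpl. ring. }
eapply Rle_trans; [right|exact T]. f_equal. unfold taylor, expo.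
rewrite !csum_shift.
rewrite (csum_ext (fun k => phi N (S (S (S k))) 0 * RtoC (s ^ S (S (S k)) / INR (fact (S (S (S k))))))%C
  (fun i => RtoC (qv N s) * (RtoC (s ^ S i / INR (fact (S (S (S i))))) * coefA (S (S (S i))))
         + RtoC (s ^ S (S (S i)) / INR (fact (S (S (S i))))) * remA (S (S (S i))) N)%C).
- set (Sm := csum _ K). rewrite !phi_at_0, Hsaddle. unfold alphaS.
  simpl (s ^ 0 / INR (fact 0)). simpl (s ^ 1 / INR (fact 1)).
  replace (s ^ 2 / INR (fact 2)) with (s ^ 2 / 2) by (simpl; field).
  replace (1 / 1) with 1 by field. replace (s * 1 / 1) with s by field.
  unfold Rdiv. rewrite !RtoC_mult, !RtoC_inv by lra. ring.
- intros i _. rewrite phi_at_0. rewrite Cmult_plus_distr_r, <- (Cmult_comm (RtoC (s ^ _ / _)) (remA _ _)). f_equal.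
  replace (s ^ S (S (S i)) / INR (fact (S (S (S i))))) with (s ^ 2 * (s ^ S i / INR (fact (S (S (S i)))))) by (simpl; unfold Rdiv; ring).
  rewrite !RtoC_mult. ring.
Qed.

End SaddleExpr.

(** * Expansion of smooth functions of s and of (1 + s)/N *)

Lemma isQ_pow_div (u : nat -> R -> R) k (c : R) : isQ (fun N s => RtoC (u N s)) -> isQ (fun N s => RtoC (u N s ^ k / c)).
Proof.
intros H. apply (isQ_ext (fun N s => RtoC (/ c) * RtoC (u N s ^ k))%C).
- apply isQ_scal. induction k; simpl; [apply isQ_const|].
  apply (isQ_ext (fun N s => RtoC (u N s) * RtoC (u N s ^ k))%C); [apply isQ_mult; auto|].
  intros; now rewrite RtoC_mult.
- intros N s. rewrite <- RtoC_mult. f_equal. unfold Rdiv. ring.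
Qed.

Lemma isQ_id_s : isQ (fun _ s => RtoC s).
Proof. apply (isQ_ext (fun _ s => RtoC s * 1)%C); [apply (isQ_s (fun _ _ => 1%C)), isQ_const|intros; ring]. Qed.

Lemma isQ_id_q : isQ (fun N s => RtoC (qv N s)).
Proof. apply (isQ_ext (fun N s => RtoC (qv N s) * 1)%C); [apply (isQ_q (fun _ _ => 1%C)), isQ_const|intros; ring]. Qed.

Lemma isQ_small_arg : isQ (fun N s => RtoC ((1 + s) * eps N)).
Proof.
apply (isQ_ext (fun N s => RtoC (eps N) * (1 + RtoC s))%C).
- apply isQ_eps, isQ_plus; [apply isQ_const|apply isQ_id_s].
- intros. rewrite RtoC_mult, RtoC_plus. ring.
Qed.

Lemma abs_s_pow_le N s L : (1 <= N)%nat -> Rabs s ^ L <= eta N ^ L * (1 + qv N s) ^ L.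
Proof. intros HN. rewrite <- Rpow_mult_distr. apply pow_incr. split; [apply Rabs_pos|apply abs_s_le_eta; auto]. Qed.

Section AsyChains.
Variable dl : R.
Hypothesis Hdl : 0 < dl <= 1.

Lemma asyL_isQ_aseq L P u : isQ P -> aseq u -> asyL dl 0 L (fun N s => P N s * u N)%C.
Proof.
intros HP Hu. replace 0 with (0 + 0) by ring. apply asyL_mult; try lra; [apply isQ_asyL; auto|apply aseq_asyL; auto].
Qed.

Lemma asyL_opp L H : asyL dl 0 L H -> asyL dl 0 L (fun N s => - H N s)%C.
Proof.
intros HH. apply (asyL_ext _ _ _ (fun N s => (fun _ _ => - 1)%C N s * H N s)%C); [intros; ring|].
replace 0 with (0 + 0) by ring. apply asyL_mult; try lra; auto. apply asyL_const; auto.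
Qed.

Lemma asy_chain_s F : chain F (- dl) dl -> asy dl 0 (fun _ s => F 0%nat s).
Proof.
intros HF L. destruct (ccont_bounded (F L) (- dl) dl ltac:(lra) (chain_cont F _ _ L HF)) as [M [HM HB]].
exists (fun _ s => taylor F 0 s L). split.
- unfold taylor. induction L; cbn [csum]; [apply isQ_const|]. clear -Hdl HF.
  assert (G : forall K, isQ (fun (_ : nat) s => csum (fun k => F k 0 * RtoC (s ^ k / INR (fact k)))%C K)).
  { induction K; cbn [csum]; [apply isQ_const|]. apply isQ_plus; auto. apply isQ_scal.
    exact (isQ_pow_div (fun _ s => s) K (INR (fact K)) isQ_id_s). }
  exact (G (S L)).
- exists (2 ^ L * M), L. split; [apply Rmult_le_pos; auto; apply pow_le; lra|]. intros N s HN Hs.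
  assert (Hs' := Hs). apply Rabs_le_between in Hs'.
  assert (T := taylor_bound L F (- dl) dl M 0 s HF HB ltac:(lra) ltac:(lra)). rewrite Rplus_0_l in T.
  eapply Rle_trans; [exact T|]. rewrite Rmult_0_l, exp_0, Rmult_1_r, (Rmult_assoc _ (eta N ^ L)).
  apply Rmult_le_compat_l; [apply Rmult_le_pos; auto; apply pow_le; lra|]. apply abs_s_pow_le; auto.
Qed.

Lemma small_arg_bounds N s : (1 <= N)%nat -> Rabs s <= dl -> 0 <= (1 + s) * eps N <= 2 /\ (1 + s) * eps N <= 2 * eta N.
Proof.
intros HN Hs. apply Rabs_le_between in Hs. assert (E := eps_bounds N HN). destruct (eta_bounds N HN) as [E1 E2].
assert (eps N <= eta N) by (rewrite <- E2; simpl; nra). split; [split|]; nra.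
Qed.

Lemma asy_chain_eps F : chain F 0 2 -> asy dl 0 (fun N s => F 0%nat ((1 + s) * eps N)).
Proof.
intros HF L. destruct (ccont_bounded (F L) 0 2 ltac:(lra) (chain_cont F _ _ L HF)) as [M [HM HB]].
exists (fun N s => taylor F 0 ((1 + s) * eps N) L). split.
- unfold taylor. generalize L. clear -Hdl HF. intros K. induction K; cbn [csum]; [apply isQ_const|].
  apply isQ_plus; auto. apply isQ_scal.
  exact (isQ_pow_div (fun N s => (1 + s) * eps N) K (INR (fact K)) isQ_small_arg).
- exists (2 ^ L * M * 2 ^ L), 0%nat.
  assert (P : 0 <= 2 ^ L * M) by (apply Rmult_le_pos; auto; apply pow_le; lra).
  split; [apply Rmult_le_pos; auto; apply pow_le; lra|]. intros N s HN Hs.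
  destruct (small_arg_bounds N s HN Hs) as [B1 B2]. destruct (eta_bounds N HN) as [E1 E2].
  assert (T := taylor_bound L F 0 2 M 0 ((1 + s) * eps N) HF HB ltac:(lra) ltac:(lra)). rewrite Rplus_0_l in T.
  eapply Rle_trans; [exact T|]. rewrite Rmult_0_l, exp_0, Rmult_1_r, pow_O, Rmult_1_r, (Rmult_assoc _ (2 ^ L)).
  apply Rmult_le_compat_l; auto. rewrite <- Rpow_mult_distr. apply pow_incr. split; [apply Rabs_pos|].
  rewrite Rabs_pos_eq; lra.
Qed.

Lemma chain_lip F a b x : a <= x <= b -> chain F a b -> exists B, 0 <= B /\ forall t, a <= t <= b ->
  Cmod (F 0%nat t - F 0%nat x) <= B * Rabs (t - x).
Proof.
intros Hx HF. destruct (ccont_bounded (F 1%nat) a b ltac:(lra) (chain_cont F _ _ 1 HF)) as [M [HM HB]].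
exists (2 * M). split; [lra|]. intros t Ht. apply (cder_mvt _ (F 1%nat)). intros u Hu.
assert (a <= u <= b) by (revert Hu; unfold Rmin, Rmax; destruct (Rle_dec x t); lra). split; auto.
Qed.
End AsyChains.

(** * The non-Gaussian factor of the integrand near the saddle *)

Section SaddleH.
Variable z0 : C.
Hypothesis Hz : Re z0 < 0.
Hypothesis Hsaddle : coefA z0 1 = 0%C.
Variable T : R.
Hypothesis HT : forall N, (1 <= N)%nat -> Rabs (stir N - T) <= 50 * eps N.
Variable m : Z.

(* The limit of [expo N 0]: minus the first Euler-Maclaurin correction. *)
Definition kap : C := (- / 2 * (lam z0 1 - lam z0 0))%C.
(** Normalized to tend to 0 at s = 0: [kap] is the limit of [expo N 0], and [T] that of the Stirling
    correction. *)
Definition expoS (N : nat) (s : R) : C := (expo z0 N s - kap - RtoC (stir N - T))%C.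

Lemma expo_asy dl : 0 < dl <= / 2 -> asy dl 0 (expo z0).
Proof.
intros Hdl L. assert (Hd1 : 0 < dl <= 1) by lra.
destruct (expo_taylor z0 Hz Hsaddle L) as [M [HM HE]].
match type of HE with forall N s, _ -> _ -> Cmod (_ + @?S N s) <= _ => set (Sm := S) in HE end.
apply (asyL_ext _ _ _ (fun N s => (expo z0 N s + Sm N s) + - Sm N s)%C); [intros; ring|].
apply asyL_plus; auto.
- apply (asyL_O _ _ _ _ M (L + 2)); auto. intros N s HN Hs. eapply Rle_trans; [apply HE; auto; lra|].
  rewrite Rmult_0_l, exp_0, Rmult_1_r, (Rmult_assoc M (eta N ^ L)). apply Rmult_le_compat_l; auto.
  assert (A := abs_s_pow_le N s (S L) HN). assert (Q := qv_ge_0 N s).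
  destruct (eta_pow_pos N L HN) as [P1 P2]. destruct (eta_bounds N HN) as [E1 _].
  assert (P3 : 0 < (1 + qv N s) ^ S L) by (apply pow_lt; lra).
  apply Rle_trans with (qv N s * (eta N ^ S L * (1 + qv N s) ^ S L)); [apply Rmult_le_compat_l; auto|].
  replace (L + 2)%nat with (S (S L)) by lia. replace ((1 + qv N s) ^ S (S L)) with ((1 + qv N s) * (1 + qv N s) ^ S L) by (simpl; ring).
  replace (eta N ^ S L) with (eta N * eta N ^ L) by (simpl; ring).
  set (q := qv N s) in *. set (p := (1 + q) ^ S L) in *. set (h := eta N) in *. set (hl := h ^ L) in *.
  replace (q * (h * hl * p)) with (hl * (q * h * p)) by ring. apply Rmult_le_compat_l; [lra|].
  apply Rmult_le_compat_r; [lra|]. nra.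
- apply asyL_opp; auto. unfold Sm.
  apply asyL_plus; auto; [apply asyL_plus; auto; [apply asyL_plus; auto|]|].
  + apply aseq_asyL; auto. apply remA_aseq; auto.
  + apply (asyL_isQ_aseq _ Hd1 L (fun _ s => RtoC s)); [apply isQ_id_s|apply remA_aseq; auto].
  + apply (asyL_isQ_aseq _ Hd1 L (fun _ s => RtoC (s ^ 2 / 2))); [|apply remA_aseq; auto].
    exact (isQ_pow_div (fun _ s => s) 2 2 isQ_id_s).
  + apply asyL_csum; auto. intros i _. apply asyL_plus; auto.
    * apply isQ_asyL; auto. apply isQ_mult; [apply isQ_id_q|].
      apply isQ_mult; [|apply isQ_const]. exact (isQ_pow_div (fun _ s => s) _ _ isQ_id_s).
    * apply (asyL_isQ_aseq _ Hd1 L (fun _ s => RtoC (s ^ S (S (S i)) / INR (fact (S (S (S i)))))));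
        [exact (isQ_pow_div (fun _ s => s) _ _ isQ_id_s)|apply remA_aseq; auto].
Qed.

(** Apart from terms of order 1/N + |s| there is only the cubic one, of size N |s|^3; it is what
    forces the saddle segment |s| <= dl to be short. *)
Lemma expoS_bound : exists B C, 0 <= B /\ 0 <= C /\ forall N s, (1 <= N)%nat -> Rabs s <= / 2 ->
  Cmod (expoS N s) <= B * (eps N + Rabs s) + C * (qv N s * Rabs s).
Proof.
destruct (expo_taylor z0 Hz Hsaddle 0) as [M [HM HE]].
destruct (remA_limit z0 Hz 0) as [B0 [HB0 H0]].
destruct (remA_bounded z0 Hz 1) as [B1 [HB1 H1]]. destruct (remA_bounded z0 Hz 2) as [B2 [HB2 H2]].
exists (B0 + B1 + B2 + 50), M. repeat split; try lra. intros N s HN Hs.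
specialize (HE N s HN Hs). specialize (H0 N HN). specialize (H1 N HN). specialize (H2 N HN). specialize (HT N HN).
cbn [csum] in HE. rewrite pow_1 in HE. change (ev z0 (dv z0 (anti z0 0))) with (lam z0) in H0.
set (r0 := remA z0 0 N) in *. set (r1 := remA z0 1 N) in *. set (r2 := remA z0 2 N) in *.
set (X := (expo z0 N s + (r0 + RtoC s * r1 + RtoC (s ^ 2 / 2) * r2 + 0))%C) in *.
replace (expoS N s) with (X + (- (r0 - / 2 * (lam z0 1 - lam z0 0)) + (- (RtoC s * r1) + (- (RtoC (s ^ 2 / 2) * r2) + - RtoC (stir N - T)))))%C
  by (unfold X, expoS, kap; ring).
assert (E := eps_bounds N HN). assert (Ps := Rabs_pos s).
assert (Y0 := Cmod_triangle X (- (r0 - / 2 * (lam z0 1 - lam z0 0)) + (- (RtoC s * r1) + (- (RtoC (s ^ 2 / 2) * r2) + - RtoC (stir N - T))))).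
assert (Y1 := Cmod_triangle (- (r0 - / 2 * (lam z0 1 - lam z0 0))) (- (RtoC s * r1) + (- (RtoC (s ^ 2 / 2) * r2) + - RtoC (stir N - T)))).
assert (Y2 := Cmod_triangle (- (RtoC s * r1)) (- (RtoC (s ^ 2 / 2) * r2) + - RtoC (stir N - T))).
assert (Y3 := Cmod_triangle (- (RtoC (s ^ 2 / 2) * r2)) (- RtoC (stir N - T))).
rewrite !Cmod_opp, ?Cmod_mult, !Cmod_R in *.
assert (Z1 : Rabs s * Cmod r1 <= B1 * Rabs s) by (rewrite Rmult_comm; apply Rmult_le_compat_r; auto).
assert (Z2 : Rabs (s ^ 2 / 2) * Cmod r2 <= B2 * Rabs s).
{ rewrite Rmult_comm. apply Rmult_le_compat; auto; [apply Cmod_ge_0|apply Rabs_pos|].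
  rewrite Rabs_pos_eq by (apply Rdiv_le_0_compat; [apply pow2_ge_0|lra]). rewrite <- (pow2_abs s). simpl. nra. }
assert (0 <= B0 * Rabs s) by nra. assert (0 <= (B1 + B2) * eps N) by (apply Rmult_le_pos; lra).
set (e := eps N) in *. rewrite Cmod_R in H0 || idtac. lra.
Qed.

(** With t = x z0 one has e^t = 1 + x z0 e_0(x) and e^t - 1 = x z0 e_0(x). Of the power - m - 1 of
    the latter only e_0 is kept here; the power of 1 + s is [powE], those of z0 and 1/N are
    prefactors. *)
Definition thetaE : sx :=
  SMul (SAdd (SCst 1) (SMul (SMul SVar (SCst z0)) (SEk 0))) (zpow (SEk 0) SInv (- m - 1)).
Definition powE : sx := zpow (SAdd (SCst 1) SVar) SRec (- m - 1).
Definition pref (N : nat) (s : R) : C := (ev z0 thetaE ((1 + s) * eps N) * ev z0 powE s)%C.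
Definition sadH (N : nat) (s : R) : C := (cexp (kap - RtoC T) * (pref N s * cexp (expoS N s)))%C.

Lemma ev_thetaE x : ev z0 thetaE x = (cexp (RtoC x * z0) * cpowz (ek z0 0 x) (- m - 1))%C.
Proof.
unfold thetaE. cbn [ev]. rewrite (ev_zpow z0) by (try reflexivity; exact (ek0_neq_0 z0 Hz x)). cbn [ev].
f_equal. rewrite ek0_eq by auto. ring.
Qed.

Lemma ev_powE s : -1 < s -> ev z0 powE s = cpowz (RtoC (1 + s)) (- m - 1).
Proof.
intros Hs. assert (N : RtoC (1 + s) <> 0%C) by (intros E; apply RtoC_inj in E; lra).
unfold powE. rewrite (ev_zpow z0); cbn [ev]; rewrite <- RtoC_plus; auto. now rewrite RtoC_inv by lra.
Qed.

Lemma cpowz_1 n : cpowz 1%C n = 1%C.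
Proof. destruct n; simpl; rewrite ?Cpow_1_l; auto. field. Qed.

Lemma pref_0 : ev z0 thetaE 0 = 1%C /\ ev z0 powE 0 = 1%C.
Proof.
rewrite ev_thetaE, ev_powE, ek0_0, Rplus_0_r, !cpowz_1, Cmult_0_l, cexp_0 by (auto; lra). split; [ring|auto].
Qed.

Lemma pref_asy dl : 0 < dl <= / 2 -> asy dl 0 pref.
Proof.
intros Hdl L. assert (Hd1 : 0 < dl <= 1) by lra. replace 0 with (0 + 0) by ring. apply asyL_mult; try lra.
- exact (asy_chain_eps dl Hd1 (chn z0 thetaE) (chn_chain z0 Hz thetaE 0 2 ltac:(lra)) L).
- exact (asy_chain_s dl Hd1 (chn z0 powE) (chn_chain z0 Hz powE (- dl) dl ltac:(lra)) L).
Qed.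

Lemma pref_limit : exists B, 0 <= B /\ forall N s, (1 <= N)%nat -> Rabs s <= / 2 ->
  Cmod (pref N s - 1) <= B * (eta N * (1 + qv N s)).
Proof.
destruct (chain_lip (chn z0 thetaE) 0 2 0 ltac:(lra) (chn_chain z0 Hz thetaE 0 2 ltac:(lra))) as [B1 [HB1 H1]].
destruct (chain_lip (chn z0 powE) (- / 2) (/ 2) 0 ltac:(lra) (chn_chain z0 Hz powE (- / 2) (/ 2) ltac:(lra))) as [B2 [HB2 H2]].
change (chn z0 thetaE 0%nat) with (ev z0 thetaE) in H1. change (chn z0 powE 0%nat) with (ev z0 powE) in H2.
rewrite (proj1 pref_0) in H1. rewrite (proj2 pref_0) in H2.
exists (2 * B1 * (1 + B2) + B2). split; [nra|]. intros N s HN Hs.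
destruct (small_arg_bounds (/ 2) ltac:(lra) N s HN Hs) as [A1 A2].
specialize (H1 ((1 + s) * eps N) A1). assert (Hs' := Hs). apply Rabs_le_between in Hs'. specialize (H2 s Hs').
rewrite Rminus_0_r in H1, H2. rewrite Rabs_pos_eq in H1 by lra.
assert (S1 := abs_s_le_eta N s HN). assert (Q := qv_ge_0 N s). destruct (eta_bounds N HN) as [E1 _].
unfold pref. set (a := ev z0 thetaE _) in *. set (p := ev z0 powE s) in *.
replace (a * p - 1)%C with ((a - 1) * (1 + (p - 1)) + (p - 1))%C by ring.
eapply Rle_trans; [apply Cmod_triangle|]. rewrite Cmod_mult.
assert (T1 := Cmod_triangle 1 (p - 1)). rewrite Cmod_1 in T1.
assert (G1 : Cmod (a - 1) <= 2 * B1 * eta N) by nra.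
assert (G2 : Cmod (p - 1) <= B2 * (eta N * (1 + qv N s))) by nra.
assert (G3 : Cmod (1 + (p - 1)) <= 1 + B2) by nra.
assert (G4 : Cmod (a - 1) * Cmod (1 + (p - 1)) <= 2 * B1 * eta N * (1 + B2))
  by (apply Rmult_le_compat; auto; apply Cmod_ge_0).
assert (G5 : 2 * B1 * eta N * (1 + B2) <= 2 * B1 * (1 + B2) * (eta N * (1 + qv N s))).
{ replace (2 * B1 * eta N * (1 + B2)) with (2 * B1 * (1 + B2) * eta N) by ring. apply Rmult_le_compat_l; nra. }
lra.
Qed.

Lemma cexp_minus_1_le (z : C) : Cmod (cexp z - 1) <= 2 * (Cmod z * exp (Cmod z)).
Proof.
assert (H := cexp_taylor z 1). cbn [csum] in H.
replace (0 + z ^ 0 * RtoC (1 ^ 0 / INR (fact 0)))%C with (RtoC 1) in H by (simpl; replace (1 / 1) with 1 by field; ring).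
simpl in H. lra.
Qed.

Lemma expoS_ccont dl N : 0 < dl <= / 2 -> (1 <= N)%nat -> ccont_on (expoS N) (- dl) dl.
Proof.
intros Hdl HN s Hs. unfold expoS, expo.
apply (gcont_ext _ _ (fun s => (INR N * coefA z0 0 - kap - RtoC (stir N - T)) + (alphaS z0 * RtoC (qv N s) + - 1 * phi z0 N 0 s))%C);
  [intros; ring|].
apply gcont_plus; [apply gcont_const|]. apply gcont_plus.
- apply gcont_mult; [apply gcont_const|apply ccont_qv].
- apply gcont_mult; [apply gcont_const|]. apply (chain_cont _ _ _ 0 (phi_chain z0 Hz N HN)). lra.
Qed.

Lemma sadH_props (b : R) : 0 < b -> exists dl, 0 < dl <= / 8 /\ asy dl b sadH /\
  (forall N, (1 <= N)%nat -> ccont_on (sadH N) (- dl) dl) /\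
  exists K, 0 <= K /\ forall N s, (1 <= N)%nat -> Rabs s <= dl ->
    Cmod (sadH N s - cexp (kap - RtoC T)) <= K * eta N * (1 + qv N s) ^ 3 * exp (b * qv N s).
Proof.
intros Hb. destruct expoS_bound as [B [C [HB [HC HE]]]].
(* C dl <= b, so that the cubic term C q |s| of the exponent is at most b q. *)
set (dl := Rmin (/ 8) (b / (C + 1))).
assert (Hdb : 0 < b / (C + 1)) by (apply Rdiv_lt_0_compat; lra).
assert (Hd8 : 0 < dl <= / 8) by (unfold dl; split; [apply Rmin_pos; lra|apply Rmin_l]).
assert (Hdl : 0 < dl <= / 2) by lra.
assert (HdC : C * dl <= b).
{ assert (dl <= b / (C + 1)) by apply Rmin_r. apply Rle_trans with (C * (b / (C + 1))); [apply Rmult_le_compat_l; auto|].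
  apply Rmult_le_reg_r with (C + 1); [lra|]. replace (C * (b / (C + 1)) * (C + 1)) with (C * b) by (field; lra). nra. }
assert (Bd1 : forall N s, (1 <= N)%nat -> Rabs s <= dl -> Cmod (expoS N s) <= b * qv N s + 2 * B).
{ intros N s HN Hs. eapply Rle_trans; [apply HE; auto; lra|]. assert (E := eps_bounds N HN). assert (P := Rabs_pos s).
  assert (Q := qv_ge_0 N s). assert (C * (qv N s * Rabs s) <= b * qv N s).
  { replace (C * (qv N s * Rabs s)) with (C * Rabs s * qv N s) by ring. apply Rmult_le_compat_r; auto. nra. }
  nra. }
assert (Bd2 : forall N s, (1 <= N)%nat -> Rabs s <= dl -> Cmod (expoS N s) <= (2 * B + C) * eta N * (1 + qv N s) ^ 2).
{ intros N s HN Hs. eapply Rle_trans; [apply HE; auto; lra|]. assert (Q := qv_ge_0 N s).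
  assert (S1 := abs_s_le_eta N s HN). destruct (eta_bounds N HN) as [E1 E2]. assert (P := Rabs_pos s).
  assert (eps N <= eta N) by (rewrite <- E2; simpl; nra).
  set (q := qv N s) in *. set (h := eta N) in *.
  assert (X1 : q * Rabs s <= q * (h * (1 + q))) by (apply Rmult_le_compat_l; auto).
  assert (X2 : C * (q * Rabs s) <= C * (h * (1 + q) ^ 2)) by (apply Rmult_le_compat_l; auto; simpl; nra).
  assert (X3 : eps N + Rabs s <= 2 * (h * (1 + q) ^ 2)) by (simpl; nra).
  assert (X4 := Rmult_le_compat_l B _ _ HB X3). lra. }
assert (Hd1 : 0 < dl <= 1) by lra.
exists dl. split; auto. split; [|split].
- intros L. unfold sadH. replace b with (0 + (0 + b)) by ring.
  apply (asyL_mult dl Hd1 _ _ _ (fun _ _ => cexp (kap - RtoC T))); try lra; [apply asyL_const; auto|].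
  apply asyL_mult; try lra; [apply pref_asy; auto|].
  apply (asy_cexp dl Hd1 b expoS (2 * B + C) 2 (2 * B)); auto; try lra.
  intros L'. apply (asyL_ext _ _ _ (fun N s => expo z0 N s + - (kap + (RtoC (stir N) + - RtoC T)))%C).
  { intros. unfold expoS. rewrite RtoC_minus. ring. }
  apply asyL_plus; auto; [apply expo_asy; auto|]. apply asyL_opp; auto.
  apply asyL_plus; auto; [apply asyL_const; auto|]. apply asyL_plus; auto; [|apply asyL_const; auto].
  apply (aseq_asyL dl L' (fun N => RtoC (stir N))). apply stir_aseq.
- intros N HN s Hs. unfold sadH. apply gcont_mult; [apply gcont_const|]. apply gcont_mult.
  + apply gcont_mult.
    * assert (E := eps_bounds N HN). eapply cder_cont.
      apply (cder_comp_real (ev z0 thetaE) (fun s => (1 + s) * eps N)); [apply ev_dv; auto; nra|].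
      auto_derive; [auto|reflexivity].
    * exact (cder_cont _ _ _ (ev_dv z0 Hz powE s ltac:(lra))).
  + apply (gcont_comp _ _ cexp); [apply Ccont_exp|]. apply (expoS_ccont dl N Hdl HN s Hs).
- destruct pref_limit as [P [HP Hpref]].
  set (hh := cexp (kap - RtoC T)).
  exists (Cmod hh * ((1 + P) * (2 * (2 * B + C) * exp (2 * B)) + P)).
  assert (Ph := Cmod_ge_0 hh). assert (Pe := exp_pos (2 * B)).
  assert (PK : 0 <= (1 + P) * (2 * (2 * B + C) * exp (2 * B))) by (apply Rmult_le_pos; [lra|apply Rmult_le_pos; lra]).
  split; [apply Rmult_le_pos; auto; lra|].
  intros N s HN Hs. unfold sadH. fold hh. specialize (Bd1 N s HN Hs). specialize (Bd2 N s HN Hs).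
  specialize (Hpref N s HN ltac:(lra)). set (E := expoS N s) in *. set (p := pref N s) in *.
  replace (hh * (p * cexp E) - hh)%C with (hh * (p * (cexp E - 1) + (p - 1)))%C by ring.
  rewrite Cmod_mult, !(Rmult_assoc (Cmod hh)). apply Rmult_le_compat_l; auto.
  eapply Rle_trans; [apply Cmod_triangle|]. rewrite Cmod_mult.
  assert (Q := qv_ge_0 N s). set (q := qv N s) in *. destruct (eta_bounds N HN) as [E1 _]. set (h := eta N) in *.
  assert (Pb : 1 <= exp (b * q)) by (rewrite <- exp_0; apply exp_le; nra).
  assert (G1 : Cmod (cexp E - 1) <= 2 * ((2 * B + C) * h * (1 + q) ^ 2 * (exp (2 * B) * exp (b * q)))).
  { eapply Rle_trans; [apply cexp_minus_1_le|]. apply Rmult_le_compat_l; [lra|].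
    apply Rmult_le_compat; auto; [apply Cmod_ge_0|left; apply exp_pos|]. rewrite <- exp_plus. apply exp_le. lra. }
  assert (G2 : Cmod p <= (1 + P) * (1 + q)).
  { replace p with (1 + (p - 1))%C by ring. eapply Rle_trans; [apply Cmod_triangle|]. rewrite Cmod_1.
    assert (P * (h * (1 + q)) <= P * (1 + q)) by (apply Rmult_le_compat_l; auto; nra). lra. }
  assert (G3 : Cmod p * Cmod (cexp E - 1) <= (1 + P) * (1 + q) * (2 * ((2 * B + C) * h * (1 + q) ^ 2 * (exp (2 * B) * exp (b * q)))))
    by (apply Rmult_le_compat; auto; apply Cmod_ge_0).
  assert (G4 : P * (h * (1 + q)) <= P * h * (1 + q) ^ 3 * exp (b * q)).
  { replace (P * (h * (1 + q))) with (P * h * ((1 + q) * 1)) by ring. rewrite (Rmult_assoc (P * h)).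
    apply Rmult_le_compat_l; [nra|]. apply Rmult_le_compat; try lra. simpl. nra. }
  replace (((1 + P) * (2 * (2 * B + C) * exp (2 * B)) + P) * h * (1 + q) ^ 3 * exp (b * q)) with
    ((1 + P) * (1 + q) * (2 * ((2 * B + C) * h * (1 + q) ^ 2 * (exp (2 * B) * exp (b * q)))) + P * h * (1 + q) ^ 3 * exp (b * q)) by ring.
  lra.
Qed.

End SaddleH.

(** * The integrand on the segment through the saddle point *)

Section SaddleIntegral.
Variable z0 : C.
Hypothesis Hz : Re z0 < 0.

(** Each factor 1 - e^(x z0) at x = (j+1)(1+s)/N equals x exp (lam x). The factors (j+1)/N multiply
    to n!/N^n, and the powers of 1 + s go into the exponent. *)
Lemma cpoch_saddle N s n : (1 <= N)%nat -> Rabs s <= / 2 -> (n <= N)%nat ->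
  cpoch (cexp (RtoC (1 + s) * z0 * / RtoC (INR N))) n =
  (RtoC (INR (fact n) / INR N ^ n) * cexp (RtoC (INR n * ln (1 + s)) + csum (fun j => lam z0 (xg N j * (1 + s))) n))%C.
Proof.
intros HN Hs. apply Rabs_le_between in Hs. assert (NP : 1 <= INR N) by (apply (le_INR 1); auto).
induction n; intros Hn.
- simpl. rewrite Rmult_0_l. replace (1 / 1) with 1 by field. rewrite Cplus_0_l, cexp_0. ring.
- cbn [cpoch csum]. rewrite IHn, cexp_div_pow by (auto; lia).
  change (INR (S n) / INR N) with (xg N n). rewrite Cmult_assoc, <- RtoC_mult.
  assert (X := xg_bounds N n HN ltac:(lia)). rewrite one_minus_cexp by (auto; nra).
  rewrite fact_simpl, mult_INR, S_INR. replace ((INR n + 1) * ln (1 + s)) with (INR n * ln (1 + s) + ln (1 + s)) by ring.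
  rewrite (RtoC_plus (INR n * ln (1 + s))).
  set (A := csum _ n). set (L := lam z0 _).
  replace (RtoC (INR n * ln (1 + s)) + RtoC (ln (1 + s)) + (A + L))%C with
    ((RtoC (INR n * ln (1 + s)) + A) + (RtoC (ln (1 + s)) + L))%C by ring.
  rewrite (cexp_add (RtoC (INR n * ln (1 + s)) + A)), (cexp_add (RtoC (ln (1 + s)))), cexp_RtoC, exp_ln by lra.
  replace ((INR n + 1) * INR (fact n) / INR N ^ S n) with (INR (fact n) / INR N ^ n * ((INR n + 1) / INR N)).
  2:{ simpl. field. split; [apply pow_nonzero|]; lra. }
  replace (xg N n) with ((INR n + 1) / INR N) by (unfold xg; now rewrite S_INR).
  rewrite !RtoC_mult. ring.
Qed.

Lemma fact_stirling N : (1 <= N)%nat ->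
  INR (fact N) / INR N ^ N = exp (stir N - INR N) * sqrt (INR N).
Proof.
intros HN. assert (NP : 1 <= INR N) by (apply (le_INR 1); auto).
assert (F : 0 < INR (fact N)) by (apply lt_0_INR, lt_O_fact).
assert (P : 0 < INR N ^ N) by (apply pow_lt; lra). assert (S0 : 0 < sqrt (INR N)) by (apply sqrt_lt_R0; lra).
assert (Ls : 2 * ln (sqrt (INR N)) = ln (INR N)).
{ rewrite <- (sqrt_sqrt (INR N)) at 2 by lra. rewrite ln_mult by auto. ring. }
apply ln_inv; [apply Rdiv_lt_0_compat; auto|apply Rmult_lt_0_compat; auto; apply exp_pos|].
unfold Rdiv. rewrite !ln_mult, ln_Rinv, ln_exp, ln_pow by first [lra | auto using exp_pos, Rinv_0_lt_compat].
unfold stir. lra.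
Qed.

Lemma rcp_saddle N s : (1 <= N)%nat -> Rabs s <= / 2 ->
  rcp (RtoC (1 + s) * z0)%C N = (RtoC (exp (INR N - stir N) / sqrt (INR N)) * cexp (- phi z0 N 0 s))%C.
Proof.
intros HN Hs. assert (NP : 1 <= INR N) by (apply (le_INR 1); auto). assert (S0 : 0 < sqrt (INR N)) by (apply sqrt_lt_R0; lra).
unfold rcp. rewrite cpoch_saddle, fact_stirling by auto.
replace (RtoC (INR N * ln (1 + s)) + csum (fun j => lam z0 (xg N j * (1 + s))) N)%C with (phi z0 N 0 s).
2:{ unfold phi. cbn [log_chain]. rewrite RtoC_mult. f_equal. apply csum_ext. intros j _. simpl. ring. }
rewrite cexp_opp. replace (INR N - stir N) with (- (stir N - INR N)) by ring. rewrite exp_Ropp.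
assert (Pe := exp_pos (stir N - INR N)). assert (Nz := cexp_neq_0 (phi z0 N 0 s)).
assert (N1 : RtoC (exp (stir N - INR N)) <> 0%C) by (intros E; apply RtoC_inj in E; lra).
assert (N2 : RtoC (sqrt (INR N)) <> 0%C) by (intros E; apply RtoC_inj in E; lra).
unfold Rdiv. rewrite !RtoC_mult, !RtoC_inv by lra. field. auto.
Qed.

Variables (T : R) (m : Z).

Lemma integrand_rcp N (z : C) : (1 <= N)%nat -> integrand N m (z * / RtoC (INR N))%C =
  (cexp (z * / RtoC (INR N)) * cpowz (cexp (z * / RtoC (INR N)) - 1) (- m - 1) * rcp z N)%C.
Proof. reflexivity. Qed.

(** The sources of the prefactors: (e^t - 1)^(-m-1) dt gives (z0/N)^(-m) (1 + s)^(-m-1), Stirling's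
    formula gives 1/sqrt N, and the value of the exponent at the saddle gives the exponential that
    will be w0^(-N). *)
Lemma integrand_saddle N s : (1 <= N)%nat -> Rabs s <= / 2 ->
  (integrand N m (RtoC (1 + s) * z0 * / RtoC (INR N)) * (z0 * / RtoC (INR N)))%C =
  (cpowz z0 (- m) * cpowz (RtoC (eps N)) (- m) * RtoC (/ sqrt (INR N)) * cexp (RtoC (INR N) * (1 - coefA z0 0))
    * (sadH z0 T m N s * cexp (- alphaS z0 * RtoC (qv N s))))%C.
Proof.
intros HN Hs. assert (NP : 1 <= INR N) by (apply (le_INR 1); auto). assert (S0 : 0 < sqrt (INR N)) by (apply sqrt_lt_R0; lra).
assert (E := eps_bounds N HN). assert (Hs' := Hs). apply Rabs_le_between in Hs'.
assert (Z := Re_neg_nz z0 Hz).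
rewrite integrand_rcp, rcp_saddle by auto.
replace (RtoC (1 + s) * z0 * / RtoC (INR N))%C with (RtoC ((1 + s) * eps N) * z0)%C
  by (rewrite RtoC_mult, RtoC_inv by lra; ring).
assert (X := ek0_eq z0 ((1 + s) * eps N)). rewrite <- X.
assert (N0 := ek0_neq_0 z0 Hz ((1 + s) * eps N)).
assert (N1 : RtoC (1 + s) <> 0%C) by (intros Y; apply RtoC_inj in Y; lra).
assert (N2 : RtoC (eps N) <> 0%C) by (intros Y; apply RtoC_inj in Y; lra).
rewrite (RtoC_mult (1 + s)) at 2.
assert (N3 : (RtoC (1 + s) * RtoC (eps N))%C <> 0%C) by (apply Cmult_neq_0; auto).
assert (N4 : (RtoC (1 + s) * RtoC (eps N) * z0)%C <> 0%C) by (apply Cmult_neq_0; auto).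
rewrite !cpowz_mult by auto.
unfold sadH, pref. rewrite ev_thetaE, ev_powE by (auto; lra).
assert (Em : forall u : C, u <> 0%C -> cpowz u (- m) = (cpowz u (- m - 1) * u)%C).
{ intros u Hu. replace (- m)%Z with ((- m - 1) + 1)%Z at 1 by lia. rewrite cpowz_add by auto.
  f_equal. unfold cpowz; simpl; ring. }
rewrite (Em z0), (Em (RtoC (eps N))) by auto.
assert (EE : (RtoC (exp (INR N - stir N)) * cexp (- phi z0 N 0 s))%C =
  (cexp (RtoC (INR N) * (1 - coefA z0 0)) * (cexp (kap z0 - RtoC T) * (cexp (expoS z0 T N s) * cexp (- alphaS z0 * RtoC (qv N s)))))%C).
{ rewrite <- cexp_RtoC, <- !cexp_add. f_equal. unfold expoS, expo. rewrite !RtoC_minus. ring. }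
unfold Rdiv. rewrite (RtoC_mult (exp (INR N - stir N))). rewrite <- (RtoC_inv (INR N)) by lra.
set (P1 := cpowz z0 (- m - 1)). set (P2 := cpowz (RtoC (eps N)) (- m - 1)). set (P3 := cpowz (RtoC (1 + s)) (- m - 1)).
set (P4 := cpowz (ek z0 0 _) (- m - 1)). set (e1 := cexp (RtoC ((1 + s) * eps N) * z0)). 
set (a := RtoC (exp (INR N - stir N))) in *. set (b := cexp (- phi z0 N 0 s)) in *.
transitivity (P1 * z0 * (P2 * RtoC (eps N)) * RtoC (/ sqrt (INR N)) * (e1 * P4 * P3) * (a * b))%C; [ring|].
rewrite EE. ring.
Qed.

Lemma saddle_integral dl N : 0 < dl <= / 2 -> (1 <= N)%nat -> ccont_on (sadH z0 T m N) (- dl) dl ->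
  CInt (fun s => integrand N m (RtoC (1 + s) * z0 * / RtoC (INR N)) * (z0 * / RtoC (INR N)))%C (- dl) dl =
  (cpowz z0 (- m) * cpowz (RtoC (eps N)) (- m) * RtoC (eps N) * cexp (RtoC (INR N) * (1 - coefA z0 0))
    * laplace dl (alphaS z0) (sadH z0 T m) N)%C.
Proof.
intros Hdl HN HC. assert (NP : 1 <= INR N) by (apply (le_INR 1); auto). assert (S0 : 0 < sqrt (INR N)) by (apply sqrt_lt_R0; lra).
rewrite (CInt_ext _ (fun s => (cpowz z0 (- m) * cpowz (RtoC (eps N)) (- m) * RtoC (/ sqrt (INR N)) * cexp (RtoC (INR N) * (1 - coefA z0 0)))
    * (sadH z0 T m N s * cexp (- alphaS z0 * RtoC (qv N s))))%C).
- rewrite CInt_scal; [|lra|].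
  + unfold laplace. replace (/ sqrt (INR N)) with (eps N * sqrt (INR N)); [rewrite RtoC_mult; ring|].
    rewrite <- (sqrt_sqrt (INR N)) at 1 by lra. field. lra.
  + intros s Hs. apply gcont_mult; [apply HC; auto|apply ccont_qexp].
- lra.
- intros s Hs. apply integrand_saddle; auto. apply Rabs_le. lra.
Qed.
End SaddleIntegral.

(** * The saddle point *)

Lemma exp_pow_lower (x c : R) n : 0 <= c <= 1 + x -> c ^ n <= exp (INR n * x).
Proof.
intros Hc. replace (exp (INR n * x)) with (exp x ^ n).
- apply pow_incr. assert (T := exp_ineq1_le x). lra.
- induction n; [simpl; rewrite Rmult_0_l, exp_0; auto|].
  rewrite S_INR, Rmult_plus_distr_r, exp_plus, <- IHn, Rmult_1_l. simpl. ring.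
Qed.

Lemma pow_double_lower (x y z : R) n : 0 <= y -> y <= x ^ n -> z <= y * y -> z <= x ^ (2 * n).
Proof. intros Hy H1 H2. replace (2 * n)%nat with (n + n)%nat by lia. rewrite pow_add. nra. Qed.

(** Repeated squaring of 1 + x/2^n, rounded down at every step to keep the rationals short. This
    bound and the next two turn the decimals of w0 into 1.6 <= - Re z0 <= 1.61 and - log |w0| >=
    0.0677. *)
Lemma exp_322 : 24.81 <= exp 3.22.
Proof.
assert (E := exp_pow_lower (3.22 / 1024) 1.00314453 1024 ltac:(lra)).
replace (INR 1024 * (3.22 / 1024)) with 3.22 in E by (rewrite INR_IZR_INZ; simpl; field).
eapply Rle_trans; [|exact E]. clear E.
change 1024%nat with (2 * (2 * (2 * (2 * (2 * (2 * (2 * (2 * (2 * (2 * 1))))))))))%nat.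
apply (pow_double_lower _ 4.99016789); [lra| |lra].
apply (pow_double_lower _ 2.23386837); [lra| |lra].
apply (pow_double_lower _ 1.49461312); [lra| |lra].
apply (pow_double_lower _ 1.22254371); [lra| |lra].
apply (pow_double_lower _ 1.10568699); [lra| |lra].
apply (pow_double_lower _ 1.05151652); [lra| |lra].
apply (pow_double_lower _ 1.02543480); [lra| |lra].
apply (pow_double_lower _ 1.01263755); [lra| |lra].
apply (pow_double_lower _ 1.00629894); [lra| |lra].
apply (pow_double_lower _ 1.00314453); [lra| |lra].
rewrite pow_1. lra.
Qed.

Lemma exp_neg_32 : 0.04033 <= exp (- (3.2)).
Proof.
assert (E := exp_pow_lower (- (3.2) / 1024) 0.996875 1024 ltac:(lra)).
replace (INR 1024 * (- (3.2) / 1024)) with (- (3.2)) in E by (rewrite INR_IZR_INZ; simpl; field).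
eapply Rle_trans; [|exact E]. clear E.
change 1024%nat with (2 * (2 * (2 * (2 * (2 * (2 * (2 * (2 * (2 * (2 * 1))))))))))%nat.
apply (pow_double_lower _ 0.20139094); [lra| |lra].
apply (pow_double_lower _ 0.44876602); [lra| |lra].
apply (pow_double_lower _ 0.66990001); [lra| |lra].
apply (pow_double_lower _ 0.81847420); [lra| |lra].
apply (pow_double_lower _ 0.90469564); [lra| |lra].
apply (pow_double_lower _ 0.95115490); [lra| |lra].
apply (pow_double_lower _ 0.97527171); [lra| |lra].
apply (pow_double_lower _ 0.98755846); [lra| |lra].
apply (pow_double_lower _ 0.99375976); [lra| |lra].
apply (pow_double_lower _ 0.99687500); [lra| |lra].
rewrite pow_1. lra.
Qed.

Lemma exp_neg_1354 : 0.8728 <= exp (- (0.1354)).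
Proof.
assert (E := exp_pow_lower (- (0.1354) / 16) 0.9915375 16 ltac:(lra)).
replace (INR 16 * (- (0.1354) / 16)) with (- (0.1354)) in E by (rewrite INR_IZR_INZ; simpl; field).
eapply Rle_trans; [|exact E]. clear E.
change 16%nat with (2 * (2 * (2 * (2 * 1))))%nat.
apply (pow_double_lower _ 0.93427158); [lra| |lra].
apply (pow_double_lower _ 0.96657725); [lra| |lra].
apply (pow_double_lower _ 0.98314661); [lra| |lra].
apply (pow_double_lower _ 0.99153750); [lra| |lra].
rewrite pow_1. lra.
Qed.

Section Params.
Variable w0 : C.
Hypothesis Hre : 0.916196 <= Re w0 <= 0.916199.
Hypothesis Him : Ropp 0.182460 <= Im w0 <= Ropp 0.182457.

Definition zs : C := (mkC 0 (2 * PI) + log1m w0)%C.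

Lemma Re_1m : Re (1 - w0)%C = 1 - Re w0 /\ Im (1 - w0)%C = - Im w0.
Proof. unfold Re, Im; simpl. split; ring. Qed.

Lemma w0_mod : Cmod w0 ^ 2 <= 0.87275 /\ 0.04031 <= Cmod (1 - w0) ^ 2 <= 0.04032.
Proof.
rewrite !Cmod2. destruct Re_1m as [-> ->]. split; [|split]; nra.
Qed.

Lemma w0_lt_1 : Cmod w0 < 1 /\ Cmod (1 - w0) < 1.
Proof.
destruct w0_mod as [H1 H2]. assert (P := Cmod_ge_0 w0). assert (Q := Cmod_ge_0 (1 - w0)). split; nra.
Qed.

Lemma w0_nz : w0 <> 0%C /\ (1 - w0)%C <> 0%C.
Proof.
split; intros E; apply (f_equal Re) in E; rewrite ?(proj1 Re_1m) in E; change (Re 0%C) with 0 in E; lra.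
Qed.

Lemma cexp_zs : cexp zs = (1 - w0)%C.
Proof.
unfold zs. rewrite cexp_add, cexp_log1m by apply w0_lt_1.
replace (cexp (mkC 0 (2 * PI))) with (RtoC 1); [ring|].
apply C_ext; unfold cexp, mkC, Re, Im; simpl; rewrite exp_0, ?cos_2PI, ?sin_2PI; ring.
Qed.

Lemma zs_bounds : 1.6 <= - Re zs <= 1.61 /\ 7 * PI / 3 <= Im zs <= 5 * PI / 2.
Proof.
assert (PP := PI_RGT_0). destruct w0_mod as [_ H2]. destruct w0_lt_1 as [L1 L2]. destruct Re_1m as [R1 R2].
unfold zs. rewrite log1m_principal by auto. rewrite R1, R2.
change (Re (mkC 0 (2 * PI) + (ln (Cmod (1 - w0)), atan (- Im w0 / (1 - Re w0))))%C) with (0 + ln (Cmod (1 - w0))).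
change (Im (mkC 0 (2 * PI) + (ln (Cmod (1 - w0)), atan (- Im w0 / (1 - Re w0))))%C) with (2 * PI + atan (- Im w0 / (1 - Re w0))).
set (c := Cmod (1 - w0)) in *. assert (Hc : 0 < c) by (apply Cmod_gt_0, w0_nz).
assert (Lc : ln (c ^ 2) = 2 * ln c) by (rewrite ln_pow by auto; simpl; ring).
assert (B1 : Ropp 3.22 <= ln (c ^ 2)).
{ rewrite <- (ln_exp (Ropp 3.22)). apply ln_le; [apply exp_pos|]. rewrite exp_Ropp.
  apply Rle_trans with (/ 24.81); [apply Rinv_le_contravar; [lra|exact exp_322]|lra]. }
assert (B2 : ln (c ^ 2) <= - (3.2)).
{ rewrite <- (ln_exp (- (3.2))). apply ln_le; [apply pow_lt; auto|]. assert (E := exp_neg_32). lra. }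
split; [lra|]. set (t := - Im w0 / (1 - Re w0)).
assert (Ht : 2 <= t).
{ unfold t. apply Rmult_le_reg_r with (1 - Re w0); [lra|]. unfold Rdiv. rewrite Rmult_assoc, Rinv_l by lra. lra. }
assert (A := atan_bound t). split; [|lra].
enough (PI / 3 <= atan t) by lra.
rewrite <- (atan_tan (PI / 3)) by lra. rewrite tan_PI3.
assert (S3 : sqrt 3 < t).
{ apply Rlt_le_trans with 2; auto. rewrite <- (sqrt_pow2 2) by lra. apply sqrt_lt_1; lra. }
left. apply atan_increasing. auto.
Qed.

Lemma zs_mkC : zs = mkC (- - Re zs) (Im zs).
Proof. apply C_ext; unfold mkC, Re, Im; simpl; ring. Qed.

Lemma Re_zs_neg : Re zs < 0.
Proof. assert (Z := zs_bounds). lra. Qed.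

Lemma zs_nz : zs <> 0%C.
Proof. exact (Re_neg_nz zs Re_zs_neg). Qed.

Hypothesis Hli : dilog w0 = (mkC 0 (2 * PI) * log1m (1 - w0))%C.

Lemma dilog_zs : ((dilog (cexp zs) - zeta2) / zs)%C = (- log1m (1 - w0))%C.
Proof.
destruct w0_lt_1 as [L1 L2]. destruct w0_nz as [N1 N2]. assert (Z := zs_nz).
assert (E := dilog_reflection w0 N1 L1 L2). rewrite cexp_zs, <- E, Hli.
replace (dilog (1 - w0) - (mkC 0 (2 * PI) * log1m (1 - w0) + dilog (1 - w0) + log1m (1 - w0) * log1m w0))%C
  with (- (log1m (1 - w0) * zs))%C by (unfold zs; ring).
field. auto.
Qed.

Lemma lam_zs_1 : lam zs 1 = log1m (1 - w0).
Proof. rewrite lam_1, cexp_zs; auto. Qed.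

Lemma Lam_zs_1 : Lam zs 1 = (1 + log1m (1 - w0))%C.
Proof.
rewrite (Lam_1 zs Re_zs_neg). assert (Z := zs_nz).
replace ((zeta2 - dilog (cexp zs)) / zs)%C with (- ((dilog (cexp zs) - zeta2) / zs))%C by (field; auto).
rewrite dilog_zs. ring.
Qed.

Lemma Re_log_w0 : Re (log1m (1 - w0)) = ln (Cmod w0).
Proof.
rewrite log1m_principal by apply w0_lt_1. replace (1 - (1 - w0))%C with w0 by ring. reflexivity.
Qed.

(** The equality of the first two quantities is the saddle equation in the form used along the
    ray. *)
Lemma hlog_zs : hlog zs 1 = - ln (Cmod w0) /\ growth zs = - ln (Cmod w0) /\ 0.0677 <= - ln (Cmod w0).
Proof.
split; [|split].
- unfold hlog. rewrite Cmult_1_l, cexp_zs, Re_log_w0; auto.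
- unfold growth. rewrite dilog_zs, <- Re_log_w0. reflexivity.
- destruct w0_mod as [H1 _]. assert (P : 0 < Cmod w0) by (apply Cmod_gt_0, w0_nz).
  assert (L : ln (Cmod w0 ^ 2) = 2 * ln (Cmod w0)) by (rewrite ln_pow by auto; simpl; ring).
  assert (B : ln (Cmod w0 ^ 2) <= - (0.1354)).
  { rewrite <- (ln_exp (- (0.1354))). apply ln_le; [apply pow_lt; auto|]. assert (E := exp_neg_1354). lra. }
  lra.
Qed.

Lemma ek_zs_1 : ek zs 0 1 = (- w0 / zs)%C /\ (zs * ek zs 1 1)%C = (1 - w0 + w0 / zs)%C.
Proof.
assert (Z := zs_nz). assert (E0 := ek0_eq zs 1). assert (E1 := ek1_eq zs Re_zs_neg 1).
rewrite !Cmult_1_l, cexp_zs in E0, E1.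
assert (X : ek zs 0 1 = (- w0 / zs)%C).
{ replace (ek zs 0 1) with (/ zs * (zs * ek zs 0 1))%C by (field; auto). rewrite E0. field. auto. }
split; auto. rewrite E1, X. field. auto.
Qed.

Lemma dlam_zs_1 : dlam zs 1 = (- zs * (1 - w0) / w0 - 1)%C.
Proof.
destruct ek_zs_1 as [E0 E1]. destruct w0_nz as [N1 _]. assert (Z := zs_nz).
unfold dlam. rewrite Cmult_assoc, E1, E0. field. auto.
Qed.

Lemma coefA_zs : coefA zs 0 = (1 + log1m (1 - w0))%C /\ coefA zs 1 = 0%C /\ coefA zs 2 = (- zs * (1 - w0) / w0)%C.
Proof.
assert (L0 : Lam zs 0 = 0%C) by apply CInt_point.
unfold coefA. cbn [log_chain anti ev npow]. rewrite Rplus_0_r, ln_1, Rinv_1.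
change (ev zs (dlamk zs 0)) with (lam zs). change (ev zs (dlamk zs 1)) with (dlam zs).
rewrite L0, Lam_zs_1, lam_zs_1, dlam_zs_1. simpl.
split; [ring|split]; [|set (d := (- zs * (1 - w0) / w0)%C)]; simpl; rewrite ?Rmult_1_r, ?Rplus_0_l, ?RtoC_plus, ?RtoC_mult, ?RtoC_opp; try ring.
Qed.

(** For w0 = a - i b and r = |w0|^2 one has (1 - w0)/w0 = (a - r + i b)/r, which makes both parts
    explicit. The inequality |Im| <= Re is the condition of [gauss_limit]. *)
Lemma alpha_zs : (2 * alphaS zs)%C = (- zs * (1 - w0) / w0)%C /\
  0 < Re (alphaS zs) /\ Rabs (Im (alphaS zs)) <= Re (alphaS zs).
Proof.
destruct coefA_zs as [_ [_ E2]].
assert (E : (2 * alphaS zs)%C = (- zs * (1 - w0) / w0)%C) by (unfold alphaS; rewrite E2; field; apply w0_nz).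
split; auto. destruct zs_bounds as [[X1 X2] [Y1 Y2]]. destruct w0_nz as [N1 _].
assert (P := PI_gt_312). assert (P4 := PI_4).
assert (W : 0.87265 <= Cmod w0 ^ 2 <= 0.87275) by (rewrite Cmod2; split; nra).
set (r := Cmod w0 ^ 2) in *. set (x := - Re zs) in *. set (y := Im zs) in *. set (a := Re w0) in *. set (b := - Im w0).
assert (Er : r = a ^ 2 + b ^ 2) by (unfold r, b, a; rewrite Cmod2; ring).
assert (EA : (- zs * (1 - w0) / w0)%C = mkC ((x * (a - r) + y * b) / r) ((x * b - y * (a - r)) / r)).
{ rewrite (zs_mkC). fold x y. apply C_ext; unfold mkC, Re, Im; simpl; fold (Re w0) (Im w0); fold a;
    replace (Im w0) with (- b) by (unfold b; ring); rewrite Er; field; nra. }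
rewrite EA in E.
assert (ER : 2 * Re (alphaS zs) = (x * (a - r) + y * b) / r).
{ apply (f_equal Re) in E. rewrite (Re_scal 2) in E. exact E. }
assert (EI : 2 * Im (alphaS zs) = (x * b - y * (a - r)) / r).
{ apply (f_equal Im) in E. rewrite (Im_scal 2) in E. exact E. }
assert (G : Rabs (x * b - y * (a - r)) <= x * (a - r) + y * b /\ 0 < x * (a - r) + y * b).
{ assert (0.182457 <= b <= 0.182460) by (unfold b; lra). assert (0.0434 <= a - r <= 0.0436) by lra.
  set (d := a - r) in *.
  assert (0.29 <= x * b <= 0.3) by nra. assert (7.28 <= y <= 10) by lra. assert (0.31 <= y * d <= 0.44) by (split; nra).
  assert (0 <= x * d) by nra. assert (1 <= y * b) by nra.
  split; [apply Rabs_le|]; lra. }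
assert (I : 0 < / r) by (apply Rinv_0_lt_compat; lra).
assert (A : 2 * Rabs (Im (alphaS zs)) = Rabs (x * b - y * (a - r)) / r).
{ rewrite <- (Rabs_pos_eq 2) at 1 by lra. rewrite <- Rabs_mult, EI. unfold Rdiv. rewrite Rabs_mult, (Rabs_pos_eq (/ r)) by lra. auto. }
unfold Rdiv in *. split; nra.
Qed.

(** The exponentials of the two logarithms are - z0 and w0, both with negative imaginary part, and
    on [- pi/2, pi/2] an angle has the sign of its sine. *)
Lemma Im_lam_zs : - (PI / 2) <= Im (lam zs 0) < 0 /\ - (PI / 2) < Im (lam zs 1) < 0.
Proof.
assert (P := PI_RGT_0).
assert (Sg : forall u : C, - (PI / 2) <= Im u <= PI / 2 -> Im (cexp u) < 0 -> Im u < 0).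
{ intros u Hu H. unfold cexp, Im in *; simpl in *. apply Rnot_le_lt. intros Hp.
  assert (0 <= sin (snd u)) by (apply sin_ge_0; lra). assert (Q := exp_pos (Re u)). nra. }
split.
- assert (B := Im_lam_0 zs Re_zs_neg). split; [lra|]. apply Sg; auto.
  rewrite cexp_lam, ek0_0, Cmult_1_r by apply Re_zs_neg. destruct zs_bounds as [_ Y].
  change (Im (- zs)%C) with (- Im zs). lra.
- rewrite lam_zs_1. assert (B := Im_log1m_bound _ (proj2 w0_lt_1)). split; [lra|]. apply Sg; [lra|].
  rewrite cexp_log1m by apply w0_lt_1. replace (1 - (1 - w0))%C with w0 by ring. lra.
Qed.

(* Both sides have the same square [1/(1 - w0) = e^(-zs)], and both real parts are positive. *)
Lemma saddle_constant (T : R) (M : C) : exp (2 * T) = 2 * PI -> (alphaS zs * M ^ 2)%C = RtoC (PI / 4) -> 0 <= Re M ->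
  (cexp (kap zs - RtoC T) * (2 * M))%C = (- cexp (- (/ 2 * zs)))%C.
Proof.
intros HT HM HRe. assert (P := PI_RGT_0).
destruct alpha_zs as [EA [Ra Ia]]. destruct w0_nz as [N1 N2]. assert (Nz := zs_nz).
set (X := (cexp (kap zs - RtoC T) * (2 * M))%C). set (Y := cexp (- (/ 2 * zs))).
assert (HY2 : (Y * Y * (1 - w0))%C = 1%C).
{ unfold Y. rewrite <- cexp_zs, <- !cexp_add. replace (- (/ 2 * zs) + - (/ 2 * zs) + zs)%C with (RtoC 0) by field.
  apply cexp_0. }
assert (HPI : RtoC PI <> 0%C) by (intros E; apply RtoC_inj in E; lra).
assert (HX2 : (X * X * (1 - w0))%C = 1%C).
{ set (al := alphaS zs) in *.
  assert (Nal : al <> 0%C) by (intros E; rewrite E in Ra; unfold Re in Ra; simpl in Ra; lra).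
  assert (Ew : (1 - w0)%C = (- (2 * al) * w0 / zs)%C) by (rewrite EA; field; auto).
  assert (EM : (M * M)%C = (RtoC PI / 4 / al)%C).
  { replace (M * M)%C with (al * M ^ 2 / al)%C by (simpl; field; auto). rewrite HM. unfold Rdiv.
    rewrite RtoC_mult, RtoC_inv by lra. field. auto. }
  assert (Ek : (cexp (kap zs - RtoC T) * cexp (kap zs - RtoC T))%C = (- zs / w0 / (2 * RtoC PI))%C).
  { rewrite <- cexp_add. replace (kap zs - RtoC T + (kap zs - RtoC T))%C with (lam zs 0 + - lam zs 1 + - RtoC (2 * T))%C
      by (unfold kap; rewrite RtoC_mult; field).
    rewrite !cexp_add, !cexp_opp, !cexp_lam, ek0_0, (proj1 ek_zs_1), cexp_RtoC, HT, RtoC_mult by apply Re_zs_neg.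
    field. auto. }
  transitivity ((cexp (kap zs - RtoC T) * cexp (kap zs - RtoC T)) * 4 * (M * M) * (1 - w0))%C; [unfold X; ring|].
  rewrite Ek, EM, Ew. field. auto. }
assert (Fac : ((X - Y) * (X + Y))%C = 0%C).
{ replace ((X - Y) * (X + Y))%C with ((X * X * (1 - w0) - Y * Y * (1 - w0)) / (1 - w0))%C by (field; auto).
  rewrite HX2, HY2. field. auto. }
assert (HYre : Re Y < 0).
{ unfold Y, cexp. destruct zs_bounds as [_ [Y1 Y2]].
  change (exp (Re (- (/ 2 * zs))) * cos (Im (- (/ 2 * zs))) < 0).
  replace (Im (- (/ 2 * zs))%C) with (- (Im zs / 2)) by (unfold Im; simpl; field). rewrite cos_neg.
  assert (C : cos (Im zs / 2) < 0) by (apply cos_lt_0; lra). assert (Q := exp_pos (Re (- (/ 2 * zs))%C)). nra. }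
(* Im kap is half the difference of two angles in [- pi/2, 0), the second not equal to - pi/2, so it
   is below pi/4 in absolute value. M^2 has positive real part and Re M >= 0, so |arg M| < pi/4 as
   well, and the product has positive real part. *)
assert (HXre : 0 < Re X).
{ destruct Im_lam_zs as [[A1 A2] [B1 B2]].
  set (th := Im (kap zs)).
  assert (Eth : th = (Im (lam zs 0) - Im (lam zs 1)) / 2) by (unfold th, kap; generalize (lam zs 0) (lam zs 1); intros u v; unfold Im; simpl; field).
  assert (Ct : 0 < cos th) by (apply cos_gt_0; lra).
  assert (Cs : 0 < cos (2 * th)) by (apply cos_gt_0; lra).
  rewrite cos_2a in Cs.
  set (p := Re M) in *. set (q := Im M).
  assert (HM1 : Re (alphaS zs) * (p * p - q * q) - Im (alphaS zs) * (2 * p * q) = PI / 4).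
  { apply (f_equal Re) in HM. transitivity (Re (RtoC (PI / 4))); [|reflexivity]. unfold p, q. rewrite <- HM.
    generalize (alphaS zs). intros u. unfold Re, Im; simpl. ring. }
  assert (HM2 : Re (alphaS zs) * (2 * p * q) + Im (alphaS zs) * (p * p - q * q) = 0).
  { apply (f_equal Im) in HM. transitivity (Im (RtoC (PI / 4))); [|reflexivity]. unfold p, q. rewrite <- HM.
    generalize (alphaS zs). intros u. unfold Re, Im; simpl. ring. }
  assert (Hpq : 0 < p * p - q * q).
  { assert (Z : (p * p - q * q) * (Re (alphaS zs) ^ 2 + Im (alphaS zs) ^ 2) = Re (alphaS zs) * (PI / 4)).
    { rewrite <- HM1. transitivity (Re (alphaS zs) * (Re (alphaS zs) * (p * p - q * q) - Im (alphaS zs) * (2 * p * q))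
        + Im (alphaS zs) * (Re (alphaS zs) * (2 * p * q) + Im (alphaS zs) * (p * p - q * q))); [ring|rewrite HM2; ring]. }
    apply Rnot_le_lt. intros X0. assert (0 < Re (alphaS zs) * (PI / 4)) by nra. assert (0 <= Re (alphaS zs) ^ 2 + Im (alphaS zs) ^ 2) by nra. nra. }
  assert (Hp : 0 < p) by nra. 
  assert (Key : 0 < cos th * p - sin th * q).
  { apply Rnot_le_lt. intros X0. assert (H1 : 0 < cos th * p) by nra.
    assert (H2 : (cos th * p) * (cos th * p) <= (sin th * q) * (sin th * q)) by nra.
    assert (H3 : 0 <= sin th * sin th) by nra. assert (H4 : 0 <= q * q) by nra.
    assert (H5 : (sin th * q) * (sin th * q) <= cos th * cos th * (q * q)) by nra.
    assert (H6 : cos th * cos th * (q * q) < cos th * cos th * (p * p)) by (apply Rmult_lt_compat_l; nra). nra. }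
  unfold X. replace (kap zs - RtoC T)%C with (kap zs + RtoC (- T))%C by (rewrite RtoC_opp; ring).
  rewrite cexp_add, cexp_RtoC.
  replace (Re (cexp (kap zs) * RtoC (exp (- T)) * (2 * M))%C) with (exp (Re (kap zs)) * exp (- T) * 2 * (cos th * p - sin th * q)).
  - repeat apply Rmult_lt_0_compat; auto using exp_pos; lra.
  - unfold p, q, th, cexp. generalize (kap zs). intros k. unfold Re, Im; simpl. ring. }
destruct (Ceq_dec (X + Y)%C 0%C) as [H|H].
- transitivity (X + Y - Y)%C; [ring|]. rewrite H. ring.
- exfalso. assert (E : (X - Y)%C = 0%C).
  { replace (X - Y)%C with (/ (X + Y) * ((X - Y) * (X + Y)))%C by (field; auto). rewrite Fac. ring. }
  apply (f_equal Re) in E. rewrite Re_minus in E. change (Re 0%C) with 0 in E. lra.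
Qed.
End Params.

(** * The contour *)

Lemma Cmod_cpowz_le (u : C) (A : R) n : 1 <= A -> / A <= Cmod u <= 1 -> Cmod (cpowz u n) <= A ^ Z.abs_nat n.
Proof.
intros HA Hu. assert (Ia : 0 < / A) by (apply Rinv_0_lt_compat; lra).
assert (Nz : u <> 0%C) by (intros E; rewrite E, Cmod_0 in Hu; lra).
destruct n as [|p|p]; simpl.
- rewrite Cmod_1. lra.
- rewrite Cmod_pow. apply Rle_trans with 1; [rewrite <- (pow1 (Pos.to_nat p)); apply pow_incr; split; [apply Cmod_ge_0|lra]|].
  apply pow_R1_Rle; auto.
- rewrite Cmod_inv, Cmod_pow, <- pow_inv by (apply Cpow_nz; auto). apply pow_incr.
  split; [left; apply Rinv_0_lt_compat; lra|]. rewrite <- (Rinv_inv A). apply Rinv_le_contravar; lra.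
Qed.

(** The primitive in the scaled variable z = N t, in which the corners of the contour do not depend
    on N. *)
Definition prim (N : nat) (m : Z) (z : C) : C := star_prim (dom_center N) (integrand N m) (z * / RtoC (INR N))%C.

Lemma cder_affine (u v : C) t : cder (fun t => u + RtoC t * v)%C t v.
Proof. eapply gder_eq; [apply gder_plus; [apply gder_const|apply cder_line]|]. ring. Qed.

Lemma prim_diff (u v : C) N m a b : (1 <= N)%nat -> a <= b ->
  (forall t, a <= t <= b -> dom N ((u + RtoC t * v) * / RtoC (INR N))%C) ->
  (prim N m (u + RtoC b * v) - prim N m (u + RtoC a * v))%C =
  CInt (fun t => integrand N m ((u + RtoC t * v) * / RtoC (INR N)) * (v * / RtoC (INR N)))%C a b.
Proof.
intros HN Hab Hd. symmetry.
apply (star_prim_int (dom N) (dom_center N) (integrand N m) (fun t => (u + RtoC t * v) * / RtoC (INR N))%C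
  (fun _ => v * / RtoC (INR N))%C); auto.
- apply Copen_dom.
- intros z t Hz Ht. apply dom_star; auto.
- apply hol_integrand_dom; auto.
- intros t. eapply gder_eq; [apply gder_mult; [apply cder_affine|apply gder_const]|]. cbv beta; ring.
- intros t. apply gcont_const.
Qed.

Definition pexp (m : Z) : nat := Z.abs_nat (- m - 1).

(** 3200 is 16 times 200: then |z| <= 200 gives |z/N| <= 1/16, the range of [cexp_sub_1_bounds], and
    the power of e^t - 1 costs at most a power of 2 N. *)
Lemma integrand_bound (z : C) N m B : (3200 <= N)%nat -> 1 <= Cmod z <= 200 -> Cmod (rcp z N) <= B ->
  Cmod (integrand N m (z * / RtoC (INR N))) <= 2 * (2 * INR N) ^ pexp m * B.
Proof.
intros HN Hz HB. assert (NP : 3200 <= INR N).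
{ replace 3200 with (INR 3200) by (rewrite INR_IZR_INZ; reflexivity). apply le_INR; auto. }
rewrite integrand_rcp, !Cmod_mult by lia.
set (t := (z * / RtoC (INR N))%C).
assert (Mt : Cmod t = Cmod z / INR N).
{ unfold t. rewrite Cmod_mult, Cmod_inv, Cmod_R, Rabs_pos_eq by first [lra | intros E; apply RtoC_inj in E; lra]. auto. }
assert (I : 0 < / INR N) by (apply Rinv_0_lt_compat; lra).
assert (I2 : / INR N <= / 3200) by (apply Rinv_le_contravar; lra).
assert (T1 : Cmod t <= 1 / 16) by (rewrite Mt; unfold Rdiv; nra).
assert (T2 : / INR N <= Cmod t) by (rewrite Mt; unfold Rdiv; nra).
assert (E := cexp_sub_1_bounds t T1).
apply Rmult_le_compat; auto; [apply Rmult_le_pos; apply Cmod_ge_0|apply Cmod_ge_0|].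
apply Rmult_le_compat; try apply Cmod_ge_0.
- replace (cexp t) with (1 + (cexp t - 1))%C by ring. eapply Rle_trans; [apply Cmod_triangle|]. rewrite Cmod_1. lra.
- apply Cmod_cpowz_le; [lra|]. rewrite Rinv_mult. lra.
Qed.

(** 9600 = 2 * 2 * 12 * 200: the factors 2 of [CInt_bound_const] and of [integrand_bound], the speed
    |v| <= 12, and the length of the parameter interval. *)
Lemma affine_piece (u v : C) N m a b B : (3200 <= N)%nat -> a <= b <= a + 200 -> Cmod v <= 12 -> 0 <= B ->
  (forall t, a <= t <= b -> dom N ((u + RtoC t * v) * / RtoC (INR N))%C) ->
  (forall t, a < t < b -> 1 <= Cmod (u + RtoC t * v) <= 200 /\ Cmod (rcp (u + RtoC t * v)%C N) <= B) ->
  Cmod (prim N m (u + RtoC b * v) - prim N m (u + RtoC a * v)) <= 9600 * (2 * INR N) ^ pexp m * B.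
Proof.
intros HN Hab Hv HB Hd Hb. assert (NP : 3200 <= INR N).
{ replace 3200 with (INR 3200) by (rewrite INR_IZR_INZ; reflexivity). apply le_INR; auto. }
rewrite prim_diff by (auto; lia || lra).
assert (P : 0 <= (2 * INR N) ^ pexp m) by (apply pow_le; lra).
assert (PB : 0 <= (2 * INR N) ^ pexp m * B) by (apply Rmult_le_pos; auto).
eapply Rle_trans; [apply (CInt_bound_const _ (2 * (2 * INR N) ^ pexp m * B * 12)); [lra| |]|nra].
- intros t Ht. apply gcont_mult; [|apply gcont_const].
  apply (gcont_comp _ _ (integrand N m) (fun t => (u + RtoC t * v) * / RtoC (INR N))%C).
  + apply (hol_ccont (dom N)); [apply Hd; auto|apply hol_integrand_dom; lia].
  + apply gcont_mult; [exact (cder_cont _ _ _ (cder_affine u v t))|apply gcont_const].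
- intros t Ht. destruct (Hb t Ht) as [H1 H2]. rewrite Cmod_mult.
  apply Rmult_le_compat; try apply Cmod_ge_0; [apply integrand_bound; auto|].
  rewrite Cmod_mult, Cmod_inv, Cmod_R, Rabs_pos_eq by first [lra | intros E; apply RtoC_inj in E; lra].
  assert (I2 : / INR N <= 1) by (rewrite <- Rinv_1; apply Rinv_le_contravar; lra).
  assert (0 < / INR N) by (apply Rinv_0_lt_compat; lra). assert (Q := Cmod_ge_0 v). nra.
Qed.

Lemma dom_scaled N (z : C) : (1 <= N)%nat -> Re z <> 0 \/ 0 < Im z < 2 * PI -> dom N (z * / RtoC (INR N))%C.
Proof.
intros HN H. assert (NP : 1 <= INR N) by (apply (le_INR 1); auto).
assert (I : 0 < / INR N) by (apply Rinv_0_lt_compat; lra).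
replace (z * / RtoC (INR N))%C with (RtoC (/ INR N) * z)%C by (rewrite RtoC_inv by lra; ring).
unfold dom. rewrite Re_scal, Im_scal. destruct H as [H|H].
- left. apply Rmult_integral_contrapositive_currified; lra.
- right. unfold Rdiv. rewrite (Rmult_comm (2 * PI)). split; [nra|apply Rmult_lt_compat_l; lra].
Qed.

Section Contour.
Variables (x y P0 : R) (m : Z).
Hypothesis Hx : 1.6 <= x <= 1.61.
Hypothesis Hy : 7 * PI / 3 <= y <= 5 * PI / 2.
Let z0 := mkC (- x) y.
Hypothesis Hhlog : hlog z0 1 = P0.
Hypothesis Hpfun : growth z0 = P0.
Hypothesis HP0 : 0.0677 <= P0.

Lemma Cmod_ge_parts (z : C) : 1 <= Rabs (Re z) \/ 1 <= Rabs (Im z) -> 1 <= Cmod z.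
Proof. assert (A := Re_le_Cmod z). assert (B := Im_le_Cmod z). intros [H|H]; lra. Qed.

(** Everything but the segment through the saddle. The difference of primitives telescopes over the
    corners, and on each of the six remaining edges the rate is at most P0 - c. *)
Lemma contour_bound dl : 0 < dl <= / 8 -> exists c K, 0 < c /\ 0 <= K /\ forall N, (3200 <= N)%nat ->
  Cmod (prim N m (RtoC (- (16 * x))) - prim N m (RtoC 3) - (prim N m (RtoC (1 + dl) * z0) - prim N m (RtoC (1 - dl) * z0)))
  <= K * (2 * INR N) ^ pexp m * exp (INR N * (P0 - c)).
Proof.
intros Hdl. destruct (ray_s1_bounds y Hy) as [S1 S2]. assert (Yb := ray_y_bounds y Hy).
destruct (ray_gap x y Hx Hy ltac:(fold z0; lra) ltac:(fold z0; lra) dl ltac:(lra)) as [cg [Hcg Hgap]].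
fold z0 in Hgap. set (s1 := (2 * PI - / 20) / y) in *. set (y' := 2 * PI - / 20) in *.
assert (PP := PI_gt_312). assert (P4 := PI_4).
set (k1 := 3 * y' / sin y' ^ 2). set (k2 := 16 * (2 * x + y) / (1 - exp (- (PI / 2 * (x / y)))) ^ 2).
assert (Hk1 : 0 <= k1).
{ unfold k1. apply Rdiv_le_0_compat; [unfold y'; lra|]. assert (sin y' < 0) by (apply sin_lt_0; unfold y'; lra). nra. }
assert (Hk2 : 0 <= k2).
{ unfold k2. apply Rdiv_le_0_compat; [lra|]. apply pow_lt.
  assert (exp (- (PI / 2 * (x / y))) < 1); [|lra]. rewrite <- exp_0. apply exp_increasing.
  assert (0 < PI / 2 * (x / y)) by (apply Rmult_lt_0_compat; [lra|apply Rdiv_lt_0_compat; lra]). lra. }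
(* 0.001 leaves 0.0677 - 0.001 = 0.0667, above the bound 0.0666 used on the edges away from the
   ray. *)
set (c := Rmin cg 0.001). assert (Hc : 0 < c /\ c <= cg /\ c <= 0.001).
{ unfold c. split; [apply Rmin_pos; lra|]. split; [apply Rmin_l|apply Rmin_r]. }
exists c, (6 * 9600 * exp (k1 + k2)). assert (Pe := exp_pos (k1 + k2)). repeat split; try lra.
intros N HN. assert (NP : 3200 <= INR N).
{ replace 3200 with (INR 3200) by (rewrite INR_IZR_INZ; reflexivity). apply le_INR; auto. }
assert (HN1 : (1 <= N)%nat) by lia.
set (B := exp (INR N * (P0 - c) + (k1 + k2))). assert (PB : 0 < B) by apply exp_pos.
assert (HB : forall e k, e <= P0 - c -> k <= k1 + k2 -> exp (INR N * e + k) <= B).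
{ intros e k He Hk. apply exp_le. apply Rplus_le_compat; auto. apply Rmult_le_compat_l; lra. }
assert (HB0 : forall e, e <= P0 - c -> exp (INR N * e) <= B).
{ intros e He. rewrite <- (Rplus_0_r (INR N * e)). apply HB; lra. }
assert (Up : forall z : C, Rabs (Re z) <= 30 -> Rabs (Im z) <= 160 -> Cmod z <= 200).
{ intros z H1 H2. eapply Rle_trans; [apply Cmod_le_ReIm|]. lra. }
assert (Mci : Cmod Ci <= 12).
{ eapply Rle_trans; [apply Cmod_le_ReIm|]. unfold Ci, Re, Im; simpl. rewrite Rabs_R0, Rabs_R1. lra. }
(* At real part 3 the rate 1.65/3 - 3/2 is negative. *)
assert (V1 : Cmod (prim N m (RtoC 3 + RtoC y' * Ci) - prim N m (RtoC 3 + RtoC 0 * Ci)) <= 9600 * (2 * INR N) ^ pexp m * B).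
{ assert (Ez : forall t, (RtoC 3 + RtoC t * Ci)%C = mkC 3 t) by (intros t; apply C_ext; unfold mkC, Ci, Re, Im; simpl; ring).
  apply affine_piece; auto; [unfold y'; lra|lra| |].
  - intros t Ht. apply dom_scaled; auto. left. rewrite Ez. unfold mkC, Re; simpl. lra.
  - intros t Ht. rewrite Ez. split; [split|].
    + apply Cmod_ge_parts. left. unfold mkC, Re; simpl. rewrite Rabs_pos_eq; lra.
    + apply Up; unfold mkC, Re, Im; simpl; rewrite Rabs_pos_eq; unfold y' in *; lra.
    + eapply Rle_trans; [apply rcp_right; auto; lra|]. apply HB0. lra. }
assert (Ey : forall t, (mkC 0 y' + RtoC t * - (1))%C = mkC (- t) y') by (intros t; apply C_ext; unfold mkC, Re, Im; simpl; ring).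
assert (M1 : Cmod (- (1)) <= 12) by (rewrite Cmod_opp, Cmod_1; lra).
assert (Hyd : forall t, dom N ((mkC 0 y' + RtoC t * - (1)) * / RtoC (INR N))%C).
{ intros t. apply dom_scaled; auto. right. rewrite Ey. unfold mkC, Im, y'; simpl. lra. }
assert (Hyb : forall t, Rabs t <= 3 -> 1 <= Cmod (mkC (- t) y') <= 200).
{ intros t Ht. split.
  - apply Cmod_ge_parts. right. unfold mkC, Im; simpl. rewrite Rabs_pos_eq; unfold y'; lra.
  - apply Up; unfold mkC, Re, Im; simpl; [rewrite Rabs_Ropp; lra|rewrite Rabs_pos_eq; unfold y'; lra]. }
assert (H1 : Cmod (prim N m (mkC 0 y' + RtoC 0 * - (1)) - prim N m (mkC 0 y' + RtoC (- 3) * - (1))) <= 9600 * (2 * INR N) ^ pexp m * B).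
{ apply affine_piece; auto; [lra|lra|].
  intros t Ht. rewrite Ey. split; [apply Hyb; apply Rabs_le; lra|].
  eapply Rle_trans; [apply (rcp_horizontal_right (- t) y' N); auto; unfold y'; lra|].
  fold k1. apply HB; lra. }
assert (Hsx : 0 < s1 * x <= 1.38) by nra.
assert (H2 : Cmod (prim N m (mkC 0 y' + RtoC (s1 * x) * - (1)) - prim N m (mkC 0 y' + RtoC 0 * - (1))) <= 9600 * (2 * INR N) ^ pexp m * B).
{ apply affine_piece; auto; [lra|lra|].
  intros t Ht. rewrite Ey. split; [apply Hyb; apply Rabs_le; lra|].
  eapply Rle_trans; [apply (rcp_horizontal_left t y' N); auto; unfold y'; lra|].
  fold k1. apply HB; [|lra]. apply Rle_trans with 0.0666; [|lra].
  assert (6.19 <= y') by (unfold y'; lra).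
  apply Rmult_le_reg_r with (t ^ 2 + y' ^ 2); [nra|]. unfold Rdiv. rewrite Rmult_assoc, Rinv_l by nra. nra. }
assert (Ez : forall t, (0 + RtoC t * z0)%C = mkC (- (t * x)) (t * y)) by (intros t; apply C_ext; unfold z0, mkC, Re, Im; simpl; ring).
assert (Mz : Cmod z0 <= 12).
{ eapply Rle_trans; [apply Cmod_le_ReIm|]. unfold z0, mkC, Re, Im; simpl. rewrite Rabs_Ropp, !Rabs_pos_eq; lra. }
assert (Ray : forall a b, s1 <= a <= b -> b <= 16 -> (forall t, a < t < b -> dl <= Rabs (t - 1)) ->
  Cmod (prim N m (0 + RtoC b * z0) - prim N m (0 + RtoC a * z0)) <= 9600 * (2 * INR N) ^ pexp m * B).
{ intros a b Hab Hb Hfar. apply affine_piece; auto; [lra|lra| |].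
  - intros t Ht. apply dom_scaled; auto. left. rewrite Ez. unfold mkC, Re; simpl. nra.
  - intros t Ht. split; [rewrite Ez; split|].
    + apply Cmod_ge_parts. left. unfold mkC, Re; simpl. rewrite Rabs_Ropp, Rabs_pos_eq; nra.
    + apply Up; unfold mkC, Re, Im; simpl; [rewrite Rabs_Ropp|]; rewrite Rabs_pos_eq; nra.
    + rewrite Cplus_0_l. eapply Rle_trans; [apply (rcp_ray x y Hx Hy t N); auto; lra|]. fold z0. fold k2.
      assert (G := Hgap t ltac:(lra) (Hfar t Ht)). apply HB; lra. }
assert (R1 := Ray s1 (1 - dl) ltac:(lra) ltac:(lra) ltac:(intros t Ht; rewrite Rabs_left1; lra)).
assert (R3 := Ray (1 + dl) 16 ltac:(lra) ltac:(lra) ltac:(intros t Ht; rewrite Rabs_pos_eq; lra)).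
assert (Ew : forall t, (mkC (- (16 * x)) (16 * y) + RtoC t * - Ci)%C = mkC (- (16 * x)) (16 * y - t))
  by (intros t; apply C_ext; unfold mkC, Ci, Re, Im; simpl; ring).
(* The rate 1.65/(16 x) is below 0.0645 because x >= 1.6; this is why the ray is followed as far as
   16 z0. *)
assert (V2 : Cmod (prim N m (mkC (- (16 * x)) (16 * y) + RtoC (16 * y) * - Ci) - prim N m (mkC (- (16 * x)) (16 * y) + RtoC 0 * - Ci))
   <= 9600 * (2 * INR N) ^ pexp m * B).
{ apply affine_piece; auto; [lra|rewrite Cmod_opp; auto|lra| |].
  - intros t Ht. apply dom_scaled; auto. left. rewrite Ew. unfold mkC, Re; simpl. lra.
  - intros t Ht. rewrite Ew. split; [split|].
    + apply Cmod_ge_parts. left. unfold mkC, Re; simpl. rewrite Rabs_Ropp, Rabs_pos_eq; lra.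
    + apply Up; unfold mkC, Re, Im; simpl; [rewrite Rabs_Ropp|]; rewrite Rabs_pos_eq; lra.
    + eapply Rle_trans; [apply rcp_left; auto; lra|]. apply HB0. apply Rle_trans with 0.0666; [|lra].
      apply Rmult_le_reg_r with (16 * x); [lra|]. unfold Rdiv. rewrite Rmult_assoc, Rinv_l by lra. lra. }
rewrite !Cplus_0_l, Cmult_0_l, Cplus_0_r in *.
assert (Q1 : (mkC 0 y' + RtoC (- 3) * - (1))%C = (RtoC 3 + RtoC y' * Ci)%C) by (apply C_ext; unfold mkC, Ci, Re, Im; simpl; ring).
assert (Q2 : (mkC 0 y' + RtoC (s1 * x) * - (1))%C = (RtoC s1 * z0)%C) by (rewrite Ey; apply C_ext; unfold z0, mkC, Re, Im; simpl; rewrite <- ?S2; ring).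
assert (Q3 : mkC (- (16 * x)) (16 * y) = (RtoC 16 * z0)%C) by (apply C_ext; unfold z0, mkC, Re, Im; simpl; ring).
assert (Q4 : (mkC (- (16 * x)) (16 * y) + RtoC (16 * y) * - Ci)%C = RtoC (- (16 * x))) by (rewrite Ew; apply C_ext; unfold mkC, Re, Im; simpl; ring).
rewrite Q1 in H1. rewrite Q2 in H2. rewrite Q4, Q3 in V2. 
rewrite ?Cmult_0_l, ?Cplus_0_r in *.
set (g1 := prim N m (RtoC 3)) in *. set (g2 := prim N m (RtoC 3 + RtoC y' * Ci)) in *. set (g3 := prim N m (mkC 0 y')) in *.
set (g4 := prim N m (RtoC s1 * z0)) in *. set (g5 := prim N m (RtoC (1 - dl) * z0)) in *.
set (g6 := prim N m (RtoC (1 + dl) * z0)) in *. set (g7 := prim N m (RtoC 16 * z0)) in *. set (g8 := prim N m (RtoC (- (16 * x)))) in *.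
replace (g8 - g1 - (g6 - g5))%C with ((g2 - g1) + ((g3 - g2) + ((g4 - g3) + ((g5 - g4) + ((g7 - g6) + (g8 - g7))))))%C by ring.
assert (T1 := Cmod_triangle (g2 - g1) ((g3 - g2) + ((g4 - g3) + ((g5 - g4) + ((g7 - g6) + (g8 - g7)))))).
assert (T2 := Cmod_triangle (g3 - g2) ((g4 - g3) + ((g5 - g4) + ((g7 - g6) + (g8 - g7))))).
assert (T3 := Cmod_triangle (g4 - g3) ((g5 - g4) + ((g7 - g6) + (g8 - g7)))).
assert (T4 := Cmod_triangle (g5 - g4) ((g7 - g6) + (g8 - g7))).
assert (T5 := Cmod_triangle (g7 - g6) (g8 - g7)).
replace (6 * 9600 * exp (k1 + k2) * (2 * INR N) ^ pexp m * exp (INR N * (P0 - c))) with (6 * (9600 * (2 * INR N) ^ pexp m * B))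
  by (unfold B; rewrite exp_plus; ring).
lra.
Qed.
End Contour.

(** * The asymptotic expansion *)

Lemma cpowz_RtoC x n : x <> 0 -> cpowz (RtoC x) n = RtoC (powerRZ x n).
Proof.
intros Hx. destruct n; simpl; auto.
- now rewrite RtoC_pow.
- rewrite RtoC_inv by (apply pow_nonzero; auto). now rewrite RtoC_pow.
Qed.

Lemma powerRZ_le_abs x n : 1 <= x -> powerRZ x n <= x ^ Z.abs_nat n.
Proof.
intros Hx. destruct n; simpl; [lra|lra|].
assert (P : 1 <= x ^ Pos.to_nat p) by (apply pow_R1_Rle; auto).
assert (/ x ^ Pos.to_nat p <= 1) by (rewrite <- Rinv_1; apply Rinv_le_contravar; lra). lra.
Qed.

Definition approx (w0 : C) (m : Z) (c : nat -> C) (r N : nat) : R :=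
  Re (/ (w0 ^ N) * / RtoC (powerRZ (INR N) (1 - m)) * csum (fun j => c j * / RtoC (INR N ^ j))%C r)%C.

Section Final.
Variable w0 : C.
Hypothesis Hre : 0.916196 <= Re w0 <= 0.916199.
Hypothesis Him : Ropp 0.182460 <= Im w0 <= Ropp 0.182457.
Hypothesis Hli : dilog w0 = (mkC 0 (2 * PI) * log1m (1 - w0))%C.
Variable m : Z.
Let z0 := zs w0.

Definition coefK : C := (cpowz z0 (- m) * / (RtoC PI * Ci))%C.

Lemma PI_Ci_nz : (RtoC PI * Ci)%C <> 0%C.
Proof. intros E. apply (f_equal Im) in E. unfold Ci, Im in E; simpl in E. assert (P := PI_RGT_0). lra. Qed.

(** Division by i turns the imaginary part produced by [laurent_coeff] into the real part of the
    expansion. *)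
Lemma Im_over_PI (S : C) : Im S / PI = Re (S * / (RtoC PI * Ci))%C.
Proof.
assert (P := PI_RGT_0). unfold Ci, Re, Im, Cinv, Cmult; simpl. field. nra.
Qed.

Lemma cexp_N_log N : cexp (RtoC (INR N) * (1 - coefA z0 0)) = (/ w0 ^ N)%C.
Proof.
unfold z0. rewrite (proj1 (coefA_zs w0 Hre Him Hli)).
replace (RtoC (INR N) * (1 - (1 + log1m (1 - w0))))%C with (- (RtoC (INR N) * log1m (1 - w0)))%C by ring.
rewrite cexp_opp, <- cexp_pow, cexp_log1m by apply (w0_lt_1 w0 Hre Him).
do 2 f_equal. ring.
Qed.

Lemma saddle_part dl N : 0 < dl <= / 8 -> (1 <= N)%nat -> forall T, ccont_on (sadH z0 T m N) (- dl) dl ->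
  ((prim N m (RtoC (1 + dl) * z0) - prim N m (RtoC (1 - dl) * z0)) * / (RtoC PI * Ci))%C =
  (/ w0 ^ N * / RtoC (powerRZ (INR N) (1 - m)) * (coefK * laplace dl (alphaS z0) (sadH z0 T m) N))%C.
Proof.
intros Hdl HN T HC. assert (Hz : Re z0 < 0) by exact (Re_zs_neg w0 Hre Him).
assert (NP : 1 <= INR N) by (apply (le_INR 1); auto).
assert (Ez : forall t, (z0 + RtoC t * z0)%C = (RtoC (1 + t) * z0)%C) by (intros t; rewrite RtoC_plus; ring).
assert (D := prim_diff z0 z0 N m (- dl) dl HN ltac:(lra)). rewrite !Ez in D.
replace (1 - dl) with (1 + - dl) by ring. rewrite D.
- rewrite (CInt_ext _ (fun s => integrand N m (RtoC (1 + s) * z0 * / RtoC (INR N)) * (z0 * / RtoC (INR N)))%C)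
    by (try lra; intros t _; now rewrite Ez).
  rewrite (saddle_integral z0 Hz T m dl N) by (auto; lra). rewrite cexp_N_log.
  assert (E : (cpowz (RtoC (eps N)) (- m) * RtoC (eps N))%C = (/ RtoC (powerRZ (INR N) (1 - m)))%C).
  { assert (Np : powerRZ (INR N) (1 - m) <> 0) by (apply powerRZ_NOR; lra).
    assert (I : eps N <> 0) by (apply Rinv_neq_0_compat; lra).
    rewrite <- RtoC_inv by auto. rewrite cpowz_RtoC by auto. rewrite <- RtoC_mult. f_equal.
    replace (1 - m)%Z with (- m + 1)%Z by lia. rewrite powerRZ_add by lra. rewrite Rinv_mult, <- !powerRZ_inv'.
    f_equal. simpl. ring. }
  rewrite <- E. unfold coefK. ring.
- intros t Ht. rewrite Ez. apply dom_scaled; auto. left. rewrite Re_scal. apply Rmult_integral_contrapositive_currified; lra.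
Qed.

(** The coefficients come from the Laplace integral over the saddle segment alone; the rest of the
    contour is smaller by a factor exp(- c N), which beats every power of N. *)
Theorem expansion : exists c : nat -> C, c 0%nat = (coefK * - cexp (- (/ 2 * z0)))%C /\
  forall r, exists K, 0 <= K /\ forall N, (3200 <= N)%nat ->
    Rabs (Im (prim N m (RtoC (- (16 * - Re z0))) - prim N m (RtoC 3)) / PI - approx w0 m c r N)
    <= K * / Cmod w0 ^ N / powerRZ (INR N) (Z.of_nat r + 1 - m).
Proof.
destruct (zs_bounds w0 Hre Him) as [Hx Hy]. assert (Hz : Re z0 < 0) by exact (Re_zs_neg w0 Hre Him).
destruct (alpha_zs w0 Hre Him Hli) as [_ [Ra Ia]]. fold z0 in Hx, Hy, Ra, Ia.
destruct (gauss_limit (alphaS z0) Ra Ia) as [M [HM1 [HM2 HM3]]].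
destruct stir_limit as [T HT]. assert (HTv := stir_value T HT).
assert (Hsad : coefA z0 1 = 0%C) by apply (coefA_zs w0 Hre Him Hli).
destruct (sadH_props z0 Hz Hsad T HT m (Re (alphaS z0) / 2) ltac:(lra)) as [dl [Hdl [HA [HC [KL [HKL HL]]]]]].
assert (Hd1 : 0 < dl <= 1) by lra.
assert (Hb : 0 <= Re (alphaS z0) / 2 < Re (alphaS z0)) by lra.
set (u := laplace dl (alphaS z0) (sadH z0 T m)).
assert (HAs : aseq u) by exact (laplace_aseq dl (alphaS z0) Hd1 Ra M HM3 _ Hb _ HA HC).
destruct (aseq_coeffs u HAs) as [d Hd].
assert (Hd0 : d 0%nat = (- cexp (- (/ 2 * z0)))%C).
{ assert (SC := saddle_constant w0 Hre Him Hli T M HTv HM1 HM2). fold z0 in SC. rewrite <- SC.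
  apply Ceq_minus, Cmod_eq_0, Rle_antisym; [|apply Cmod_ge_0].
  destruct (laplace_limit dl (alphaS z0) Hd1 Ra M HM3 _ Hb _ (cexp (kap z0 - RtoC T)) KL 3 HKL HC HL) as [K [HK HKb]].
  destruct (Hd 1%nat) as [B [HB HBb]]. apply (small_eta (B + K)). intros N HN.
  specialize (HKb N HN). specialize (HBb N HN). unfold epoly in HBb. cbn [csum] in HBb. fold u in HKb.
  set (h := (cexp (kap z0 - RtoC T) * (2 * M))%C) in *.
  replace (d 0%nat - h)%C with (- (u N - (0 + d 0%nat * RtoC (eps N) ^ 0)) + (u N - h))%C by (simpl; ring).
  eapply Rle_trans; [apply Cmod_triangle|]. rewrite Cmod_opp. rewrite pow_1 in HBb.
  destruct (eta_bounds N HN) as [E1 E2]. assert (eps N <= eta N) by (rewrite <- E2; simpl; nra). nra. }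
exists (fun j => coefK * d j)%C. split; [now rewrite Hd0|]. intros r.
destruct (Hd r) as [B [HB HBb]].
destruct (hlog_zs w0 Hre Him Hli) as [Hh [Hp HP]]. fold z0 in Hh, Hp.
assert (Ez0 := zs_mkC w0). fold z0 in Ez0.
destruct (contour_bound (- Re z0) (Im z0) (- ln (Cmod w0)) m Hx Hy ltac:(rewrite <- Ez0; auto) ltac:(rewrite <- Ez0; auto) HP dl Hdl)
  as [c [K [Hc [HK HKb]]]]. rewrite <- Ez0 in HKb.
(* The powers of N that exp (c N) has to absorb: those of the contour bound and those of the target
   scale. *)
set (p := (pexp m + Z.abs_nat (Z.of_nat r + 1 - m))%nat).
destruct (pow_exp_bound p c Hc) as [D [HD HDb]].
exists (Cmod coefK * B + / PI * (K * 2 ^ pexp m * D)).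
assert (PK := Cmod_ge_0 coefK). assert (PPI : 0 < / PI) by (apply Rinv_0_lt_compat, PI_RGT_0).
assert (P2 : 0 < 2 ^ pexp m) by (apply pow_lt; lra).
assert (PKD : 0 <= / PI * (K * 2 ^ pexp m * D)) by (apply Rmult_le_pos; [lra|]; apply Rmult_le_pos; [|lra]; apply Rmult_le_pos; lra).
assert (PKB : 0 <= Cmod coefK * B) by (apply Rmult_le_pos; auto).
split; [lra|].
intros N HN. assert (HN1 : (1 <= N)%nat) by lia. assert (NP : 1 <= INR N) by (apply (le_INR 1); auto).
specialize (HKb N HN). specialize (HBb N HN1).
assert (Hw : 0 < Cmod w0) by (apply Cmod_gt_0, (w0_nz w0 Hre)).
set (W := / Cmod w0 ^ N). assert (HW : 0 < W) by (apply Rinv_0_lt_compat, pow_lt; auto).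
set (Q := powerRZ (INR N) (Z.of_nat r + 1 - m)). assert (HQ : 0 < Q) by (apply powerRZ_lt; lra).
set (Q1 := powerRZ (INR N) (1 - m)). assert (HQ1 : 0 < Q1) by (apply powerRZ_lt; lra).
assert (EQ : Q = INR N ^ r * Q1).
{ unfold Q, Q1. replace (Z.of_nat r + 1 - m)%Z with (Z.of_nat r + (1 - m))%Z by lia.
  rewrite powerRZ_add by lra. now rewrite <- pow_powerRZ. }
set (tot := (prim N m (RtoC (- (16 * - Re z0))) - prim N m (RtoC 3))%C) in *.
set (sp := (prim N m (RtoC (1 + dl) * z0) - prim N m (RtoC (1 - dl) * z0))%C) in *.
assert (Hsp := saddle_part dl N Hdl HN1 T (HC N HN1)). fold sp in Hsp. fold u in Hsp. fold Q1 in Hsp.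
replace tot with (sp + (tot - sp))%C by ring.
assert (Eim : Im (sp + (tot - sp))%C / PI = Im sp / PI + / PI * Im (tot - sp)%C).
{ unfold Rdiv. change (Im (sp + (tot - sp))%C) with (Im sp + Im (tot - sp)%C). ring. }
rewrite Eim, Im_over_PI, Hsp.
assert (Eap : approx w0 m (fun j => coefK * d j)%C r N = Re (/ w0 ^ N * / RtoC Q1 * (coefK * epoly d N r))%C).
{ unfold approx. fold Q1. f_equal. f_equal. unfold epoly. rewrite <- csum_scal. apply csum_ext. intros j _.
  rewrite <- RtoC_pow, pow_inv, RtoC_inv by (apply pow_nonzero; lra). ring. }
rewrite Eap.
replace (Re (/ w0 ^ N * / RtoC Q1 * (coefK * u N))%C + / PI * Im (tot - sp)%C - Re (/ w0 ^ N * / RtoC Q1 * (coefK * epoly d N r))%C)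
  with (Re (/ w0 ^ N * / RtoC Q1 * (coefK * (u N - epoly d N r)))%C + / PI * Im (tot - sp)%C).
2:{ replace (/ w0 ^ N * / RtoC Q1 * (coefK * (u N - epoly d N r)))%C with
      (/ w0 ^ N * / RtoC Q1 * (coefK * u N) - / w0 ^ N * / RtoC Q1 * (coefK * epoly d N r))%C by ring. rewrite Re_minus. ring. }
eapply Rle_trans; [apply Rabs_triang|].
assert (T1 : Rabs (Re (/ w0 ^ N * / RtoC Q1 * (coefK * (u N - epoly d N r)))%C) <= Cmod coefK * B * (W * / Q)).
{ eapply Rle_trans; [apply Re_le_Cmod|].
  rewrite !Cmod_mult, !Cmod_inv, Cmod_pow, Cmod_R, (Rabs_pos_eq Q1)
    by first [lra | apply Cpow_nz, (w0_nz w0 Hre) | intros E; apply RtoC_inj in E; lra].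
  fold W. rewrite EQ, Rinv_mult, <- pow_inv.
  replace (Cmod coefK * B * (W * (eps N ^ r * / Q1))) with (W * / Q1 * (Cmod coefK * (B * eps N ^ r))) by ring.
  assert (0 < / Q1) by (apply Rinv_0_lt_compat; auto).
  apply Rmult_le_compat_l; [nra|]. apply Rmult_le_compat_l; auto. }
assert (T2 : Rabs (/ PI * Im (tot - sp)%C) <= / PI * (K * 2 ^ pexp m * D) * (W * / Q)).
{ rewrite Rabs_mult, (Rabs_pos_eq (/ PI)), (Rmult_assoc (/ PI)) by lra. apply Rmult_le_compat_l; [lra|].
  eapply Rle_trans; [apply Im_le_Cmod|]. eapply Rle_trans; [exact HKb|].
  assert (Ee : exp (INR N * (- ln (Cmod w0) - c)) = W * / exp (c * INR N)).
  { replace (INR N * (- ln (Cmod w0) - c)) with (- (INR N * ln (Cmod w0)) + - (c * INR N)) by ring.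
    rewrite exp_plus, !exp_Ropp. f_equal. unfold W. f_equal. rewrite <- ln_pow, exp_ln; auto. apply pow_lt; auto. }
  rewrite Ee, Rpow_mult_distr.
  assert (Pe := exp_pos (c * INR N)).
  assert (G : INR N ^ pexp m * Q <= D * exp (c * INR N)).
  { specialize (HDb (INR N) ltac:(lra)). eapply Rle_trans; [|exact HDb].
    apply Rle_trans with (INR N ^ p); [|apply pow_incr; lra]. unfold p. rewrite pow_add.
    apply Rmult_le_compat_l; [apply pow_le; lra|]. apply powerRZ_le_abs; auto. }
  apply Rmult_le_reg_r with (exp (c * INR N) * Q); [apply Rmult_lt_0_compat; auto|].
  replace (K * (2 ^ pexp m * INR N ^ pexp m) * (W * / exp (c * INR N)) * (exp (c * INR N) * Q))
    with (K * 2 ^ pexp m * W * (INR N ^ pexp m * Q)) by (field; lra).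
  replace (K * 2 ^ pexp m * D * (W * / Q) * (exp (c * INR N) * Q)) with (K * 2 ^ pexp m * W * (D * exp (c * INR N))) by (field; lra).
  apply Rmult_le_compat_l; auto. apply Rmult_le_pos; [apply Rmult_le_pos|]; lra. }
unfold Rdiv. rewrite Rmult_assoc, Rmult_plus_distr_r. lra.
Qed.
End Final.

(** * Laurent coefficients at 1 *)

(** [CC] and the library type [C] are both R * R, and addition and multiplication agree by
    conversion; norm, inverse, powers and sums are reconciled here. *)
Lemma Cnorm_Cmod (z : C) : Defs.Cnorm z = Cmod z.
Proof. unfold Defs.Cnorm, Cmod, Defs.Re, Defs.Im. f_equal. ring. Qed.

Lemma DCinv (z : C) : Defs.Cinv z = Cinv z.
Proof. unfold Defs.Cinv, Cinv, Defs.Re, Defs.Im. cbv zeta. f_equal; f_equal; ring. Qed.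

Lemma DCdiv (z w : C) : Defs.Cdiv z w = (z * / w)%C.
Proof. unfold Defs.Cdiv. rewrite DCinv. reflexivity. Qed.

Lemma DCpow (z : C) n : Defs.Cpow z n = (z ^ n)%C.
Proof. induction n; [reflexivity|]. cbn [Defs.Cpow]. rewrite IHn, Cpow_S. reflexivity. Qed.

Lemma DCpowz (z : C) n : Defs.Cpowz z n = cpowz z n.
Proof. destruct n; simpl; rewrite ?DCinv, ?DCpow; reflexivity. Qed.

Lemma DCsum (f g : nat -> C) n : (forall j, f j = g j) -> Defs.Csum f n = csum g n.
Proof. intros H. induction n; [reflexivity|]. cbn [Defs.Csum csum]. rewrite IHn, H. reflexivity. Qed.

Lemma Dqpoch (q : C) n : Defs.qpoch q n = cpoch q n.
Proof. induction n; [reflexivity|]. cbn [Defs.qpoch cpoch]. rewrite IHn, DCpow. reflexivity. Qed.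

Lemma DCLog (w : C) : Cmod w < 1 -> Defs.CLog (1 - w)%C = log1m w.
Proof.
intros H. rewrite log1m_principal by auto. unfold Defs.CLog. rewrite Cnorm_Cmod. f_equal.
unfold Defs.Carg. cbv zeta. assert (P := Re_one_minus_pos w H).
destruct (Rlt_dec 0 (Defs.Re (1 - w)%C)) as [_|Q]; [reflexivity|]. contradiction.
Qed.

Lemma Ccv_elim (u : nat -> C) (l : C) : Defs.Ccv u l -> forall e, 0 < e ->
  exists n0, forall n, (n0 <= n)%nat -> Cmod (u n - l) < e.
Proof.
intros H e He. destruct (H e He) as [n0 Hn]. exists n0. intros n Hle. specialize (Hn n Hle).
unfold R_dist in Hn. rewrite Rminus_0_r, Cnorm_Cmod in Hn. eapply Rle_lt_trans; [apply Rle_abs|exact Hn].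
Qed.

Lemma Li2_is_dilog (w s : C) : Cmod w < 1 -> Defs.Li2_is w s -> dilog w = s.
Proof.
intros Hw H. apply Ceq_minus, Cmod_eq_0, Rle_antisym; [|apply Cmod_ge_0].
apply le_epsilon. intros e He. rewrite Rplus_0_l.
destruct (Ccv_elim _ _ H (e / 2) ltac:(lra)) as [n0 Hn].
destruct (nfloor_ex (4 / e)) as [k [_ Hk]]; [apply Rdiv_le_0_compat; lra|].
set (K := S (n0 + k)). specialize (Hn K ltac:(unfold K; lia)).
set (f := fun n => (RtoC (/ (INR (S n) * INR (S n))) * w ^ S n)%C).
assert (E : Defs.Li2_partial w K = csum f K).
{ apply DCsum. intros j. rewrite DCdiv, DCpow. change (Defs.RtoC (INR (S j) * INR (S j))) with (RtoC (INR (S j) * INR (S j))).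
  unfold f. assert (P := INR_S_pos j). rewrite <- RtoC_inv by nra. ring. }
rewrite E in Hn.
destruct (Cser_incr_n f K (dominated_dilog w ltac:(lra))) as [Es _].
assert (Tl : Cmod (Cser (fun n => f (K + n)%nat)) <= 2 * / INR K).
{ destruct (inv_sq_tail K ltac:(unfold K; lia)) as [T1 T2].
  eapply Rle_trans; [apply (Cser_bound _ _ T1)|].
  - intros n. unfold f. replace (S (K + n)) with (K + S n)%nat by lia. rewrite Cmod_mult, Cmod_pow, Cmod_R.
    assert (P : 0 < INR (K + S n)) by (apply lt_0_INR; lia).
    assert (I : 0 < / (INR (K + S n) * INR (K + S n))) by (apply Rinv_0_lt_compat; nra). rewrite Rabs_pos_eq by lra.
    assert (Cmod w ^ (K + S n) <= 1) by (rewrite <- (pow1 (K + S n)); apply pow_incr; split; [apply Cmod_ge_0|lra]). nra.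
  - apply Rmult_le_compat_l; [lra|exact T2]. }
change (dilog w) with (Cser f). rewrite Es.
replace (csum f K + Cser (fun n => f (K + n)%nat) - s)%C with ((csum f K - s) + Cser (fun n => f (K + n)%nat))%C by ring.
eapply Rle_trans; [apply Cmod_triangle|].
assert (HK : 4 / e < INR K).
{ unfold K. rewrite S_INR, plus_INR. assert (P := pos_INR n0). lra. }
assert (I : / INR K <= e / 4).
{ replace (e / 4) with (/ (4 / e)) by (field; lra). left. apply Rinv_lt_contravar; [|auto].
  apply Rmult_lt_0_compat; [apply Rdiv_lt_0_compat; lra|]. apply Rlt_trans with (4 / e); auto. apply Rdiv_lt_0_compat; lra. }
lra.
Qed.

(* [X] and [Y] are arbitrary, so [3] and [16 |Re z0|] may be used for every [N]. *)
Lemma laurent_value N m (a : Z -> C) X Y : (1 <= N)%nat -> (0 <= m + Z.of_nat N)%Z -> 0 < X -> 0 < Y ->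
  Defs.IsLaurentAt1 N a -> a m = RtoC (Im (prim N m (RtoC (- Y)) - prim N m (RtoC X)) / PI).
Proof.
intros HN Hm HX HY [_ [delta [Hd HL]]].
assert (NP : 1 <= INR N) by (apply (le_INR 1); auto).
assert (Ep : forall t, prim N m (RtoC t) = star_prim (dom_center N) (integrand N m) (RtoC (t / INR N))).
{ intros t. unfold prim. f_equal. rewrite <- RtoC_inv, <- RtoC_mult by lra. reflexivity. }
rewrite !Ep. replace (- Y / INR N) with (- (Y / INR N)) by (field; lra).
set (M := Z.to_nat (m + Z.of_nat N)). set (b := fun n => a (Z.of_nat n - Z.of_nat N)%Z).
assert (EM : Z.of_nat M = (m + Z.of_nat N)%Z) by (unfold M; lia).
replace (a m) with (b M) by (unfold b; f_equal; lia).
apply (laurent_coeff N m M b delta); auto; try (apply Rdiv_lt_0_compat; lra).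
intros u Hu e He.
assert (Hu0 : u <> 0%C) by (intros E; rewrite E, Cmod_0 in Hu; lra).
assert (Eu : Defs.Csub (1 + u)%C Defs.C1 = u) by (apply C_ext; unfold Re, Im; simpl; ring).
assert (Pu : 0 < Cmod u ^ N) by (apply pow_lt; lra).
assert (H1 := HL (1 + u)%C). rewrite Eu, Cnorm_Cmod in H1. specialize (H1 Hu).
destruct (Ccv_elim _ _ H1 (e / Cmod u ^ N)) as [n0 Hn]; [apply Rdiv_lt_0_compat; auto|].
exists n0. intros n Hle. specialize (Hn n Hle). rewrite DCinv, Dqpoch in Hn.
match type of Hn with Cmod (?s - _) < _ => set (S := s) in Hn end.
assert (ES : (u ^ N * S)%C = csum (fun n => b n * u ^ n)%C n).
{ unfold S. rewrite (DCsum _ (fun n => b n * (u ^ n / u ^ N))%C).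
  - rewrite <- csum_scal. apply csum_ext. intros j _. field. apply Cpow_nz; auto.
  - intros j. rewrite DCpowz, cpowz_sub by auto. reflexivity. }
rewrite <- ES. replace (u ^ N * S - u ^ N / cpoch (1 + u) N)%C with (u ^ N * (S - / cpoch (1 + u) N))%C by (unfold Cdiv; ring).
rewrite Cmod_mult, Cmod_pow. apply (Rmult_lt_compat_l (Cmod u ^ N)) in Hn; auto.
replace (Cmod u ^ N * (e / Cmod u ^ N)) with e in Hn by (field; lra). exact Hn.
Qed.

Lemma finite_bound (g : nat -> R) n : exists K, 0 <= K /\ forall N, (N < n)%nat -> g N <= K.
Proof.
induction n as [|n [K [HK IH]]]; [exists 0; split; [lra|lia]|].
exists (K + Rabs (g n)). assert (P := Rabs_pos (g n)). split; [lra|]. intros N HN.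
destruct (Nat.eq_dec N n) as [->|Hne]; [assert (T := Rle_abs (g n)); lra|]. specialize (IH N ltac:(lia)). lra.
Qed.

Lemma cpowz_opp (z : C) n : z <> 0%C -> cpowz z (- n) = (/ cpowz z n)%C.
Proof.
intros Hz. assert (Nz := cpowz_neq_0 z n Hz). assert (E := cpowz_add z n (- n) Hz).
rewrite Z.add_opp_diag_r in E. simpl in E.
replace (cpowz z (- n)) with (/ cpowz z n * (cpowz z n * cpowz z (- n)))%C by (field; auto). rewrite <- E. ring.
Qed.

Lemma laurent_expansion (w0 : C) (m : Z) : Defs.Cnorm w0 < 1 ->
  Defs.Cnorm (Defs.Csub w0 (0.91619782, -0.18245890)) < 1e-6 ->
  Defs.Li2_is w0 (Defs.Cmul Defs.two_pi_i (Defs.CLog w0)) ->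
  exists c : nat -> C, c 0%nat = Defs.c0_of w0 m /\
    forall r : nat, exists K : R, forall N : nat, (1 <= N)%nat -> forall a : Z -> C, Defs.IsLaurentAt1 N a ->
      Cmod (a m - RtoC (approx w0 m c r N)) <= K * / Cmod w0 ^ N / powerRZ (INR N) (Z.of_nat r + 1 - m).
Proof.
intros Hw0 Hnum Hli. rewrite Cnorm_Cmod in Hw0, Hnum.
assert (A := Re_le_Cmod (w0 - (0.91619782, -0.18245890))%C). assert (B := Im_le_Cmod (w0 - (0.91619782, -0.18245890))%C).
change (Defs.Csub w0 (0.91619782, -0.18245890)) with (w0 - (0.91619782, -0.18245890))%C in Hnum.
rewrite Re_minus in A. rewrite Im_minus in B.
change (Re (0.91619782, -0.18245890)) with 0.91619782 in A. change (Im (0.91619782, -0.18245890)) with (-0.18245890) in B.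
apply Rabs_le_between in A. apply Rabs_le_between in B.
assert (Hre : 0.916196 <= Re w0 <= 0.916199) by lra.
assert (Him : Ropp 0.182460 <= Im w0 <= Ropp 0.182457) by lra.
destruct (w0_lt_1 w0 Hre Him) as [L1 L2]. destruct (w0_nz w0 Hre) as [Nw _].
assert (Li : dilog w0 = (mkC 0 (2 * PI) * log1m (1 - w0))%C).
{ apply Li2_is_dilog in Hli; auto. rewrite Hli, <- DCLog by auto. replace (1 - (1 - w0))%C with w0 by ring. reflexivity. }
destruct (expansion w0 Hre Him Li m) as [c [Hc HE]].
exists c. split.
{ assert (Ez : Defs.z0_of w0 = zs w0).
  { unfold Defs.z0_of, zs. change (Defs.Csub Defs.C1 w0) with (1 - w0)%C. rewrite DCLog by auto. reflexivity. }
  assert (Nz := zs_nz w0 Hre Him). rewrite Hc. unfold Defs.c0_of, coefK. rewrite Ez, DCinv, DCpowz, cpowz_opp by auto.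
  change (Defs.Copp ?z) with (- z)%C.
  assert (P := cpowz_neq_0 _ m Nz). assert (Q := PI_Ci_nz). assert (X := cexp_neq_0 (/ 2 * zs w0)).
  assert (E1 : Defs.Cexp (Defs.Cmul (Defs.RtoC (1 / 2)) (zs w0)) = cexp (/ 2 * zs w0)).
  { change (Defs.Cexp (Defs.Cmul (Defs.RtoC (1 / 2)) (zs w0))) with (cexp (RtoC (1 / 2) * zs w0)).
    f_equal. unfold Rdiv. rewrite Rmult_1_l, RtoC_inv by lra. reflexivity. }
  assert (E2 : (0, PI) = (RtoC PI * Ci)%C) by (apply C_ext; unfold Ci, Re, Im; simpl; ring).
  rewrite E1, E2. rewrite cexp_opp.
  do 2 change (Defs.Cmul ?u ?v) with (u * v)%C.
  set (pc := (RtoC PI * Ci)%C) in *. field. auto. }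
intros r. destruct (HE r) as [K [HK HKb]].
set (x := - Re (zs w0)) in *. destruct (zs_bounds w0 Hre Him) as [Hx _]. fold x in Hx.
(* The value that every Laurent expansion forces on [a m], so that the constant for the finitely
   many small N is chosen before [a] is given. For m < - N the expansion has coefficient 0 by
   definition. *)
set (V := fun N => if Z_lt_dec m (- Z.of_nat N) then 0
  else Im (prim N m (RtoC (- (16 * x))) - prim N m (RtoC 3)) / PI).
set (sc := fun N => / Cmod w0 ^ N / powerRZ (INR N) (Z.of_nat r + 1 - m)).
(* From 3200 + |m| on, the contour bound applies and m >= - N. *)
destruct (finite_bound (fun N => Rabs (V N - approx w0 m c r N) / sc N) (3200 + Z.abs_nat m)) as [K2 [HK2 HB2]].
exists (K + K2). intros N HN a Ha.
assert (NP : 1 <= INR N) by (apply (le_INR 1); auto).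
assert (Hw : 0 < Cmod w0) by (apply Cmod_gt_0; auto).
assert (Hsc : 0 < sc N).
{ unfold sc. apply Rdiv_lt_0_compat; [apply Rinv_0_lt_compat, pow_lt; auto|apply powerRZ_lt; lra]. }
assert (Ea : a m = RtoC (V N)).
{ unfold V. destruct (Z_lt_dec m (- Z.of_nat N)) as [H|H].
  - exact (proj1 Ha m H).
  - apply laurent_value; auto; try lra. lia. }
rewrite Ea, <- RtoC_minus, Cmod_R.
replace ((K + K2) * / Cmod w0 ^ N / powerRZ (INR N) (Z.of_nat r + 1 - m)) with (K * sc N + K2 * sc N) by (unfold sc, Rdiv; ring).
destruct (Nat.lt_ge_cases N (3200 + Z.abs_nat m)) as [Hlt|Hge].
- specialize (HB2 N Hlt). apply (Rmult_le_compat_r (sc N)) in HB2; [|lra].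
  unfold Rdiv in HB2. rewrite Rmult_assoc, Rinv_l, Rmult_1_r in HB2 by lra. nra.
- specialize (HKb N ltac:(lia)).
  assert (EV : V N = Im (prim N m (RtoC (- (16 * x))) - prim N m (RtoC 3)) / PI).
  { unfold V. destruct (Z_lt_dec m (- Z.of_nat N)) as [H|H]; auto. lia. }
  rewrite EV. eapply Rle_trans; [exact HKb|].
  replace (K * / Cmod w0 ^ N / powerRZ (INR N) (Z.of_nat r + 1 - m)) with (K * sc N) by (unfold sc, Rdiv; ring). nra.
Qed.

Import Defs.

Theorem theorem1p1 (w0 : CC)
  (Hw0 : Cnorm w0 < 1)
  (Hw0num : Cnorm (Csub w0 (0.91619782, -0.18245890)) < 1e-6)
  (Hw0eq : Li2_is w0 (Cmul two_pi_i (CLog w0)))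
  (m : Z) :
  exists c : nat -> CC,
    c 0%nat = c0_of w0 m /\
    forall r : nat, (1 <= r)%nat ->
      exists K : R, forall N : nat, (1 <= N)%nat ->
        forall a : Z -> CC, IsLaurentAt1 N a ->
          Cnorm (Csub (a m)
            (RtoC (Re (Cmul (Cdiv (Cinv (Cpow w0 N))
                                  (RtoC (powerRZ (INR N) (1 - m))))
                            (Csum (fun j => Cdiv (c j) (RtoC (INR N ^ j))) r)))))
          <= K * (/ (Cnorm w0 ^ N)) / powerRZ (INR N) (Z.of_nat r + 1 - m).
Proof.
destruct (laurent_expansion w0 m Hw0 Hw0num Hw0eq) as [c [Hc0 HE]].
exists c. split; [exact Hc0|]. intros r _. destruct (HE r) as [K HK]. exists K. intros N HN a Ha.
specialize (HK N HN a Ha).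
assert (Ea : Re (Cmul (Cdiv (Cinv (Cpow w0 N)) (RtoC (powerRZ (INR N) (1 - m))))
    (Csum (fun j => Cdiv (c j) (RtoC (INR N ^ j))) r)) = approx w0 m c r N).
{ rewrite DCdiv, DCinv, DCpow.
  rewrite (DCsum _ (fun j => Complex.Cmult (c j) (Complex.Cinv (Complex.RtoC (INR N ^ j))))) by (intros j; apply DCdiv).
  reflexivity. }
rewrite Ea, !Cnorm_Cmod. exact HK.
Qed.
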